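(* Let $f:[a,b]\to\overline{\mathbb R}$ be a distributionally integrable function over $[a,b]$, with indefinite integral $F(x)=(\mathfrak{dist})\int_a^x f(t)\,dt$ for $a\le x\le b$, extended by $F(x)=0$ for $x<a$ and $F(x)=F(b)$ for $x>b$. Then $F$ is a Łojasiewicz function.
   Context: Distributions are real. Notation: $\overline{\mathbb R}=\mathbb R\cup\{-\infty,\infty\}$; $\mathcal E'[a,b]$ is the space of distributions on $\mathbb R$ with support contained in $[a,b]$; $\langle \mathsf g(x+ty),\phi(y)\rangle:=|t|^{-1}\langle \mathsf g(y),\phi((y-x)/t)\rangle$ for $t\ne0$. Point values. For $\mathsf g\in\mathcal D'(\mathbb R)$, the distributional (Łojasiewicz) point value $\mathsf g(x_0)$ exists and equals $\gamma\in\mathbb R$ if $\lim_{\varepsilon\to0}\langle \mathsf g(x_0+\varepsilon y),\phi(y)\rangle=\gamma\int_{-\infty}^\infty\phi(y)\,dy$ for every $\phi\in\mathcal D(\mathbb R)$. A Łojasiewicz distribution is one having a point value at every point of $\mathbb R$. A function $G:\mathbb R\to\mathbb R$ is a Łojasiewicz function if there is a (necessarily unique) Łojasiewicz distribution $\mathsf G$ with $\mathsf G(x)=G(x)$ for all $x\in\mathbb R$; write $G\leftrightarrow\mathsf G$. Test classes. $\mathcal T_0$: functions $\phi\in C^\infty(\mathbb R)$, $\phi\ge0$, $\int\phi=1$, such that for some $\alpha<-1$, $\phi^{(m)}(x)=O(|x|^{\alpha-m})$ as $|x|\to\infty$ for all $m\ge0$. $\mathcal T_1$: those $\phi\in\mathcal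 T_0$ with $x\phi'(x)\le0$ for all $x$. For $\mathsf g\in\mathcal E'(\mathbb R)$, $\phi\in\mathcal T_0$: $\mathsf g^{+}_{\phi,0}(x)=\limsup_{t\to0^+}\langle \mathsf g(x+ty),\phi(y)\rangle$ and $\mathsf g^{-}_{\phi,0}(x)=\liminf_{t\to0^+}\langle \mathsf g(x+ty),\phi(y)\rangle$. Integral. Let $f:[a,b]\to\overline{\mathbb R}$. A major distributional pair $(\mathsf u,\mathsf U)$ for $f$ consists of $\mathsf u\in\mathcal E'[a,b]$ and a Łojasiewicz distribution $\mathsf U$ with $\mathsf U'=\mathsf u$, $\mathsf U(a)=0$, such that there exist a countable set $E$ and a Lebesgue null set $Z$ with $\mathsf u^-_{\phi,0}(x)\ge f(x)$ for all $x\in[a,b]\setminus Z$, $\phi\in\mathcal T_0$, and $\mathsf u^-_{\phi,0}(x)>-\infty$ for all $x\in[a,b]\setminus E$, $\phi\in\mathcal T_1$. A minor distributional pair $(\mathsf v,\mathsf V)$ for $f$ consists of $\mathsf v\in\mathcal E'[a,b]$ and a Łojasiewicz distribution $\mathsf V$ with $\mathsf V'=\mathsf v$, $\mathsf V(a)=0$, such that there exist a countable set $E$ and a null set $Z$ with $\mathsf v^+_{\phi,0}(x)\le f(x)$ for all $x\in[a,b]\setminus Z$, $\phi\in\mathcal T_0$, and $\mathsf v^+_{\phi,0}(x)<\infty$ for all $x\in[a,b]\setminus E$, $\phi\in\mathcal T_1$. The function $f$ is distributionally integrable over $[a,b]$ if it has both major and minor pairs and $\sup\mathsf V(b)=\inf\mathsf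 U(b)$ (sup over minor pairs, inf over major pairs); the common value is $(\mathfrak{dist})\int_a^bf(x)\,dx$. A function distributionally integrable over $[a,b]$ is distributionally integrable over each subinterval, so $F(x)$ is defined for $a\le x\le b$ (with $F(a)=0$). *)

(* Defs.v *)
From HB Require Import structures.
From mathcomp Require Import all_boot all_order all_algebra.
From mathcomp Require Import all_classical all_reals all_analysis.

Set Implicit Arguments.
Unset Strict Implicit.
Unset Printing Implicit Defensive.

Import Order.TTheory GRing.Theory Num.Theory.
Import numFieldNormedType.Exports.

Local Open Scope ring_scope.
Local Open Scope classical_set_scope.

Section Distributions.
Variable R : realType.
Implicit Types (phi psi : R -> R) (x t : R) (K O : set R).

Definition smooth phi : Prop := forall (m : nat) x, derivable (phi^`(m)) x 1.

Definition fun_support phi : set R := closure [set x | phi x != 0].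

Definition test_function phi : Prop := smooth phi /\ compact (fun_support phi).

Definition Cm_norm (n : nat) phi : R :=
  \sum_(m < n.+1) sup (range (fun x => `|(phi^`(m))%classic x|)).

(* The functional is total on R -> R, but only its values on test functions
   are constrained or used. *)
Record distribution := Distribution {
  pairing :> (R -> R) -> R;
  pairing_linear : forall (c : R) phi psi,
    test_function phi -> test_function psi ->
    pairing (fun x => c * phi x + psi x) = c * pairing phi + pairing psi;
  pairing_continuous : forall K, compact K ->
    exists (C : R) (n : nat), forall phi,
      test_function phi -> fun_support phi `<=` K ->
      `|pairing phi| <= C * Cm_norm n phi }.

Implicit Types g u v U V : distribution.

Definition vanishes_on g O : Prop :=
  forall phi, test_function phi -> fun_support phi `<=` O -> g phi = 0.

(* The complement of the union of all open sets on which g vanishes. *)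
Definition dsupport g : set R :=
  ~` \bigcup_(O in [set O | open O /\ vanishes_on g O]) O.

Definition E' (a b : R) : set distribution :=
  [set g | dsupport g `<=` `[a, b]].

Definition is_derivative u U : Prop :=
  forall phi, test_function phi -> u phi = - U (phi^`()).

Definition cutoff K (chi : R -> R) : Prop :=
  test_function chi /\
  exists O, [/\ open O, K `<=` O & forall x, O x -> chi x = 1].

(* For g with compact support, the extension of g to all smooth functions:
   <g, phi> := <g, chi phi> with chi a test function equal to 1 near the
   support of g; the value does not depend on chi. *)
Definition smooth_pairing g phi : R :=
  g (fun x => xget (cst 0) [set chi | cutoff (dsupport g) chi] x * phi x).

Definition affine_pull x t phi : R -> R := fun y => phi ((y - x) / t).

(* gamma is the Lojasiewicz point value of g at x. *)
Definition point_value g x (gamma : R) : Prop :=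
  forall phi, test_function phi ->
    `|t|^-1 * g (affine_pull x t phi) @[t --> 0^'] -->
      gamma * \int[@lebesgue_measure R]_y phi y.

Definition lojasiewicz_distribution g : Prop :=
  forall x, exists gamma, point_value g x gamma.

Definition lojasiewicz_function (G : R -> R) : Prop :=
  exists g, lojasiewicz_distribution g /\ forall x, point_value g x (G x).

Definition T0 : set (R -> R) := [set phi |
  [/\ smooth phi,
      (forall x, 0 <= phi x),
      (\int[@lebesgue_measure R]_x (phi x)%:E)%E = 1%E &
      exists alpha : R, alpha < -1 /\
        forall m : nat, exists C M : R, 0 < M /\
          forall x, M <= `|x| ->
            `|(phi^`(m))%classic x| <= C * `|x| `^ (alpha - m%:R)]].

Definition T1 : set (R -> R) :=
  T0 `&` [set phi | forall x, x * (phi^`())%classic x <= 0].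

Definition upper_value g phi x : \bar R :=
  limf_esup (fun t => (`|t|^-1 * smooth_pairing g (affine_pull x t phi))%:E)
    0^'+.

Definition lower_value g phi x : \bar R :=
  limf_einf (fun t => (`|t|^-1 * smooth_pairing g (affine_pull x t phi))%:E)
    0^'+.

(* In what follows f : R -> \bar R stands for a function on [a, b]; its values
   outside of [a, b] are never used. *)

Definition major_pair (a b : R) (f : R -> \bar R) u U : Prop :=
  [/\ E' a b u, lojasiewicz_distribution U, is_derivative u U,
      point_value U a 0 &
      exists E Z : set R,
        [/\ countable E,
            (@lebesgue_measure R).-negligible Z,
            (forall x phi, (`[a, b] `\` Z) x -> T0 phi ->
               (f x <= lower_value u phi x)%E) &
            (forall x phi, (`[a, b] `\` E) x -> T1 phi ->
               (-oo < lower_value u phi x)%E)]].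

Definition minor_pair (a b : R) (f : R -> \bar R) v V : Prop :=
  [/\ E' a b v, lojasiewicz_distribution V, is_derivative v V,
      point_value V a 0 &
      exists E Z : set R,
        [/\ countable E,
            (@lebesgue_measure R).-negligible Z,
            (forall x phi, (`[a, b] `\` Z) x -> T0 phi ->
               (upper_value v phi x <= f x)%E) &
            (forall x phi, (`[a, b] `\` E) x -> T1 phi ->
               (upper_value v phi x < +oo)%E)]].

Definition upper_dist_integral (a b : R) (f : R -> \bar R) : \bar R :=
  ereal_inf [set c%:E | c in
    [set c | exists u U, major_pair a b f u U /\ point_value U b c]].

Definition lower_dist_integral (a b : R) (f : R -> \bar R) : \bar R :=
  ereal_sup [set c%:E | c in
    [set c | exists v V, minor_pair a b f v V /\ point_value V b c]].

Definition dist_integrable (a b : R) (f : R -> \bar R) : Prop :=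
  [/\ exists u U, major_pair a b f u U,
      exists v V, minor_pair a b f v V &
      lower_dist_integral a b f = upper_dist_integral a b f].

(* Only meaningful when dist_integrable a b f holds; the upper and lower
   integrals are then equal and finite. *)
Definition dist_integral (a b : R) (f : R -> \bar R) : R :=
  fine (upper_dist_integral a b f).

Definition indefinite_dist_integral (a b : R) (f : R -> \bar R) : R -> R :=
  fun x => if x <= a then 0
           else if x <= b then dist_integral a x f
           else dist_integral a b f.

End Distributions.

(* Main.v *)
(* The key point is that a distribution w = W', with W a Lojasiewicz
   distribution, is nonnegative as soon as its lower Gaussian averages are
   > -oo off a countable set and >= 0 almost everywhere.  A null set is removed
   by adding to W a small continuous increasing function with infinite slope on
   that set.  For a countable exceptional set, the Baire category theorem gives
   a portion of the closed set P of bad points on which the averages are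
   nonnegative uniformly in the scale t, and the bump averages of W are bounded;
   in the gaps of P the latter are monotone, hence bounded too.  The Gaussian
   averages t^-1 w(exp(-(y - x)^2 / 2t^2)) solve u_t = t u_xx, so they are
   nonnegative in each gap by the minimum principle, with a barrier built from
   Gaussians centred just inside and just outside of the gap.  Letting t tend
   to 0 contradicts the definition of P.

   Applied to u - v for a major pair (u, U) and a minor pair (v, V), this makes
   the values of U - V nondecreasing, and continuous since a monotone
   Lojasiewicz function is continuous.  Truncating U at x turns a major pair on
   [a, b] into one on [a, x], so that V(x) <= F(x) <= U(x).  Hence F - U is a
   uniform limit of continuous functions U_n - U = (U_n - V) - (U - V), and
   F = U + (F - U) is a Lojasiewicz function. *)

From HB Require Import structures.
Require Import Defs.
From mathcomp Require Import all_boot all_order all_algebra.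
From mathcomp Require Import all_classical all_reals all_analysis.
From mathcomp Require Import lra ring.

Set Implicit Arguments.
Unset Strict Implicit.
Unset Printing Implicit Defensive.

Import Order.TTheory GRing.Theory Num.Theory.
Import numFieldNormedType.Exports.

Local Open Scope ring_scope.
Local Open Scope classical_set_scope.

(** * Smooth functions *)

Section Calculus.
Variable R : realType.
Implicit Types (f g : R -> R) (x y t l : R).

(** The obstacle is that W is controlled only on average and point by point, while a minimum
    principle in a gap needs uniform information at its ends down to time 0. A point value first
    gives, by a gliding hump, a finite order uniform in the scale, hence bounded bump averages. Once
    these bounds are uniform on a portion, W acts there like a bounded function, and the derivative
    of a bounded function can leave at worst a multiple of a Gaussian at an end of the gap as t
    tends to 0. The barrier absorbs exactly this singularity. Gaussians serve because they lie in
    T1, stay of the same form under differentiation, and solve a heat equation in their width. Point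
    values have two more uses: isolated bad points are removable, so the bad set is perfect and a
    single exceptional point can be avoided; and truncation at x converges, since a change of the
    cut-off scale s costs O(s). A major pair on [a, x] is compared with a minor pair on the whole of
    [a, b], so that only major pairs have to be truncated. *)

Lemma is_derive_derive1 f x l : is_derive x 1 f l -> derive1 f x = l.
Proof. by move=> h; rewrite derive1E; exact: derive_val. Qed.

Lemma derivable_is_derive f x : derivable f x 1 -> is_derive x 1 f (derive1 f x).
Proof. by move=> h; rewrite derive1E; exact: derivableP. Qed.

Lemma is_derive_affine f x t y l : t != 0 ->
  is_derive ((y - x) / t) 1 f l ->
  is_derive y 1 (fun z => f ((z - x) / t)) (t^-1 * l).
Proof.
move=> t0 fl.
have h : is_derive y 1 (fun z : R => (z - x) / t) (t^-1).
  rewrite (_ : (fun z => _) = (fun z : R => t^-1 * z + - (x / t))); last first.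
    by apply/funext => z; rewrite mulrBl mulrC.
  by apply: is_derive_eq; rewrite subr0 -[LHS]/(t^-1 * 1) mulr1.
rewrite mulrC.
exact: (@is_derive1_comp _ f (fun z => (z - x) / t) y l t^-1 fl h).
Qed.

Lemma is_derive_ext f g x l : f =1 g -> is_derive x 1 f l -> is_derive x 1 g l.
Proof. by move=> /funext ->. Qed.

(** A quadratic remainder makes the difference quotient converge linearly. Uniform quadratic
    remainders pass through functionals, integrals and limits of sequences, which is why derivatives
    are mostly obtained in this form. *)
Lemma quadratic_derive f x l (B d : R) : 0 < d ->
  (forall h, `|h| < d -> `|f (x + h) - f x - h * l| <= B * h ^+ 2) ->
  is_derive x 1 f l.
Proof.
move=> d0 H.
have B0 : 0 <= B.
  have d2 : `|d / 2| < d by rewrite gtr0_norm ?divr_gt0// ltr_pdivrMr// mulr2n mulrDr mulr1 ltrDl.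
  have := le_trans (normr_ge0 _) (H _ d2).
  by rewrite pmulr_lge0// exprn_gt0// divr_gt0.
have cv : h^-1 *: ((f \o shift x) (h *: 1) - f x) @[h --> 0^'] --> l.
  apply/cvgrPdist_le => e e0; near=> h.
  have h0 : h != 0 by near: h; exact: nbhs_dnbhs_neq.
  have hd : `|h| < d.
    by near: h; apply: dnbhs0_lt.
  have hB : `|h| <= e / (B + 1).
    by near: h; apply: dnbhs0_le; rewrite divr_gt0// ltr_wpDl.
  rewrite /= [_%:A](mulr1 h) [h + x]addrC.
  rewrite -[_ *: _]/(h^-1 * _).
  have -> : l - h^-1 * (f (x + h) - f x) = - h^-1 * (f (x + h) - f x - h * l).
    by field.
  rewrite normrM normrN normfV ler_pdivrMl ?normr_gt0//.
  apply: (le_trans (H h hd)).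
  rewrite -[h ^+ 2]real_normK ?num_real// expr2 mulrCA ler_wpM2l//.
  rewrite (le_trans (ler_wpM2l B0 hB))// mulrCA ler_piMr// ?ltW//.
  by rewrite ltr_pdivrMr ?mul1r ?ltrDl// ltr_wpDl.
apply: DeriveDef; first by apply/cvg_ex; exists l.
exact/cvg_lim.
Unshelve. all: by end_near. Qed.

Lemma derivable_continuous f : (forall x, derivable f x 1) -> continuous f.
Proof.
by move=> df x; apply/differentiable_continuous/derivable1_diffP.
Qed.

Lemma mean_value_bound f (df : R -> R) (a b B : R) :
  (forall x, a <= x <= b -> is_derive x 1 f (df x)) ->
  (forall x, a <= x <= b -> `|df x| <= B) ->
  forall x y, a <= x <= b -> a <= y <= b -> `|f y - f x| <= B * `|y - x|.
Proof.
move=> Df Bd x y; wlog xy : x y / x <= y.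
  move=> W xab yab; case: (leP x y) => [xy|/ltW yx]; first exact: W.
  by rewrite distrC (distrC y); exact: W.
move=> /andP[ax xb] /andP[ay yb].
have [||c cxy ->] := @MVT_segment R f df x y xy.
- move=> z; rewrite in_itv/= => /andP[xz zy]; apply: Df.
  by rewrite (le_trans ax (ltW xz)) (le_trans (ltW zy) yb).
- apply: derivable_within_continuous => z; rewrite in_itv/= => /andP[xz zy].
  have [] // := Df z.
  by rewrite (le_trans ax xz) (le_trans zy yb).
- rewrite normrM ler_wpM2r//; apply: Bd.
  by move: cxy; rewrite in_itv/= => /andP[xz zy]; rewrite (le_trans ax xz) (le_trans zy yb).
Qed.

(** The mean value bound is used twice: z |-> f z - f1 x * (z - x) has derivative f1 z - f1 x,
    itself at most B |h|. The price is B in place of the sharp B / 2. *)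
Lemma taylor_bound f (f1 f2 : R -> R) (a b B : R) :
  (forall x, a <= x <= b -> is_derive x 1 f (f1 x)) ->
  (forall x, a <= x <= b -> is_derive x 1 f1 (f2 x)) ->
  (forall x, a <= x <= b -> `|f2 x| <= B) ->
  forall x h, a <= x <= b -> a <= x + h <= b ->
    `|f (x + h) - f x - h * f1 x| <= B * h ^+ 2.
Proof.
move=> D1 D2 B2 x h xab xhab.
pose g z := f z - f1 x * (z - x).
pose m := Num.min x (x + h); pose M := Num.max x (x + h).
have mM z : m <= z <= M -> a <= z <= b /\ `|z - x| <= `|h|.
  move: xab xhab; rewrite /m /M; case: (leP x (x + h)) => xh /andP[? ?] /andP[? ?] /andP[? ?].
    by split; [lra|rewrite ger0_norm ?ger0_norm; lra].
  by split; [lra|rewrite ler0_norm ?ler0_norm; lra].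
have := @mean_value_bound g (fun z => f1 z - f1 x) m M (B * `|h|) _ _ x (x + h).
have -> : g (x + h) - g x = f (x + h) - f x - h * f1 x by rewrite /g; ring.
rewrite [x + h - x]addrC addKr -mulrA -[`|h| * `|h|]expr2 real_normK ?num_real//.
apply.
- move=> z /mM[zab _].
  apply: (@is_derive_ext (f + (fun z => - f1 x * z + f1 x * x))); last first.
    have Dz := D1 z zab.
    by apply: is_derive_eq; rewrite addr0 -[_ *: _]/(- f1 x * 1) mulr1.
  by move=> w; rewrite /g /= !fctE; ring.
- move=> z /mM[zab zh].
  have := @mean_value_bound f1 f2 a b B D2 B2 x z xab zab.
  move=> /le_trans; apply; rewrite ler_wpM2l//.
  exact: (le_trans (normr_ge0 _) (B2 x xab)).
- by rewrite /m /M ge_min le_max lexx.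
- by rewrite /m /M ge_min le_max lexx !orbT.
Qed.

End Calculus.

(** * Closure properties of smooth functions and Leibniz bounds *)

Section Smooth.
Variable R : realType.
Implicit Types (f g : R -> R) (x y t l : R).

Lemma smooth_derivable f x : smooth f -> derivable f x 1.
Proof. by move=> /(_ 0%N x). Qed.

Lemma smooth_is_derive f x : smooth f -> is_derive x 1 f (derive1 f x).
Proof. by move=> sf; apply/derivable_is_derive/smooth_derivable. Qed.

Lemma smooth_derive1 f : smooth f -> smooth (derive1 f).
Proof. by move=> sf m x; rewrite -derive1Sn; exact: sf. Qed.

Lemma smooth_derive1n f n : smooth f -> smooth (derive1n n f).
Proof. by move=> sf; elim: n => [|n IH]; [exact: sf|rewrite derive1nS; exact: smooth_derive1 IH]. Qed.

Lemma smooth_is_derive1n f n x : smooth f -> is_derive x 1 (derive1n n f) (derive1n n.+1 f x).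
Proof. by move=> sf; rewrite derive1nS; apply/smooth_is_derive/smooth_derive1n. Qed.

Lemma smooth_continuous f : smooth f -> continuous f.
Proof. by move=> sf; apply: derivable_continuous => x; exact: smooth_derivable. Qed.

(* Differentiability up to order k: closure properties are proved by induction
   on k. *)
Definition Ck k f := forall m, (m < k)%N -> forall x, derivable (derive1n m f) x 1.

Lemma smoothP f : smooth f <-> forall k, Ck k f.
Proof. by split=> [sf k m _ x|H m x]; [exact: sf|exact: (H m.+1)]. Qed.

Lemma CkS k f : Ck k.+1 f <-> (forall x, derivable f x 1) /\ Ck k (derive1 f).
Proof.
split=> [H|[H1 H2] [|m] mk x].
  split=> [x|m mk x]; first exact: (H 0%N).
  by rewrite -derive1Sn; exact: H.
- exact: H1.
- by rewrite derive1Sn; exact: H2.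
Qed.

Lemma CkW k f : Ck k.+1 f -> Ck k f.
Proof. by move=> H m mk; apply: H; rewrite ltnS ltnW. Qed.

Lemma CkI k f (df : R -> R) : (forall x, is_derive x 1 f (df x)) -> Ck k df -> Ck k.+1 f.
Proof.
move=> Df H; apply/CkS; split=> [x|]; first by have [] := Df x.
suff -> : derive1 f = df by [].
by apply/funext => x; apply: is_derive_derive1.
Qed.

Lemma Ck_is_derive k f x : Ck k.+1 f -> is_derive x 1 f (derive1 f x).
Proof. by move=> /CkS[H _]; exact: derivable_is_derive. Qed.

Lemma CkD k f g : Ck k f -> Ck k g -> Ck k (fun x => f x + g x).
Proof.
elim: k f g => [|k IH] f g Cf Cg; first by move=> m; rewrite ltn0.
apply: (@CkI _ (fun x => f x + g x) (fun x => derive1 f x + derive1 g x)) => [x|].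
  exact: (is_deriveD (Ck_is_derive x Cf) (Ck_is_derive x Cg)).
by apply: IH; [case/CkS : Cf|case/CkS : Cg].
Qed.

Lemma is_deriveM_fun f g x a b : is_derive x 1 f a -> is_derive x 1 g b ->
  is_derive x 1 (fun z => f z * g z) (a * g x + f x * b).
Proof.
move=> Df Dg; have H := is_deriveM Df Dg.
apply: is_derive_eq H _.
by rewrite addrC -[_ *: a]/(g x * a) [g x * a]mulrC.
Qed.

Lemma is_deriveZ_fun f x c a : is_derive x 1 f a ->
  is_derive x 1 (fun z => c * f z) (c * a).
Proof. by move=> Df; exact: (is_deriveZ c Df). Qed.

Lemma is_deriveD_fun f g x a b : is_derive x 1 f a -> is_derive x 1 g b ->
  is_derive x 1 (fun z => f z + g z) (a + b).
Proof. by move=> Df Dg; exact: (is_deriveD Df Dg). Qed.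

Lemma is_deriveB_fun f g x a b : is_derive x 1 f a -> is_derive x 1 g b ->
  is_derive x 1 (fun z => f z - g z) (a - b).
Proof. by move=> Df Dg; exact: (is_deriveB Df Dg). Qed.

Lemma CkM k f g : Ck k f -> Ck k g -> Ck k (fun x => f x * g x).
Proof.
elim: k f g => [|k IH] f g Cf Cg; first by move=> m; rewrite ltn0.
apply: (@CkI _ (fun x => f x * g x) (fun x => derive1 f x * g x + f x * derive1 g x)) => [x|].
  by apply: is_deriveM_fun; [exact: Ck_is_derive Cf|exact: Ck_is_derive Cg].
have [_ Cf'] := (CkS _ _).1 Cf; have [_ Cg'] := (CkS _ _).1 Cg.
have {}Cf := CkW Cf; have {}Cg := CkW Cg.
by apply: CkD; apply: IH.
Qed.

Lemma Ck_cst k (c : R) : Ck k (fun=> c).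
Proof.
by elim: k c => // k IH c; apply: (@CkI _ _ (fun=> 0)).
Qed.

Lemma is_deriveV_fun f x a : f x != 0 -> is_derive x 1 f a ->
  is_derive x 1 (fun z => (f z)^-1) (- a * ((f x)^-1 * (f x)^-1)).
Proof.
move=> f0 Df; apply: is_derive_eq (is_deriveV f0 Df) _.
by rewrite -[LHS]/(_ * a) expr2 invfM; ring.
Qed.

Lemma CkV k f : (forall x, f x != 0) -> Ck k f -> Ck k (fun x => (f x)^-1).
Proof.
move=> f0; elim: k => [_ m|k IH Cf]; first by rewrite ltn0.
apply: (@CkI _ (fun x => (f x)^-1) (fun x => (- 1 * derive1 f x) * ((f x)^-1 * (f x)^-1))) => [x|].
  by rewrite mulN1r; apply: is_deriveV_fun => //; exact: Ck_is_derive Cf.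
have [_ Cf'] := (CkS _ _).1 Cf.
have C1 := IH (CkW Cf).
have C2 := @CkM k (fun x => (f x)^-1) (fun x => (f x)^-1) C1 C1.
have C3 := @CkM k (fun=> -1) (derive1 f) (@Ck_cst k (-1)) Cf'.
exact: (@CkM k _ _ C3 C2).
Qed.

Lemma is_derive_expR_comp f x a : is_derive x 1 f a ->
  is_derive x 1 (fun z => expR (f z)) (a * expR (f x)).
Proof.
by move=> Df; rewrite mulrC; exact: (is_derive1_comp (is_derive_expR (f x)) Df).
Qed.

Lemma smoothD f g : smooth f -> smooth g -> smooth (fun x => f x + g x).
Proof. by move=> /smoothP sf /smoothP sg; apply/smoothP => k; exact: CkD. Qed.

Lemma smoothM f g : smooth f -> smooth g -> smooth (fun x => f x * g x).
Proof. by move=> /smoothP sf /smoothP sg; apply/smoothP => k; exact: CkM. Qed.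

Lemma smooth_cst (c : R) : smooth (fun=> c).
Proof. by apply/smoothP => k; exact: Ck_cst. Qed.

Lemma smoothZ (c : R) f : smooth f -> smooth (fun x => c * f x).
Proof. by move=> sf; exact: (@smoothM (fun=> c) f (@smooth_cst c) sf). Qed.

Lemma smoothN f : smooth f -> smooth (fun x => - f x).
Proof.
move=> /(@smoothZ (-1)); rewrite (_ : (fun x => -1 * f x) = (fun x => - f x))//.
by apply/funext => x; rewrite mulN1r.
Qed.

Lemma smoothB f g : smooth f -> smooth g -> smooth (fun x => f x - g x).
Proof. by move=> sf sg; exact: (@smoothD f (fun x => - g x) sf (smoothN sg)). Qed.

Lemma smoothV f : (forall x, f x != 0) -> smooth f -> smooth (fun x => (f x)^-1).
Proof. by move=> f0 /smoothP sf; apply/smoothP => k; exact: CkV. Qed.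

Lemma derive1n_lin (c : R) f g n : smooth f -> smooth g ->
  derive1n n (fun x => c * f x + g x) = fun x => c * derive1n n f x + derive1n n g x.
Proof.
move=> sf sg; elim: n => // n IH; rewrite derive1nS IH; apply/funext => x.
apply: is_derive_derive1; apply: is_deriveD_fun; last exact: smooth_is_derive1n.
by apply: is_deriveZ_fun; exact: smooth_is_derive1n.
Qed.

Lemma derive1nD f g n : smooth f -> smooth g ->
  derive1n n (fun x => f x + g x) = fun x => derive1n n f x + derive1n n g x.
Proof.
move=> sf sg; have := @derive1n_lin 1 f g n sf sg.
by under eq_fun do rewrite mul1r; move=> ->; apply/funext => x; rewrite mul1r.
Qed.

Lemma derive1n_cst0 n : derive1n n (fun=> 0 : R) = fun=> 0.
Proof.
elim: n => // n IH; rewrite derive1nS IH; apply/funext => x.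
exact: derive1_cst.
Qed.

Lemma derive1nZ (c : R) f n : smooth f ->
  derive1n n (fun x => c * f x) = fun x => c * derive1n n f x.
Proof.
move=> sf; have := @derive1n_lin c f (fun=> 0) n sf (@smooth_cst 0).
by under eq_fun do rewrite addr0; move=> ->; apply/funext => x; rewrite derive1n_cst0 addr0.
Qed.

Lemma derive1nB f g n : smooth f -> smooth g ->
  derive1n n (fun x => f x - g x) = fun x => derive1n n f x - derive1n n g x.
Proof.
move=> sf sg; have := @derive1n_lin (-1) g f n sg sf.
rewrite (_ : (fun x => -1 * g x + f x) = fun x => f x - g x); last first.
  by apply/funext => x; rewrite mulN1r addrC.
by move=> ->; apply/funext => x; rewrite mulN1r addrC.
Qed.

Lemma derive1n_affine f x t n : t != 0 -> smooth f ->
  derive1n n (fun y => f ((y - x) / t)) = fun y => t^-1 ^+ n * derive1n n f ((y - x) / t).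
Proof.
move=> t0 sf; elim: n => [|n IH]; first by apply/funext => y; rewrite expr0 mul1r.
rewrite derive1nS IH; apply/funext => y; apply: is_derive_derive1.
rewrite exprSr -mulrA; apply: is_deriveZ_fun; apply: is_derive_affine; first exact: t0.
exact: smooth_is_derive1n.
Qed.

Lemma smooth_affine_comp f x t : t != 0 -> smooth f ->
  smooth (fun y => f ((y - x) / t)).
Proof.
move=> t0 sf m y; rewrite derive1n_affine//.
suff : is_derive y 1 (fun y => t^-1 ^+ m * derive1n m f ((y - x) / t))
  (t^-1 ^+ m * (t^-1 * derive1n m.+1 f ((y - x) / t))) by case.
apply: is_deriveZ_fun; apply: is_derive_affine; first exact: t0.
exact: smooth_is_derive1n.
Qed.

Lemma derive1n_open (O : set R) f g n : open O -> (forall x, O x -> f x = g x) ->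
  forall x, O x -> derive1n n f x = derive1n n g x.
Proof.
move=> oO fg; elim: n => [|n IH] x Ox; first exact: fg.
rewrite !derive1nS !derive1E; apply: near_eq_derive.
by apply: filterS (open_nbhs_nbhs (conj oO Ox)) => z; exact: IH.
Qed.

(** Differentiating the product once leaves two products that satisfy the same bounds one order
    lower, so the constant doubles at each order. *)
Lemma leibniz_bound f g x (A B : R) n : smooth f -> smooth g ->
  (forall j, (j <= n)%N -> `|derive1n j f x| <= A) ->
  (forall j, (j <= n)%N -> `|derive1n j g x| <= B) ->
  `|derive1n n (fun y => f y * g y) x| <= 2 ^+ n * (A * B).
Proof.
elim: n f g => [|n IH] f g sf sg Hf Hg.
  by rewrite expr0 mul1r /= normrM ler_pM//; [exact: (Hf 0%N)|exact: (Hg 0%N)].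
have -> : derive1n n.+1 (fun y => f y * g y) =
    derive1n n (fun y => derive1 f y * g y + f y * derive1 g y).
  rewrite derive1Sn; congr (derive1n n _); apply/funext => y.
  by apply: is_derive_derive1; apply: is_deriveM_fun; exact: smooth_is_derive.
have sf' := smooth_derive1 sf; have sg' := smooth_derive1 sg.
rewrite derive1nD; [|exact: smoothM|exact: smoothM].
apply: (le_trans (ler_normD _ _)); rewrite exprS -mulrA [2]mulr2n mulrDl mul1r.
by apply: lerD; apply: IH => // j jn; rewrite -?derive1Sn; by [apply: Hf|apply: Hg|apply: Hf; rewrite ltnW|apply: Hg; rewrite ltnW].
Qed.

End Smooth.

(** * Distributions as functionals on smooth functions *)

Section Functionals.
Variable R : realType.
Implicit Types (f g phi psi : R -> R) (x y t l : R) (T : (R -> R) -> R).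

Definition supp_in (a b : R) f := forall x, (x < a) || (b < x) -> f x = 0.

Lemma supp_inW a b a' b' f : a' <= a -> b <= b' -> supp_in a b f -> supp_in a' b' f.
Proof.
move=> aa bb H x /orP[xa|bx]; apply: H; first by rewrite (lt_le_trans xa aa).
by rewrite (le_lt_trans bb bx) orbT.
Qed.

Lemma derive1n_supp a b f n : supp_in a b f -> supp_in a b (derive1n n f).
Proof.
move=> H x /orP[xa|bx].
  rewrite (@derive1n_open _ [set z | z < a] f (fun=> 0) n (@open_lt _ a))//=.
    by rewrite derive1n_cst0.
  by move=> z /= za; apply: H; rewrite za.
rewrite (@derive1n_open _ [set z | b < z] f (fun=> 0) n (@open_gt _ b))//=.
  by rewrite derive1n_cst0.
by move=> z /= za; apply: H; rewrite za orbT.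
Qed.

Lemma supp_in_fun_support a b f : supp_in a b f -> fun_support f `<=` `[a, b].
Proof.
move=> H; rewrite /fun_support [`[a, b]](closure_id _).1; last first.
  exact: interval_closed.
apply: closure_subset => x /= fx; rewrite in_itv/= !leNgt -negb_or.
by apply/negP => /H fx0; rewrite fx0 eqxx in fx.
Qed.

Lemma supp_in_test a b f : smooth f -> supp_in a b f -> test_function f.
Proof.
move=> sf /supp_in_fun_support H; split => //.
apply: (subclosed_compact _ (@segment_compact _ a b) H).
exact: closed_closure.
Qed.

Lemma fun_support_eq0 f x : ~ fun_support f x -> f x = 0.
Proof.
by move=> H; apply/eqP/negPn/negP => fx; apply: H; exact: subset_closure.
Qed.

Lemma test_supp_in f : test_function f -> exists2 r, 0 < r & supp_in (- r) r f.
Proof.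
move=> [_ /compact_bounded]; rewrite /bounded_set => H.
have [M [_ HM]] := H.
pose r := `|M| + 1; exists r; first by rewrite ltr_wpDl.
move=> x xr; apply: fun_support_eq0 => fx.
have := HM r _ x fx; have -> : M < r.
  by rewrite /r (le_lt_trans (ler_norm _))// ltrDl.
move=> /(_ isT) /=; rewrite ler_norml => /andP[h1 h2].
by move: xr; rewrite ltNge h1/= ltNge h2.
Qed.

Lemma test_smooth f : test_function f -> smooth f.
Proof. by case. Qed.

Lemma continuous_bounded f a b : continuous f ->
  exists2 M, 0 < M & forall x, a <= x <= b -> `|f x| <= M.
Proof.
move=> cf; case: (leP a b) => ab; last first.
  exists 1 => // x /andP[ax xb].
  by have := le_trans ax xb; rewrite leNgt ab.
have [|c cab H] := @EVT_max R (fun x => `|f x|) a b ab.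
  apply: continuous_subspaceT => x.
  by apply: (@continuous_comp _ _ _ f Num.norm); [exact: cf|exact: norm_continuous].
exists (`|f c| + 1); first by rewrite ltr_wpDl.
by move=> x xab; rewrite (le_trans (H x _)) ?lerDl// in_itv/=.
Qed.

(** Common home of compactly supported bumps and of Gaussian kernels; boundedness makes translation
    estimates uniform. *)
Definition bsmooth f := smooth f /\
  forall j, exists M, forall x, `|derive1n j f x| <= M.

Lemma bsmooth_supp a b f : smooth f -> supp_in a b f -> bsmooth f.
Proof.
move=> sf ff; split => // j.
have [M M0 HM] := @continuous_bounded (derive1n j f) a b
  (smooth_continuous (@smooth_derive1n _ f j sf)).
exists M => x; case: (boolP (a <= x <= b)) => [/HM//|].
rewrite negb_and -!ltNge => /(derive1n_supp j ff) ->.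
by rewrite normr0 ltW.
Qed.

Lemma bsmooth_derive1 f : bsmooth f -> bsmooth (derive1 f).
Proof.
by move=> [sf H]; split=> [|j]; [exact: smooth_derive1|rewrite -derive1Sn].
Qed.

(* Compactly supported distributions, as functionals on all smooth functions. *)
Definition cfun T :=
  (forall c f g, smooth f -> smooth g -> T (fun x => c * f x + g x) = c * T f + T g) /\
  exists C r : R, exists n : nat, [/\ 0 < C, 0 < r & forall f M, smooth f ->
    (forall j, (j <= n)%N -> forall x, - r <= x <= r -> `|derive1n j f x| <= M) ->
    `|T f| <= C * M].

(** Trades [Cm_norm], a sum of suprema over the line, for any common bound M on [a, b]. In the
    constant, n + 1 counts the summands and the added 1 gives positivity. *)
Lemma distribution_order (g : Defs.distribution R) (a b : R) : a <= b ->
  exists (C : R) (n : nat), 0 < C /\ forall f M, smooth f -> supp_in a b f ->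
    (forall j, (j <= n)%N -> forall x, a <= x <= b -> `|derive1n j f x| <= M) -> `|g f| <= C * M.
Proof.
move=> ab; have [C [n H]] := pairing_continuous g (@segment_compact _ a b).
exists (`|C| * n.+1%:R + 1), n; split; first by rewrite ltr_wpDl ?mulr_ge0.
move=> f M sf ff HM0.
have HM : forall j, (j <= n)%N -> forall x, `|derive1n j f x| <= Num.max M 0.
  move=> j jn x; rewrite le_max; case: (boolP (a <= x <= b)) => [/(HM0 j jn) ->//|].
  by rewrite negb_and -!ltNge => /(derive1n_supp j ff) ->; rewrite normr0 lexx orbT.
have M0 : 0 <= M by rewrite (le_trans _ (HM0 0%N isT a _)) ?lexx.
apply: (le_trans (H f (supp_in_test sf ff) (supp_in_fun_support ff))).
rewrite mulrDl mul1r.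
apply: (@le_trans _ _ (`|C| * (n.+1%:R * M))).
  apply: (@le_trans _ _ (`|C| * Cm_norm n f)).
    rewrite ler_wpM2r ?ler_norm// /Cm_norm sumr_ge0// => i _.
    apply: (@le_trans _ _ `|derive1n i f 0|) => //.
    apply: ub_le_sup; last by exists 0.
    by exists (Num.max M 0) => _ [x _ <-]; apply: HM; rewrite -ltnS.
  rewrite ler_wpM2l// /Cm_norm.
  rewrite -[n.+1 in leRHS]card_ord mulr_natl -sumr_const ler_sum// => i _.
  apply: ge_sup; first by exists `|derive1n i f 0|, 0.
  move=> _ [x _ <-]; rewrite -[M](max_idPl M0) HM//.
  by rewrite -ltnS.
by rewrite mulrA lerDl.
Qed.

End Functionals.

(** * Differentiation of a functional along a smooth family *)

Section FunctionalCalculus.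
Variable R : realType.
Implicit Types (f g phi psi kappa : R -> R) (x y s t l r : R) (T : (R -> R) -> R).

Lemma unif_nat (P : nat -> R -> Prop) n :
  (forall j A B, A <= B -> P j A -> P j B) -> (forall j, exists A, P j A) ->
  exists2 A, 0 < A & forall j, (j <= n)%N -> P j A.
Proof.
move=> Pmon PA; elim: n => [|n [A A0 HA]].
  have [A HA] := PA 0%N; exists (Num.max A 1); first by rewrite lt_max ltr01 orbT.
  by move=> j; rewrite leqn0 => /eqP ->; apply: (Pmon _ A) => //; rewrite le_max lexx.
have [B HB] := PA n.+1; exists (Num.max A B); first by rewrite lt_max A0.
move=> j; rewrite leq_eqVlt => /orP[/eqP ->|].
  by apply: (Pmon _ B) => //; rewrite le_max lexx orbT.
by rewrite ltnS => /HA; apply: Pmon; rewrite le_max lexx.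
Qed.

Section cfun_theory.
Variables (T : (R -> R) -> R) (cT : cfun T).

Lemma cfun_lin c f g : smooth f -> smooth g -> T (fun x => c * f x + g x) = c * T f + T g.
Proof. by move=> sf sg; case: cT => H _; exact: H. Qed.

Lemma cfun0 : T (fun=> 0) = 0.
Proof.
have := @cfun_lin (-1) (fun=> 0) (fun=> 0) (@smooth_cst _ 0) (@smooth_cst _ 0).
have -> : (fun x : R => -1 * 0 + 0 : R) = (fun=> 0) by apply/funext => x; rewrite mulr0 addr0.
by rewrite mulN1r addNr.
Qed.

Lemma cfunZ c f : smooth f -> T (fun x => c * f x) = c * T f.
Proof.
move=> sf; have := @cfun_lin c f (fun=> 0) sf (@smooth_cst _ 0).
rewrite (_ : (fun x => c * f x + 0) = fun x => c * f x); last first.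
  by apply/funext => x; rewrite addr0.
by move=> ->; rewrite cfun0 addr0.
Qed.

Lemma cfunD f g : smooth f -> smooth g -> T (fun x => f x + g x) = T f + T g.
Proof.
move=> sf sg; have := @cfun_lin 1 f g sf sg; rewrite mul1r => <-.
by congr T; apply/funext => x; rewrite mul1r.
Qed.

Lemma cfunN f : smooth f -> T (fun x => - f x) = - T f.
Proof.
move=> sf; rewrite -mulN1r -cfunZ//.
by congr T; apply/funext => x; rewrite mulN1r.
Qed.

Lemma cfunB f g : smooth f -> smooth g -> T (fun x => f x - g x) = T f - T g.
Proof. by move=> sf sg; rewrite (cfunD sf (smoothN sg)) cfunN. Qed.

(** A compactly supported functional has a finite order n, so only the remainders of orders j <= n
    on [- r, r] matter. Their common constant times C is a quadratic remainder for s |-> T (F s). *)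
Lemma cfun_derive (F : R -> R -> R) F' s (d : R) : 0 < d ->
  (forall h, `|h| < d -> smooth (F (s + h))) -> smooth F' ->
  (forall (j : nat) r, exists B, forall h y, `|h| < d -> - r <= y <= r ->
    `|derive1n j (F (s + h)) y - derive1n j (F s) y - h * derive1n j F' y| <= B * h ^+ 2) ->
  is_derive s 1 (fun s => T (F s)) (T F').
Proof.
move=> d0 sF sF' H; have [_ [C [r [n [C0 r0 HC]]]]] := cT.
have sFs : smooth (F s) by rewrite -[s]addr0; apply: sF; rewrite normr0.
pose P (j : nat) (B : R) := forall h y, `|h| < d -> - r <= y <= r ->
    `|derive1n j (F (s + h)) y - derive1n j (F s) y - h * derive1n j F' y| <= B * h ^+ 2.
have Pmon j A B : A <= B -> P j A -> P j B.
  move=> AB HA h y hd yr; apply: (le_trans (HA h y hd yr)).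
  by rewrite ler_wpM2r// sqr_ge0.
have [B B0 HB] := unif_nat n Pmon (fun j => H j r).
  apply: (@quadratic_derive _ _ _ _ (C * B) d) => // h hd.
  have sFh := sF h hd.
  have sd := smoothB sFh sFs; have sz := smoothZ (c := h) sF'.
  rewrite -(cfunB sFh sFs) -(cfunZ h sF') -(cfunB sd sz).
  rewrite -mulrA; apply: HC.
    exact: smoothB.
  by move=> j jn x xr; rewrite (derive1nB _ sd sz) (derive1nB _ sFh sFs) derive1nZ//; exact: HB.
Qed.

Lemma cfun_translation kappa t s : bsmooth kappa -> t != 0 ->
  is_derive s 1 (fun s => T (fun y => kappa ((y - s) / t)))
    (- t^-1 * T (fun y => derive1 kappa ((y - s) / t))).
Proof.
move=> [sk bk] t0; rewrite -cfunZ; last by apply/smooth_affine_comp/smooth_derive1.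
apply: (@cfun_derive _ _ s 1 ltr01).
- by move=> h _; exact: smooth_affine_comp.
- by apply/smoothZ/smooth_affine_comp/smooth_derive1.
move=> j r; have [M HM] := bk j.+2.
exists (`|t^-1| ^+ j.+2 * M) => h y h1 yr.
rewrite !derive1n_affine// derive1nZ; last by apply/smooth_affine_comp/smooth_derive1.
rewrite derive1n_affine//; last exact: smooth_derive1.
have D i (z : R) : is_derive z 1 (fun z : R => derive1n i kappa ((y - z) / t))
    (- t^-1 * derive1n i.+1 kappa ((y - z) / t)).
  have e w : (y - w) / t = (w - y) / (- t) by rewrite invrN mulrN -mulNr opprB.
  apply: (@is_derive_ext _ (fun z => derive1n i kappa ((z - y) / (- t)))).
    by move=> w; rewrite e.
  rewrite e -invrN; apply: is_derive_affine; first by rewrite oppr_eq0.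
  exact: smooth_is_derive1n.
have := @taylor_bound R (fun z => t^-1 ^+ j * derive1n j kappa ((y - z) / t))
   (fun z => t^-1 ^+ j * (- t^-1 * derive1n j.+1 kappa ((y - z) / t)))
   (fun z => t^-1 ^+ j * (- t^-1 * (- t^-1 * derive1n j.+2 kappa ((y - z) / t))))
   (s - 1) (s + 1) (`|t^-1| ^+ j.+2 * M) _ _ _ s h.
have -> : t^-1 ^+ j * (- t^-1 * derive1n j.+1 kappa ((y - s) / t)) =
  - t^-1 * (t^-1 ^+ j * derive1n j (derive1 kappa) ((y - s) / t)).
  by rewrite derive1Sn; ring.
apply.
- move=> z _; rewrite mulrA mulrA mulrA !normrM ler_pM ?mulr_ge0//.
  by rewrite !normrX !normrN !exprSr.
- by rewrite lerDl lerBlDr lerDl ler01.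
- by move: h1; rewrite ltr_norml => /andP[h1 h2]; apply/andP; split; lra.
Qed.

Lemma cfun_translation_continuous kappa t : bsmooth kappa -> t != 0 ->
  continuous (fun s => T (fun y => kappa ((y - s) / t))).
Proof.
move=> bk t0; apply: derivable_continuous => s.
by have [] := cfun_translation s bk t0.
Qed.

End cfun_theory.

(** Leibniz' rule on an interval around the support of [chi]. This is how an arbitrary distribution
    becomes a functional that accepts Gaussians. *)
Lemma cfun_localize (W : Defs.distribution R) (chi : R -> R) : test_function chi ->
  cfun (fun f => W (fun x => chi x * f x)).
Proof.
move=> tc; have sc := test_smooth tc; have [r r0 cr] := test_supp_in tc.
have cs f : supp_in (- r) r (fun x => chi x * f x).
  by move=> x /cr ->; rewrite mul0r.
have ct f : smooth f -> test_function (fun x => chi x * f x).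
  by move=> sf; exact: (@supp_in_test _ (- r) r _ (@smoothM R chi f sc sf) (cs f)).
split=> [c f g sf sg|].
  rewrite -(pairing_linear W c (ct f sf) (ct g sg)).
  by congr (W _); apply/funext => x; ring.
have rr : - r <= r by lra.
have [C [n [C0 HC]]] := distribution_order W rr.
have [A A0 HA] := @unif_nat (fun j A => forall x, `|derive1n j chi x| <= A) n
  (fun j A B AB H x => le_trans (H x) AB) (bsmooth_supp sc cr).2.
exists (C * (2 ^+ n * A)), r, n; split => //; first by rewrite !mulr_gt0// exprn_gt0.
move=> f M sf HM; rewrite -mulrA -mulrA.
apply: HC; [exact: (@smoothM R chi f sc sf)|exact: cs|].
have M0 : 0 <= M by rewrite (le_trans _ (HM 0%N isT 0 _))//; lra.
move=> j jn x xr; apply: (@le_trans _ _ (2 ^+ j * (A * M))).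
  apply: leibniz_bound => // i ij; first by apply: HA; exact: leq_trans ij jn.
  by apply: HM => //; exact: leq_trans ij jn.
rewrite ler_wpM2r//; first by rewrite mulr_ge0// ltW.
by rewrite ler_eXn2l// ltr1n.
Qed.

End FunctionalCalculus.

(** * Steps, integrals and mollifiers *)

Section Bumps.
Variable R : realType.
Implicit Types (f g : R -> R) (p : {poly R}) (x y s t l r u : R).

Lemma exprn_expR_bound n u : 0 <= u -> u ^+ n * expR (- u) <= n`!%:R.
Proof.
move=> u0; rewrite expRN ler_pdivrMr ?expR_gt0//.
case: n => [|n].
  by rewrite expr0 mul1r (le_trans _ (expR_ge1Dx _))// lerDl.
have H := expR_ge1Dxn n u0.
have f0 : 0 < (n.+1)`!%:R :> R by rewrite ltr0n fact_gt0.
by rewrite -ler_pdivrMl// mulrC; lra.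
Qed.

Lemma horner_expR_bound p : exists2 B, 0 < B &
  forall u, 0 <= u -> `|p.[u]| * expR (- u) <= B.
Proof.
suff H : forall n, exists2 B, 0 < B & forall u, 0 <= u -> u ^+ n * `|p.[u]| * expR (- u) <= B.
  have [B B0 HB] := H 0%N; exists B => // u u0; have := HB u u0.
  by rewrite expr0 mul1r.
elim/poly_ind: p => [|p c IH] n.
  by exists 1 => // u u0; rewrite horner0 normr0 mulr0 mul0r.
have [B B0 HB] := IH n.+1.
exists (B + `|c| * n`!%:R); first by rewrite ltr_pwDl// mulr_ge0.
move=> u u0; rewrite !hornerE.
have e0 := expR_ge0 (- u).
apply: (@le_trans _ _ (u ^+ n.+1 * `|p.[u]| * expR (- u) + `|c| * (u ^+ n * expR (- u)))).
  rewrite [X in _ <= X](_ : _ = u ^+ n * (`|p.[u]| * u + `|c|) * expR (- u)); last first.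
    by rewrite exprS; ring.
  rewrite ler_wpM2r// ler_wpM2l ?exprn_ge0//.
  by rewrite (le_trans (ler_normD _ _))// normrM (ger0_norm u0).
by rewrite lerD ?HB// ler_wpM2l// exprn_expR_bound.
Qed.

(** Differentiation turns p(1/x) exp(-1/x) into the same expression for X^2 (p - p'), so smoothness
    at 0 follows by induction for all p at once. *)
Definition flat p x := if 0 < x then p.[x^-1] * expR (- x^-1) else 0.

(** With u = 1/x this is the boundedness of u^2 p(u) exp(-u); the order 2 gives the derivative 0 at
    the origin. *)
Lemma flat_quadratic p : exists2 B, 0 < B & forall x, `|flat p x| <= B * x ^+ 2.
Proof.
have [B B0 HB] := horner_expR_bound ('X^2 * p).
exists B => // x; rewrite /flat; case: ltP => x0; last first.
  by rewrite normr0 mulr_ge0 ?sqr_ge0// ltW.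
have xi0 : 0 <= x^-1 by rewrite invr_ge0 ltW.
have H := HB _ xi0; rewrite hornerM hornerXn normrM normrX (ger0_norm xi0) in H.
rewrite normrM (ger0_norm (expR_ge0 _)).
have xn0 : x != 0 by rewrite gt_eqF.
have -> : `|p.[x^-1]| * expR (- x^-1) = (x^-1 ^+ 2 * `|p.[x^-1]| * expR (- x^-1)) * x ^+ 2 by field.
by rewrite ler_wpM2r// sqr_ge0.
Qed.

Lemma is_derive_flat p x : is_derive x 1 (flat p) (flat ('X^2 * (p - p^`())) x).
Proof.
case: (ltgtP x 0) => x0; last first.
- have [B B0 HB] := flat_quadratic p; rewrite x0.
  apply: (@quadratic_derive _ _ _ _ B 1) => // h _.
  by rewrite /flat ltxx add0r subr0 mulr0 subr0; exact: HB.
- rewrite {2}/flat x0.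
  apply: (@near_eq_is_derive _ _ _ (fun x => p.[x^-1] * expR (- x^-1))).
    near=> z; rewrite /flat; have -> // : 0 < z.
    by near: z; exact: lt_nbhsr.
  have xn0 : x != 0 by rewrite gt_eqF.
  have Di : is_derive x 1 (fun z : R => z^-1) (- 1 * (x^-1 * x^-1)).
    by apply: (@is_deriveV_fun _ id).
  have D1 := is_derive1_comp (is_derive_poly p x^-1) Di.
  have Dn : is_derive x 1 (fun z : R => -1 * z^-1) (- 1 * (- 1 * (x^-1 * x^-1))).
    exact: is_deriveZ_fun.
  have D2 := is_derive_expR_comp Dn.
  apply: (@is_derive_ext _ (fun z => p.[z^-1] * expR (-1 * z^-1))).
    by move=> z; rewrite mulN1r.
  have H := is_deriveM_fun D1 D2; apply: is_derive_eq H _.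
  by rewrite hornerM hornerXn hornerD hornerN /= !mulN1r; ring.
- rewrite {2}/flat ltNge (ltW x0)/=.
  apply: (@near_eq_is_derive _ _ _ (fun=> 0)).
    near=> z; rewrite /flat ltNge.
    suff -> : z <= 0 by [].
    by apply: ltW; near: z; exact: lt_nbhsl.
Unshelve. all: by end_near. Qed.

Lemma smooth_flat p : smooth (flat p).
Proof.
apply/smoothP => k; elim: k p => // k IH p.
exact: (@CkI _ _ _ (flat ('X^2 * (p - p^`())))) (is_derive_flat p) (IH _).
Qed.

Lemma flat1_gt0 x : 0 < x -> 0 < flat 1 x.
Proof. by move=> x0; rewrite /flat x0 hornerE mul1r expR_gt0. Qed.

Lemma flat1_le0 p x : x <= 0 -> flat p x = 0.
Proof. by rewrite leNgt /flat => /negbTE ->. Qed.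

Lemma flat1_ge0 x : 0 <= flat 1 x.
Proof. by case: (leP x 0) => [/flat1_le0 ->//|/flat1_gt0/ltW]. Qed.

Definition dflat := flat ('X^2 * (1 - (1 : {poly R})^`())).

Lemma dflat_ge0 x : 0 <= dflat x.
Proof.
case: (leP x 0) => x0; first by rewrite /dflat flat1_le0.
by rewrite /dflat /flat x0 derivC subr0 !hornerE mulr_ge0// ?expR_ge0// sqr_ge0.
Qed.

(** Smooth Heaviside function, rising from 0 at -1 to 1 at 1. Its derivative [stepD] is the bump of
    mass 1 by which W is averaged. *)
Definition step x := flat 1 (1 + x) / (flat 1 (1 + x) + flat 1 (1 - x)).

Let den x : 0 < flat 1 (1 + x) + flat 1 (1 - x).
Proof.
case: (ltP 0 (1 + x)) => h.
  by rewrite ltr_pwDl ?flat1_gt0 ?flat1_ge0.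
by rewrite ltr_wpDl ?flat1_ge0 ?flat1_gt0//; lra.
Qed.

Let sp : smooth (fun x => flat 1 (1 + x)).
Proof.
have -> : (fun x : R => flat 1 (1 + x)) = fun x => flat 1 ((x - (- 1)) / 1).
  by apply/funext => x; rewrite divr1 opprK addrC.
by apply: smooth_affine_comp; [exact: oner_neq0|exact: smooth_flat].
Qed.

Let sm : smooth (fun x => flat 1 (1 - x)).
Proof.
have -> : (fun x : R => flat 1 (1 - x)) = fun x => flat 1 ((x - 1) / (-1)).
  by apply/funext => x; congr flat; lra.
by apply: smooth_affine_comp; [rewrite oppr_eq0 oner_neq0|exact: smooth_flat].
Qed.

Lemma smooth_step : smooth step.
Proof.
apply: (@smoothM R _ _ sp); apply: smoothV; last exact: (@smoothD R _ _ sp sm).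
by move=> x; rewrite gt_eqF.
Qed.

Lemma step_ge0 x : 0 <= step x.
Proof. by rewrite /step divr_ge0 ?flat1_ge0// ltW. Qed.

Lemma step_le1 x : step x <= 1.
Proof. by rewrite /step ler_pdivrMr// mul1r lerDl flat1_ge0. Qed.

Lemma step0 x : x <= -1 -> step x = 0.
Proof. by move=> x1; rewrite /step flat1_le0 ?mul0r//; lra. Qed.

Lemma step1 x : 1 <= x -> step x = 1.
Proof.
move=> x1; rewrite /step (@flat1_le0 1 (1 - x)) ?addr0 ?divff//; last by lra.
by rewrite gt_eqF// flat1_gt0//; lra.
Qed.

Lemma is_derive_step x : is_derive x 1 step
  ((dflat (1 + x) * flat 1 (1 - x) + flat 1 (1 + x) * dflat (1 - x)) /
   (flat 1 (1 + x) + flat 1 (1 - x)) ^+ 2).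
Proof.
have Dp : is_derive x 1 (fun z => flat 1 (1 + z)) (dflat (1 + x)).
  have : is_derive x 1 (fun z : R => flat 1 ((z - (- 1)) / 1)) (1^-1 * dflat ((x - (- 1)) / 1)).
    by apply: is_derive_affine; [exact: oner_neq0|exact: is_derive_flat].
  have e z : (z - (- 1)) / 1 = 1 + z by rewrite divr1 opprK addrC.
  rewrite e => H; apply: (@is_derive_eq _ _ _ _ _ _ _ (1^-1 * dflat (1 + x))); last by rewrite invr1 mul1r.
  by apply: is_derive_ext H => z /=; rewrite e.
have Dm : is_derive x 1 (fun z => flat 1 (1 - z)) (- dflat (1 - x)).
  have : is_derive x 1 (fun z : R => flat 1 ((z - 1) / (-1))) ((-1)^-1 * dflat ((x - 1) / (-1))).
    by apply: is_derive_affine; [rewrite oppr_eq0 oner_neq0|exact: is_derive_flat].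
  have e (z : R) : (z - 1) / (- 1) = 1 - z by lra.
  rewrite e => H; apply: (@is_derive_eq _ _ _ _ _ _ _ ((-1)^-1 * dflat (1 - x))); last by rewrite invrN1 mulN1r.
  by apply: is_derive_ext H => z /=; rewrite e.
have Dd := is_deriveD_fun Dp Dm.
have dn0 : flat 1 (1 + x) + flat 1 (1 - x) != 0 by rewrite gt_eqF.
have Dv := @is_deriveV_fun _ (fun z => flat 1 (1 + z) + flat 1 (1 - z)) _ _ dn0 Dd.
have H := is_deriveM_fun Dp Dv; apply: is_derive_eq H _.
by field.
Qed.

Lemma step_derive_ge0 x : 0 <= derive1 step x.
Proof.
rewrite (is_derive_derive1 (is_derive_step x)).
by rewrite divr_ge0 ?sqr_ge0// addr_ge0// mulr_ge0// ?dflat_ge0// flat1_ge0.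
Qed.

Lemma step_homo x y : x <= y -> step x <= step y.
Proof.
move=> xy; apply: (@ger0_derive1_ndecr R step x y) => //.
- by move=> z _; apply/smooth_derivable/smooth_step.
- by move=> z _; exact: step_derive_ge0.
- by apply/continuous_subspaceT/smooth_continuous/smooth_step.
Qed.

Definition stepD := derive1 step.

Lemma smooth_stepD : smooth stepD.
Proof. exact/smooth_derive1/smooth_step. Qed.

Lemma stepD_supp : supp_in (-1) 1 stepD.
Proof.
move=> x /orP[x1|x1]; rewrite /stepD.
  rewrite -derive1n1 (@derive1n_open _ [set z | z < -1] step (fun=> 0) 1 (@open_lt _ _))//=.
    exact: derive1_cst.
  by move=> z /= /ltW /step0.
rewrite -derive1n1 (@derive1n_open _ [set z | 1 < z] step (fun=> 1) 1 (@open_gt _ _))//=.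
  exact: derive1_cst.
by move=> z /= /ltW /step1.
Qed.

Lemma stepD_ge0 x : 0 <= stepD x.
Proof. exact: step_derive_ge0. Qed.

Lemma bsmooth_stepD : bsmooth stepD.
Proof. exact: bsmooth_supp smooth_stepD stepD_supp. Qed.

End Bumps.

(** * Integrals over compact intervals and primitives *)

Section Integrals.
Variable R : realType.
Implicit Types (f g : R -> R) (a b c x y M : R).
Notation mu := (@lebesgue_measure R).

Definition integral_cc a b f : R := \int[mu]_(x in `[a, b]) f x.

Lemma continuous_integrable a b f : continuous f ->
  mu.-integrable `[a, b] (EFin \o f).
Proof.
move=> cf; apply: continuous_compact_integrable; first exact: segment_compact.
exact: continuous_subspaceT.
Qed.

Let meas a b : measurable (`[a, b]%classic : set (measurableTypeR R)).
Proof. exact: measurable_itv. Qed.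

Lemma integral_ccD a b f g : continuous f -> continuous g ->
  integral_cc a b (fun x => f x + g x) = integral_cc a b f + integral_cc a b g.
Proof. by move=> cf cg; apply: RintegralD => //; exact: continuous_integrable. Qed.

Lemma integral_ccB a b f g : continuous f -> continuous g ->
  integral_cc a b (fun x => f x - g x) = integral_cc a b f - integral_cc a b g.
Proof. by move=> cf cg; apply: RintegralB => //; exact: continuous_integrable. Qed.

Lemma integral_ccZ a b c f : continuous f ->
  integral_cc a b (fun x => c * f x) = c * integral_cc a b f.
Proof. by move=> cf; apply: RintegralZl => //; exact: continuous_integrable. Qed.

Lemma integral_cc_eq a b f g : (forall x, a <= x <= b -> f x = g x) ->
  integral_cc a b f = integral_cc a b g.
Proof. by move=> fg; apply: eq_Rintegral => x; rewrite inE/= in_itv/= => /fg. Qed.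

Lemma integral_cc_le a b f g : continuous f -> continuous g ->
  (forall x, a <= x <= b -> f x <= g x) -> integral_cc a b f <= integral_cc a b g.
Proof.
move=> cf cg fg; apply: le_Rintegral => //; try exact: continuous_integrable.
Qed.

Lemma integral_cc_cst a b c : a <= b -> integral_cc a b (fun=> c) = c * (b - a).
Proof.
move=> ab; rewrite /integral_cc Rintegral_cst; last exact: measurable_itv.
congr (c * _).
have H : mu `[a, b] = (if (a < b)%R then b%:E - a%:E else 0)%E by rewrite (lebesgue_measure_itv `[a, b]%R)/= lte_fin.
apply: (etrans (congr1 fine H)).
by case: ltgtP ab => //= [-> _]; rewrite subrr.
Qed.

Lemma integral_cc_ge0 a b f : continuous f ->
  (forall x, a <= x <= b -> 0 <= f x) -> 0 <= integral_cc a b f.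
Proof. by move=> cf f0; apply: Rintegral_ge0 => x /=; rewrite in_itv/=; exact: f0. Qed.

Lemma integral_cc_bound a b f M : a <= b -> continuous f ->
  (forall x, a <= x <= b -> `|f x| <= M) -> `|integral_cc a b f| <= M * (b - a).
Proof.
move=> ab cf fM; rewrite ler_norml; apply/andP; split.
  rewrite -mulNr -integral_cc_cst//; apply: integral_cc_le => //.
    by move=> x; exact: cvg_cst.
  by move=> x /fM; rewrite ler_norml => /andP[].
rewrite -integral_cc_cst//; apply: integral_cc_le => //.
  by move=> x; exact: cvg_cst.
by move=> x /fM; rewrite ler_norml => /andP[].
Qed.

Lemma integral_cc_split a b c f : continuous f -> a <= b -> b <= c ->
  integral_cc a c f = integral_cc a b f + integral_cc b c f.
Proof.
move=> cf ab bc.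
have := @Rintegral_itvB R f (BLeft a) (BRight c) b (continuous_integrable a c cf).
rewrite !bnd_simp => /(_ ab bc) /eqP; rewrite subr_eq => /eqP.
rewrite Rintegral_itv_obnd_cbnd; last first.
  apply: integrableS (continuous_integrable a c cf) => //.
  by move=> x /=; rewrite !in_itv/= => /andP[/ltW bx ->]; rewrite (le_trans ab bx).
by rewrite addrC.
Qed.

Lemma integral_cc_derive a b (F f : R -> R) : continuous f -> a <= b ->
  (forall x, is_derive x 1 F (f x)) -> integral_cc a b f = F b - F a.
Proof.
move=> cf; rewrite le_eqVlt => /orP[/eqP ->|ab] DF.
  by rewrite /integral_cc set_itv1 Rintegral_set1 subrr.
have dF x : derivable F x 1 by have [] := DF x.
have cF := derivable_continuous dF.
rewrite /integral_cc /Rintegral (@continuous_FTC2 R f F a b)//.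
- exact: continuous_subspaceT.
- split; [by move=> x _; exact: dF| |].
  + exact/cvg_at_right_filter/cF.
  + exact/cvg_at_left_filter/cF.
- by move=> x _; exact: is_derive_derive1.
Qed.

Lemma integral_cc_parts a b f g (df dg : R -> R) : a <= b ->
  continuous df -> continuous dg ->
  (forall x, is_derive x 1 f (df x)) -> (forall x, is_derive x 1 g (dg x)) ->
  integral_cc a b (fun x => f x * dg x) =
  f b * g b - f a * g a - integral_cc a b (fun x => df x * g x).
Proof.
move=> ab cdf cdg Df Dg.
have cf : continuous f by apply: derivable_continuous => x; have [] := Df x.
have cg : continuous g by apply: derivable_continuous => x; have [] := Dg x.
have c1 : continuous (fun x => df x * g x) by move=> x; apply: cvgM; [exact: cdf|exact: cg].
have c2 : continuous (fun x => f x * dg x) by move=> x; apply: cvgM; [exact: cf|exact: cdg].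
apply/eqP; rewrite eq_sym subr_eq -integral_ccD//; apply/eqP/esym.
have H x : is_derive x 1 (fun z => f z * g z) (f x * dg x + df x * g x).
  by rewrite addrC; exact: is_deriveM_fun.
apply: (integral_cc_derive _ ab H) => x.
by apply: cvgD; [exact: c2|exact: c1].
Qed.

Lemma Rintegral_supp a b f : a <= b -> supp_in a b f ->
  \int[mu]_x f x = integral_cc a b f.
Proof.
move=> ab sf; rewrite /integral_cc [RHS]Rintegral_mkcond; apply: eq_Rintegral => x _.
rewrite patchE; case: ifPn => //; rewrite notin_setE/= in_itv/= => /negP.
by rewrite negb_and -!ltNge => /sf.
Qed.

(** The case split gives an antiderivative on the whole line, as [integral_cc] over a reversed
    interval is 0. *)
Definition primitive f x := if 0 <= x then integral_cc 0 x f else - integral_cc x 0 f.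

Lemma primitiveB f x y : continuous f -> x <= y ->
  primitive f y - primitive f x = integral_cc x y f.
Proof.
move=> cf xy; rewrite /primitive; case: (leP 0 x) => x0.
  rewrite (le_trans x0 xy) (integral_cc_split cf x0 xy); lra.
case: (leP 0 y) => y0.
  by rewrite (integral_cc_split cf (ltW x0) y0); lra.
by rewrite (integral_cc_split cf xy (ltW y0)); lra.
Qed.

Lemma is_derive_primitive f (f1 : R -> R) x :
  continuous f1 -> (forall x, is_derive x 1 f (f1 x)) ->
  is_derive x 1 (primitive f) (f x).
Proof.
move=> cf1 Df; have cf : continuous f by apply: derivable_continuous => z; have [] := Df z.
have [M M0 HM] := continuous_bounded (x - 1) (x + 1) cf1.
have cb c : continuous (fun z => f z - c).
  by move=> z; apply: cvgB; [exact: cf|exact: cvg_cst].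
have cc c : continuous (fun _ : R => c) by move=> z; exact: cvg_cst.
have mvb y z : x - 1 <= y <= x + 1 -> x - 1 <= z <= x + 1 -> `|f z - f y| <= M * `|z - y|.
  exact: (@mean_value_bound R f f1 (x - 1) (x + 1) M (fun w _ => Df w) HM y z).
apply: (@quadratic_derive _ _ _ _ M 1) => // h; rewrite ltr_norml => /andP[h1 h2].
case: (leP 0 h) => h0.
  rewrite primitiveB//; last by lra.
  have -> : h * f x = integral_cc x (x + h) (fun=> f x).
    by rewrite integral_cc_cst ?lerDl//; ring.
  rewrite -integral_ccB//.
  rewrite (_ : M * h ^+ 2 = (M * h) * (x + h - x)); last by ring.
  apply: integral_cc_bound => //; first by lra.
  move=> z /andP[z1 z2]; apply: le_trans (mvb x z _ _) _; [apply/andP; split; lra|apply/andP; split; lra|].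
  by rewrite ler_wpM2l ?(ltW M0)// ger0_norm; lra.
rewrite -[_ - _ - _]opprK normrN.
have -> : - (primitive f (x + h) - primitive f x - h * f x) =
   (primitive f x - primitive f (x + h)) - (- h * f x) by ring.
rewrite primitiveB//; last by lra.
have -> : - h * f x = integral_cc (x + h) x (fun=> f x).
  by rewrite integral_cc_cst//; [ring|lra].
rewrite -integral_ccB//.
rewrite (_ : M * h ^+ 2 = (M * - h) * (x - (x + h))); last by ring.
apply: integral_cc_bound => //; first by lra.
move=> z /andP[z1 z2]; apply: le_trans (mvb x z _ _) _; [apply/andP; split; lra|apply/andP; split; lra|].
by rewrite ler_wpM2l ?(ltW M0)// ler0_norm; lra.
Qed.

End Integrals.

(** * Convolution with kernels that concentrate at 0 *)

Section Mollification.
Variable R : realType.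
Implicit Types (f g psi kappa : R -> R) (x y z s t l r : R) (T : (R -> R) -> R).

Lemma bsmooth_continuous f : bsmooth f -> continuous f.
Proof. by move=> [sf _]; exact: smooth_continuous. Qed.

Lemma bsmooth_derive1n f n : bsmooth f -> bsmooth (derive1n n f).
Proof. by move=> bf; elim: n => // n IH; rewrite derive1nS; exact: bsmooth_derive1. Qed.

Lemma continuous_reflect f y t : continuous f -> continuous (fun z => f ((y - z) / t)).
Proof.
move=> cf z; apply: (@continuous_comp _ _ _ (fun z => (y - z) / t) f); last exact: cf.
by apply: cvgMl; apply: cvgB; [exact: cvg_cst|exact: cvg_id].
Qed.

Lemma is_derive_reflect f y t z l : t != 0 -> is_derive ((y - z) / t) 1 f l ->
  is_derive z 1 (fun z => f ((y - z) / t)) (- t^-1 * l).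
Proof.
move=> t0 fl.
have e w : (y - w) / t = (w - y) / (- t) by rewrite invrN mulrN -mulNr opprB.
apply: (@is_derive_ext _ (fun z => f ((z - y) / (- t)))); first by move=> w; rewrite e.
by rewrite -invrN; apply: is_derive_affine; [rewrite oppr_eq0|rewrite -e].
Qed.

Definition convolve a b t f kappa y := integral_cc a b (fun z => f z * kappa ((y - z) / t)).

Lemma continuous_convolve_integrand t f kappa y : continuous f -> continuous kappa ->
  continuous (fun z => f z * kappa ((y - z) / t)).
Proof.
by move=> cf ck z; apply: cvgM; [exact: cf|exact: continuous_reflect].
Qed.

Lemma is_derive_convolve a b t f kappa y : a <= b -> t != 0 -> continuous f -> bsmooth kappa ->
  is_derive y 1 (convolve a b t f kappa) (t^-1 * convolve a b t f (derive1 kappa) y).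
Proof.
move=> ab t0 cf bk; have [sk Hk] := bk.
have ck := bsmooth_continuous bk; have ck1 := bsmooth_continuous (bsmooth_derive1 bk).
have [M M0 HM] := continuous_bounded a b cf.
have [B HB] := Hk 2%N.
apply: (@quadratic_derive _ _ _ _ (M * (`|t^-1| ^+ 2 * B) * (b - a)) 1) => // h _.
rewrite /convolve.
have cc k w : continuous k -> continuous (fun z => f z * k ((w - z) / t)).
  exact: continuous_convolve_integrand.
have cz (c : R) k : continuous k -> continuous (fun z => c * k z).
  by move=> ckk z; apply: cvgM; [exact: cvg_cst|exact: ckk].
have c1 := cc _ (y + h) ck; have c2 := cc _ y ck; have c3 := cc _ y ck1.
have c4 := cz t^-1 _ c3; have c5 := cz h _ c4.
have c6 : continuous (fun z => f z * kappa ((y + h - z) / t) - f z * kappa ((y - z) / t)).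
  by move=> z; apply: cvgB; [exact: c1|exact: c2].
rewrite -(integral_ccB _ _ c1 c2) -(integral_ccZ _ _ _ c3) -(integral_ccZ _ _ _ c4) -(integral_ccB _ _ c6 c5).
rewrite mulrAC; apply: integral_cc_bound => //.
  by move=> z; apply: cvgB; [exact: c6|exact: c5].
move=> z zab.
have -> : f z * kappa ((y + h - z) / t) - f z * kappa ((y - z) / t) -
   h * (t^-1 * (f z * derive1 kappa ((y - z) / t))) =
   f z * (kappa ((y + h - z) / t) - kappa ((y - z) / t) - h * (t^-1 * derive1 kappa ((y - z) / t))).
  by ring.
rewrite normrM -[leRHS]mulrA ler_pM ?HM//.
have D (k : R -> R) (w : R) : smooth k -> is_derive w 1 (fun w => k ((w - z) / t)) (t^-1 * derive1 k ((w - z) / t)).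
  by move=> skk; apply: is_derive_affine => //; exact: smooth_is_derive.
apply: (@taylor_bound R (fun w => kappa ((w - z) / t)) (fun w => t^-1 * derive1 kappa ((w - z) / t))
  (fun w => t^-1 * (t^-1 * derive1 (derive1 kappa) ((w - z) / t))) (y - `|h|) (y + `|h|)).
- by move=> w _; exact: D.
- by move=> w _; apply: is_deriveZ_fun; apply: D; exact: smooth_derive1.
- move=> w _; rewrite mulrA normrM normrM -expr2 ler_wpM2l//; exact: HB.
- by apply/andP; split; rewrite ?lerDl// lerBlDr lerDl.
- by rewrite lerD2l lerD2l ler_norm andbT lerNnormlW.
Qed.

Lemma smooth_convolve a b t f kappa : a <= b -> t != 0 -> continuous f -> bsmooth kappa ->
  smooth (convolve a b t f kappa) /\
  forall n, derive1n n (convolve a b t f kappa) = fun y => t^-1 ^+ n * convolve a b t f (derive1n n kappa) y.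
Proof.
move=> ab t0 cf bk.
have H n : derive1n n (convolve a b t f kappa) = fun y => t^-1 ^+ n * convolve a b t f (derive1n n kappa) y.
  elim: n => [|n IH]; first by apply/funext => y; rewrite expr0 mul1r.
  rewrite derive1nS IH; apply/funext => y; apply: is_derive_derive1.
  rewrite exprSr -mulrA; apply: is_deriveZ_fun; apply: is_derive_convolve => //.
  exact: bsmooth_derive1n.
split => // m y; rewrite H.
suff : is_derive y 1 (fun y => t^-1 ^+ m * convolve a b t f (derive1n m kappa) y)
  (t^-1 ^+ m * (t^-1 * convolve a b t f (derive1 (derive1n m kappa)) y)) by case.
by apply: is_deriveZ_fun; apply: is_derive_convolve => //; exact: bsmooth_derive1n.
Qed.

Lemma convolve_parts a b t f kappa y : a <= b -> t != 0 -> smooth f -> f a = 0 -> f b = 0 ->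
  bsmooth kappa ->
  t^-1 * convolve a b t f (derive1 kappa) y = convolve a b t (derive1 f) kappa y.
Proof.
move=> ab t0 sf fa fb bk; have [sk _] := bk.
have sf1 := smooth_derive1 sf; have bk1 := bsmooth_derive1 bk.
have cz (c : R) (k : R -> R) : continuous k -> continuous (fun z => c * k z).
  by move=> ckk z; apply: cvgM; [exact: cvg_cst|exact: ckk].
have ck1 : continuous (fun z => - t^-1 * derive1 kappa ((y - z) / t)).
  by apply: cz; apply: continuous_reflect; exact: bsmooth_continuous.
have Dk z : is_derive z 1 (fun z => kappa ((y - z) / t)) (- t^-1 * derive1 kappa ((y - z) / t)).
  by apply: is_derive_reflect => //; exact: smooth_is_derive.
have := @integral_cc_parts R a b f (fun z => kappa ((y - z) / t)) (derive1 f)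
   (fun z => - t^-1 * derive1 kappa ((y - z) / t)) ab (smooth_continuous sf1) ck1
   (fun z => smooth_is_derive z sf) Dk.
rewrite fa fb !mul0r subrr add0r => H.
rewrite /convolve; apply: oppr_inj; rewrite -H -mulNr -integral_ccZ; last first.
  apply: continuous_convolve_integrand; [exact: smooth_continuous|exact: bsmooth_continuous].
by apply: integral_cc_eq => z _; ring.
Qed.

(** All derivatives of f vanish at both ends, so integration by parts moves each derivative from the
    kernel to f. Convergence of convolutions thereby extends to convergence of all their
    derivatives. *)
Lemma derive1n_convolve a b t f kappa n : a <= b -> t != 0 -> smooth f ->
  (forall j, derive1n j f a = 0) -> (forall j, derive1n j f b = 0) -> bsmooth kappa ->
  derive1n n (convolve a b t f kappa) = convolve a b t (derive1n n f) kappa.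
Proof.
move=> ab t0 sf fa fb bk; elim: n => // n IH; rewrite derive1nS IH; apply/funext => y.
have sfn := smooth_derive1n (n := n) sf.
apply: is_derive_derive1; rewrite -convolve_parts//; last exact: (fb n); last exact: (fa n).
by apply: is_derive_convolve => //; exact: smooth_continuous.
Qed.


(** An approximate identity given by a primitive of its kernel, so that masses are differences of
    values. The last clause says that the rescaled kernel vanishes uniformly away from 0; it is met
    by the bump and by the Gaussian. *)
Definition mollifier (CDF : R -> R) := [/\ bsmooth (derive1 CDF), smooth CDF,
  forall x, 0 <= derive1 CDF x, CDF (-1) < CDF 1 &
  forall d e, 0 < d -> 0 < e -> exists2 t1, 0 < t1 &
    forall t x, 0 < t -> t < t1 -> d <= `|x| -> t^-1 * derive1 CDF (x / t) <= e].

Section mollifier_theory.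
Variables (CDF : R -> R) (mCDF : mollifier CDF).
Let kappa := derive1 CDF.

Lemma mollifier_mass a b t y : a <= b -> 0 < t ->
  integral_cc a b (fun z => t^-1 * kappa ((y - z) / t)) = CDF ((y - a) / t) - CDF ((y - b) / t).
Proof.
move=> ab t0; have [bk sC k0 _ _] := mCDF.
have tn0 : t != 0 by rewrite gt_eqF.
have D z : is_derive z 1 (fun z => -1 * CDF ((y - z) / t)) (t^-1 * kappa ((y - z) / t)).
  have -> : t^-1 * kappa ((y - z) / t) = -1 * (- t^-1 * kappa ((y - z) / t)) by ring.
  by apply: is_deriveZ_fun; apply: is_derive_reflect => //; exact: smooth_is_derive.
rewrite (integral_cc_derive _ ab D); first by ring.
move=> z; apply: cvgM; first exact: cvg_cst.
exact/continuous_reflect/bsmooth_continuous.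
Qed.

Lemma CDF_homo x y : x <= y -> CDF x <= CDF y.
Proof.
have [bk sC k0 _ _] := mCDF.
move=> xy; apply: (@ger0_derive1_ndecr R CDF x y) => //.
  by move=> z _; exact: smooth_derivable.
exact/continuous_subspaceT/smooth_continuous.
Qed.

Lemma convolve_approx f a b r B e : smooth f -> a + 1 <= - r -> r <= b - 1 -> 0 < r -> 0 < e ->
  (forall x, `|f x| <= B) -> (forall x, `|derive1 f x| <= B) ->
  exists2 t1, 0 < t1 & forall t y, 0 < t -> t < t1 -> - r <= y <= r ->
    `|convolve a b t f kappa y / (t * (CDF t^-1 - CDF (- t^-1))) - f y| <= e.
Proof.
move=> sf ar rb r0 e0 fB f1B; have [bk sC k0 c0 tail] := mCDF.
set c := CDF 1 - CDF (-1); have {}c0 : 0 < c by rewrite subr_gt0.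
pose L := b - a; have L0 : 0 < L by rewrite /L; lra.
have B0 : 0 <= B by apply: le_trans (fB 0).
(* Within distance d of y, f varies by at most e / 2. Beyond d the rescaled kernel is at most [tau],
   chosen so that errors amounting to 4 B tau L fit into the other half. *)
pose d := Num.min 1 (e / (2 * (B + 1))).
have d0 : 0 < d by rewrite /d lt_min ltr01 divr_gt0//; lra.
have d1 : d <= 1 by rewrite /d ge_min lexx.
have de : B * d <= e / 2.
  apply: (@le_trans _ _ ((B + 1) * (e / (2 * (B + 1))))).
    by rewrite ler_pM// ?(ltW d0)//; [lra|rewrite /d ge_min lexx orbT].
  rewrite le_eqVlt; apply/orP; left; apply/eqP; field.
  by rewrite gt_eqF//; lra.
pose tau := e / 2 * c / ((B + 3 * B + 1) * L).
have tau0 : 0 < tau by rewrite /tau divr_gt0// ?mulr_gt0//; lra.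
have [t1 t10 Ht1] := tail d tau d0 tau0.
exists (Num.min t1 1); first by rewrite lt_min t10 ltr01.
move=> t y t0; rewrite lt_min => /andP[tt1 t1'] /andP[yr1 yr2].
have tn0 : t != 0 by rewrite gt_eqF.
have ab : a <= b by lra.
pose k z := t^-1 * kappa ((y - z) / t).
have ck : continuous k.
  move=> z; apply: cvgM; first exact: cvg_cst.
  exact/continuous_reflect/bsmooth_continuous.
have cf := smooth_continuous sf.
have kge0 z : 0 <= k z by rewrite mulr_ge0// invr_ge0 ltW.
have ti1 : 1 <= t^-1 by rewrite invf_ge1// ltW.
(* The mass of the rescaled kernel on [y - 1, y + 1] stands in for its total mass; it is at least c
   because t < 1. *)
set m := CDF t^-1 - CDF (- t^-1).
have mc : c <= m.
  have h1 := CDF_homo ti1.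
  have h2 : CDF (- t^-1) <= CDF (-1) by apply: CDF_homo; lra.
  by rewrite /c /m; lra.
have m0 : 0 < m by exact: lt_le_trans mc.
have Im : integral_cc (y - 1) (y + 1) k = m.
  rewrite mollifier_mass//; last by lra.
  by rewrite /m; congr (CDF _ - CDF _); field.
pose m' := integral_cc a b k.
have ktail z : d <= `|y - z| -> `|k z| <= tau.
  by move=> dz; rewrite ger0_norm//; exact: Ht1.
have m'E : m' = integral_cc a (y - 1) k + m + integral_cc (y + 1) b k.
  rewrite -Im /m' (@integral_cc_split _ a (y - 1) b)//; try lra.
  by rewrite (@integral_cc_split _ (y - 1) (y + 1) b)//; [ring|lra|lra].
have mm' : m <= m' <= m + tau * L.
  have g1 : 0 <= integral_cc a (y - 1) k by apply: integral_cc_ge0.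
  have g2 : 0 <= integral_cc (y + 1) b k by apply: integral_cc_ge0.
  have h1 : `|integral_cc a (y - 1) k| <= tau * (y - 1 - a).
    apply: integral_cc_bound => //; first by lra.
    move=> z /andP[z1 z2]; apply: ktail; rewrite (le_trans d1)// ger0_norm; lra.
  have h2 : `|integral_cc (y + 1) b k| <= tau * (b - (y + 1)).
    apply: integral_cc_bound => //; first by lra.
    move=> z /andP[z1 z2]; apply: ktail; rewrite (le_trans d1)// ler0_norm; lra.
  rewrite ger0_norm// in h1; rewrite ger0_norm// in h2.
  rewrite m'E; apply/andP; split; first by lra.
  have : tau * (y - 1 - a) + tau * (b - (y + 1)) <= tau * L.
    by rewrite -mulrDr ler_wpM2l ?(ltW tau0)// /L; lra.
  lra.
have cfk : continuous (fun z => f z * k z) by move=> z; apply: cvgM; [exact: cf|exact: ck].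
have ckc (w : R) : continuous (fun z => w * k z) by move=> z; apply: cvgM; [exact: cvg_cst|exact: ck].
have Ec : convolve a b t f kappa y / t = integral_cc a b (fun z => f z * k z).
  rewrite mulrC -integral_ccZ; last exact: continuous_convolve_integrand cf (bsmooth_continuous bk).
  by apply: integral_cc_eq => z _; rewrite /k; ring.
have main : `|convolve a b t f kappa y / t - f y * m'| <= B * d * m' + 2 * B * tau * L.
  rewrite Ec /m' -integral_ccZ// -integral_ccB//.
  have cfyk : continuous (fun z => f z * k z - f y * k z).
    by move=> z; apply: cvgB; [exact: cfk|exact: ckc].
  have bound z : `|f z * k z - f y * k z| <= B * d * k z + 2 * B * tau.
    rewrite -mulrBl normrM (ger0_norm (kge0 z)).
    case: (leP d `|y - z|) => dz.
      have kt : k z <= tau by have := ktail z dz; rewrite ger0_norm.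
      have f2 : `|f z - f y| <= 2 * B.
        by rewrite (le_trans (ler_normB _ _))// mulr2n mulrDl mul1r lerD.
      rewrite (le_trans (ler_pM _ _ f2 kt))// lerDr mulr_ge0//.
      by rewrite mulr_ge0// ltW.
    have : `|f z - f y| <= B * `|z - y|.
      apply: (@mean_value_bound R f (derive1 f) (Num.min y z) (Num.max y z)).
      - by move=> w _; exact: smooth_is_derive.
      - by move=> w _.
      - by rewrite ge_min le_max lexx.
      - by rewrite ge_min le_max lexx !orbT.
    rewrite distrC in dz; move=> h.
    have {}h : `|f z - f y| <= B * d.
      by rewrite (le_trans h)// ler_wpM2l// ltW.
    by rewrite (le_trans (ler_wpM2r (kge0 z) h))// lerDl mulr_ge0 ?(ltW tau0)//; lra.
  have cb : continuous (fun z => B * d * k z + 2 * B * tau).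
    by move=> z; apply: cvgD; [exact: ckc|exact: cvg_cst].
  have cc : continuous (fun _ : R => 2 * B * tau) by move=> z; exact: cvg_cst.
  have -> : B * d * integral_cc a b k + 2 * B * tau * L =
      integral_cc a b (fun z => B * d * k z + 2 * B * tau).
    rewrite (integral_ccD _ _ (ckc (B * d)) cc) (integral_ccZ _ _ _ ck).
    by congr (_ + _); rewrite integral_cc_cst.
  rewrite ler_norml; apply/andP; split.
    rewrite -mulN1r -integral_ccZ//; apply: integral_cc_le => //.
      by move=> z; apply: cvgM; [exact: cvg_cst|exact: cb].
    by move=> z _; have := bound z; rewrite ler_norml mulN1r => /andP[].
  apply: integral_cc_le => // z _.
  by have := bound z; rewrite ler_norml => /andP[].
have -> : convolve a b t f kappa y / (t * m) - f y =
   (convolve a b t f kappa y / t - f y * m' + f y * (m' - m)) / m.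
  by field; rewrite tn0 gt_eqF.
rewrite normrM normfV (ger0_norm (ltW m0)) ler_pdivrMr//.
move/andP : mm' => [mm1 mm2].
have h2 : `|f y * (m' - m)| <= B * (tau * L).
  by rewrite normrM ler_pM// ger0_norm; lra.
apply: (le_trans (ler_normD _ _)); apply: (le_trans (lerD main h2)).
have h3 : B * d * m' <= e / 2 * m + B * (tau * L).
  apply: (@le_trans _ _ (B * d * (m + tau * L))).
    by rewrite ler_wpM2l// mulr_ge0// ltW.
  rewrite mulrDr lerD//; first by rewrite ler_wpM2r// ltW.
  rewrite ler_wpM2r//; first by rewrite ltW// mulr_gt0.
  by rewrite ler_piMr.
have h4 : (B + 3 * B) * (tau * L) <= e / 2 * m.
  apply: (@le_trans _ _ (e / 2 * c)); last by rewrite ler_wpM2l//; lra.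
  apply: (@le_trans _ _ ((B + 3 * B + 1) * (tau * L))).
    by rewrite ler_wpM2r ?lerDl//; apply: ltW; rewrite mulr_gt0.
  rewrite le_eqVlt; apply/orP; left; apply/eqP; rewrite /tau; field.
  by rewrite !gt_eqF//; lra.
lra.
Qed.

End mollifier_theory.
End Mollification.

(** * Nonnegativity tested on translated kernels *)

Section MollificationPositivity.
Variable R : realType.
Implicit Types (f g psi kappa CDF : R -> R) (x y z s t l r : R) (T : (R -> R) -> R).

(** Moving the upper end of the integral takes the place of exchanging T with the integral: the
    derivative in s is the pairing with a single translated kernel, weighted by f s. *)
Lemma cfun_convolve_derive T a s t f kappa : cfun T -> a < s -> t != 0 ->
  bsmooth f -> bsmooth kappa ->
  is_derive s 1 (fun s => T (convolve a s t f kappa)) (f s * T (fun y => kappa ((y - s) / t))).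
Proof.
move=> cT as0 t0 bf bk; have [sf Hf] := bf; have [sk Hk] := bk.
have cf := smooth_continuous sf.
have ska : smooth (fun y => kappa ((y - s) / t)) by exact: smooth_affine_comp.
rewrite -(cfunZ cT)//; apply: (@cfun_derive _ _ cT _ _ s (s - a)).
- by rewrite subr_gt0.
- move=> h; rewrite ltr_norml => /andP[h1 h2].
  by have [] := @smooth_convolve R a (s + h) t f kappa; try done; lra.
- exact: smoothZ.
move=> j r.
have [F0 HF0] := Hf 0%N; have [F1 HF1] := Hf 1%N.
have [K0 HK0] := Hk j; have [K1 HK1] := Hk j.+1.
exists (`|t^-1 ^+ j| * (F1 * K0 + F0 * (`|t^-1| * K1))) => h y.
rewrite ltr_norml => /andP[h1 h2] _.
have bkj := @bsmooth_derive1n _ _ j bk.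
have ckj := bsmooth_continuous bkj.
pose g z := f z * derive1n j kappa ((y - z) / t).
pose g1 z := derive1 f z * derive1n j kappa ((y - z) / t) + f z * (- t^-1 * derive1n j.+1 kappa ((y - z) / t)).
have Dg z : is_derive z 1 g (g1 z).
  apply: is_deriveM_fun; first exact: smooth_is_derive.
  apply: is_derive_reflect => //; exact: smooth_is_derive1n.
have cg : continuous g by exact: continuous_convolve_integrand.
have cg1 : continuous g1.
  move=> z; apply: cvgD; apply: cvgM.
  - exact/smooth_continuous/smooth_derive1.
  - exact: continuous_reflect.
  - exact: cf.
  - apply: cvgM; first exact: cvg_cst.
    exact/continuous_reflect/bsmooth_continuous/bsmooth_derive1n.
have ash : a <= s + h by lra.
have [_ ->] := smooth_convolve ash t0 cf bk.
have [_ ->] := smooth_convolve (ltW as0) t0 cf bk.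
rewrite derive1nZ// derive1n_affine//.
have E w : a <= w -> convolve a w t f (derive1n j kappa) y = primitive g w - primitive g a.
  by move=> aw; rewrite primitiveB.
rewrite !E; [|lra|lra].
have -> : t^-1 ^+ j * (primitive g (s + h) - primitive g a) - t^-1 ^+ j * (primitive g s - primitive g a) -
   h * (f s * (t^-1 ^+ j * derive1n j kappa ((y - s) / t))) =
   t^-1 ^+ j * (primitive g (s + h) - primitive g s - h * g s) by rewrite /g; ring.
rewrite normrM -mulrA ler_wpM2l//.
apply: (@taylor_bound R (primitive g) g g1 (s - `|h|) (s + `|h|)).
- by move=> z _; exact: is_derive_primitive cg1 Dg.
- move=> z _; apply: (le_trans (ler_normD _ _)); rewrite !normrM normrN.
  have i1 : `|derive1 f z| <= F1 by exact: HF1.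
  have i2 : `|f z| <= F0 by exact: HF0.
  have i3 : `|derive1n j kappa ((y - z) / t)| <= K0 by exact: HK0.
  have i4 : `|derive1n j.+1 kappa ((y - z) / t)| <= K1 by exact: HK1.
  by apply: lerD; apply: ler_pM => //; rewrite ?mulr_ge0// ?ler_wpM2l//.
- by apply/andP; split; rewrite ?lerDl// lerBlDr lerDl.
- by rewrite lerD2l lerD2l ler_norm andbT lerNnormlW.
Qed.

(** For fixed t, T of the convolution over [a, s] starts at 0 and has derivative psi s times a
    nonnegative pairing, so its final value is nonnegative. As t tends to 0 the normalised
    convolutions converge to [psi] with all derivatives up to the order of T. *)
Theorem mollifier_cfun_ge0 T CDF al be t0 psi : cfun T -> mollifier CDF -> 0 < t0 ->
  (forall t z, 0 < t -> t < t0 -> al <= z <= be -> 0 <= T (fun y => derive1 CDF ((y - z) / t))) ->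
  smooth psi -> (forall x, 0 <= psi x) -> supp_in al be psi -> 0 <= T psi.
Proof.
move=> cT mC t00 HT sp p0 psupp.
have [bk sC k0 c0 _] := mC.
have [_ [C [r [n [C0 r0 HC]]]]] := cT.
pose rho := r + `|al| + `|be| + 1.
pose a := - rho - 2; pose b := rho + 1.
have al1 : - `|al| <= al by rewrite lerNnormlW.
have be1 : be <= `|be| by exact: ler_norm.
have al0 := normr_ge0 al; have be0 := normr_ge0 be.
have bp := bsmooth_supp sp psupp.
have cp := smooth_continuous sp.
have psupp' : supp_in (- rho) rho psi by apply: supp_inW psupp; rewrite /rho; lra.
have pa j : derive1n j psi a = 0.
  by apply: (derive1n_supp j psupp'); apply/orP; left; rewrite /a; lra.
have pb j : derive1n j psi b = 0.
  by apply: (derive1n_supp j psupp'); apply/orP; right; rewrite /b; lra.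
have conv_ge0 t : 0 < t -> t < t0 -> 0 <= T (convolve a b t psi (derive1 CDF)).
  move=> tp tt0; have tn0 : t != 0 by rewrite gt_eqF.
  have D s : a < s -> is_derive s 1 (fun s => T (convolve a s t psi (derive1 CDF)))
     (psi s * T (fun y => derive1 CDF ((y - s) / t))).
    by move=> as0; exact: cfun_convolve_derive.
  (* The start is a + 1, as the derivative formula asks for a < s; [psi] vanishes on [a, a + 1], so
     the initial value is still 0. *)
  have := @ger0_derive1_ndecr R (fun s => T (convolve a s t psi (derive1 CDF))) (a + 1) b _ _ _ (a + 1) b.
  have -> : T (convolve a (a + 1) t psi (derive1 CDF)) = 0.
    rewrite -(cfun0 cT); congr T; apply/funext => y; rewrite /convolve.
    rewrite (@integral_cc_eq _ _ _ _ (fun=> 0)).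
      by rewrite integral_cc_cst ?mul0r// lerDl.
    move=> z /andP[z1 z2]; rewrite psupp' ?mul0r//.
    by apply/orP; left; move: z2; rewrite /a; lra.
  apply => //.
  - move=> s; rewrite in_itv/= => /andP[s1 s2].
    have as0 : a < s by lra.
    by have [] := D s as0.
  - move=> s; rewrite in_itv/= => /andP[s1 s2].
    have as0 : a < s by lra.
    rewrite (is_derive_derive1 (D s as0)).
    case: (boolP (al <= s <= be)) => [sab|].
      by rewrite mulr_ge0// HT.
    by rewrite negb_and -!ltNge => /psupp ->; rewrite mul0r.
  - apply: derivable_within_continuous => s; rewrite in_itv/= => /andP[s1 s2].
    have as0 : a < s by lra.
    by have [] := D s as0.
  - by rewrite /a /b /rho; lra.
apply/ler_addgt0Pr => e e0.
have [B B0 HB] := @unif_nat R (fun j B => forall x, `|derive1n j psi x| <= B) n.+1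
  (fun j A B AB H x => le_trans (H x) AB) bp.2.
have ar : a + 1 <= - r by rewrite /a /rho; lra.
have rb : r <= b - 1 by rewrite /b /rho; lra.
have eC : 0 < e / C by rewrite divr_gt0.
have [t1 t10 Ht1] : exists2 t1, 0 < t1 & forall j, (j <= n)%N -> forall t y, 0 < t -> t < t1 -> - r <= y <= r ->
    `|convolve a b t (derive1n j psi) (derive1 CDF) y / (t * (CDF t^-1 - CDF (- t^-1))) - derive1n j psi y| <= e / C.
  have : forall k, (k <= n)%N -> exists2 t1, 0 < t1 & forall j, (j <= k)%N -> forall t y, 0 < t -> t < t1 -> - r <= y <= r ->
    `|convolve a b t (derive1n j psi) (derive1 CDF) y / (t * (CDF t^-1 - CDF (- t^-1))) - derive1n j psi y| <= e / C.
    have one k : (k <= n)%N -> _ := fun kn => @convolve_approx R CDF mC (derive1n k psi) a b r B (e / C)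
      (smooth_derive1n sp) ar rb r0 eC (HB k (leqW kn)) (HB k.+1 kn).
    elim=> [|k IH] kn.
      by have [t1 t10 H1] := one 0%N kn; exists t1 => // j; rewrite leqn0 => /eqP ->.
    have [t1 t10 H1] := IH (ltnW kn).
    have [t2 t20 H2] := one k.+1 kn.
    exists (Num.min t1 t2); first by rewrite lt_min t10.
    move=> j jk t y tp; rewrite lt_min => /andP[tt1 tt2].
    move: jk; rewrite leq_eqVlt => /orP[/eqP ->|jk]; [exact: H2|exact: H1].
  exact.
pose m := Num.min t0 (Num.min t1 1); pose t := m / 2.
have m0 : 0 < m by rewrite /m !lt_min t00 t10 ltr01.
have tp : 0 < t by rewrite /t divr_gt0.
have tm : t < m by rewrite /t; lra.
move: (tm); rewrite !lt_min => /and3P[tt0 tt1 tl1].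
have tn0 : t != 0 by rewrite gt_eqF.
have mass0 : 0 < CDF t^-1 - CDF (- t^-1).
  have ti1 : 1 <= t^-1 by rewrite invf_ge1// ltW.
  have h1 := CDF_homo mC ti1.
  have h2 : CDF (- t^-1) <= CDF (-1) by apply: (CDF_homo mC); lra.
  lra.
have ab : a <= b by rewrite /a /b /rho; lra.
have sc := (smooth_convolve ab tn0 cp bk).1.
set w := t * (CDF t^-1 - CDF (- t^-1)).
have w0 : 0 < w by rewrite mulr_gt0.
have szc := smoothZ (c := w^-1) sc.
have := HC (fun x => w^-1 * convolve a b t psi (derive1 CDF) x - psi x) (e / C) (smoothB szc sp) _.
rewrite (cfunB cT szc sp) (cfunZ cT _ sc) mulrCA divff ?gt_eqF// mulr1.
have H : 0 <= w^-1 * T (convolve a b t psi (derive1 CDF)).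
  by rewrite mulr_ge0 ?conv_ge0// invr_ge0 ltW.
move=> K; have {}K := K _; rewrite -lerBlDr sub0r.
suff : `|w^-1 * T (convolve a b t psi (derive1 CDF)) - T psi| <= e.
  by rewrite ler_norml => /andP[]; lra.
apply: K => j jn x xr.
rewrite (derive1nB _ szc sp) (derive1nZ _ _ sc) derive1n_convolve// mulrC.
exact: Ht1.
Qed.

End MollificationPositivity.

(** * Gaussians with polynomial factors *)

Section Gaussian.
Variable R : realType.
Implicit Types (p : {poly R}) (x y z s t l r : R).

(** The polynomial factor makes the class closed under differentiation, p becoming p' - X p; the
    kernel itself is p = 1, without normalisation. *)
Definition gauss p x := p.[x] * expR (- (2^-1 * (x * x))).

Lemma is_derive_gauss p x : is_derive x 1 (gauss p) (gauss (p^`() - 'X * p) x).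
Proof.
have D1 := is_derive_poly p x.
have D2 : is_derive x 1 (fun z : R => -1 * (2^-1 * (z * z))) (-1 * (2^-1 * (1 * x + x * 1))).
  by do 2 apply: is_deriveZ_fun; apply: is_deriveM_fun; exact: is_derive_id.
have D3 := is_deriveM_fun D1 (is_derive_expR_comp D2).
apply: (@is_derive_ext _ (fun z => p.[z] * expR (-1 * (2^-1 * (z * z))))).
  by move=> z; rewrite mulN1r.
apply: is_derive_eq D3 _.
by rewrite /gauss hornerD hornerN hornerM hornerX mulN1r; field.
Qed.

Lemma derive1_gauss p : derive1 (gauss p) = gauss (p^`() - 'X * p).
Proof. by apply/funext => x; apply: is_derive_derive1; exact: is_derive_gauss. Qed.

Lemma smooth_gauss p : smooth (gauss p).
Proof.
apply/smoothP => k; elim: k p => // k IH p.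
exact: (@CkI _ _ _ (gauss (p^`() - 'X * p))) (is_derive_gauss p) (IH _).
Qed.

Lemma derive1n_gauss p n : exists q, derive1n n (gauss p) = gauss q.
Proof.
elim: n => [|n [q IH]]; first by exists p.
by exists (q^`() - 'X * q); rewrite derive1nS IH derive1_gauss.
Qed.

Lemma gauss_bounded p : exists2 B, 0 < B & forall x, `|gauss p x| <= B.
Proof.
suff H n : exists2 B, 0 < B & forall x, `|x| ^+ n * `|gauss p x| <= B.
  by have [B B0 HB] := H 0%N; exists B => // x; have := HB x; rewrite expr0 mul1r.
elim/poly_ind: p n => [|p c IH] n.
  by exists 1 => // x; rewrite /gauss horner0 mul0r normr0 mulr0.
have [B B0 HB] := IH n.+1.
pose N := 1 + 2 ^+ n * n`!%:R : R.
have N0 : 0 < N by rewrite /N ltr_pwDl// mulr_ge0// exprn_ge0.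
have HN x : `|x| ^+ n * expR (- (2^-1 * (x * x))) <= N.
  set u := 2^-1 * (x * x).
  have u0 : 0 <= u by rewrite mulr_ge0// -expr2 sqr_ge0.
  have e1 : expR (- u) <= 1 by rewrite -expR0 ler_expR; lra.
  have e0 := expR_ge0 (- u).
  case: (leP `|x| 1) => x1.
    rewrite (@le_trans _ _ 1)//; last by rewrite /N lerDl mulr_ge0// exprn_ge0.
    by rewrite mulr_ile1// ?exprn_ge0// exprn_ile1.
  have xu : `|x| ^+ n <= 2 ^+ n * u ^+ n.
    rewrite -exprMn /u mulrA divff// mul1r -expr2 -real_normK ?num_real// -exprM.
    by rewrite ler_weXn2l ?ltW// leq_pmull.
  apply: (@le_trans _ _ (2 ^+ n * (u ^+ n * expR (- u)))).
    by rewrite mulrA ler_wpM2r.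
  rewrite /N ler_wpDl// ler_wpM2l ?exprn_ge0//.
  exact: exprn_expR_bound.
exists (B + `|c| * N); first by rewrite ltr_pwDl// mulr_ge0// ltW.
move=> x; have := HB x; rewrite /gauss.
set E := expR _; have E0 : 0 <= E by exact: expR_ge0.
rewrite !normrM (ger0_norm E0) exprSr => H.
rewrite hornerD hornerM hornerX hornerC.
apply: (@le_trans _ _ (`|x| ^+ n * ((`|p.[x]| * `|x| + `|c|) * E))).
  by rewrite ler_wpM2l ?exprn_ge0// ler_wpM2r// (le_trans (ler_normD _ _))// normrM.
have -> : `|x| ^+ n * ((`|p.[x]| * `|x| + `|c|) * E) =
  `|x| ^+ n * `|x| * (`|p.[x]| * E) + `|c| * (`|x| ^+ n * E) by ring.
by rewrite lerD// ler_wpM2l// HN.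
Qed.

Lemma bsmooth_gauss p : bsmooth (gauss p).
Proof.
split=> [|j]; first exact: smooth_gauss.
have [q ->] := derive1n_gauss p j.
by have [B _ HB] := gauss_bounded q; exists B.
Qed.

Lemma gauss_decay p k : exists2 B, 0 < B & forall x, `|x| ^+ k * `|gauss p x| <= B.
Proof.
have [B B0 HB] := gauss_bounded ('X^k * p); exists B => // x.
have := HB x; rewrite /gauss hornerM hornerXn -mulrA normrM normrX.
by rewrite /gauss.
Qed.

Lemma gauss1_gt0 x : 0 < gauss 1 x.
Proof. by rewrite /gauss hornerC mul1r expR_gt0. Qed.

Definition gaussCDF := primitive (gauss 1).

Lemma is_derive_gaussCDF x : is_derive x 1 gaussCDF (gauss 1 x).
Proof.
apply: (@is_derive_primitive R (gauss 1) (gauss (1^`() - 'X * 1))).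
  exact/smooth_continuous/smooth_gauss.
exact: is_derive_gauss.
Qed.

Lemma derive1_gaussCDF : derive1 gaussCDF = gauss 1.
Proof. by apply/funext => x; apply: is_derive_derive1; exact: is_derive_gaussCDF. Qed.

Lemma smooth_gaussCDF : smooth gaussCDF.
Proof.
apply/smoothP => -[//|k].
exact: (@CkI _ _ _ (gauss 1) is_derive_gaussCDF ((smoothP _).1 (@smooth_gauss 1) k)).
Qed.

(** Decay of order j + 1 absorbs t^-j and leaves one factor t to spare, whence the threshold e
    d^(j+1) / B. *)
Lemma gauss_tail p (j : nat) d e : 0 < d -> 0 < e ->
  exists2 t1, 0 < t1 & forall t x, 0 < t -> t < t1 -> d <= `|x| ->
    t^-1 ^+ j * `|gauss p (x / t)| <= e.
Proof.
move=> d0 e0; have [B B0 HB] := gauss_decay p j.+1.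
exists (e * d ^+ j.+1 / B); first by rewrite divr_gt0// mulr_gt0// exprn_gt0.
move=> t x t0; rewrite ltr_pdivlMr// => tt1 dx.
have := HB (x / t); rewrite normrM normfV (gtr0_norm t0) exprMn => H.
have dx' : d ^+ j.+1 <= `|x| ^+ j.+1 by rewrite lerXn2r// nnegrE ltW.
have tj : 0 < t^-1 ^+ j.+1 by rewrite exprn_gt0// invr_gt0.
have H' : d ^+ j.+1 * (t^-1 ^+ j.+1 * `|gauss p (x / t)|) <= B.
  apply: le_trans H; rewrite mulrA ler_wpM2r// ler_wpM2r//.
  by rewrite ltW.
have dj : 0 < d ^+ j.+1 by rewrite exprn_gt0.
rewrite -(ler_pM2l dj).
apply: (@le_trans _ _ (t * B)).
  rewrite -ler_pdivrMl// mulrCA (le_trans _ H')//.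
  by rewrite [t^-1 ^+ j.+1]exprS le_eqVlt; apply/orP; left; apply/eqP; ring.
by rewrite mulrC; apply: ltW; rewrite mulrC (mulrC (_ ^+ _)).
Qed.

Lemma mollifier_gaussCDF : mollifier gaussCDF.
Proof.
split.
- by rewrite derive1_gaussCDF; exact: bsmooth_gauss.
- exact: smooth_gaussCDF.
- by move=> x; rewrite derive1_gaussCDF ltW// gauss1_gt0.
- apply: (@gtr0_derive1_incr R gaussCDF (-1) 1) => //.
  + by move=> x _; have [] := is_derive_gaussCDF x.
  + by move=> x _; rewrite derive1_gaussCDF gauss1_gt0.
  + exact/continuous_subspaceT/smooth_continuous/smooth_gaussCDF.
- move=> d e d0 e0; have [t1 t10 H] := gauss_tail 1 1 d0 e0.
  exists t1 => // t x t0 tt1 dx; rewrite derive1_gaussCDF.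
  by have := H t x t0 tt1 dx; rewrite expr1 gtr0_norm// gauss1_gt0.
Qed.

Lemma mollifier_step : mollifier (@step R).
Proof.
split.
- exact: bsmooth_stepD.
- exact: smooth_step.
- exact: step_derive_ge0.
- by rewrite step0// step1.
- move=> d e d0 e0; exists d => // t x t0 td dx.
  suff -> : derive1 (@step R) (x / t) = 0 by rewrite mulr0 ltW.
  apply: (@stepD_supp R).
  have : 1 < `|x / t|.
    by rewrite normrM normfV (gtr0_norm t0) ltr_pdivlMr// mul1r (lt_le_trans td).
  by rewrite ltr_normr => /orP[->|]; rewrite ?orbT// ltrNr => ->.
Qed.

End Gaussian.

(** * Uniform bounds at a point with a value *)

Section SmoothLimit.
Variable R : realType.
Implicit Types (f g psi : R -> R) (x y z s t l r : R).

Lemma geometric_le (X Y D : R) : (forall k, X <= Y + D * 3^-1 ^+ k) -> X <= Y.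
Proof.
move=> H; apply/ler_addgt0Pr => e e0.
have [k Hk] : exists k : nat, `|D| / e < k%:R.
  exists (Num.truncn (`|D| / e)).+1.
  by have /andP[_] := truncn_itv (divr_ge0 (normr_ge0 D) (ltW e0)).
apply: (le_trans (H k)); rewrite lerD2l (le_trans (ler_norm _))// normrM.
rewrite (ger0_norm (x := 3^-1 ^+ k)) ?exprn_ge0 ?invr_ge0// exprVn ler_pdivrMr ?exprn_gt0//.
rewrite ltr_pdivrMr// in Hk; apply: (le_trans (ltW Hk)); rewrite mulrC ler_wpM2l ?ltW//.
elim: k {Hk} => [|k IH]; first by rewrite expr0.
rewrite exprS -natr1.
have : 1 <= 3 ^+ k :> R by rewrite exprn_ege1// ler1n.
by move=> ?; lra.
Qed.

(** The sequences u_k - 2 A 3^-k and u_k + 2 A 3^-k are monotone and enclose the limit, taken as a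
    supremum. The sharp constant would be 3 / 2. *)
Lemma geometric_limit (u : nat -> R) (A : R) :
  (forall k, `|u k.+1 - u k| <= A * 3^-1 ^+ k) ->
  exists l, forall k, `|l - u k| <= 2 * A * 3^-1 ^+ k.
Proof.
move=> H.
have A0 : 0 <= A by have := H 0%N; rewrite expr0 mulr1; apply: le_trans.
pose v k := u k - 2 * A * 3^-1 ^+ k; pose w k := u k + 2 * A * 3^-1 ^+ k.
have E k : 0 <= A * 3^-1 ^+ k by rewrite mulr_ge0// exprn_ge0// invr_ge0.
have S k : 2 * A * 3^-1 ^+ k.+1 = 2 / 3 * (A * 3^-1 ^+ k) by rewrite exprS; ring.
have vS k : v k <= v k.+1.
  have := H k; rewrite ler_norml /v S => /andP[h1 h2]; have := E k.
  have -> : 2 * A * 3^-1 ^+ k = 2 * (A * 3^-1 ^+ k) by ring.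
  by move=> ?; lra.
have wS k : w k.+1 <= w k.
  have := H k; rewrite ler_norml /w S => /andP[h1 h2]; have := E k.
  have -> : 2 * A * 3^-1 ^+ k = 2 * (A * 3^-1 ^+ k) by ring.
  by move=> ?; lra.
have vh : {homo v : m n / (m <= n)%N >-> m <= n} by apply: homo_leq => //; exact: le_trans.
have wh m n : (m <= n)%N -> w n <= w m.
  elim: n => [|n IH]; first by rewrite leqn0 => /eqP ->.
  rewrite leq_eqVlt => /orP[/eqP -> //|]; rewrite ltnS => /IH; exact: le_trans.
have vw m n : v m <= w n.
  have vwk k : v k <= w k.
    rewrite /v /w; have := E k.
    have -> : 2 * A * 3^-1 ^+ k = 2 * (A * 3^-1 ^+ k) by ring.
    by move=> ?; lra.
  case: (leqP m n) => mn; first by rewrite (le_trans (vh _ _ mn)).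
  by rewrite (le_trans (vwk m))// wh// ltnW.
exists (sup (range v)) => k.
have v1 : v k <= sup (range v).
  apply: ub_le_sup; last by exists k.
  by exists (w 0%N) => _ [m _ <-].
have v2 : sup (range v) <= w k.
  apply: ge_sup; first by exists (v 0%N), 0%N.
  by move=> _ [m _ <-].
by rewrite ler_norml; apply/andP; split; move: v1 v2; rewrite /v /w; lra.
Qed.

(** Let G (j, x) be the limit of the j-th derivatives. Taylor's formula with the bound B (j + 2) is
    uniform in k, so it survives in the limit and shows that G (j + 1, x) is the derivative of G (j,
    x). *)
Lemma smooth_limit (f : nat -> R -> R) (A B : nat -> R) : (forall k, smooth (f k)) ->
  (forall j k x, `|derive1n j (f k.+1) x - derive1n j (f k) x| <= A j * 3^-1 ^+ k) ->
  (forall j k x, `|derive1n j (f k) x| <= B j) ->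
  exists2 g, smooth g & forall j k x, `|derive1n j g x - derive1n j (f k) x| <= 2 * A j * 3^-1 ^+ k.
Proof.
move=> sf HA HB.
have /choice[G HG] : forall jx : nat * R, exists l, forall k,
    `|l - derive1n jx.1 (f k) jx.2| <= 2 * A jx.1 * 3^-1 ^+ k.
  by move=> [j x]; apply: geometric_limit => k /=.
have DG j x : is_derive x 1 (fun z => G (j, z)) (G (j.+1, x)).
  apply: (@quadratic_derive _ _ _ _ (B j.+2) 1) => // h _.
  apply: (@geometric_le _ _ (2 * A j + 2 * A j + `|h| * (2 * A j.+1))) => k.
  set e := 3^-1 ^+ k.
  have g1 := HG (j, x + h) k; have g2 := HG (j, x) k; have g3 := HG (j.+1, x) k.
  rewrite /= -/e in g1 g2 g3.
  have tb : `|derive1n j (f k) (x + h) - derive1n j (f k) x - h * derive1n j.+1 (f k) x| <= B j.+2 * h ^+ 2.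
    apply: (@taylor_bound R (derive1n j (f k)) (derive1n j.+1 (f k)) (derive1n j.+2 (f k)) (x - `|h|) (x + `|h|)).
    - by move=> z _; exact: smooth_is_derive1n.
    - by move=> z _; exact: smooth_is_derive1n.
    - by move=> z _; exact: HB.
    - by apply/andP; split; rewrite ?lerDl// lerBlDr lerDl.
    - by rewrite lerD2l lerD2l ler_norm andbT lerNnormlW.
  have -> : G (j, x + h) - G (j, x) - h * G (j.+1, x) =
    (derive1n j (f k) (x + h) - derive1n j (f k) x - h * derive1n j.+1 (f k) x) +
    ((G (j, x + h) - derive1n j (f k) (x + h)) - (G (j, x) - derive1n j (f k) x)
     - h * (G (j.+1, x) - derive1n j.+1 (f k) x)) by ring.
  apply: (le_trans (ler_normD _ _)); rewrite lerD// 2!mulrDl.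
  apply: (le_trans (ler_normB _ _)); rewrite lerD//.
    by apply: (le_trans (ler_normB _ _)); rewrite lerD.
  by rewrite normrM -mulrA ler_wpM2l.
have EG j : derive1n j (fun z => G (0%N, z)) = fun z => G (j, z).
  elim: j => // j IH; rewrite derive1nS IH; apply/funext => x.
  exact: is_derive_derive1 (DG j x).
exists (fun z => G (0%N, z)) => [m x|j k x]; first by rewrite EG; have [] := DG m x.
by rewrite EG; exact: (HG (j, x)).
Qed.

End SmoothLimit.

(** * Dilations at a point: boundedness on bounded families *)

Section UniformBoundedness.
Variable R : realType.
Implicit Types (f g psi phi : R -> R) (x y z s t l r : R).
Notation mu := (@lebesgue_measure R).

(** Meant for t > 0, where it is the expression in the definition of the point value; negative
    scales are recovered by reflecting the test function. *)
Definition dilate (W : Defs.distribution R) c t phi : R := t^-1 * W (affine_pull c t phi).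

Lemma supp_in_affine_pull c t phi r : 0 < t -> supp_in (- r) r phi ->
  supp_in (c - t * r) (c + t * r) (affine_pull c t phi).
Proof.
move=> t0 H x xc; apply: H.
case/orP : xc => xc; apply/orP; [left|right].
  by rewrite ltr_pdivrMr//; lra.
by rewrite ltr_pdivlMr//; lra.
Qed.

Lemma smooth_affine_pull c t phi : t != 0 -> smooth phi -> smooth (affine_pull c t phi).
Proof. exact: smooth_affine_comp. Qed.

Lemma test_affine_pull c t phi r : 0 < t -> smooth phi -> supp_in (- r) r phi ->
  test_function (affine_pull c t phi).
Proof.
move=> t0 sp rp; have H := @supp_in_affine_pull c t phi r t0 rp.
by apply: (supp_in_test _ H); apply: smooth_affine_pull => //; rewrite gt_eqF.
Qed.

Lemma dilate_lin W c t r (k : R) f g : 0 < t -> smooth f -> smooth g ->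
  supp_in (- r) r f -> supp_in (- r) r g ->
  dilate W c t (fun x => k * f x + g x) = k * dilate W c t f + dilate W c t g.
Proof.
move=> t0 sf sg rf rg.
have tf := @test_affine_pull c t f r t0 sf rf; have tg := @test_affine_pull c t g r t0 sg rg.
rewrite /dilate (_ : affine_pull c t _ = fun x => k * affine_pull c t f x + affine_pull c t g x)//.
by rewrite pairing_linear//; ring.
Qed.

Lemma dilate_order W c r t : 0 < r -> 0 < t <= 1 -> exists C n, 0 < C /\
  forall f M, smooth f -> supp_in (- r) r f ->
   (forall j, (j <= n)%N -> forall x, `|derive1n j f x| <= M) -> `|dilate W c t f| <= C * M.
Proof.
move=> r0 /andP[t0 t1].
have cr : c - r <= c + r by lra.
have [C [n [C0 H]]] := distribution_order W cr.
have ti : 1 <= t^-1 by rewrite invf_ge1.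
exists (t^-1 * (C * t^-1 ^+ n)), n; split.
  by rewrite !mulr_gt0// ?exprn_gt0// invr_gt0.
move=> f M sf rf HM; have tn0 : t != 0 by rewrite gt_eqF.
have M0 : 0 <= M by rewrite (le_trans _ (HM 0%N isT 0)).
rewrite /dilate normrM (ger0_norm (x := t^-1)) ?invr_ge0 ?(ltW t0)// -mulrA ler_wpM2l ?invr_ge0 ?(ltW t0)//.
rewrite -mulrA; apply: H; first exact: smooth_affine_pull.
  have Hs := @supp_in_affine_pull c t f r t0 rf.
  apply: supp_inW Hs.
    by rewrite lerD2l lerN2 ler_piMl// ltW.
  by rewrite lerD2l ler_piMl// ltW.
move=> j jn x _; rewrite derive1n_affine// normrM ger0_norm ?exprn_ge0 ?invr_ge0 ?(ltW t0)//.
by rewrite ler_pM// ?exprn_ge0 ?invr_ge0 ?(ltW t0)// ?ler_weXn2l// HM.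
Qed.

Lemma point_value_lim W c l phi : point_value W c l -> test_function phi ->
  forall e, 0 < e -> exists2 d, 0 < d & forall t, 0 < t -> t < d ->
    `|dilate W c t phi - l * \int[mu]_x phi x| <= e.
Proof.
move=> pv tp e e0; have := pv phi tp => /cvgrPdist_le/(_ e e0).
rewrite near_withinE => /nbhs_ballP[d /= d0 H]; exists d => // t t0 td.
have := H t; rewrite /ball/= sub0r normrN gtr0_norm// gt_eqF// => /(_ td isT).
by rewrite distrC.
Qed.

(** Convergence settles small t. For t between d1 and 1 the rescaled functions have their supports
    in one interval and derivatives bounded through t^-1 <= d1^-1. *)
Lemma point_value_bounded W c l phi r : point_value W c l -> smooth phi -> supp_in (- r) r phi -> 0 < r ->
  exists B, forall t, 0 < t <= 1 -> `|dilate W c t phi| <= B.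
Proof.
move=> pv sp rp r0; have tp := supp_in_test sp rp.
have [d d0 H] := point_value_lim pv tp ltr01.
have cr : c - r <= c + r by lra.
have [C [n [C0 HC]]] := distribution_order W cr.
have [M M0 HM] := @unif_nat R (fun j B => forall x, `|derive1n j phi x| <= B) n
  (fun j A B AB H x => le_trans (H x) AB) (bsmooth_supp sp rp).2.
pose L := `|l * \int[mu]_x phi x| + 1.
pose d1 := Num.min d 1.
have d10 : 0 < d1 by rewrite lt_min d0 ltr01.
pose E := d1^-1 * (C * (d1^-1 ^+ n * M)).
exists (L + E) => t /andP[t0 t1].
have E0 : 0 <= E by rewrite /E !mulr_ge0// ?exprn_ge0// ?invr_ge0 ltW.
have L0 : 0 <= L by rewrite addr_ge0.
case: (ltP t d) => td.
  have h := H t t0 td.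
  have -> : dilate W c t phi = (dilate W c t phi - l * \int[mu]_x phi x) + l * \int[mu]_x phi x.
    by rewrite subrK.
  rewrite (le_trans (ler_normD _ _))// addrC; apply: (@le_trans _ _ L); last by rewrite lerDl.
  by rewrite /L lerD.
have d1t : d1 <= t by rewrite /d1 ge_min td.
rewrite (le_trans _ (_ : E <= _))// ?lerDr//.
have tn0 : t != 0 by rewrite gt_eqF.
have ti : t^-1 <= d1^-1 by rewrite lef_pV2.
rewrite /dilate normrM (ger0_norm (x := t^-1)) ?invr_ge0 ?(ltW t0)//.
rewrite ler_pM// ?invr_ge0 ?(ltW t0)//.
apply: HC; first exact: smooth_affine_pull.
  have Hs := @supp_in_affine_pull c t phi r t0 rp.
  apply: supp_inW Hs.
    by rewrite lerD2l lerN2 ler_piMl// ltW.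
  by rewrite lerD2l ler_piMl// ltW.
move=> j jn x _; rewrite derive1n_affine// normrM ger0_norm ?exprn_ge0 ?invr_ge0 ?(ltW t0)//.
rewrite ler_pM// ?exprn_ge0 ?invr_ge0 ?(ltW t0)//; last exact: HM.
apply: (@le_trans _ _ (d1^-1 ^+ j)); first by rewrite lerXn2r// nnegrE invr_ge0 ltW.
by rewrite ler_weXn2l// invf_ge1// /d1 ge_min lexx orbT.
Qed.


(* Gliding hump with signs chosen one by one: at the step k, one of the two
   choices of sign makes the k-th functional large on the partial sum. *)
Lemma bounded_family_dilate W c l r (F : nat -> R -> R) (tau : nat -> R) :
  point_value W c l -> 0 < r -> (forall k, smooth (F k)) -> (forall k, supp_in (- r) r (F k)) ->
  (forall j, exists M, forall k x, `|derive1n j (F k) x| <= M) ->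
  (forall k, 0 < tau k <= 1) ->
  exists B, forall k, `|dilate W c (tau k) (F k)| <= B.
Proof.
move=> pv r0 sF rF bF tau01.
apply: contrapT => /forallNP nB.
have {}nB B : exists k, B < `|dilate W c (tau k) (F k)|.
  apply: contrapT => /forallNP H; apply: (nB B) => k.
  by rewrite leNgt; apply/negP; exact: H.
have /choice[M HM] := bF.
have M0 j : 0 <= M j by rewrite (le_trans _ (HM j 0%N 0)).
pose V t := [set `|dilate W c t (F i)| | i in [set: nat]].
have Vb t : 0 < t <= 1 -> has_ubound (V t).
  move=> t01; have [C [n [C0 HC]]] := dilate_order W c r0 t01.
  have [A A0 HA] := @unif_nat R (fun j A => M j <= A) n
    (fun j A B AB H => le_trans H AB) (fun j => ex_intro _ (M j) (lexx _)).
  exists (C * A) => _ [i _ <-]; apply: HC => // j jn x.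
  by rewrite (le_trans (HM _ _ _))// HA.
(* La t is the size on the family of the functional at scale t. The choice [m] finds scales at which
   it exceeds 4^k, and [i] a member of the family that reaches 9 / 10 of it. *)
pose La t := sup (V t).
have LaP t i : 0 < t <= 1 -> `|dilate W c t (F i)| <= La t.
  by move=> /Vb h; apply: ub_le_sup => //; exists i.
have /choice[m Hm] : forall k : nat, exists m, 4 ^+ k < `|dilate W c (tau m) (F m)|.
  by move=> k; exact: nB.
pose s k := tau (m k).
have s01 k : 0 < s k <= 1 by exact: tau01.
have Las k : 4 ^+ k < La (s k) by rewrite (lt_le_trans (Hm k))// LaP.
have La0 k : 0 < La (s k) by rewrite (lt_trans _ (Las k))// exprn_gt0.
have /choice[i Hi] : forall k : nat, exists i, 9 / 10 * La (s k) <= `|dilate W c (s k) (F i)|.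
  move=> k; have hs : has_sup (V (s k)).
    by split; [exists `|dilate W c (s k) (F 0%N)|, 0%N|exact: Vb].
  have e0 : 0 < 1 / 10 * La (s k) by rewrite mulr_gt0//; lra.
  have [_ [i _ <-] Hi] := sup_adherent e0 hs.
  by exists i; move: Hi; rewrite -/(La _); lra.
pose chi k := F (i k); pose L k := dilate W c (s k).
pose fix S k : R -> R := if k is k'.+1 then
   (if 3^-1 ^+ k' * `|L k' (chi k')| <= `|L k' (fun x => 3^-1 ^+ k' * chi k' x + S k' x)|
    then (fun x => 3^-1 ^+ k' * chi k' x + S k' x) else (fun x => (- 3^-1 ^+ k') * chi k' x + S k' x))
   else fun=> 0.
have SE k : exists2 e : R, `|e| = 3^-1 ^+ k & S k.+1 = fun x => e * chi k x + S k x.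
  rewrite /=; case: ifP => _.
    by exists (3^-1 ^+ k) => //; rewrite ger0_norm// exprn_ge0// invr_ge0.
  by exists (- 3^-1 ^+ k) => //; rewrite normrN ger0_norm// exprn_ge0// invr_ge0.
have sS k : smooth (S k).
  elim: k => [|k IH]; first exact: smooth_cst.
  have [e _ ->] := SE k; exact: (@smoothD R (fun x => e * chi k x) (S k) (@smoothZ R e (chi k) (sF _)) IH).
have rS k : supp_in (- r) r (S k).
  elim: k => [|k IH] x xr; first by [].
  by have [e _ ->] := SE k; rewrite /chi (rF _ _ xr) (IH _ xr) mulr0 addr0.
have Llin : forall (q : nat) (w : R) (f1 f2 : R -> R), smooth f1 -> smooth f2 ->
    supp_in (- r) r f1 -> supp_in (- r) r f2 ->
    L q (fun x => w * f1 x + f2 x) = w * L q f1 + L q f2.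
  move=> q w f1 f2 sf1 sf2 rf1 rf2; case/andP: (s01 q) => sq0 _.
  exact: (dilate_lin W c w sq0 sf1 sf2 rf1 rf2).
have Lchi k j : `|L k (chi j)| <= La (s k) by exact: LaP.
have LS k : 3^-1 ^+ k * `|L k (chi k)| <= `|L k (S k.+1)|.
  have key (a b d : R) : 0 <= a -> `|a * b + d| < a * `|b| -> a * `|b| <= `|- a * b + d|.
    move=> a0 H; have : `|2 * (a * b)| <= `|a * b + d| + `|- a * b + d|.
      rewrite (_ : 2 * (a * b) = (a * b + d) - (- a * b + d)); last by ring.
      exact: ler_normB.
    by rewrite !normrM (ger0_norm a0) normr_nat; lra.
  have lin e : L k (fun x => e * chi k x + S k x) = e * L k (chi k) + L k (S k).
    exact: (Llin k e _ _ (sF _) (sS _) (rF _) (rS _)).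
  rewrite /=; case: ifPn => //; rewrite -ltNge !lin; apply: key.
  by rewrite exprn_ge0// invr_ge0.
have LT k n : `|L k (S (k.+1 + n)%N) - L k (S k.+1)| <= (3^-1 ^+ k / 2) * (1 - 3^-1 ^+ n) * La (s k).
  elim: n => [|n IH]; first by rewrite addn0 !subrr normr0 mulr0 mul0r.
  rewrite addnS; have [e eE ->] := SE (k.+1 + n)%N.
  rewrite (Llin k e _ _ (sF _) (sS _) (rF _) (rS _)).
  have -> : e * L k (chi (k.+1 + n)%N) + L k (S (k.+1 + n)%N) - L k (S k.+1) =
     e * L k (chi (k.+1 + n)%N) + (L k (S (k.+1 + n)%N) - L k (S k.+1)) by ring.
  apply: (le_trans (ler_normD _ _)); rewrite normrM eE.
  apply: (@le_trans _ _ (3^-1 ^+ (k.+1 + n) * La (s k) + (3^-1 ^+ k / 2) * (1 - 3^-1 ^+ n) * La (s k))).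
    by rewrite lerD// ler_wpM2l// exprn_ge0// invr_ge0.
  rewrite -mulrDl ler_wpM2r// ?(ltW (La0 k))// addSn exprS exprD exprS.
  by rewrite le_eqVlt; apply/orP; left; apply/eqP; field.
have SB j k x : `|derive1n j (S k) x| <= 2 * M j * (1 - 3^-1 ^+ k).
  elim: k => [|k IH]; first by rewrite derive1n_cst0 normr0 subrr mulr0.
  have [e eE ->] := SE k.
  rewrite (derive1n_lin e j (sF _) (sS k)); apply: (le_trans (ler_normD _ _)); rewrite normrM eE.
  have p0 : 0 <= 3^-1 ^+ k :> R by rewrite exprn_ge0// invr_ge0.
  have h1 : 3^-1 ^+ k * `|derive1n j (chi k) x| <= 3^-1 ^+ k * M j by rewrite ler_wpM2l// HM.
  apply: (le_trans (lerD h1 IH)); rewrite exprS.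
  have := mulr_ge0 p0 (M0 j); set q := 3^-1 ^+ k => h.
  have -> : q * M j + 2 * M j * (1 - q) = 2 * M j - q * M j by ring.
  have -> : 2 * M j * (1 - 3^-1 * q) = 2 * M j - 2 / 3 * (q * M j) by ring.
  by lra.
have SD j k x : `|derive1n j (S k.+1) x - derive1n j (S k) x| <= M j * 3^-1 ^+ k.
  have [e eE ->] := SE k.
  by rewrite (derive1n_lin e j (sF _) (sS k)) addrK normrM eE mulrC ler_wpM2r ?exprn_ge0 ?invr_ge0// HM.
have SB' j k x : `|derive1n j (S k) x| <= 2 * M j.
  have h1 : 1 - 3^-1 ^+ k <= 1 :> R by rewrite gerBl exprn_ge0// invr_ge0.
  have h2 : 0 <= 2 * M j by rewrite mulr_ge0.
  by rewrite (le_trans (SB j k x))// ler_piMr.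
have [g sg Hg] := smooth_limit sS SD SB'.
have rg : supp_in (- r) r g.
  move=> x xr; apply/eqP; rewrite -normr_eq0; apply/eqP/le_anti; rewrite normr_ge0 andbT.
  apply: (@geometric_le R _ 0 (2 * M 0%N)) => k; rewrite add0r.
  by have := Hg 0%N k x; rewrite /= (rS k _ xr) subr0.
have [B HB] := point_value_bounded pv sg rg r0.
(* The k-th term contributes at least 9 / 10 of 3^-k La, and all later terms take away at most 1 / 2
   of it, since the powers of 1 / 3 beyond k add up to half of 3^-k. As La exceeds 4^k, the
   remainder 4 / 10 is at least a multiple of (4/3)^k, which is unbounded. *)
have main k : 4 / 10 * (3^-1 ^+ k * La (s k)) <= B.
  have [C [n [C0 HC]]] := dilate_order W c r0 (s01 k).
  have [A A0 HA] := @unif_nat R (fun j A => 2 * M j <= A) n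
    (fun j A B AB H => le_trans H AB) (fun j => ex_intro _ (2 * M j) (lexx _)).
  apply: (@geometric_le R _ _ (C * A)) => q.
  set K := (k.+1 + q)%N.
  have h1 : `|L k g - L k (S K)| <= C * A * 3^-1 ^+ q.
    have sgS : smooth (fun x => -1 * S K x + g x).
      exact: (@smoothD R (fun x => -1 * S K x) g (@smoothZ R (-1) (S K) (sS K)) sg).
    have rgS : supp_in (- r) r (fun x => -1 * S K x + g x).
      by move=> x xr; rewrite (rS K _ xr) (rg _ xr) mulr0 addr0.
    have -> : L k g - L k (S K) = L k (fun x => -1 * S K x + g x).
      by rewrite Llin// mulN1r addrC.
    rewrite -mulrA; apply: HC => // j jn x.
    rewrite (derive1n_lin (-1) j (sS K) sg) mulN1r addrC (le_trans (Hg j K x))//.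
    have q0 : 0 <= 3^-1 ^+ q :> R by rewrite exprn_ge0// invr_ge0.
    rewrite ler_pM// ?mulr_ge0 ?exprn_ge0 ?invr_ge0//; first exact: HA.
    rewrite exprD ler_piMl// exprn_ile1// ?invr_ge0// invf_le1//.
    by rewrite ler1n.
  have h2 := LT k q; have h3 := LS k; have h4 := HB (s k) (s01 k).
  have h5 := Hi k; have l0 := La0 k.
  have p0 : 0 <= 3^-1 ^+ k :> R by rewrite exprn_ge0// invr_ge0.
  have h6 : (3^-1 ^+ k / 2) * (1 - 3^-1 ^+ q) * La (s k) <= (3^-1 ^+ k / 2) * La (s k).
    have g1 : 1 - 3^-1 ^+ q <= 1 :> R by rewrite gerBl exprn_ge0// invr_ge0.
    have g2 : 0 <= 3^-1 ^+ k / 2 :> R by rewrite divr_ge0.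
    by rewrite ler_wpM2r ?(ltW l0)// ler_piMr.
  have h7 : 3^-1 ^+ k * (9 / 10 * La (s k)) <= 3^-1 ^+ k * `|L k (chi k)| by rewrite ler_wpM2l.
  have h8 : `|L k (S k.+1)| <= `|L k g| + `|L k g - L k (S K)| + `|L k (S K) - L k (S k.+1)|.
    rewrite {1}(_ : L k (S k.+1) = L k g - (L k g - L k (S K)) - (L k (S K) - L k (S k.+1))); last by ring.
    by apply: (le_trans (ler_normB _ _)); rewrite lerD2r ler_normB.
  have h4' : `|L k g| <= B by exact: h4.
  have e1 : 3^-1 ^+ k * (9 / 10 * La (s k)) = 9 / 10 * (3^-1 ^+ k * La (s k)) by ring.
  have e2 : (3^-1 ^+ k / 2) * La (s k) = 1 / 2 * (3^-1 ^+ k * La (s k)) by field.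
  rewrite e1 in h7; rewrite e2 in h6; set Z := 3^-1 ^+ k * La (s k) in h6 h7 *.
  by lra.
have [k Hk] : exists k : nat, 10 / 4 * `|B| < k%:R / 3.
  exists (Num.truncn (3 * (10 / 4 * `|B|))).+1.
  have nn : 0 <= 3 * (10 / 4 * `|B|) by rewrite !mulr_ge0// invr_ge0.
  by have /andP[_] := truncn_itv nn; lra.
have bern (q : nat) : q%:R / 3 <= 3^-1 ^+ q * 4 ^+ q :> R.
  rewrite -exprMn; elim: q => [|q IH]; first by rewrite expr0 mul0r.
  have g1 : 1 <= (3^-1 * 4) ^+ q :> R by rewrite exprn_ege1//; lra.
  by rewrite exprS -natr1; lra.
have h1 := main k; have h2 := bern k.
have h3 : 3^-1 ^+ k * 4 ^+ k <= 3^-1 ^+ k * La (s k) by rewrite ler_wpM2l ?exprn_ge0 ?invr_ge0// ltW.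
have h4 := ler_norm B.
by lra.
Qed.

End UniformBoundedness.

(** * Order uniform in the scale, and multiplication by smooth functions *)

Section PointValues.
Variable R : realType.
Implicit Types (f g psi phi : R -> R) (x y z s t l r : R) (W : Defs.distribution R).
Notation mu := (@lebesgue_measure R).

(** A uniform boundedness principle across scales. If no m served both as order and as bound, the
    counterexample for m would have its j-th derivative at most 1 as soon as m >= j; the
    counterexamples would form a bounded family with unbounded dilations. *)
Theorem point_value_order W c l r : point_value W c l -> 0 < r ->
  exists C m, 0 < C /\ forall f M t, 0 < t <= 1 -> smooth f -> supp_in (- r) r f ->
    (forall j, (j <= m)%N -> forall x, `|derive1n j f x| <= M) -> `|dilate W c t f| <= C * M.
Proof.
move=> pv r0.
have [m Hm] : exists m : nat, forall f t, 0 < t <= 1 -> smooth f -> supp_in (- r) r f ->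
    (forall j, (j <= m)%N -> forall x, `|derive1n j f x| <= 1) -> `|dilate W c t f| <= m%:R.
  apply: contrapT => /forallNP H.
  have /choice[F HF] : forall m : nat, exists ft : (R -> R) * R, [/\ 0 < ft.2 <= 1, smooth ft.1,
      supp_in (- r) r ft.1, (forall j, (j <= m)%N -> forall x, `|derive1n j ft.1 x| <= 1) &
      m%:R < `|dilate W c ft.2 ft.1|].
    move=> m; apply: contrapT => /forallNP K; apply: (H m) => f t t01 sf rf Hf.
    by rewrite leNgt; apply/negP => lt; apply: (K (f, t)); split.
  have bF j : exists M, forall k x, `|derive1n j (F k).1 x| <= M.
    have K N : exists M, 1 <= M /\ forall k, (k < N)%N -> forall x, `|derive1n j (F k).1 x| <= M.
      elim: N => [|N [M [M1 IH]]]; first by exists 1; split.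
      have [_ sF rF _ _] := HF N.
      have [M' HM'] := (bsmooth_supp sF rF).2 j.
      exists (Num.max M M'); split; first by rewrite le_max M1.
      move=> k; rewrite ltnS leq_eqVlt => /orP[/eqP -> x|/IH kM x].
        by rewrite le_max HM' orbT.
      by rewrite le_max kM.
    have [M [M1 HM]] := K j; exists M => k x; case: (ltnP k j) => kj; first exact: HM.
    by have [_ _ _ h _] := HF k; rewrite (le_trans (h j kj x)).
  have [B HB] := @bounded_family_dilate R W c l r (fun k => (F k).1) (fun k => (F k).2) pv r0
     (fun k => let: And5 _ h _ _ _ := HF k in h) (fun k => let: And5 _ _ h _ _ := HF k in h) bF
     (fun k => let: And5 h _ _ _ _ := HF k in h).
  pose N := (Num.truncn `|B|).+1.
  have : `|B| < N%:R by have /andP[] := truncn_itv (normr_ge0 B).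
  have [_ _ _ _ h] := HF N; have := HB N; have := ler_norm B; lra.
exists (m%:R + 1), m; split; first by rewrite ltr_wpDl.
move=> f M t t01 sf rf HM.
have M0 : 0 <= M by rewrite (le_trans _ (HM 0%N isT 0)).
(* M may be 0, so f is normalised by an arbitrary e > M, and e tends to M at the end. *)
have H e : M < e -> `|dilate W c t f| <= m%:R * e.
  move=> Me; have e0 : 0 < e by exact: le_lt_trans Me.
  have sfe := smoothZ (c := e^-1) sf.
  have rfe : supp_in (- r) r (fun x => e^-1 * f x) by move=> x /rf ->; rewrite mulr0.
  have := Hm _ t t01 sfe rfe.
  have -> : dilate W c t (fun x => e^-1 * f x) = e^-1 * dilate W c t f.
    have /andP[t0 _] := t01.
    have s0 : smooth (fun=> 0 : R) by exact: smooth_cst.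
    have r00 : supp_in (- r) r (fun=> 0 : R) by [].
    have := dilate_lin W c e^-1 t0 sf s0 rf r00.
    have -> : dilate W c t (fun=> 0) = 0.
      have := dilate_lin W c (-1) t0 s0 s0 r00 r00.
      have -> : (fun x : R => -1 * 0 + 0 : R) = fun=> 0 by apply/funext => x; rewrite mulr0 addr0.
      by move=> ->; lra.
    rewrite addr0 => <-; congr (dilate W c t _); apply/funext => x.
    by rewrite addr0.
  rewrite normrM normfV (gtr0_norm e0) ler_pdivrMl// mulrC; apply => j jm x.
  rewrite derive1nZ// normrM normfV (gtr0_norm e0) ler_pdivrMl// mulr1.
  by rewrite (le_trans (HM j jm x))// ltW.
apply/ler_addgt0Pr => e e0.
have := H (M + e / (m%:R + 1)) _.
have m0 : 0 <= m%:R :> R by [].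
have m1 : 0 < m%:R + 1 :> R by rewrite ltr_wpDl.
rewrite ltrDl divr_gt0// => /(_ isT) /le_trans; apply.
rewrite mulrDr mulrDl mul1r -addrA lerD2l.
apply: (@le_trans _ _ e); last by rewrite lerDr.
by rewrite mulrCA ler_piMr ?(ltW e0)// ler_pdivrMr// mul1r lerDl.
Qed.

Lemma derive1n_blowup c t f n : smooth f ->
  smooth (fun z => f (c + t * z)) /\ derive1n n (fun z => f (c + t * z)) = fun z => t ^+ n * derive1n n f (c + t * z).
Proof.
move=> sf.
have D (h : R -> R) z : smooth h -> is_derive z 1 (fun z => h (c + t * z)) (t * derive1 h (c + t * z)).
  move=> sh; rewrite mulrC; apply: (@is_derive1_comp _ h (fun z => c + t * z)).
    exact: smooth_is_derive.
  apply: (@is_derive_ext _ (fun z => t * z + c)); first by move=> w; rewrite addrC.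
  by apply: is_derive_eq; rewrite addr0 -[LHS]/(t * 1) mulr1.
have H m : derive1n m (fun z => f (c + t * z)) = fun z => t ^+ m * derive1n m f (c + t * z).
  elim: m => [|m IH]; first by apply/funext => z; rewrite expr0 mul1r.
  rewrite derive1nS IH; apply/funext => z; apply: is_derive_derive1.
  rewrite exprSr -mulrA; apply: is_deriveZ_fun.
  by apply: D; exact: smooth_derive1n.
split => // m z; rewrite H.
suff : is_derive z 1 (fun z => t ^+ m * derive1n m f (c + t * z))
   (t ^+ m * (t * derive1 (derive1n m f) (c + t * z))) by case.
by apply: is_deriveZ_fun; apply: D; exact: smooth_derive1n.
Qed.

Lemma mul_affine_pull c t f eta : t != 0 ->
  (fun y => f y * affine_pull c t eta y) = affine_pull c t (fun z => f (c + t * z) * eta z).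
Proof.
move=> t0; apply/funext => y; rewrite /affine_pull; congr (f _ * _).
by field.
Qed.

(** At scale t the multiplier f is seen as its blow-up f (c + t z), so that only the blow-up on
    [- r, r] has to be bounded. *)
Lemma dilate_mult_bound W c l r eta : point_value W c l -> 0 < r -> smooth eta ->
  supp_in (- r) r eta ->
  exists C m, 0 < C /\ forall f M t, 0 < t <= 1 -> smooth f ->
    (forall j, (j <= m)%N -> forall z, - r <= z <= r -> `|derive1n j (fun z => f (c + t * z)) z| <= M) ->
    `|t^-1 * W (fun y => f y * affine_pull c t eta y)| <= C * M.
Proof.
move=> pv r0 se re; have [C [m [C0 H]]] := point_value_order pv r0.
have [A A0 HA] := @unif_nat R (fun j A => forall x, `|derive1n j eta x| <= A) m
  (fun j A B AB H x => le_trans (H x) AB) (bsmooth_supp se re).2.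
exists (C * (2 ^+ m * A)), m; split; first by rewrite !mulr_gt0// exprn_gt0.
move=> f M t t01 sf HM; have /andP[t0 t1] := t01.
rewrite mul_affine_pull ?gt_eqF// -/(dilate W c t _).
have [sb _] := @derive1n_blowup c t f 0%N sf.
have rb : supp_in (- r) r (fun z => f (c + t * z) * eta z).
  by move=> z /re ->; rewrite mulr0.
have M0 : 0 <= M by rewrite (le_trans _ (HM 0%N isT 0 _))//; lra.
rewrite -mulrA; apply: H; [exact: t01|exact: (@smoothM R (fun z => f (c + t * z)) eta sb se)|exact: rb|].
move=> j jm x; case: (boolP (- r <= x <= r)) => [xr|].
  apply: (@le_trans _ _ (2 ^+ j * (M * A))).
    apply: leibniz_bound => // i ij; first by apply: HM => //; exact: leq_trans ij jm.
    by apply: HA; exact: leq_trans ij jm.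
  rewrite [M * A]mulrC -mulrA ler_wpM2r ?mulr_ge0 ?(ltW A0)//.
  by rewrite ler_weXn2l// ler1n.
rewrite negb_and -!ltNge => /(derive1n_supp j rb) ->.
by rewrite normr0 !mulr_ge0 ?exprn_ge0 ?(ltW A0).
Qed.

(** The blow-up of f - f c is O(t) on [- r, r] together with its derivatives, so f acts like the
    number f c in the limit. *)
Lemma dilate_mult_lim W c l r eta f : point_value W c l -> 0 < r -> smooth eta ->
  supp_in (- r) r eta -> smooth f ->
  forall e, 0 < e -> exists2 d, 0 < d & forall t, 0 < t -> t < d ->
    `|t^-1 * W (fun y => f y * affine_pull c t eta y) - f c * (l * \int[mu]_x eta x)| <= e.
Proof.
move=> pv r0 se re sf e e0.
have [C [m [C0 H]]] := dilate_mult_bound pv r0 se re.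
have [B B0 HB] := @unif_nat R (fun j A => forall x, c - r <= x <= c + r -> `|derive1n j f x| <= A) m.+1
  (fun j A B AB H x xr => le_trans (H x xr) AB)
  (fun j => let: ex_intro2 M _ HM := continuous_bounded (c - r) (c + r) (smooth_continuous (smooth_derive1n (n := j) sf)) in ex_intro _ M HM).
have te := supp_in_test se re.
have e1 : 0 < e / 2 / (`|f c| + 1) by rewrite !divr_gt0// ltr_wpDl.
have [d d0 Hd] := point_value_lim pv te e1.
have K0 : 0 < C * (B * (r + 1)) by rewrite !mulr_gt0// addr_gt0.
exists (Num.min (Num.min d 1) (e / 2 / (C * (B * (r + 1))))).
  by rewrite !lt_min d0 ltr01/= !divr_gt0.
move=> t t0; rewrite !lt_min => /andP[/andP[td t1] te2].
have tn0 : t != 0 by rewrite gt_eqF.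
have t01 : 0 < t <= 1 by rewrite t0 ltW.
have sfc : smooth (fun y => f y - f c) by exact: (@smoothB R f (fun=> f c) sf (@smooth_cst R (f c))).
have split_f : t^-1 * W (fun y => f y * affine_pull c t eta y) =
    t^-1 * W (fun y => (f y - f c) * affine_pull c t eta y) + f c * dilate W c t eta.
  have -> : (fun y => f y * affine_pull c t eta y) =
     (fun y => f c * affine_pull c t eta y + (f y - f c) * affine_pull c t eta y).
    by apply/funext => y; ring.
  have ta : test_function (affine_pull c t eta) by exact: test_affine_pull t0 se re.
  have ra := @supp_in_affine_pull R c t eta r t0 re.
  have tb : test_function (fun y => (f y - f c) * affine_pull c t eta y).
    apply: (@supp_in_test _ (c - t * r) (c + t * r)).
      exact: (@smoothM R (fun y => f y - f c) _ sfc (test_smooth ta)).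
    by move=> y /ra ->; rewrite mulr0.
  by rewrite (pairing_linear W (f c) ta tb) /dilate; ring.
rewrite split_f.
have -> : t^-1 * W (fun y => (f y - f c) * affine_pull c t eta y) + f c * dilate W c t eta -
   f c * (l * \int[mu]_x eta x) = t^-1 * W (fun y => (f y - f c) * affine_pull c t eta y) +
   f c * (dilate W c t eta - l * \int[mu]_x eta x) by ring.
apply: (le_trans (ler_normD _ _)).
have h2 : `|f c * (dilate W c t eta - l * \int[mu]_x eta x)| <= e / 2.
  rewrite normrM; apply: (@le_trans _ _ (`|f c| * (e / 2 / (`|f c| + 1)))).
    by rewrite ler_wpM2l// Hd.
  rewrite mulrCA ler_piMr//; first by rewrite divr_ge0// ltW.
  by rewrite ler_pdivrMr ?mul1r ?lerDl// ltr_wpDl.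
have h1 : `|t^-1 * W (fun y => (f y - f c) * affine_pull c t eta y)| <= C * (t * (B * (r + 1))).
  apply: H => // j jm z /andP[z1 z2].
  have zc : c - r <= c + t * z <= c + r.
    have tz1 : - r <= t * z.
      case: (leP 0 z) => zs; first by apply: (@le_trans _ _ 0); [lra|rewrite mulr_ge0// ltW].
      have : - z * t <= - z by rewrite ler_piMr// ?(ltW t1)//; lra.
      by lra.
    have tz2 : t * z <= r.
      case: (leP z 0) => zs; first by apply: (@le_trans _ _ 0); [rewrite mulr_ge0_le0// ltW|lra].
      by have : z * t <= z by [rewrite ler_piMr// ltW]; lra.
    by apply/andP; split; lra.
  case: j jm => [|j] jm.
    rewrite /=.
    have : `|f (c + t * z) - f c| <= B * `|c + t * z - c|.
      apply: (@mean_value_bound R f (derive1 f) (c - r) (c + r)) => //.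
      - by move=> w _; exact: smooth_is_derive.
      - by move=> w wr; exact: (HB 1%N isT w wr).
      - by apply/andP; split; lra.
    move=> /le_trans; apply; rewrite addrAC subrr add0r normrM (gtr0_norm t0) mulrCA.
    rewrite ler_wpM2l ?(ltW t0)// ler_wpM2l ?(ltW B0)//.
    by rewrite (@le_trans _ _ r) ?lerDl// ler_norml z1.
  have [_ ->] := @derive1n_blowup c t (fun y => f y - f c) j.+1 sfc.
  rewrite (derive1nB j.+1 sf (@smooth_cst R (f c))).
  have -> : derive1n j.+1 (fun=> f c) (c + t * z) = 0.
    by rewrite derive1Sn (_ : derive1 (fun=> f c) = fun=> 0) ?derive1n_cst0//; apply/funext => w; exact: derive1_cst.
  rewrite subr0 normrM ger0_norm ?exprn_ge0 ?(ltW t0)//.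
  rewrite ler_pM ?exprn_ge0 ?(ltW t0)//.
    by rewrite exprS ler_piMr ?(ltW t0)// exprn_ile1// ltW.
  rewrite (@le_trans _ _ B)//; first by apply: HB => //; rewrite ltnW.
  by rewrite ler_peMr ?(ltW B0)// lerDr ltW.
have h3 : C * (t * (B * (r + 1))) <= e / 2.
  by rewrite ltr_pdivlMr// in te2; rewrite mulrCA ltW.
by lra.
Qed.

End PointValues.

(** * Local positivity *)

Section Gluing.
Variable R : realType.
Implicit Types (f g psi phi : R -> R) (x y z s t l r a b p q h : R) (u v w W : Defs.distribution R).
Notation mu := (@lebesgue_measure R).

Definition smooth01 f := smooth f /\ forall x, 0 <= f x <= 1.

Lemma smooth01_step m h : 0 < h -> smooth01 (fun y => step ((y - m) / h)).
Proof.
move=> h0; split=> [|x]; last by rewrite step_ge0 step_le1.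
by apply: smooth_affine_comp; [rewrite gt_eqF|exact: smooth_step].
Qed.

Lemma smooth01_onem f : smooth01 f -> smooth01 (fun y => 1 - f y).
Proof.
move=> [sf f01]; split=> [|x]; last by have := f01 x; lra.
by apply: smoothB => //; exact: smooth_cst.
Qed.

Lemma smooth01M f g : smooth01 f -> smooth01 g -> smooth01 (fun y => f y * g y).
Proof.
move=> [sf f01] [sg g01]; split=> [|x]; first exact: smoothM.
have /andP[f0 f1] := f01 x; have /andP[g0 g1] := g01 x.
by rewrite mulr_ge0//= mulr_ile1.
Qed.

(* Supremum of the s such that the property holds for the admissible functions
   supported in [a, s]. *)
Lemma gluing (A P : (R -> R) -> Prop) a b : a <= b ->
  (forall f (k : R -> R), A f -> smooth01 k -> A (fun x => f x * k x)) ->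
  (forall f g, A f -> A g -> supp_in a b f -> supp_in a b g -> P f -> P g -> P (fun x => f x + g x)) ->
  (forall x, a <= x <= b -> exists2 d, 0 < d & forall f, A f -> supp_in (x - d) (x + d) f -> P f) ->
  forall f, A f -> supp_in a b f -> P f.
Proof.
move=> ab AM PD loc.
pose S := [set s | a <= s <= b /\ forall f, A f -> supp_in a s f -> P f].
have Sa : S a.
  split; first by rewrite lexx.
  have [|d d0 H] := loc a; first by rewrite lexx.
  by move=> f Af fa; apply: H => //; apply: supp_inW fa; lra.
have hS : has_sup S by split; [exists a|exists b => s [/andP[]]].
set m := sup S.
have am : a <= m by apply: ub_le_sup => //; case: hS.
have mb : m <= b by apply: ge_sup; [exists a|move=> s [/andP[]]].
have [|d d0 H] := loc m; first by rewrite am.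
have [s [sab Ss] sm] := sup_adherent d0 hS; rewrite -/m in sm.
have sm' : s <= m by apply: ub_le_sup; [case: hS|].
pose c := Num.min b (m + d / 2).
have Sc : S c.
  have cb : c <= b by rewrite /c ge_min lexx.
  have cm : c <= m + d / 2 by rewrite /c ge_min lexx orbT.
  have mc : m <= c by rewrite /c le_min mb; lra.
  have ac : a <= c by exact: le_trans mc.
  split; first by rewrite ac.
  move=> f Af fac.
  pose h := (s - m + d) / 2; pose k := (s + m - d) / 2.
  have h0 : 0 < h by rewrite /h; lra.
  have s01 := smooth01_step k h0.
  pose f1 y := f y * step ((y - k) / h); pose f2 y := f y * (1 - step ((y - k) / h)).
  have -> : f = fun y => f1 y + f2 y by apply/funext => y; rewrite /f1 /f2; ring.
  have A1 : A f1 by exact: AM.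
  have A2 : A f2 by apply: (AM _ _ Af); exact: smooth01_onem.
  have /andP[as0 sb] := sab.
  have f1s : supp_in (m - d) c f1.
    move=> y /orP[yk|yc]; rewrite /f1; last by rewrite fac ?mul0r// yc orbT.
    rewrite step0 ?mulr0// ler_pdivrMr//; move: yk; rewrite /k /h; lra.
  have f1s' : supp_in a c f1 by move=> y /fac; rewrite /f1 => ->; rewrite mul0r.
  have f2s : supp_in a s f2.
    move=> y /orP[yk|yc]; rewrite /f2; first by rewrite fac ?mul0r// yk.
    rewrite step1 ?subrr ?mulr0// ler_pdivlMr//; move: yc; rewrite /k /h; lra.
  apply: PD => //.
  - by apply: supp_inW f1s'.
  - by apply: supp_inW f2s.
  - by apply: H => //; apply: supp_inW f1s; lra.
  - exact: Ss.
have cm : c <= m by apply: ub_le_sup; [case: hS|].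
have cb : c = b.
  by move: cm; rewrite /c; case: (leP b (m + d / 2)) => //; lra.
by case: Sc => _; rewrite cb.
Qed.

Lemma open_ball_sub (O : set R) x : open O -> O x -> exists2 d, 0 < d & forall y, x - d <= y <= x + d -> O y.
Proof.
move=> oO Ox; have /nbhs_ballP[e /= e0 H] := open_nbhs_nbhs (conj oO Ox).
exists (e / 2); first by rewrite divr_gt0.
move=> y /andP[y1 y2]; apply: H; rewrite /ball/= ltr_norml; apply/andP; split; lra.
Qed.

Lemma distribution0 w f : (forall x, f x = 0) -> w f = 0.
Proof.
move=> f0; have -> : f = fun=> 0 by apply/funext.
have t0 : test_function (fun=> 0 : R).
  by apply: (@supp_in_test R 0 1) => //; exact: smooth_cst.
have := pairing_linear w (-1) t0 t0.
have -> : (fun x : R => -1 * 0 + 0 : R) = fun=> 0 by apply/funext => x; rewrite mulr0 addr0.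
by move=> ->; lra.
Qed.

Lemma distributionZD w (k : R) f g a b : smooth f -> smooth g -> supp_in a b f -> supp_in a b g ->
  w (fun x => k * f x + g x) = k * w f + w g.
Proof. by move=> sf sg fa ga; apply: pairing_linear; [exact: supp_in_test sf fa|exact: supp_in_test sg ga]. Qed.

Lemma distributionD w f g a b : smooth f -> smooth g -> supp_in a b f -> supp_in a b g ->
  w (fun x => f x + g x) = w f + w g.
Proof.
move=> sf sg fa ga; rewrite -[w f]mul1r -(distributionZD w 1 sf sg fa ga).
by congr (w _); apply/funext => x; rewrite mul1r.
Qed.

Lemma distributionB w f g a b : smooth f -> smooth g -> supp_in a b f -> supp_in a b g ->
  w (fun x => f x - g x) = w f - w g.
Proof.
move=> sf sg fa ga; rewrite -mulN1r addrC -(distributionZD w (-1) sg sf ga fa).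
by congr (w _); apply/funext => x; rewrite mulN1r addrC.
Qed.

(** Around each point either the function vanishes (inside O) or w does (off its support); gluing
    plays the part of a partition of unity. *)
Lemma vanish_off_support w (O : set R) f : open O -> dsupport w `<=` O ->
  test_function f -> (forall x, O x -> f x = 0) -> w f = 0.
Proof.
move=> oO sO tf fO; have sf := test_smooth tf; have [r r0 fr] := test_supp_in tf.
have rr : - r <= r by lra.
apply: (@gluing (fun f => smooth f /\ forall x, O x -> f x = 0) (fun f => w f = 0) (- r) r) => //.
- move=> g s [sg gO] [ss _]; split; first exact: smoothM.
  by move=> x /gO ->; rewrite mul0r.
- move=> g h [sg _] [sh _] gr hr g0 h0.
  by rewrite (distributionD w sg sh gr hr) g0 h0 addr0.
move=> x _; have [Ox|nOx] := pselect (O x).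
  have [d d0 H] := open_ball_sub oO Ox; exists d => // g [sg gO] gd.
  apply: distribution0 => y; case: (boolP (x - d <= y <= x + d)) => [/H/gO//|].
  by rewrite negb_and -!ltNge => /gd.
have : ~ dsupport w x by move=> /sO.
rewrite /dsupport /setC /= => /contrapT [V1 [oV1 vV1] V1x].
have [d d0 H] := open_ball_sub oV1 V1x; exists d => // g [sg gO] gd.
apply: vV1; first exact: supp_in_test gd.
by move=> y /(supp_in_fun_support gd); rewrite /= in_itv/=; exact: H.
Qed.

Lemma E'_vanish a b w f p q : E' a b w -> smooth f -> supp_in p q f -> (q < a) || (b < p) -> w f = 0.
Proof.
move=> Ew sf fpq; have tf := supp_in_test sf fpq; move=> /orP[qa|bp].
  apply: (@vanish_off_support w [set x | q < x]) => //.
    by move=> x /Ew /=; rewrite in_itv/= => /andP[ax _]; exact: lt_le_trans ax.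
  by move=> x /= qx; apply: fpq; rewrite qx orbT.
apply: (@vanish_off_support w [set x | x < p]) => //.
  by move=> x /Ew /=; rewrite in_itv/= => /andP[_ xb]; exact: le_lt_trans bp.
by move=> x /= xp; apply: fpq; rewrite xp.
Qed.

Definition plateau p q h : R -> R := fun x => step ((x - p) / h) * (1 - step ((x - q) / h)).

Lemma smooth01_plateau p q h : 0 < h -> smooth01 (plateau p q h).
Proof.
by move=> h0; apply: smooth01M; [|apply: smooth01_onem]; exact: smooth01_step.
Qed.

Lemma plateau1 p q h x : 0 < h -> p + h <= x <= q - h -> plateau p q h x = 1.
Proof.
move=> h0 /andP[px xq]; rewrite /plateau step1; last by rewrite ler_pdivlMr//; lra.
by rewrite step0 ?subr0 ?mul1r// ler_pdivrMr//; lra.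
Qed.

Lemma plateau_supp p q h : 0 < h -> supp_in (p - h) (q + h) (plateau p q h).
Proof.
move=> h0 x /orP[xp|qx]; rewrite /plateau.
  by rewrite step0 ?mul0r// ler_pdivrMr//; lra.
by rewrite [step ((x - q) / h)]step1 ?subrr ?mulr0// ler_pdivlMr//; lra.
Qed.

Lemma test_plateau p q h : 0 < h -> test_function (plateau p q h).
Proof.
by move=> h0; apply: supp_in_test (plateau_supp h0); case: (smooth01_plateau p q h0).
Qed.

(** Two cut-offs equal to 1 near the support differ by a function that vanishes near it. This frees
    later arguments from the particular cut-off picked by [xget]. *)
Lemma smooth_pairingE a b w chi (O : set R) psi : E' a b w -> test_function chi ->
  open O -> `[a, b]%classic `<=` O -> (forall x, O x -> chi x = 1) -> smooth psi ->
  smooth_pairing w psi = w (fun x => chi x * psi x).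
Proof.
move=> Ew tc oO abO cO sp; rewrite /smooth_pairing.
have cc : cutoff (dsupport w) chi.
  by split => //; exists O; split => //; exact: subset_trans Ew abO.
have := @xgetPex _ (cst 0) [set chi | cutoff (dsupport w) chi] (ex_intro _ _ cc).
set chi' := xget _ _ => -[tc' [V1 [oV1 sV1 c1']]].
have [r r0 cr] := test_supp_in tc; have [r' r'0 cr'] := test_supp_in tc'.
have sc := test_smooth tc; have sc' := test_smooth tc'.
have cR : supp_in (- (r + r')) (r + r') chi by apply: supp_inW cr; lra.
have cR' : supp_in (- (r + r')) (r + r') chi' by apply: supp_inW cr'; lra.
have H1 : supp_in (- (r + r')) (r + r') (fun x => chi x * psi x) by move=> x /cR ->; rewrite mul0r.
have H2 : supp_in (- (r + r')) (r + r') (fun x => chi' x * psi x) by move=> x /cR' ->; rewrite mul0r.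
have s1 := smoothM sc sp; have s2 := smoothM sc' sp.
apply/eqP; rewrite -subr_eq0 -(distributionB w s2 s1 H2 H1); apply/eqP.
apply: (@vanish_off_support w (V1 `&` O)).
- exact: openI.
- by move=> x xw; split; [exact: sV1|apply/abO/Ew].
- apply: (@supp_in_test R (- (r + r')) (r + r')); first exact: smoothB.
  by move=> x xr; rewrite H1// H2// subrr.
- by move=> x [/c1' -> /cO ->]; rewrite subrr.
Qed.

(** The bump is the derivative of [step]. A single step has no compact support, but a difference of
    two steps has, and there W' = w applies. *)
Lemma dilate_bump_diff w W y z s t : is_derivative w W -> 0 < s -> 0 < t ->
  dilate W z t (@stepD R) - dilate W y s (@stepD R) =
  w (fun x => step ((x - y) / s) - step ((x - z) / t)).
Proof.
move=> wW s0 t0; set Phi := fun x => _.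
have sn0 : s != 0 by rewrite gt_eqF.
have tn0 : t != 0 by rewrite gt_eqF.
have sP : smooth Phi by apply: smoothB; apply: smooth_affine_comp => //; exact: smooth_step.
have D : derive1 Phi = fun x => s^-1 * stepD ((x - y) / s) - t^-1 * stepD ((x - z) / t).
  apply/funext => x; apply: is_derive_derive1; apply: is_deriveB_fun.
    by apply: is_derive_affine; [exact: sn0|exact: (smooth_is_derive _ (@smooth_step R))].
  by apply: is_derive_affine; [exact: tn0|exact: (smooth_is_derive _ (@smooth_step R))].
pose a := Num.min (y - s) (z - t); pose b := Num.max (y + s) (z + t).
have ay : a <= y - s by rewrite /a ge_min lexx.
have az : a <= z - t by rewrite /a ge_min lexx orbT.
have yb : y + s <= b by rewrite /b le_max lexx.
have zb : z + t <= b by rewrite /b le_max lexx orbT.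
have tP : test_function Phi.
  apply: (@supp_in_test R a b) => // x /orP[xa|bx]; rewrite /Phi.
    by rewrite !step0 ?subrr// ler_pdivrMr//; lra.
  by rewrite !step1 ?subrr// ler_pdivlMr//; lra.
have Bs c k : 0 < k -> a <= c - k -> c + k <= b -> supp_in a b (affine_pull c k (@stepD R)) .
  move=> k0 ak kb; have H := @supp_in_affine_pull R c k (@stepD R) 1 k0 (@stepD_supp R).
  by apply: supp_inW H; rewrite mulr1.
have Sb c k : 0 < k -> smooth (affine_pull c k (@stepD R)).
  by move=> k0; apply: smooth_affine_pull; [rewrite gt_eqF|exact: smooth_stepD].
rewrite (wW _ tP) D /dilate.
have -> : (fun x => s^-1 * stepD ((x - y) / s) - t^-1 * stepD ((x - z) / t)) =
  fun x => s^-1 * affine_pull y s (@stepD R) x + ((- t^-1) * affine_pull z t (@stepD R) x + (fun=> 0) x).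
  by apply/funext => x; rewrite /affine_pull addr0 mulNr.
have b1 := Bs _ _ s0 ay yb; have b2 := Bs _ _ t0 az zb.
have z0 : supp_in a b (fun=> 0 : R) by [].
have sz : smooth (fun=> 0 : R) by exact: smooth_cst.
have s1 := Sb y s s0; have s2 := Sb z t t0.
have s3 : smooth (fun x => - t^-1 * affine_pull z t (@stepD R) x + (fun=> 0) x).
  exact: (@smoothD R (fun x => - t^-1 * affine_pull z t (@stepD R) x) (fun=> 0) (@smoothZ R (- t^-1) _ s2) sz).
have b3 : supp_in a b (fun x => - t^-1 * affine_pull z t (@stepD R) x + (fun=> 0) x).
  by move=> x /b2 ->; rewrite mulr0 addr0.
rewrite (distributionZD W s^-1 s1 s3 b1 b3) (distributionZD W (- t^-1) s2 sz b2 z0).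
rewrite (@distribution0 W (fun=> 0) (fun=> erefl)).
by move: (W (affine_pull y s _)) (W (affine_pull z t _)) => X Y; ring.
Qed.

Definition nonneg_on w p q := forall f, smooth f -> (forall x, 0 <= f x) ->
  (exists a b, [/\ p < a, b < q & supp_in a b f]) -> 0 <= w f.

(** Two steps are ordered when their transition zones are disjoint or when they have the same width,
    and then their difference is a nonnegative test function. So W increases in the mean wherever w
    is nonnegative. *)
Lemma dilate_bump_le w W p q y z s t : is_derivative w W -> nonneg_on w p q ->
  0 < s -> 0 < t -> p < y - s -> z + t < q -> y + s <= z - t \/ (s = t /\ y <= z) ->
  dilate W y s (@stepD R) <= dilate W z t (@stepD R).
Proof.
move=> wW w0 s0 t0 py zq yz; rewrite -subr_ge0 (dilate_bump_diff y z wW s0 t0).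
apply: w0.
- apply: smoothB; apply: smooth_affine_comp; rewrite ?gt_eqF//; exact: smooth_step.
- move=> x; rewrite subr_ge0; case: yz => [yz|[<- yz]].
    case: (leP x (y + s)) => xy.
      by rewrite (step0 (x := (x - z) / t)) ?step_ge0// ler_pdivrMr//; lra.
    by rewrite (step1 (x := (x - y) / s)) ?step_le1// ler_pdivlMr//; lra.
  by apply: step_homo; rewrite ler_pM2r ?invr_gt0//; lra.
exists (y - s), (z + t); split => // x /orP[xa|bx].
  rewrite !step0 ?subrr// ler_pdivrMr//; case: yz => [h|[h1 h2]]; lra.
by rewrite !step1 ?subrr// ler_pdivlMr//; case: yz => [h|[h1 h2]]; lra.
Qed.

Lemma nonneg_on_glue w p q :
  (forall x, p < x < q -> exists2 d, 0 < d & forall f, smooth f -> (forall y, 0 <= f y) ->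
     supp_in (x - d) (x + d) f -> 0 <= w f) -> nonneg_on w p q.
Proof.
move=> loc f sf f0 [a [b [pa bq fab]]].
case: (leP a b) => ab; last first.
  rewrite (@distribution0 w f)// => x; apply: fab; case: ltP => //= ax; exact: lt_le_trans ab ax.
apply: (@gluing (fun f => smooth f /\ forall x, 0 <= f x) (fun f => 0 <= w f) a b) => //.
- move=> g s [sg g0] [ss s01]; split; first exact: smoothM.
  by move=> x; rewrite mulr_ge0//; case/andP: (s01 x).
- move=> g h [sg _] [sh _] ga ha g0 h0.
  by rewrite (distributionD w sg sh ga ha) addr_ge0.
move=> x /andP[ax xb]; have [|d d0 H] := loc x; first by apply/andP; split; lra.
by exists d => // g [sg g0]; exact: H.
Qed.

End Gluing.

(** * Removable points, and the Baire category theorem *)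

Section RemovableBaire.
Variable R : realType.
Implicit Types (f g psi phi : R -> R) (x y z s t l r a b p q h e : R) (u v w W : Defs.distribution R).
Notation mu := (@lebesgue_measure R).

Lemma supp_in_derive1 a b f : supp_in a b f -> supp_in a b (derive1 f).
Proof. by move=> /(derive1n_supp 1). Qed.

Lemma integral_derive_supp a b f : a <= b -> smooth f -> supp_in a b f ->
  \int[mu]_x derive1 f x = 0.
Proof.
move=> ab sf fab.
have sub : supp_in (a - 1) (b + 1) (derive1 f).
  by apply: supp_inW (supp_in_derive1 fab); lra.
rewrite (Rintegral_supp _ sub); last by lra.
have D x : is_derive x 1 f (derive1 f x) by exact: smooth_is_derive.
rewrite (integral_cc_derive _ _ D); last by lra.
  rewrite (fab (b + 1)) ?(fab (a - 1)) ?subrr//; first by apply/orP; left; lra.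
  by apply/orP; right; lra.
exact/smooth_continuous/smooth_derive1.
Qed.

Lemma standard_plateau : exists eta, [/\ @smooth01 R eta, supp_in (- 3) 3 eta &
  forall z, -1 <= z <= 1 -> eta z = 1].
Proof.
have h01 : 0 < (1 : R) by [].
exists (plateau (-2) 2 (1 : R)); split; first exact: smooth01_plateau.
  by have := @plateau_supp R (-2) 2 1 h01; apply: supp_inW; lra.
by move=> z z1; apply: plateau1 => //; lra.
Qed.

(** With [et] a cut-off of width t at e, w (f et) is - W (f' et) - t^-1 W (f eta'((y - e) / t)). The
    first term is O(t); the second tends to a multiple of the integral of eta', which is 0. Hence w
    f is a limit of the nonnegative numbers w (f (1 - et)). *)
Lemma nonneg_on_removable w W e l p q : is_derivative w W -> point_value W e l ->
  nonneg_on w p e -> nonneg_on w e q -> nonneg_on w p q.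
Proof.
move=> wW pv wl wr f sf f0 [a [b [pa bq fab]]].
case: (leP a b) => ab; last first.
  rewrite (@distribution0 R w f)// => x; apply: fab; case: ltP => //= ax; exact: lt_le_trans ab ax.
have [eta [[se e01] etas eta1]] := standard_plateau.
have t3 : 0 < (3 : R) by lra.
have sde := smooth_derive1 se; have sdf := smooth_derive1 sf.
have detas := supp_in_derive1 etas.
apply/ler_addgt0Pr => k k0.
have k2 : 0 < k / 2 by rewrite divr_gt0.
have [d1 d10 H1] := dilate_mult_lim pv t3 sde detas sf k2.
have [d2 d20 H2] := dilate_mult_lim pv t3 se etas sdf ltr01.
have i0 : \int[mu]_x derive1 eta x = 0.
  by apply: (@integral_derive_supp (-3) 3) => //; lra.
set L := derive1 f e * (l * \int[mu]_x eta x) in H2.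
pose m := Num.min (Num.min d1 d2) (k / 2 / (`|L| + 1)); pose t := m / 2.
have L1 : 0 < `|L| + 1 by rewrite ltr_wpDl.
have m0 : 0 < m by rewrite /m !lt_min d10 d20/= !divr_gt0.
have t0 : 0 < t by rewrite /t divr_gt0.
have tm : t < m by rewrite /t; lra.
move: (tm); rewrite /m !lt_min => /andP[/andP[td1 td2] tk].
have tn0 : t != 0 by rewrite gt_eqF.
pose et := affine_pull e t eta.
have set_ : smooth et by exact: (@smooth_affine_pull R e t eta tn0 se).
have ft1 : smooth (fun x => f x * (1 - et x)).
  exact: (smoothM sf (smoothB (@smooth_cst R 1) set_)).
have ft2 : smooth (fun x => f x * et x) by exact: (smoothM sf set_).
have fs1 : supp_in a b (fun x => f x * (1 - et x)) by move=> x /fab ->; rewrite mul0r.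
have fs2 : supp_in a b (fun x => f x * et x) by move=> x /fab ->; rewrite mul0r.
have -> : f = fun x => f x * (1 - et x) + f x * et x by apply/funext => x; ring.
rewrite (distributionD w ft1 ft2 fs1 fs2).
have w1 : 0 <= w (fun x => f x * (1 - et x)).
  apply: (@gluing R (fun f => [/\ smooth f, (forall x, 0 <= f x) & forall x, e - t <= x <= e + t -> f x = 0])
    (fun f => 0 <= w f) a b ab).
  - move=> g s [sg g0 gO] [ss s01]; split; first exact: (@smoothM R g s sg ss).
      by move=> x; rewrite mulr_ge0//; case/andP: (s01 x).
    by move=> x /gO ->; rewrite mul0r.
  - move=> g h [sg _ _] [sh _ _] ga ha g0 h0.
    by rewrite (distributionD w sg sh ga ha) addr_ge0.
  - move=> x /andP[ax xb]; case: (ltgtP x e) => xe.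
    + pose d := Num.min (x - p) (e - x) / 2.
      have mm : 0 < Num.min (x - p) (e - x) by rewrite lt_min; apply/andP; split; lra.
      have dd : 2 * d <= x - p /\ 2 * d <= e - x.
        have -> : 2 * d = Num.min (x - p) (e - x) by rewrite /d mulrC divfK.
        by rewrite !ge_min !lexx orbT.
      have d0 : 0 < d by rewrite /d divr_gt0.
      exists d => // g [sg g0 _] gd; apply: wl => //.
      by exists (x - d), (x + d); split => //; lra.
    + pose d := Num.min (x - e) (q - x) / 2.
      have mm : 0 < Num.min (x - e) (q - x) by rewrite lt_min; apply/andP; split; lra.
      have dd : 2 * d <= x - e /\ 2 * d <= q - x.
        have -> : 2 * d = Num.min (x - e) (q - x) by rewrite /d mulrC divfK.
        by rewrite !ge_min !lexx orbT.
      have d0 : 0 < d by rewrite /d divr_gt0.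
      exists d => // g [sg g0 _] gd; apply: wr => //.
      by exists (x - d), (x + d); split => //; lra.
    + exists t => // g [sg g0 gO] gd; rewrite (@distribution0 R w g)// => y.
      case: (boolP (e - t <= y <= e + t)) => [/gO//|].
      by rewrite negb_and -!ltNge -xe => /gd.
  - split=> //.
      move=> x; rewrite mulr_ge0// subr_ge0.
      by case/andP: (e01 ((x - e) / t)).
    move=> x /andP[x1 x2]; rewrite /et /affine_pull eta1 ?subrr ?mulr0//.
    by rewrite ler_pdivlMr// ler_pdivrMr//; apply/andP; split; lra.
  - exact: fs1.
have w2 : `|w (fun x => f x * et x)| <= k.
  have tt := supp_in_test ft2 fs2.
  have D : derive1 (fun x => f x * et x) = fun x => t^-1 * (f x * affine_pull e t (derive1 eta) x) + derive1 f x * et x.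
    apply/funext => x.
    have De : is_derive x 1 et (t^-1 * derive1 eta ((x - e) / t)).
      exact: (is_derive_affine tn0 (smooth_is_derive ((x - e) / t) se)).
    rewrite (is_derive_derive1 (is_deriveM_fun (smooth_is_derive x sf) De)) /affine_pull.
    by ring.
  have s1 : smooth (fun x => f x * affine_pull e t (derive1 eta) x).
    exact: (smoothM sf (@smooth_affine_pull R e t _ tn0 sde)).
  have s2 : smooth (fun x => derive1 f x * et x) by exact: (smoothM sdf set_).
  have r1 : supp_in a b (fun x => f x * affine_pull e t (derive1 eta) x) by move=> x /fab ->; rewrite mul0r.
  have r2 : supp_in a b (fun x => derive1 f x * et x).
    by move=> x /(supp_in_derive1 fab) ->; rewrite mul0r.
  rewrite (wW _ tt) D (distributionZD W t^-1 s1 s2 r1 r2) normrN.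
  have h1 := H1 t t0 td1; rewrite i0 !mulr0 subr0 in h1.
  have h2 := H2 t t0 td2.
  apply: (le_trans (ler_normD _ _)).
  have h3 : `|W (fun x => derive1 f x * et x)| <= k / 2.
    have : `|t^-1 * W (fun x => derive1 f x * et x)| <= `|L| + 1.
      rewrite -[_ * _](subrK L) addrC (le_trans (ler_normD _ _))// lerD2l.
      exact: h2.
    rewrite normrM (ger0_norm (x := t^-1)) ?invr_ge0 ?(ltW t0)// ler_pdivrMl// => /le_trans; apply.
    by rewrite ltr_pdivlMr// in tk; rewrite ltW.
  by lra.
by move: w2; rewrite ler_norml => /andP[]; lra.
Qed.

(** Nested intervals: were it false, each interval that meets C would contain a smaller one that
    meets C and misses G k. The common point lies in C and in ]p, q[, but in no G k. *)
Lemma baire_portion (C : set R) (G : nat -> set R) p q : closed C -> (forall k, closed (G k)) ->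
  (exists2 x, C x & p < x < q) -> (forall x, C x -> p < x < q -> exists k, G k x) ->
  exists k l r, [/\ p < l, r < q, (exists2 x, C x & l < x < r) &
    forall x, C x -> l < x < r -> G k x].
Proof.
move=> cC cG [x0 Cx0 /andP[px0 x0q]] cov; apply: contrapT => H.
pose good (lr : R * R) := [/\ p < lr.1, lr.2 < q & exists2 x, C x & lr.1 < x < lr.2].
have /choice[F HF] : forall klr : nat * (R * R), exists lr : R * R, good klr.2 ->
   [/\ good lr, klr.2.1 < lr.1, lr.2 < klr.2.2, lr.2 - lr.1 <= 2 * 3^-1 ^+ klr.1 &
     forall x, lr.1 <= x <= lr.2 -> ~ G klr.1 x].
  move=> [k [l r]] /=; have [gd|] := pselect (good (l, r)); last by exists (0, 0).
  have [/= pl rq exC] := gd.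
  have [y [Cy /andP[ly yr] nG]] : exists y, [/\ C y, l < y < r & ~ G k y].
    apply: contrapT => K; apply: H; exists k, l, r; split => // x Cx xlr.
    by apply: contrapT => nG; apply: K; exists x.
  have oG : open (~` G k) by exact: closed_openC.
  have [d d0 Hd] := open_ball_sub oG nG.
  pose m := Num.min (Num.min d (3^-1 ^+ k)) (Num.min (y - l) (r - y) / 2).
  have e0 : 0 < 3^-1 ^+ k :> R by rewrite exprn_gt0// invr_gt0.
  have n0 : 0 < Num.min (y - l) (r - y) by rewrite lt_min; apply/andP; split; lra.
  have m0 : 0 < m by rewrite /m !lt_min d0 e0/= divr_gt0.
  have md : m <= d by rewrite /m !ge_min lexx.
  have me : m <= 3^-1 ^+ k by rewrite /m !ge_min lexx orbT.
  have mn : m <= Num.min (y - l) (r - y) / 2 by rewrite /m !ge_min lexx orbT.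
  have nl : Num.min (y - l) (r - y) <= y - l by rewrite ge_min lexx.
  have nr : Num.min (y - l) (r - y) <= r - y by rewrite ge_min lexx orbT.
  exists (y - m, y + m) => _ /=; split; try lra.
    by split => /=; [lra|lra|exists y => //; apply/andP; split; lra].
  by move=> x xm; apply: Hd; lra.
pose fix S k := if k is k'.+1 then F (k', S k') else ((p + x0) / 2, (x0 + q) / 2).
have gS k : good (S k).
  elim: k => [|k IH].
    by split => /=; [lra|lra|exists x0 => //; apply/andP; split; lra].
  by have [] := HF (k, S k) IH.
have HS k := HF (k, S k) (gS k).
have S1 k : (S k).1 <= (S k.+1).1 by have [_ /ltW] := HS k.
have S2 k : (S k.+1).2 <= (S k).2 by have [_ _ /ltW] := HS k.
have h1 : {homo (fun k => (S k).1) : m n / (m <= n)%N >-> m <= n} by apply: homo_leq => //; exact: le_trans.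
have h2 m n : (m <= n)%N -> (S n).2 <= (S m).2.
  elim: n => [|n IH]; first by rewrite leqn0 => /eqP ->.
  rewrite leq_eqVlt => /orP[/eqP -> //|]; rewrite ltnS => /IH; exact: le_trans.
have S12 k : (S k).1 <= (S k).2.
  by have [_ _ [x _ /andP[x1 x2]]] := gS k; rewrite ltW// (lt_trans x1).
have h12 m n : (S m).1 <= (S n).2.
  case: (leqP m n) => mn; first by rewrite (le_trans (h1 _ _ mn)).
  by rewrite (le_trans (S12 m))// h2// ltnW.
pose x := sup (range (fun k => (S k).1)).
have xl k : (S k).1 <= x.
  by apply: ub_le_sup; [exists (S 0%N).2 => _ [m _ <-]|exists k].
have xr k : x <= (S k).2.
  by apply: ge_sup; [exists (S 0%N).1, 0%N|move=> _ [m _ <-]].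
have Cx : C x.
  apply: contrapT => nCx.
  have oC : open (~` C) by exact: closed_openC.
  have [d d0 Hd] := open_ball_sub oC nCx.
  suff : d <= 0 by lra.
  apply: (@geometric_le R d 0 2) => k; rewrite add0r.
  have [[_ _ [y Cy /andP[y1 y2]]] _ _ len _] := HS k.
  have := xl k.+1; have := xr k.+1 => /= g1 g2; rewrite /= in len.
  rewrite leNgt; apply/negP => lt; apply: (Hd y _ Cy).
  by apply/andP; split; lra.
have [|k Gk] := cov x Cx.
  have [pl rq _] := gS 0%N; have := xl 0%N; have := xr 0%N.
  by move=> ? ?; apply/andP; split; lra.
have [_ _ _ _ nG] := HS k; apply: (nG x) => //.
by have := xl k.+1; have := xr k.+1 => /= -> ->.
Qed.

End RemovableBaire.

(** * The heat equation *)

Section Heat.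
Variable R : realType.
Implicit Types (f g psi phi : R -> R) (x y z s t l r a b c d h e : R) (p q : {poly R})
  (T : (R -> R) -> R).

Lemma is_derive_approx f x l : is_derive x 1 f l ->
  forall e, 0 < e -> exists2 d, 0 < d & forall h, `|h| < d -> `|f (x + h) - f x - h * l| <= e * `|h|.
Proof.
move=> [df <-] e e0.
have : h^-1 *: ((f \o shift x) (h *: 1) - f x) @[h --> 0^'] --> 'D_1 f x by exact: df.
move=> /cvgrPdist_le/(_ e e0); rewrite near_withinE => /nbhs_ballP[d /= d0 H].
exists d => // h hd; have [->|h0] := eqVneq h 0; first by rewrite addr0 subrr mul0r subrr normr0 mulr0.
have := H h; rewrite /ball/= sub0r normrN => /(_ hd h0).
rewrite [_%:A](mulr1 h) [h + x]addrC -[_ *: _]/(h^-1 * _) => K.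
have -> : f (x + h) - f x - h * 'D_1 f x = - h * ('D_1 f x - h^-1 * (f (x + h) - f x)).
  by field.
by rewrite normrM normrN mulrC ler_wpM2r.
Qed.

(** One-sided, because a minimum in time may be reached at the last instant. *)
Lemma is_derive_le0_left f x l a : a < x -> is_derive x 1 f l ->
  (forall y, a <= y <= x -> f x <= f y) -> l <= 0.
Proof.
move=> ax Df H; apply/ler_addgt0Pr => e e0; rewrite add0r.
have [d d0 Hd] := is_derive_approx Df e0.
pose h := Num.min d (x - a) / 2.
have m0 : 0 < Num.min d (x - a) by rewrite lt_min d0/=; lra.
have h0 : 0 < h by rewrite divr_gt0.
have hm : h < Num.min d (x - a) by rewrite /h; lra.
move: hm; rewrite lt_min => /andP[hd hxa].
have hd' : `|- h| < d by rewrite normrN gtr0_norm.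
have := Hd (- h) hd'.
rewrite normrN (gtr0_norm h0) ler_norml => /andP[_ K].
have : f x <= f (x + - h) by apply: H; apply/andP; split; lra.
move=> K2; have : h * l <= h * e by lra.
by rewrite ler_pM2l.
Qed.

Lemma is_derive_ge0_right f x l b : x < b -> is_derive x 1 f l ->
  (forall y, x <= y <= b -> f x <= f y) -> 0 <= l.
Proof.
move=> xb Df H; apply/ler_addgt0Pr => e e0.
have [d d0 Hd] := is_derive_approx Df e0.
pose h := Num.min d (b - x) / 2.
have m0 : 0 < Num.min d (b - x) by rewrite lt_min d0/=; lra.
have h0 : 0 < h by rewrite divr_gt0.
have hm : h < Num.min d (b - x) by rewrite /h; lra.
move: hm; rewrite lt_min => /andP[hd hxa].
have hd' : `|h| < d by rewrite gtr0_norm.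
have := Hd h hd'.
rewrite (gtr0_norm h0) ler_norml => /andP[_ K].
have : f x <= f (x + h) by apply: H; apply/andP; split; lra.
move=> K2; have : h * 0 <= h * (l + e) by lra.
by rewrite ler_pM2l.
Qed.

(** The two one-sided lemmas give f1 x = 0. If l were negative, f1 would be negative just to the
    right of x and f would drop below f x. *)
Lemma second_derivative_min f (f1 : R -> R) x l a b : a < x < b ->
  (forall y, a < y < b -> is_derive y 1 f (f1 y)) -> is_derive x 1 f1 l ->
  (forall y, a <= y <= b -> f x <= f y) -> 0 <= l.
Proof.
move=> /andP[ax xb] D1 D2 H.
have Dx : is_derive x 1 f (f1 x) by apply: D1; rewrite ax.
have f10 : f1 x = 0.
  apply/le_anti/andP; split.
    by apply: (is_derive_le0_left ax Dx) => y /andP[ay yx]; apply: H; rewrite ay (le_trans yx)// ltW.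
  by apply: (is_derive_ge0_right xb Dx) => y /andP[ay yx]; apply: H; rewrite yx andbT (le_trans _ ay)// ltW.
rewrite leNgt; apply/negP => l0.
have e0 : 0 < - l / 2 by rewrite divr_gt0//; lra.
have [d d0 Hd] := is_derive_approx D2 e0.
pose h := Num.min d (b - x) / 2.
have m0 : 0 < Num.min d (b - x) by rewrite lt_min d0/=; lra.
have h0 : 0 < h by rewrite divr_gt0.
have hm : h < Num.min d (b - x) by rewrite /h; lra.
move: hm; rewrite lt_min => /andP[hd hxa].
have xh : x < x + h by rewrite ltrDl.
have [||k] := @MVT R f f1 x (x + h) xh.
- move=> y; rewrite in_itv/= => /andP[y1 y2]; apply: D1.
  by apply/andP; split; lra.
- apply: derivable_within_continuous => y; rewrite in_itv/= => /andP[y1 y2].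
  have yab : a < y < b by apply/andP; split; lra.
  by have [] := D1 y yab.
rewrite in_itv/= => /andP[k1 k2] E.
have : f x <= f (x + h) by apply: H; apply/andP; split; lra.
have kx : `|k - x| < d by rewrite gtr0_norm; lra.
have xk : x + (k - x) = k by ring.
have := Hd (k - x) kx; rewrite xk f10 subr0 (gtr0_norm (x := k - x)); last by lra.
rewrite ler_norml => /andP[_ K].
have kk : 0 < k - x by lra.
have : f1 k < 0.
  have : f1 k <= (k - x) * (l / 2) by lra.
  by move=> /le_lt_trans; apply; rewrite pmulr_rlt0//; lra.
move=> f1k; have : f1 k * (x + h - x) < 0 by rewrite nmulr_rlt0//; lra.
by lra.
Qed.

(** Clamping the argument to [a, b] extends f to a continuous function on the line, for which the
    extreme value theorem is available. *)
Lemma lipschitz_min f a b (L : R) : a <= b ->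
  (forall x y, a <= x <= b -> a <= y <= b -> `|f x - f y| <= L * `|x - y|) ->
  exists2 c, a <= c <= b & forall x, a <= x <= b -> f c <= f x.
Proof.
move=> ab HL.
pose cl x := Num.max a (Num.min x b).
have clab x : a <= cl x <= b.
  by rewrite /cl le_max lexx ge_max ab/= ge_min lexx orbT.
have clid x : a <= x <= b -> cl x = x.
  by move=> /andP[ax xb]; rewrite /cl (min_idPl xb) (max_idPr ax).
have cl1 x y : `|cl x - cl y| <= `|x - y|.
  have mx (u v : R) : `|Num.max a u - Num.max a v| <= `|u - v|.
    have := ler_norm (u - v); have := ler_norm (v - u); rewrite (distrC v u) => h1 h2.
    by case: (leP a u) => g1; case: (leP a v) => g2; rewrite ler_norml; apply/andP; split; lra.
  have mn (u v : R) : `|Num.min u b - Num.min v b| <= `|u - v|.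
    have := ler_norm (u - v); have := ler_norm (v - u); rewrite (distrC v u) => h1 h2.
    by case: (leP u b) => g1; case: (leP v b) => g2; rewrite ler_norml; apply/andP; split; lra.
  exact: (le_trans (mx _ _) (mn _ _)).
pose L' := `|L| + 1.
have L'0 : 0 < L' by rewrite ltr_wpDl.
have cont : continuous (f \o cl).
  move=> x; apply/cvgrPdist_le => e e0; near=> y.
  have xy : `|x - y| <= e / L'.
    by near: y; apply: cvgr_dist_le; [exact: cvg_id|rewrite divr_gt0].
  apply: (le_trans (HL _ _ (clab x) (clab y))).
  apply: (@le_trans _ _ (L' * `|x - y|)).
    apply: (@le_trans _ _ (L' * `|cl x - cl y|)).
      by rewrite ler_wpM2r// /L' (le_trans (ler_norm _))// lerDl.
    by rewrite ler_wpM2l ?(ltW L'0).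
  by rewrite mulrC -ler_pdivlMr.
have [k kab Hk] := EVT_min ab (continuous_subspaceT cont).
exists k; first by move: kab; rewrite in_itv.
move=> x xab; have := Hk x; rewrite in_itv/= xab => /(_ isT).
by rewrite /= !clid//; move: kab; rewrite in_itv.
Unshelve. all: by end_near. Qed.

(** The minimum is taken in x for each t and then in t: the minimiser X t may jump, but t |-> v (X
    t) t is again Lipschitz. Off the parabolic boundary a minimum forces vt <= 0 <= vxx, against the
    strict inequality. *)
Lemma heat_minimum (v vx vxx vt : R -> R -> R) c d t1 t0 (L : R) : c < d -> t1 < t0 ->
  (forall x t, c < x < d -> t1 < t <= t0 -> is_derive x 1 (v^~ t) (vx x t)) ->
  (forall x t, c < x < d -> t1 < t <= t0 -> is_derive x 1 (vx^~ t) (vxx x t)) ->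
  (forall x t, c < x < d -> t1 < t <= t0 -> is_derive t 1 (v x) (vt x t)) ->
  (forall x t, c < x < d -> t1 < t <= t0 -> 0 < vt x t - t * vxx x t) ->
  0 <= t1 ->
  (forall x y t, c <= x <= d -> c <= y <= d -> t1 <= t <= t0 -> `|v x t - v y t| <= L * `|x - y|) ->
  (forall x s t, c <= x <= d -> t1 <= s <= t0 -> t1 <= t <= t0 -> `|v x s - v x t| <= L * `|s - t|) ->
  (forall t, t1 <= t <= t0 -> 0 <= v c t) -> (forall t, t1 <= t <= t0 -> 0 <= v d t) ->
  (forall x, c <= x <= d -> 0 <= v x t1) ->
  forall x t, c <= x <= d -> t1 <= t <= t0 -> 0 <= v x t.
Proof.
move=> cd tt Dx Dxx Dt pos t10 Lx Lt wc wd bot.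
have /choice[X HX] : forall t, exists X, t1 <= t <= t0 ->
    c <= X <= d /\ forall x, c <= x <= d -> v X t <= v x t.
  move=> t; have [tI|] := boolP (t1 <= t <= t0); last by exists 0.
  have [X Xcd HX] := @lipschitz_min (v^~ t) c d L (ltW cd) (fun x y xc yc => Lx x y t xc yc tI).
  by exists X.
have Lm s t : t1 <= s <= t0 -> t1 <= t <= t0 -> `|v (X s) s - v (X t) t| <= L * `|s - t|.
  move=> sI tI; have [Xs Hs] := HX s sI; have [Xt Ht] := HX t tI.
  have h1 := Hs (X t) Xt; have h2 := Ht (X s) Xs.
  have := Lt (X t) s t Xt sI tI; have := Lt (X s) s t Xs sI tI.
  rewrite !ler_norml => /andP[k1 k2] /andP[k3 k4]; apply/andP; split; lra.
have [s sI Hs] := @lipschitz_min (fun t => v (X t) t) t1 t0 L (ltW tt) Lm.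
have [Xcd HXs] := HX s sI.
set k := X s in Xcd HXs Hs.
suff kk : 0 <= v k s.
  move=> x t xcd tI; apply: (le_trans kk); apply: (le_trans (Hs t tI)).
  by have [_] := HX t tI; apply.
have /andP[ck kd] := Xcd; have /andP[t1s st0] := sI.
have [->|kc] := eqVneq k c; first exact: wc.
have [->|kd'] := eqVneq k d; first exact: wd.
have [->|st1] := eqVneq s t1; first exact: bot.
have kcd : c < k < d by rewrite !lt_neqAle eq_sym kc ck kd' kd.
have sI' : t1 < s <= t0 by rewrite lt_neqAle eq_sym st1 t1s st0.
have /andP[t1s' _] := sI'.
have h1 : vt k s <= 0.
  apply: (is_derive_le0_left t1s' (Dt k s kcd sI')) => y /andP[y1 y2].
  have yI : t1 <= y <= t0 by rewrite y1 (le_trans y2).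
  by apply: (le_trans (Hs y yI)); have [_] := HX y yI; apply.
have h2 : 0 <= vxx k s.
  apply: (@second_derivative_min (v^~ s) (vx^~ s) k (vxx k s) c d kcd) => //.
  - by move=> y ycd; exact: Dx.
  - exact: Dxx.
have := pos k s kcd sI'.
have : 0 <= s * vxx k s by rewrite mulr_ge0// (le_trans t10).
by lra.
Qed.

End Heat.

(** * Gaussian averages of a functional as a solution of the heat equation *)

Section HeatExtension.
Variable R : realType.
Implicit Types (f g psi phi : R -> R) (x y z s t l r a b c d h e : R) (p q : {poly R})
  (T : (R -> R) -> R).

Definition dgauss p : {poly R} := p^`() - 'X * p.

Lemma derive1n_gaussE p n : derive1n n (gauss p) = gauss (iter n dgauss p).
Proof. by elim: n => // n IH; rewrite derive1nS IH derive1_gauss. Qed.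

Lemma gaussD p q x : gauss (p + q) x = gauss p x + gauss q x.
Proof. by rewrite /gauss hornerD mulrDl. Qed.

Lemma gaussN p x : gauss (- p) x = - gauss p x.
Proof. by rewrite /gauss hornerN mulNr. Qed.

Lemma gaussX p x : gauss ('X * p) x = x * gauss p x.
Proof. by rewrite /gauss hornerM hornerX -mulrA. Qed.

Lemma gaussMn p n x : gauss (p *+ n) x = n%:R * gauss p x.
Proof. by rewrite /gauss hornerMn -mulr_natl mulrA. Qed.

(* The t-derivative of t^-j * gauss q ((y - x) / t) is of the same form, with
   j + 1 in place of j and euler j q in place of q. *)
Definition euler j p : {poly R} := - (p *+ j + 'X * dgauss p).

(** Differentiations in the width and in space commute; the one in space brings a further factor
    t^-1, whence j + 1. *)
Lemma dgauss_euler j p : dgauss (euler j p) = euler j.+1 (dgauss p).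
Proof.
have dN q : dgauss (- q) = - dgauss q by rewrite /dgauss derivN mulrN opprD.
have dD q (r : {poly R}) : dgauss (q + r) = dgauss q + dgauss r.
  by rewrite /dgauss derivD mulrDr opprD addrACA.
have dX q : dgauss ('X * q) = q + 'X * dgauss q.
  by rewrite /dgauss derivM derivX mul1r mulrBr addrA.
have dM q : dgauss (q *+ j) = dgauss q *+ j.
  by rewrite /dgauss derivMn mulrnAr mulrnBl.
by rewrite /euler dN dD dX dM mulrSr addrA.
Qed.

Lemma iter_dgauss_euler j p : iter j dgauss (euler 0 p) = euler j (iter j dgauss p).
Proof. by elim: j => // j IH; rewrite iterS IH dgauss_euler. Qed.

Lemma is_derive_inv_exp j s : s != 0 ->
  is_derive s 1 (fun s => s^-1 ^+ j) (- (j%:R * s^-1 ^+ j.+1)).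
Proof.
move=> s0.
have Di : is_derive s 1 (fun z : R => z^-1) (- 1 * (s^-1 * s^-1)).
  by apply: (@is_deriveV_fun _ id).
elim: j => [|j IH].
  by rewrite mul0r oppr0; apply: (@is_derive_ext _ (fun=> 1)) => z; rewrite expr0.
apply: (@is_derive_ext _ (fun z => z^-1 * z^-1 ^+ j)) => [z|]; first by rewrite exprS.
apply: is_derive_eq (is_deriveM_fun Di IH) _.
by rewrite !exprS -natr1; ring.
Qed.

Lemma is_derive_gauss_dilation q (j : nat) x y s : s != 0 ->
  is_derive s 1 (fun s => s^-1 ^+ j * gauss q ((y - x) / s))
    (s^-1 ^+ j.+1 * gauss (euler j q) ((y - x) / s)).
Proof.
move=> s0.
have Di : is_derive s 1 (fun z : R => (y - x) * z^-1) ((y - x) * (- 1 * (s^-1 * s^-1))).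
  by apply: is_deriveZ_fun; apply: (@is_deriveV_fun _ id).
have Dg : is_derive s 1 (fun z => gauss q ((y - x) * z^-1))
    (gauss (dgauss q) ((y - x) / s) * ((y - x) * (- 1 * (s^-1 * s^-1)))).
  exact: (@is_derive1_comp _ (gauss q) (fun z => (y - x) * z^-1) s _ _
    (is_derive_gauss q ((y - x) / s)) Di).
apply: is_derive_eq (is_deriveM_fun (is_derive_inv_exp j s0) Dg) _.
rewrite /euler gaussN (gaussD (q *+ j) ('X * dgauss q)) gaussMn gaussX exprS.
by ring.
Qed.

Section extension.
Variables (T : (R -> R) -> R) (cT : cfun T).

Lemma smooth_gauss_pull p x t : t != 0 -> smooth (fun y => gauss p ((y - x) / t)).
Proof. by move=> t0; apply: smooth_affine_comp => //; exact: smooth_gauss. Qed.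

Arguments smooth_gauss_pull : clear implicits.

(** Uniform in x because every derivative of a Gaussian is bounded on the line, and in t because
    t^-1 <= t1^-1. *)
Lemma cfun_gauss_bound p t1 : 0 < t1 -> exists2 L, 0 < L &
  forall x t, t1 <= t -> `|T (fun y => gauss p ((y - x) / t))| <= L.
Proof.
move=> t10; have [_ [C [r [n [C0 r0 HC]]]]] := cT.
have [|B B0 HB] := @unif_nat R (fun j A => forall x, t1^-1 ^+ j * `|gauss (iter j dgauss p) x| <= A) n
  (fun j A B AB H x => le_trans (H x) AB).
  move=> j; have [B B0 HB] := gauss_bounded (iter j dgauss p).
  by exists (t1^-1 ^+ j * B) => x; rewrite ler_wpM2l// exprn_ge0// invr_ge0 ltW.
exists (C * B); first by rewrite mulr_gt0.
move=> x t t1t; have t0 : 0 < t by exact: lt_le_trans t1t.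
have tn0 : t != 0 by rewrite gt_eqF.
apply: HC; first exact: smooth_gauss_pull.
move=> j jn y _; rewrite derive1n_affine//; last exact: smooth_gauss.
have ti0 : 0 <= t^-1 by rewrite invr_ge0 ltW.
rewrite normrM (ger0_norm (x := t^-1 ^+ j)) ?exprn_ge0// derive1n_gaussE.
apply: le_trans (HB j jn ((y - x) / t)).
rewrite ler_wpM2r// lerXn2r// ?nnegrE ?invr_ge0 ?(ltW t10)//.
by rewrite lef_pV2// posrE.
Qed.

Lemma cfun_gauss_dilation p x t : 0 < t ->
  is_derive t 1 (fun t => T (fun y => gauss p ((y - x) / t)))
   (t^-1 * T (fun y => gauss (euler 0 p) ((y - x) / t))).
Proof.
move=> t0; have tn0 : t != 0 by rewrite gt_eqF.
have s0 := smooth_gauss_pull (euler 0 p) x t tn0.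
rewrite -(cfunZ cT _ s0).
have t2 : 0 < t / 2 by rewrite divr_gt0.
have pos h : `|h| < t / 2 -> t / 2 <= t + h.
  by rewrite ltr_norml => /andP[h1 h2]; lra.
have posn h : `|h| < t / 2 -> t + h != 0.
  by move=> /pos H; rewrite gt_eqF// (lt_le_trans t2).
apply: (cfun_derive cT t2).
- by move=> h /posn; exact: smooth_gauss_pull.
- exact: smoothZ.
move=> j r; have [B B0 HB] := gauss_bounded (euler j.+1 (euler j (iter j dgauss p))).
exists ((t / 2)^-1 ^+ j.+2 * B) => h y hd _.
have th0 := posn h hd.
rewrite (derive1n_affine x j th0 (@smooth_gauss R p)) (derive1n_affine x j tn0 (@smooth_gauss R p)).
rewrite (derive1nZ _ j s0) (derive1n_affine x j tn0 (@smooth_gauss R _)).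
rewrite !derive1n_gaussE iter_dgauss_euler (mulrA (t^-1)) -exprS.
set q := iter j dgauss p.
apply: (@taylor_bound R (fun s => s^-1 ^+ j * gauss q ((y - x) / s))
  (fun s => s^-1 ^+ j.+1 * gauss (euler j q) ((y - x) / s))
  (fun s => s^-1 ^+ j.+2 * gauss (euler j.+1 (euler j q)) ((y - x) / s)) (t / 2) (t + `|h|)).
- move=> s /andP[s1 _]; apply: is_derive_gauss_dilation.
  by rewrite gt_eqF// (lt_le_trans t2).
- move=> s /andP[s1 _]; apply: is_derive_gauss_dilation.
  by rewrite gt_eqF// (lt_le_trans t2).
- move=> s /andP[s1 _]; have sp : 0 < s by exact: lt_le_trans s1.
  have si : 0 <= s^-1 by rewrite invr_ge0 ltW.
  rewrite normrM (ger0_norm (x := s^-1 ^+ j.+2)) ?exprn_ge0//.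
  rewrite ler_pM ?exprn_ge0//.
  rewrite lerXn2r ?nnegrE ?invr_ge0 ?(ltW t2) ?(ltW sp)//.
  by rewrite lef_pV2 ?posrE.
- by rewrite lerDl normr_ge0 andbT; lra.
- by rewrite pos// lerD2l ler_norm.
Qed.

(** Time is the width of the kernel: in the variable t^2 / 2 the equation is the standard one.
    Without normalisation the values are sqrt(2 pi) times the averages. *)
Definition heat x t := t^-1 * T (fun y => gauss 1 ((y - x) / t)).

Definition heat_x x t := t^-1 * (- t^-1 * T (fun y => gauss (dgauss 1) ((y - x) / t))).

Definition heat_xx x t := t^-1 * (- t^-1 * (- t^-1 * T (fun y => gauss (dgauss (dgauss 1)) ((y - x) / t)))).

Lemma is_derive_gauss_translation p x t : t != 0 ->
  is_derive x 1 (fun x => T (fun y => gauss p ((y - x) / t)))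
    (- t^-1 * T (fun y => gauss (dgauss p) ((y - x) / t))).
Proof.
by move=> t0; have := @cfun_translation R T cT (gauss p) t x (bsmooth_gauss p) t0; rewrite derive1_gauss.
Qed.

Lemma is_derive_heat_x x t : t != 0 -> is_derive x 1 (heat^~ t) (heat_x x t).
Proof. by move=> t0; apply: is_deriveZ_fun; exact: is_derive_gauss_translation. Qed.

Lemma is_derive_heat_xx x t : t != 0 -> is_derive x 1 (heat_x^~ t) (heat_xx x t).
Proof. by move=> t0; do 2 apply: is_deriveZ_fun; exact: is_derive_gauss_translation. Qed.

Lemma is_derive_heat_t x t : 0 < t -> is_derive t 1 (heat x) (t * heat_xx x t).
Proof.
move=> t0; have tn0 : t != 0 by rewrite gt_eqF.
have Di : is_derive t 1 (fun z : R => z^-1) (- 1 * (t^-1 * t^-1)).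
  by apply: (@is_deriveV_fun _ id).
have H := is_deriveM_fun Di (cfun_gauss_dilation 1 x t0).
apply: is_derive_eq H _.
(* This identity is the heat equation: both sides are X^2, and the summand 1 cancels the derivative
   of the prefactor t^-1. *)
have e0 : euler 0 1 = dgauss (dgauss 1) + 1 :> {poly R}.
  by rewrite /euler /dgauss mulr0n add0r derivC !mulr1 derivB derivC derivX; ring.
have sg := smooth_gauss_pull (dgauss (dgauss 1)) x t tn0; have s1 := smooth_gauss_pull 1 x t tn0.
rewrite /heat_xx e0.
have -> : T (fun y => gauss (dgauss (dgauss 1) + 1) ((y - x) / t)) =
   T (fun y => gauss (dgauss (dgauss 1)) ((y - x) / t)) + T (fun y => gauss 1 ((y - x) / t)).
  by rewrite -(cfunD cT sg s1); congr T; apply/funext => y; rewrite gaussD.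
by field.
Qed.

Lemma heat_lipschitz t1 t0 : 0 < t1 -> exists2 L, 0 < L &
  (forall x y t, t1 <= t -> `|heat x t - heat y t| <= L * `|x - y|) /\
  (forall x s t, t1 <= s <= t0 -> t1 <= t <= t0 -> `|heat x s - heat x t| <= L * `|s - t|).
Proof.
move=> t10.
have [L1 L10 H1] := cfun_gauss_bound (dgauss 1) t10.
have [L2 L20 H2] := cfun_gauss_bound (dgauss (dgauss 1)) t10.
have ti : 0 <= t1^-1 by rewrite invr_ge0 ltW.
have inv t : t1 <= t -> [/\ 0 < t, 0 <= t^-1 & t^-1 <= t1^-1].
  move=> tt; have t0' : 0 < t by exact: lt_le_trans tt.
  by split => //; [rewrite invr_ge0 ltW|rewrite lef_pV2 ?posrE].
pose A := t1^-1 * t1^-1 * L1; pose B := t1^-1 * t1^-1 * L2.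
have A0 : 0 <= A by rewrite !mulr_ge0// ltW.
have B0 : 0 <= B by rewrite !mulr_ge0// ltW.
exists (A + B + 1); first by lra.
split.
  move=> x y t tt; have [t0' ti0 tit] := inv t tt.
  have tn0 : t != 0 by rewrite gt_eqF.
  apply: (@le_trans _ _ (A * `|x - y|)); last by rewrite ler_wpM2r//; lra.
  pose m := Num.min x y; pose M := Num.max x y.
  apply: (@mean_value_bound R (heat^~ t) (heat_x^~ t) m M).
  - by move=> z _; exact: is_derive_heat_x.
  - move=> z _; rewrite /heat_x mulrA mulrN mulNr normrN normrM (ger0_norm (mulr_ge0 ti0 ti0)).
    by apply: ler_pM; rewrite ?mulr_ge0//; [exact: ler_pM|exact: H1].
  - by rewrite /m /M ge_min le_max lexx !orbT.
  - by rewrite /m /M ge_min le_max lexx.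
move=> x s t sI tI.
apply: (@le_trans _ _ (B * `|s - t|)); last by rewrite ler_wpM2r//; lra.
apply: (@mean_value_bound R (heat x) (fun t => t * heat_xx x t) t1 t0) => //.
- move=> z /andP[z1 _]; apply: is_derive_heat_t; exact: lt_le_trans z1.
- move=> z /andP[z1 _]; have [z0 zi0 zit] := inv z z1.
  have -> : z * heat_xx x z = z^-1 * z^-1 * T (fun y => gauss (dgauss (dgauss 1)) ((y - x) / z)).
    by rewrite /heat_xx; field; rewrite gt_eqF.
  rewrite normrM (ger0_norm (mulr_ge0 zi0 zi0)).
  by apply: ler_pM; rewrite ?mulr_ge0//; [exact: ler_pM|exact: H2].
Qed.

(** The term k' (t - t1) makes the differential inequality strict, and k' = k / (t0 - t1) keeps it
    at most k, which is arbitrary. *)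
Theorem heat_min_principle c d t1 t0 e : c < d -> 0 < t1 -> t1 < t0 ->
  (forall t, t1 <= t <= t0 -> - e <= heat c t) -> (forall t, t1 <= t <= t0 -> - e <= heat d t) ->
  (forall x, c <= x <= d -> - e <= heat x t1) ->
  forall x t, c <= x <= d -> t1 <= t <= t0 -> - e <= heat x t.
Proof.
move=> cd t10 tt wc wd bot x t xcd tI.
have [L L0 [Lx Lt]] := heat_lipschitz t0 t10.
apply/ler_addgt0Pr => k k0.
pose k' := k / (t0 - t1); have tt0 : 0 < t0 - t1 by lra.
have k'0 : 0 < k' by rewrite divr_gt0.
pose v x t := heat x t + (e + k' * (t - t1)).
have pt s : t1 < s <= t0 -> 0 < s /\ s != 0.
  by move=> /andP[s1 _]; have s0 := lt_trans t10 s1; rewrite gt_eqF.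
have kt s : t1 <= s -> 0 <= k' * (s - t1) by move=> ss; rewrite mulr_ge0 ?(ltW k'0)// subr_ge0.
have := @heat_minimum R v heat_x heat_xx (fun x t => t * heat_xx x t + k') c d t1 t0 (L + k') cd tt.
have D1 : forall y s, c < y < d -> t1 < s <= t0 -> is_derive y 1 (v^~ s) (heat_x y s).
  move=> y s _ /pt[_ sn0]; rewrite -[heat_x y s]addr0.
  by apply: is_deriveD_fun; exact: is_derive_heat_x.
have D2 : forall y s, c < y < d -> t1 < s <= t0 -> is_derive y 1 (heat_x^~ s) (heat_xx y s).
  by move=> y s _ /pt[_ sn0]; exact: is_derive_heat_xx.
have D3 : forall y s, c < y < d -> t1 < s <= t0 -> is_derive s 1 (v y) (s * heat_xx y s + k').
  move=> y s _ /pt[s0 _]; apply: is_deriveD_fun; first exact: is_derive_heat_t.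
  have D4 : is_derive s 1 (fun z => e + k' * (z - t1)) (0 + k' * (1 - 0)).
    by apply: is_deriveD_fun; apply: is_deriveZ_fun; apply: is_deriveB_fun; exact: is_derive_id.
  by apply: is_derive_eq D4 _; ring.
move=> /(_ D1 D2 D3) H.
have : 0 <= v x t.
  apply: H => //.
  - by move=> y s _ _; lra.
  - exact: ltW.
  - move=> y z s _ _ /andP[s1 _]; rewrite /v.
    have -> : heat y s + (e + k' * (s - t1)) - (heat z s + (e + k' * (s - t1))) = heat y s - heat z s by ring.
    by rewrite (le_trans (Lx y z s s1))// ler_wpM2r// lerDl ltW.
  - move=> y s s' _ sI sI'; rewrite /v.
    have -> : heat y s + (e + k' * (s - t1)) - (heat y s' + (e + k' * (s' - t1))) =
      (heat y s - heat y s') + k' * (s - s') by ring.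
    rewrite (le_trans (ler_normD _ _))// mulrDl lerD//; first exact: Lt.
    by rewrite normrM (gtr0_norm k'0).
  - by move=> s sI; have := wc s sI; have := kt s (andP sI).1; rewrite /v; lra.
  - by move=> s sI; have := wd s sI; have := kt s (andP sI).1; rewrite /v; lra.
  - by move=> y ycd; have := bot y ycd; rewrite /v subrr mulr0; lra.
have : k' * (t - t1) <= k.
  have /andP[_ tt'] := tI.
  by rewrite /k' mulrAC ler_pdivrMr// ler_wpM2l ?(ltW k0)//; lra.
by rewrite /v; lra.
Qed.

End extension.

(** Point evaluations are the sources of the barrier: adding one to T adds a Gaussian centred at z
    to [heat], and the minimum principle continues to apply. *)
Lemma cfun_eval T a z : cfun T -> cfun (fun f => T f + a * f z).
Proof.
move=> cT; split=> [k f g sf sg|]; first by rewrite (cfun_lin cT)//; ring.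
have [_ [C [r [n [C0 r0 HC]]]]] := cT.
exists (C + `|a|), (r + `|z|), n; split; [by rewrite ltr_pwDl|by rewrite ltr_pwDl|].
move=> f M sf HM.
have zz : - (r + `|z|) <= z <= r + `|z|.
  by have := lexx `|z|; rewrite {1}ler_norml => /andP[]; lra.
rewrite (le_trans (ler_normD _ _))// mulrDl lerD//.
  by apply: HC => // j jn x xr; apply: HM => //; have := normr_ge0 z; lra.
by rewrite normrM ler_wpM2l//; exact: (HM 0%N).
Qed.

Lemma heat_eval T a z x t : heat (fun f => T f + a * f z) x t = heat T x t + a * (t^-1 * gauss 1 ((z - x) / t)).
Proof. by rewrite /heat; ring. Qed.

End HeatExtension.

(** * Lower bound in a gap as the time tends to 0 *)

Section HeatGap.
Variable R : realType.
Implicit Types (f g F B psi phi : R -> R) (x y z s t l r a b c d h e : R) (p q : {poly R})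
  (T : (R -> R) -> R).

Lemma gauss1E x : gauss 1 x = expR (- (2^-1 * (x * x))).
Proof. by rewrite /gauss hornerC mul1r. Qed.

Lemma gauss1_le x y : x * x <= y * y -> gauss 1 y <= gauss 1 x.
Proof. by move=> xy; rewrite !gauss1E ler_expR lerN2 ler_wpM2l// invr_ge0. Qed.

Lemma gauss1_le1 x : gauss 1 x <= 1.
Proof. by rewrite gauss1E -expR0 ler_expR lerNl oppr0 mulr_ge0 ?invr_ge0// -expr2 sqr_ge0. Qed.

Lemma gauss1N x : gauss 1 (- x) = gauss 1 x.
Proof. by rewrite !gauss1E mulrNN. Qed.

(** The number sqrt e, the largest loss in [gauss1_factor]. *)
Definition gauss_mass : R := expR 2^-1.

Lemma gauss_mass_gt0 : 0 < gauss_mass. Proof. exact: expR_gt0. Qed.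

(* Only the part of the kernel at distance h from its center x is seen by T. *)
Lemma far_pull T F phi a b h e : cfun T -> smooth F -> smooth phi ->
  (forall (j : nat) k, 0 < k -> exists2 t1, 0 < t1 & forall t x, 0 < t -> t < t1 -> h <= `|x| ->
     t^-1 ^+ j.+1 * `|derive1n j phi (x / t)| <= k) ->
  (forall y, a < y < b -> F y = 0) -> 0 < e ->
  exists2 t1, 0 < t1 & forall x t, a + h <= x <= b - h -> 0 < t -> t < t1 ->
    `|t^-1 * T (fun y => F y * phi ((y - x) / t))| <= e.
Proof.
move=> [_ [C [r [n [C0 r0 HC]]]]] sF sphi tail F0 e0.
have [|M M0 HM] := @unif_nat R (fun j M => forall y, - r <= y <= r -> `|derive1n j F y| <= M) n
   (fun j (A B : R) AB H y yr => le_trans (H y yr) AB).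
  move=> j; have [M M0 HM] := continuous_bounded (- r) r (smooth_continuous (@smooth_derive1n R F j sF)).
  by exists M.
have D0 : 0 < C * (2 ^+ n * M) by rewrite !mulr_gt0// exprn_gt0.
have [e' e'0 eE] : exists2 e', 0 < e' & forall t, t * e = C * (2 ^+ n * (M * (t * e'))).
  exists (e / (C * (2 ^+ n * M))); first exact: divr_gt0.
  move=> t; move: D0; set k := 2 ^+ n => D0.
  by rewrite -{1}(mulfK (lt0r_neq0 D0) e); ring.
have [||A A0 HA] := @unif_nat R (fun j A => forall t z, 0 < t -> A < t^-1 -> h <= `|z| ->
    t^-1 ^+ j.+1 * `|derive1n j phi (z / t)| <= e') n.
- by move=> j A B AB H t z t0 tB; apply: H => //; exact: le_lt_trans tB.
- move=> j; have [t1 t10 Ht] := tail j _ e'0.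
  exists t1^-1 => t z t0; rewrite ltf_pV2 ?posrE// => tt hz.
  exact: Ht.
exists A^-1; rewrite ?invr_gt0// => x t xab t0 tA.
have tn0 : t != 0 by rewrite gt_eqF.
have At : A < t^-1 by rewrite -(invrK A) ltf_pV2 ?posrE ?invr_gt0.
have sg : smooth (fun y => phi ((y - x) / t)) by exact: smooth_affine_comp.
rewrite normrM ger0_norm ?invr_ge0 ?(ltW t0)// ler_pdivrMl// eE.
have te0 : 0 <= t * e' by rewrite mulr_ge0// ltW.
apply: HC; first exact: smoothM.
move=> j jn y yr.
have [yab|yab] := boolP (a < y < b).
  rewrite (@derive1n_open _ [set z | a < z < b] _ (fun=> 0) j)//=.
  - by rewrite derive1n_cst0 normr0 mulr_ge0 ?exprn_ge0// mulr_ge0// ltW.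
  - have -> : [set z | a < z < b] = `]a, b[%classic by apply/seteqP; split => z /=; rewrite in_itv.
    exact: interval_open.
  - by move=> z /= zab; rewrite F0// mul0r.
apply: (@le_trans _ _ (2 ^+ j * (M * (t * e')))); last first.
  by apply: ler_wpM2r; [rewrite mulr_ge0// ltW|rewrite ler_weXn2l// ler1n].
apply: leibniz_bound => // i ij; first by apply: HM => //; exact: leq_trans ij jn.
rewrite (derive1n_affine x i tn0 sphi).
have hy : h <= `|y - x|.
  move: yab; rewrite negb_and -!leNgt ler_normr => /orP[ya|by_]; apply/orP; [right|left]; lra.
have := HA i (leq_trans ij jn) t (y - x) t0 At hy.
rewrite exprS -mulrA ler_pdivrMl// (normrM (t^-1 ^+ i)).
by rewrite (ger0_norm (x := t^-1 ^+ i)) ?exprn_ge0 ?invr_ge0 ?(ltW t0).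
Qed.

Lemma far_heat T F a b h e : cfun T -> smooth F -> (forall y, a < y < b -> F y = 0) ->
  0 < h -> 0 < e ->
  exists2 t1, 0 < t1 & forall x t, a + h <= x <= b - h -> 0 < t -> t < t1 ->
    `|t^-1 * T (fun y => F y * gauss 1 ((y - x) / t))| <= e.
Proof.
move=> cT sF F0 h0 e0; apply: far_pull => //; first exact: smooth_gauss.
by move=> j k k0; rewrite derive1n_gaussE; exact: gauss_tail.
Qed.

(** Expanding (y - x)^2 about z, the cross term adds (x - z) (y - z) / t^2 <= 1 / 2 to the exponent.
    So near a wall z the kernel centred at x is at most sqrt e times its value at z. *)
Lemma gauss1_factor x y z t : 0 < t -> (x - z) * (y - z) <= t * t / 2 ->
  gauss 1 ((y - x) / t) <= gauss_mass * (gauss 1 ((x - z) / t) * gauss 1 ((y - z) / t)).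
Proof.
move=> t0 H; rewrite !gauss1E /gauss_mass -!expRD ler_expR.
have t2 : 0 < t * t by rewrite mulr_gt0.
rewrite -(ler_pM2r t2).
have -> : - (2^-1 * ((y - x) / t * ((y - x) / t))) * (t * t) = - (2^-1 * ((y - x) * (y - x))).
  by field; rewrite gt_eqF.
have -> : (2^-1 + (- (2^-1 * ((x - z) / t * ((x - z) / t))) + - (2^-1 * ((y - z) / t * ((y - z) / t)))))
   * (t * t) = t * t / 2 - 2^-1 * ((x - z) * (x - z)) - 2^-1 * ((y - z) * (y - z)).
  by field; rewrite gt_eqF.
have -> : (y - x) * (y - x) = (y - z) * (y - z) + (x - z) * (x - z) - 2 * ((x - z) * (y - z)) by ring.
lra.
Qed.

Lemma derive1_gauss_pull x t y : t != 0 ->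
  derive1 (fun y => gauss 1 ((y - x) / t)) y = t^-1 * (t^-1 * (x - y)) * gauss 1 ((y - x) / t).
Proof.
move=> t0; have H := is_derive_affine t0 (is_derive_gauss 1 ((y - x) / t)).
have -> := is_derive_derive1 H.
by rewrite /gauss derivC sub0r mulr1 hornerN hornerX hornerC; ring.
Qed.

Definition ramp m l y : R := step ((y - m) / l).

Lemma smooth_ramp m l : 0 < l -> smooth (ramp m l).
Proof. by move=> /(smooth01_step m)[]. Qed.

Lemma ramp01 m l y : 0 <= ramp m l y <= 1.
Proof. by rewrite /ramp step_ge0 step_le1. Qed.

Lemma ramp0 m l y : 0 < l -> y <= m - l -> ramp m l y = 0.
Proof. by move=> l0 H; apply: step0; rewrite ler_pdivrMr//; lra. Qed.

Lemma ramp1 m l y : 0 < l -> m + l <= y -> ramp m l y = 1.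
Proof. by move=> l0 H; apply: step1; rewrite ler_pdivlMr//; lra. Qed.

Lemma derive1_ramp m l y : 0 < l -> derive1 (ramp m l) y = l^-1 * stepD ((y - m) / l).
Proof.
move=> l0; apply: is_derive_derive1; apply: is_derive_affine; first by rewrite gt_eqF.
exact/smooth_is_derive/smooth_step.
Qed.

Lemma ramp_derive_ge0 m l y : 0 < l -> 0 <= derive1 (ramp m l) y.
Proof. by move=> l0; rewrite derive1_ramp// mulr_ge0 ?stepD_ge0// invr_ge0 ltW. Qed.

Lemma ramp_derive_supp m l : 0 < l -> supp_in (m - l) (m + l) (derive1 (ramp m l)).
Proof.
move=> l0 y H; rewrite derive1_ramp// stepD_supp ?mulr0//.
by rewrite ltr_pdivrMr// ltr_pdivlMr//; case/orP: H => H; apply/orP; [left|right]; lra.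
Qed.

Section gap.
(** The setting of one gap ]c, d[ of the bad set, inside a slightly larger window. By [bW], W acts
    on the window like a function bounded by N; together with [TW] this is all that controls T at
    the ends c and d. *)
Variables (T : (R -> R) -> R) (W : Defs.distribution R) (c0 c d d0 N : R).
Hypotheses (cT : cfun T) (c0c : c0 < c) (cd : c < d) (dd0 : d < d0) (N0 : 0 <= N)
  (TW : forall f, smooth f -> supp_in c0 d0 f -> T f = - W (derive1 f))
  (bW : forall B, smooth B -> (forall x, 0 <= B x) -> supp_in c0 d0 B ->
     `|W B| <= N * integral_cc c0 d0 B)
  (pT : forall B a b, c < a -> b < d -> smooth B -> (forall x, 0 <= B x) -> supp_in a b B -> 0 <= T B).

Let c0d0 : c0 <= d0. Proof. exact: ltW (lt_trans c0c (lt_trans cd dd0)). Qed.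

(* The sign sg is that of the derivative of k on the support of P - Q, up to an
   error controlled by eta. *)
Lemma primitive_bound (P Q k : R -> R) (KP KQ sg eta : R) :
  smooth P -> smooth Q -> smooth k -> (forall y, 0 <= derive1 P y) -> (forall y, 0 <= derive1 Q y) ->
  (forall y, 0 <= P y <= 1) -> (forall y, 0 <= Q y <= 1) -> (forall y, Q y <= P y) ->
  supp_in c0 d0 (derive1 P) -> supp_in c0 d0 (derive1 Q) -> supp_in c0 d0 (fun y => P y - Q y) ->
  P c0 = Q c0 -> P d0 = Q d0 ->
  (forall y, 0 <= k y <= 1) -> 0 <= KP -> 0 <= KQ -> 0 <= eta -> sg * sg = 1 -> `|sg| = 1 ->
  (forall y, derive1 P y != 0 -> k y <= KP) -> (forall y, derive1 Q y != 0 -> k y <= KQ) ->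
  (forall y, P y - Q y != 0 -> 0 <= sg * derive1 k y + eta * k y) ->
  `|T (fun y => (P y - Q y) * k y)| <= 2 * N * (KP + KQ + eta * (d0 - c0)).
Proof.
move=> sP sQ sk P'0 Q'0 P01 Q01 QP suP suQ suL Pc Pd k01 KP0 KQ0 eta0 sg2 sg1 HP HQ Hk.
have k0 y : 0 <= k y by have /andP[] := k01 y.
have sP' := smooth_derive1 sP; have sQ' := smooth_derive1 sQ; have sk' := smooth_derive1 sk.
pose L y := P y - Q y.
have sL : smooth L by exact: smoothB.
have L0 y : 0 <= L y by rewrite subr_ge0.
have sPk : smooth (fun y => derive1 P y * k y) by exact: (@smoothM R _ k sP' sk).
have sQk : smooth (fun y => derive1 Q y * k y) by exact: (@smoothM R _ k sQ' sk).
have sLk : smooth (fun y => L y * k y) by exact: (@smoothM R L k sL sk).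
have sLk' : smooth (fun y => L y * derive1 k y) by exact: (@smoothM R L _ sL sk').
have suPk : supp_in c0 d0 (fun y => derive1 P y * k y) by move=> y /suP ->; rewrite mul0r.
have suQk : supp_in c0 d0 (fun y => derive1 Q y * k y) by move=> y /suQ ->; rewrite mul0r.
have suLk : supp_in c0 d0 (fun y => L y * k y) by move=> y /suL; rewrite /L => ->; rewrite mul0r.
have suLk' : supp_in c0 d0 (fun y => L y * derive1 k y) by move=> y /suL; rewrite /L => ->; rewrite mul0r.
have sZ (a : R) f : smooth f -> smooth (fun y => a * f y) by exact: smoothZ.
have suZ (a : R) f : supp_in c0 d0 f -> supp_in c0 d0 (fun y => a * f y) by move=> H y /H ->; rewrite mulr0.
have WZ (a : R) f : smooth f -> supp_in c0 d0 f -> W (fun y => a * f y) = a * W f.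
  move=> sf suf; have sf0 : smooth (fun=> 0 : R) by exact: smooth_cst.
  have := @distributionZD R W a f (fun=> 0) c0 d0 sf sf0 suf (fun _ _ => erefl).
  by rewrite [W (fun=> 0)]distribution0// addr0 => <-; congr (W _); apply/funext => y; rewrite addr0.
have dL y : derive1 L y = derive1 P y - derive1 Q y.
  apply: is_derive_derive1; apply: is_deriveB_fun; exact: smooth_is_derive.
have dLk y : derive1 (fun y => L y * k y) y = (derive1 P y * k y - derive1 Q y * k y) + L y * derive1 k y.
  apply: is_derive_derive1; rewrite -mulrBl -dL.
  by apply: is_deriveM_fun; exact: smooth_is_derive.
have mass (F : R -> R) : smooth F -> (forall y, 0 <= F y <= 1) -> integral_cc c0 d0 (derive1 F) <= 1.
  move=> sF F01; rewrite (@integral_cc_derive R c0 d0 F _ (smooth_continuous (smooth_derive1 sF)) c0d0 (fun y => smooth_is_derive y sF)).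
  by have /andP[_ h1] := F01 d0; have /andP[h2 _] := F01 c0; lra.
have massk (F : R -> R) K : smooth F -> (forall y, 0 <= F y <= 1) -> (forall y, 0 <= derive1 F y) -> 0 <= K ->
    (forall y, derive1 F y != 0 -> k y <= K) ->
    integral_cc c0 d0 (fun y => derive1 F y * k y) <= K.
  move=> sF F01 F'0 K0 HK; have sF' := smooth_derive1 sF.
  apply: (@le_trans _ _ (integral_cc c0 d0 (fun y => K * derive1 F y))).
    apply: integral_cc_le.
    - by apply: smooth_continuous; exact: (@smoothM R _ k sF' sk).
    - by apply: smooth_continuous; exact: sZ.
    - move=> y _; have [->|/HK h] := eqVneq (derive1 F y) 0; first by rewrite mul0r mulr0.
      by rewrite mulrC ler_wpM2r.
  rewrite integral_ccZ; last exact: smooth_continuous.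
  by rewrite ler_piMr// mass.
pose IP := integral_cc c0 d0 (fun y => derive1 P y * k y).
pose IQ := integral_cc c0 d0 (fun y => derive1 Q y * k y).
pose IL := integral_cc c0 d0 (fun y => L y * k y).
have IPb : IP <= KP by exact: massk.
have IQb : IQ <= KQ by exact: massk.
have ILb : IL <= d0 - c0.
  rewrite -[leRHS]mul1r -integral_cc_cst//; apply: integral_cc_le.
  - exact: smooth_continuous.
  - exact: cst_continuous.
  - move=> y _; have /andP[_ k1] := k01 y; have /andP[_ P1] := P01 y; have /andP[q0 _] := Q01 y.
    by rewrite /L -[leRHS]mulr1 ler_pM// /L ?L0//; lra.
have IP0 : 0 <= IP by apply: integral_cc_ge0 => [|y _]; [exact: smooth_continuous|rewrite mulr_ge0].
have IQ0 : 0 <= IQ by apply: integral_cc_ge0 => [|y _]; [exact: smooth_continuous|rewrite mulr_ge0].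
have Lc : L c0 = 0 by rewrite /L Pc subrr.
have Ld : L d0 = 0 by rewrite /L Pd subrr.
have IL0 : 0 <= IL by apply: integral_cc_ge0 => [|y _]; [exact: smooth_continuous|rewrite mulr_ge0].
have parts : integral_cc c0 d0 (fun y => L y * derive1 k y) = IQ - IP.
  rewrite (@integral_cc_parts R c0 d0 L k _ _ c0d0 (smooth_continuous (smooth_derive1 sL))
    (smooth_continuous sk') (fun y => smooth_is_derive y sL) (fun y => smooth_is_derive y sk)).
  rewrite Lc Ld !mul0r subrr sub0r.
  rewrite (@integral_cc_eq R _ _ _ (fun y => derive1 P y * k y - derive1 Q y * k y)).
    by rewrite integral_ccB ?opprB//; exact: smooth_continuous.
  by move=> y _; rewrite -/(derive1 L y) dL mulrBl.
(* L k' may change sign, but the correction by eta L k makes B nonnegative, so [bW] bounds W B by N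
   times the integral of B. Integration by parts expresses the integral of L k' by those of P' k and
   Q' k. *)
pose B y := sg * (L y * derive1 k y) + eta * (L y * k y).
have sB : smooth B by exact: (@smoothD R _ _ (sZ sg _ sLk') (sZ eta _ sLk)).
have suB : supp_in c0 d0 B by move=> y yo; rewrite /B suLk'// suLk// !mulr0 addr0.
have B0 y : 0 <= B y.
  rewrite /B mulrCA (mulrCA eta) -mulrDr.
  by have [->|/Hk h] := eqVneq (L y) 0; [rewrite mul0r|rewrite mulr_ge0].
have IB : integral_cc c0 d0 B = sg * (IQ - IP) + eta * IL.
  rewrite /B integral_ccD; [|by apply: smooth_continuous; exact: sZ|by apply: smooth_continuous; exact: sZ].
  by rewrite !integral_ccZ ?parts//; exact: smooth_continuous.
have WB := bW sB B0 suB.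
have WLk : `|W (fun y => L y * k y)| <= N * IL.
  by apply: bW => // y; rewrite mulr_ge0.
have WPk : `|W (fun y => derive1 P y * k y)| <= N * IP by apply: bW => // y; rewrite mulr_ge0.
have WQk : `|W (fun y => derive1 Q y * k y)| <= N * IQ by apply: bW => // y; rewrite mulr_ge0.
clearbody IP IQ IL.
have WLk' : `|W (fun y => L y * derive1 k y)| <= N * (IP + IQ) + 2 * N * (eta * IL).
  have E : sg * W (fun y => L y * derive1 k y) = W B - eta * W (fun y => L y * k y).
    have := @distributionD R W _ _ c0 d0 (sZ sg _ sLk') (sZ eta _ sLk) (suZ sg _ suLk') (suZ eta _ suLk).
    by rewrite -/B => ->; rewrite !WZ// addrK.
  have -> : `|W (fun y => L y * derive1 k y)| = `|sg * W (fun y => L y * derive1 k y)| by rewrite normrM sg1 mul1r.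
  rewrite E (le_trans (ler_normB _ _))// normrM (ger0_norm eta0).
  have h1 : eta * `|W (fun y => L y * k y)| <= eta * (N * IL) by rewrite ler_wpM2l.
  have h2 : sg * (IQ - IP) <= IP + IQ.
    apply: le_trans (ler_norm _) _; rewrite normrM sg1 mul1r (le_trans (ler_normB _ _))//.
    by rewrite (ger0_norm IP0) (ger0_norm IQ0) addrC.
  have h3 : N * integral_cc c0 d0 B <= N * (IP + IQ + eta * IL).
    by rewrite ler_wpM2l// IB lerD2r.
  lra.
rewrite (TW sLk suLk) normrN.
have -> : derive1 (fun y => L y * k y) = fun y => (derive1 P y * k y - derive1 Q y * k y) + L y * derive1 k y.
  by apply/funext.
have sPQ : smooth (fun y => derive1 P y * k y - derive1 Q y * k y) by exact: (@smoothB R _ _ sPk sQk).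
have suPQ : supp_in c0 d0 (fun y => derive1 P y * k y - derive1 Q y * k y).
  by move=> y yo; rewrite suPk// suQk// subrr.
rewrite (@distributionD R W _ _ c0 d0 sPQ sLk' suPQ suLk') (@distributionB R W _ _ c0 d0 sPk sQk suPk suQk).
rewrite (le_trans (ler_normD _ _))// (le_trans (lerD (ler_normB _ _) (lexx _)))//.
have h1 : N * IP <= N * KP by rewrite ler_wpM2l.
have h2 : N * IQ <= N * KQ by rewrite ler_wpM2l.
have h3 : N * (eta * IL) <= N * (eta * (d0 - c0)) by rewrite !ler_wpM2l.
lra.
Qed.

Let A := 2 * N * gauss_mass.

Section walls.
Variables (x t h k K1 : R).
Hypotheses (xcd : c <= x <= d) (t0 : 0 < t) (h0 : 0 < h) (hc : 3 * h <= c - c0) (hd : 3 * h <= d0 - d)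
  (k0 : 0 < k) (k1 : 7 * k <= d - c) (k2 : 3 * k * (d - c) <= t * t / 2) (K10 : 0 <= K1)
  (far : forall y, h <= `|y - x| -> gauss 1 ((y - x) / t) <= K1).

Let g y := gauss 1 ((y - x) / t).

Let tn0 : t != 0. Proof. by rewrite gt_eqF. Qed.

Let sg : smooth g. Proof. exact: smooth_gauss_pull. Qed.

Let g01 y : 0 <= g y <= 1.
Proof. by rewrite gauss1_le1 andbT; apply: ltW; exact: gauss1_gt0. Qed.

Let eta_ge0 : 0 <= 3 * k / (t * t).
Proof. by rewrite divr_ge0 ?mulr_ge0// ltW. Qed.

Let near_z z y : (x - z) * (y - z) <= t * t / 2 -> g y <= gauss_mass * gauss 1 ((x - z) / t).
Proof. by move=> /(gauss1_factor t0) /le_trans; apply; rewrite mulrA ler_piMr ?gauss1_le1//;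
  apply: mulr_ge0; apply: ltW; [exact: gauss_mass_gt0|exact: gauss1_gt0]. Qed.

Let gm0 z : 0 <= gauss_mass * gauss 1 z.
Proof. by apply: mulr_ge0; apply: ltW; [exact: gauss_mass_gt0|exact: gauss1_gt0]. Qed.

Let dg (sgn : R) y : sgn * derive1 g y + 3 * k / (t * t) * g y = (sgn * (x - y) + 3 * k) / (t * t) * g y.
Proof. by rewrite derive1_gauss_pull//; rewrite /g; field. Qed.

Let not_in (a b y : R) f : supp_in a b f -> f y != 0 -> a <= y /\ y <= b.
Proof.
move=> su fy; apply/andP; apply: contraR fy; rewrite negb_and -!ltNge => /su ->; exact: eqxx.
Qed.

Let cx : c <= x. Proof. by have /andP[] := xcd. Qed.
Let xd : x <= d. Proof. by have /andP[] := xcd. Qed.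

(** The cut-off equals 1 around c. It rises at distance at least h to the left of c, where the
    kernel is at most K1, and falls within 3k to the right of c, where by [gauss1_factor] the kernel
    is at most sqrt e times its value at c. On its support x - y >= - 3k, whence the correction 3k /
    t^2. *)
Lemma wall_left : `|T (fun y => (ramp (c - 2 * h) h y - ramp (c + 2 * k) k y) * g y)| <=
  2 * N * (K1 + gauss_mass * gauss 1 ((x - c) / t) + 3 * k / (t * t) * (d0 - c0)).
Proof.
have h1 : 3 * h <= c - c0 by []. have k1' : 7 * k <= d - c by [].
have h0' : 0 < h by []. have k0' : 0 < k by []. have dd := dd0.
have cx' := cx; have xd' := xd.
apply: (@primitive_bound (ramp (c - 2 * h) h) (ramp (c + 2 * k) k) g _ _ 1).
- exact: smooth_ramp.
- exact: smooth_ramp.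
- exact: sg.
- by move=> y; exact: ramp_derive_ge0.
- by move=> y; exact: ramp_derive_ge0.
- by move=> y; exact: ramp01.
- by move=> y; exact: ramp01.
- move=> y; have [yc|yc] := leP y c.
    by rewrite (ramp0 k0); [have /andP[] := ramp01 (c - 2 * h) h y|lra].
  by rewrite (ramp1 h0); [have /andP[] := ramp01 (c + 2 * k) k y|lra].
- by apply: supp_inW; [| |exact: (ramp_derive_supp h0)]; lra.
- by apply: supp_inW; [| |exact: (ramp_derive_supp k0)]; lra.
- move=> y /orP[H|H]; first by rewrite (ramp0 h0) ?(ramp0 k0) ?subrr//; lra.
  by rewrite (ramp1 h0) ?(ramp1 k0) ?subrr//; lra.
- by rewrite (ramp0 h0) ?(ramp0 k0)//; lra.
- by rewrite (ramp1 h0) ?(ramp1 k0)//; lra.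
- exact: g01.
- exact: K10.
- exact: gm0.
- exact: eta_ge0.
- by rewrite mulr1.
- by rewrite normr1.
- move=> y /(not_in (ramp_derive_supp h0))[y1 y2]; apply: far.
  by rewrite ler_normr; apply/orP; right; lra.
- move=> y /(not_in (ramp_derive_supp k0))[y1 y2]; apply: near_z; apply: le_trans k2.
  by rewrite mulrC; apply: ler_pM; lra.
- move=> y Ly; rewrite dg; apply: mulr_ge0; last by have /andP[] := g01 y.
  apply: divr_ge0; last by rewrite mulr_ge0// ltW.
  have : y <= c + 3 * k.
    by rewrite leNgt; apply: contra Ly => H; rewrite (ramp1 h0) ?(ramp1 k0) ?subrr//; lra.
  lra.
Qed.

Lemma wall_right : `|T (fun y => (ramp (d - 2 * k) k y - ramp (d + 2 * h) h y) * g y)| <=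
  2 * N * (gauss_mass * gauss 1 ((x - d) / t) + K1 + 3 * k / (t * t) * (d0 - c0)).
Proof.
have h1 : 3 * h <= d0 - d by []. have k1' : 7 * k <= d - c by [].
have h0' : 0 < h by []. have k0' : 0 < k by []. have cc := c0c.
have cx' := cx; have xd' := xd.
apply: (@primitive_bound (ramp (d - 2 * k) k) (ramp (d + 2 * h) h) g _ _ (-1)).
- exact: smooth_ramp.
- exact: smooth_ramp.
- exact: sg.
- by move=> y; exact: ramp_derive_ge0.
- by move=> y; exact: ramp_derive_ge0.
- by move=> y; exact: ramp01.
- by move=> y; exact: ramp01.
- move=> y; have [yc|yc] := leP y d.
    by rewrite (ramp0 h0); [have /andP[] := ramp01 (d - 2 * k) k y|lra].
  by rewrite (ramp1 k0); [have /andP[] := ramp01 (d + 2 * h) h y|lra].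
- by apply: supp_inW; [| |exact: (ramp_derive_supp k0)]; lra.
- by apply: supp_inW; [| |exact: (ramp_derive_supp h0)]; lra.
- move=> y /orP[H|H]; first by rewrite (ramp0 h0) ?(ramp0 k0) ?subrr//; lra.
  by rewrite (ramp1 h0) ?(ramp1 k0) ?subrr//; lra.
- by rewrite (ramp0 h0) ?(ramp0 k0)//; lra.
- by rewrite (ramp1 h0) ?(ramp1 k0)//; lra.
- exact: g01.
- exact: gm0.
- exact: K10.
- exact: eta_ge0.
- by rewrite mulrNN mulr1.
- by rewrite normrN1.
- move=> y /(not_in (ramp_derive_supp k0))[y1 y2]; apply: near_z; apply: le_trans k2.
  by rewrite mulrC -mulrNN; apply: ler_pM; lra.
- move=> y /(not_in (ramp_derive_supp h0))[y1 y2]; apply: far.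
  by rewrite ler_normr; apply/orP; left; lra.
- move=> y Ly; rewrite dg; apply: mulr_ge0; last by have /andP[] := g01 y.
  apply: divr_ge0; last by rewrite mulr_ge0// ltW.
  have : d - 3 * k <= y.
    by rewrite leNgt; apply: contra Ly => H; rewrite (ramp0 h0) ?(ramp0 k0) ?subrr//; lra.
  lra.
Qed.

End walls.

(** The constant 1 is split into a far part, two walls and an interior part. The far part costs e /
    2 for small t, each wall costs A times the Gaussian of its end plus e / 4, and the interior part
    is nonnegative. *)
Lemma heat_gap_bottom e : 0 < e -> exists2 t2, 0 < t2 & forall x t, c <= x <= d -> 0 < t -> t < t2 ->
  - (A * (t^-1 * gauss 1 ((x - c) / t))) - A * (t^-1 * gauss 1 ((x - d) / t)) - e <= heat T x t.
Proof.
move=> e0; have N0' := N0; have c0c' := c0c; have cd' := cd; have dd0' := dd0.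
pose h := Num.min (c - c0) (d0 - d) / 3.
have h0 : 0 < h by rewrite divr_gt0// lt_min !subr_gt0 c0c.
have hc : 3 * h <= c - c0 by rewrite /h mulrC divfK ?pnatr_eq0// ge_min lexx.
have hd : 3 * h <= d0 - d by rewrite /h mulrC divfK ?pnatr_eq0// ge_min lexx orbT.
clearbody h.
pose Zc := ramp (c - 2 * h) h; pose Zd := ramp (d + 2 * h) h.
have sZc : smooth Zc by exact: smooth_ramp.
have sZd : smooth Zd by exact: smooth_ramp.
have Zc0 y : y <= c - 3 * h -> Zc y = 0 by move=> H; apply: ramp0 => //; lra.
have Zc1 y : c - h <= y -> Zc y = 1 by move=> H; apply: ramp1 => //; lra.
have Zd0 y : y <= d + h -> Zd y = 0 by move=> H; apply: ramp0 => //; lra.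
have Zd1 y : d + 3 * h <= y -> Zd y = 1 by move=> H; apply: ramp1 => //; lra.
have s1Z : smooth (fun y => 1 - Zc y) by exact: (@smoothB R (fun=> 1) Zc (@smooth_cst R 1) sZc).
have sF : smooth (fun y => (1 - Zc y) + Zd y) by exact: (@smoothD R (fun y => 1 - Zc y) Zd s1Z sZd).
have e2 : 0 < e / 2 by rewrite divr_gt0.
have [|t2 t20 Ht2] := @far_heat T (fun y => (1 - Zc y) + Zd y) (c - h) (d + h) h (e / 2) cT sF _ h0 e2.
  by move=> y /andP[y1 y2]; rewrite Zc1 ?Zd0 ?subrr ?add0r// ltW.
have N1 : 0 < 16 * (N + 1) by lra.
have e1 : 0 < e / (16 * (N + 1)) by rewrite divr_gt0.
have [t3 t30 Ht3] := gauss_tail (1 : {poly R}) 1 h0 e1.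
exists (Num.min t2 t3); first by rewrite lt_min t20.
move=> x t xcd t0; rewrite lt_min => /andP[tt2 tt3]; have tn0 : t != 0 by rewrite gt_eqF.
have /andP[cx xd] := xcd.
pose D := d0 - c0; have D0 : 0 < D by rewrite /D; lra.
(* The three bounds keep the inner ramps apart, give the hypothesis of [gauss1_factor] on them, and
   make the term in [eta] at most e / 8 after division by t. So k shrinks with t, while h is
   fixed. *)
pose k := Num.min ((d - c) / 7) (Num.min (t * t / (6 * (d - c))) (e * (t * t * t) / (48 * (N + 1) * D))).
have dc0 : 0 < d - c by rewrite subr_gt0.
have tt0 : 0 < t * t by rewrite mulr_gt0.
have NN : 0 < N + 1 by lra.
have k0 : 0 < k by rewrite !lt_min !divr_gt0// !mulr_gt0.
have k1 : 7 * k <= d - c by rewrite mulrC -ler_pdivlMr// /k ge_min lexx.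
have k2 : 3 * k * (d - c) <= t * t / 2.
  have : k <= t * t / (6 * (d - c)) by rewrite /k !ge_min lexx orbT.
  rewrite ler_pdivlMr ?mulr_gt0//; lra.
have k3 : k <= e * (t * t * t) / (48 * (N + 1) * D) by rewrite /k !ge_min lexx !orbT.
clearbody k.
pose eta := 3 * k / (t * t).
have eta0 : 0 <= eta by rewrite divr_ge0 ?mulr_ge0// ltW.
have eta_small : t^-1 * (2 * N * (eta * D)) <= e / 8.
  apply: (@le_trans _ _ (t^-1 * (2 * (N + 1) * (eta * D)))).
    rewrite ler_wpM2l ?invr_ge0 ?(ltW t0)//; apply: ler_wpM2r; last lra.
    by rewrite mulr_ge0// ltW.
  have -> : t^-1 * (2 * (N + 1) * (eta * D)) = k * (6 * (N + 1) * D / (t * t * t)).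
    by rewrite /eta; field.
  have -> : e / 8 = e * (t * t * t) / (48 * (N + 1) * D) * (6 * (N + 1) * D / (t * t * t)).
    by field; rewrite tn0 !gt_eqF.
  by apply: ler_wpM2r => //; rewrite divr_ge0 ?mulr_ge0// ltW.
pose Sc := ramp (c + 2 * k) k; pose Sd := ramp (d - 2 * k) k.
have sSc : smooth Sc by exact: smooth_ramp.
have sSd : smooth Sd by exact: smooth_ramp.
have Sc0 y : y <= c + k -> Sc y = 0 by move=> H; apply: ramp0 => //; lra.
have Sc1 y : c + 3 * k <= y -> Sc y = 1 by move=> H; apply: ramp1 => //; lra.
have Sd0 y : y <= d - 3 * k -> Sd y = 0 by move=> H; apply: ramp0 => //; lra.
have Sd1 y : d - k <= y -> Sd y = 1 by move=> H; apply: ramp1 => //; lra.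
pose g y := gauss 1 ((y - x) / t).
have sg : smooth g by exact: smooth_gauss_pull.
have g01 y : 0 <= g y <= 1 by rewrite gauss1_le1 andbT; apply: ltW; exact: gauss1_gt0.
have g0 y : 0 <= g y by have /andP[] := g01 y.
have gfar y : h <= `|y - x| -> g y <= t * (e / (16 * (N + 1))).
  move=> H; have := Ht3 t (y - x) t0 tt3 H.
  by rewrite expr1 ler_pdivrMl// ger0_norm// g0.
have te0 : 0 <= t * (e / (16 * (N + 1))) by rewrite mulr_ge0// ltW.
have final KQ (X : R) : `|X| <= 2 * N * (t * (e / (16 * (N + 1))) + gauss_mass * KQ + eta * D) ->
    - (A * (t^-1 * KQ)) - e / 4 <= t^-1 * X.
  move=> HX; have HX' : - (2 * N * (t * (e / (16 * (N + 1))) + gauss_mass * KQ + eta * D)) <= X.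
    by move: HX; rewrite ler_norml => /andP[].
  have ti : 0 <= t^-1 by rewrite invr_ge0 ltW.
  apply: le_trans (ler_wpM2l ti HX').
  have -> : t^-1 * - (2 * N * (t * (e / (16 * (N + 1))) + gauss_mass * KQ + eta * D)) =
     - (A * (t^-1 * KQ)) - N / (N + 1) * (e / 8) - t^-1 * (2 * N * (eta * D)).
    by rewrite /A; field; rewrite tn0 gt_eqF.
  have : N / (N + 1) * (e / 8) <= 1 * (e / 8).
    by apply: ler_wpM2r; [rewrite divr_ge0// ltW|rewrite ler_pdivrMr// mul1r; lra].
  lra.
have [boundL boundR] :
  - (A * (t^-1 * gauss 1 ((x - c) / t))) - e / 4 <= t^-1 * T (fun y => (Zc y - Sc y) * g y) /\
  - (A * (t^-1 * gauss 1 ((x - d) / t))) - e / 4 <= t^-1 * T (fun y => (Sd y - Zd y) * g y).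
  by split; apply: final; [exact: wall_left|rewrite (addrC (t * _)); exact: wall_right].
pose Th y := Sc y - Sd y.
have sTh : smooth Th by exact: (@smoothB R Sc Sd sSc sSd).
have sT : smooth (fun y => Th y * g y) by exact: (@smoothM R Th g).
have boundT : 0 <= T (fun y => Th y * g y).
  apply: (@pT (fun y => Th y * g y) (c + k) (d - k)).
  - by rewrite ltrDl.
  - by rewrite gtrBl.
  - exact: sT.
  - move=> y; apply: mulr_ge0 => //; rewrite /Th subr_ge0.
    have [yc|yc] := leP y (c + 3 * k); first by rewrite Sd0; [have /andP[] := ramp01 (c + 2 * k) k y|lra].
    by rewrite Sc1; [have /andP[] := ramp01 (d - 2 * k) k y|lra].
  - move=> y /orP[H|H]; rewrite /Th; first by rewrite Sc0 ?Sd0 ?subrr ?mul0r//; lra.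
    by rewrite Sc1 ?Sd1 ?subrr ?mul0r//; lra.
have tp : 0 <= t^-1 * T (fun y => Th y * g y) by rewrite mulr_ge0// invr_ge0 ltW.
have xI : c - h + h <= x <= d + h - h by rewrite subrK addrK.
have := Ht2 x t xI t0 tt2; rewrite ler_norml => /andP[far _].
have sL : smooth (fun y => (Zc y - Sc y) * g y) by exact: (@smoothM R (fun y => Zc y - Sc y) g (@smoothB R Zc Sc sZc sSc) sg).
have sR : smooth (fun y => (Sd y - Zd y) * g y) by exact: (@smoothM R (fun y => Sd y - Zd y) g (@smoothB R Sd Zd sSd sZd) sg).
have sFg : smooth (fun y => (1 - Zc y + Zd y) * g y) by exact: (@smoothM R (fun y => 1 - Zc y + Zd y) g sF sg).
have -> : heat T x t = t^-1 * T (fun y => (1 - Zc y + Zd y) * g y) + t^-1 * T (fun y => (Zc y - Sc y) * g y)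
   + t^-1 * T (fun y => Th y * g y) + t^-1 * T (fun y => (Sd y - Zd y) * g y).
  have s1 := @smoothD R _ _ sFg sL; have s2 := @smoothD R _ _ s1 sT.
  rewrite -!mulrDr -(cfunD cT sFg sL) -(cfunD cT s1 sT) -(cfunD cT s2 sR).
  by congr (_ * T _); apply/funext => y; rewrite /Th /g; ring.
move: boundL boundR tp far; rewrite -/g.
move: (T _) (T _) (T _) (T _) => X1 X2 X3 X4 h1 h2 h3 h4; lra.
Qed.

End gap.
End HeatGap.

(** * The barrier, and positivity in a gap *)

Section HeatBarrier.
Variable R : realType.
Implicit Types (f g F B psi phi : R -> R) (x y z s t l r a b c d h e : R) (p q : {poly R})
  (T : (R -> R) -> R).

(** The infimum over z >= 0 of (gauss 1 (z - 1) - gauss 1 (z + 2)) / gauss 1 z, attained at z =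
    0. *)
Definition gauss_gap : R := expR (- 2^-1) - expR (-2).

Lemma gauss_gap_gt0 : 0 < gauss_gap.
Proof. by rewrite subr_gt0 ltr_expR ltrN2; lra. Qed.

Lemma gauss_gap_le z : 0 <= z -> gauss_gap * gauss 1 z <= gauss 1 (z - 1) - gauss 1 (z + 2).
Proof.
move=> z0; rewrite /gauss_gap !gauss1E mulrBl -!expRD; apply: lerB; rewrite ler_expR; lra.
Qed.

(* The barrier at time t1 is obtained by adding to T the evaluations at
   c + t1 and d - t1 and subtracting those at c - 2 t1 and d + 2 t1. *)
Lemma heat_barrier T c d A t0 : cfun T -> c < d -> 0 <= A ->
  (forall e, 0 < e -> exists2 t2, 0 < t2 & forall x t, c <= x <= d -> 0 < t -> t < t2 ->
    - (A * (t^-1 * gauss 1 ((x - c) / t))) - A * (t^-1 * gauss 1 ((x - d) / t)) - e <= heat T x t) ->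
  (forall t, 0 < t -> t < t0 -> 0 <= heat T c t) ->
  (forall t, 0 < t -> t < t0 -> 0 <= heat T d t) ->
  forall x t, c <= x <= d -> 0 < t -> t < t0 -> 0 <= heat T x t.
Proof.
move=> cT cd A0 bot wc wd x t xcd t0' tt0.
have gp := gauss_gap_gt0.
apply/ler_addgt0Pr => e e0.
pose D := A / gauss_gap.
have [L L0 HL] := gauss_bounded (1^`() - 'X * 1 : {poly R}).
have lip u v : `|gauss 1 u - gauss 1 v| <= L * `|u - v|.
  apply: (@mean_value_bound R (gauss 1) (gauss (1^`() - 'X * 1)) (Num.min u v) (Num.max u v) L) => //.
  - by move=> z _; exact: is_derive_gauss.
  - by rewrite ge_min le_max lexx !orbT.
  - by rewrite ge_min le_max lexx.
have D0 : 0 <= D by rewrite divr_ge0// ltW.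
have DA : D * gauss_gap = A by rewrite /D divfK// gt_eqF.
clearbody D.
have [|t2 t20 Ht2] := bot (e / 2); first by rewrite divr_gt0.
(* Below t2 the bound at the bottom holds with e / 2. The last entry makes the barrier, of size O(t1
   / t^2), at most e / 2 at the given time t. *)
pose t1 := Num.min (Num.min (t2 / 2) (t / 2)) (Num.min ((d - c) / 4) (e / 2 * (t * t) / (6 * L * (D + 1)))).
have dc0 : 0 < d - c by rewrite subr_gt0.
have t10 : 0 < t1 by by rewrite !lt_min !divr_gt0// !mulr_gt0 ?divr_gt0//; lra.
have t12 : t1 < t2.
  by apply: (@le_lt_trans _ _ (t2 / 2)); [rewrite /t1 !ge_min lexx|lra].
have t1t : t1 < t.
  by apply: (@le_lt_trans _ _ (t / 2)); [rewrite /t1 !ge_min lexx orbT|lra].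
have t1d : 4 * t1 <= d - c.
  by rewrite mulrC -ler_pdivlMr// /t1 !ge_min lexx !orbT.
have t1e : 6 * L * (D + 1) * t1 <= e / 2 * (t * t).
  have D1 : 0 < 6 * L * (D + 1) by rewrite !mulr_gt0//; lra.
  by rewrite mulrC -ler_pdivlMr// /t1 !ge_min lexx !orbT.
clearbody t1.
pose k := D; have k0 : 0 <= k by [].
pose T1 f := T f + k * f (c + t1); pose T2 f := T1 f + - k * f (c - 2 * t1).
pose T3 f := T2 f + k * f (d - t1); pose T4 f := T3 f + - k * f (d + 2 * t1).
have cT4 : cfun T4 by do 4 apply: cfun_eval.
have T4E y s : heat T4 y s = heat T y s +
    k * s^-1 * (gauss 1 ((c + t1 - y) / s) - gauss 1 ((c - 2 * t1 - y) / s)) +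
    k * s^-1 * (gauss 1 ((d - t1 - y) / s) - gauss 1 ((d + 2 * t1 - y) / s)).
  by rewrite !heat_eval; ring.
have gwall u v s : 0 < s -> u * u <= v * v -> 0 <= k * s^-1 * (gauss 1 (u / s) - gauss 1 (v / s)).
  move=> s0 uv; apply: mulr_ge0; first by rewrite mulr_ge0// invr_ge0 ltW.
  rewrite subr_ge0; apply: gauss1_le; rewrite !mulf_div.
  by rewrite ler_wpM2r// invr_ge0 mulr_ge0// ltW.
have sq u v : 0 <= u -> u <= v -> u * u <= v * v by move=> u0 uv; rewrite ler_pM.
have sqN u v : 0 <= u -> u <= - v -> u * u <= v * v.
  by move=> u0 uv; rewrite -(mulrNN v); exact: sq.
have sqN' u v : 0 <= - u -> - u <= - v -> u * u <= v * v.
  by move=> u0 uv; rewrite -(mulrNN v) -(mulrNN u); exact: sq.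
have := @heat_min_principle R T4 cT4 c d t1 t (e / 2) cd t10 t1t.
have pos s : t1 <= s <= t -> 0 < s /\ s < t0.
  by move=> /andP[s1 s2]; split; [exact: lt_le_trans s1|exact: le_lt_trans tt0].
have e2 : 0 < e / 2 by rewrite divr_gt0.
(* Seen from a wall, the positive source of each pair is nearer than the negative one, so the
   barrier is nonnegative there at all times. *)
have W1 s : t1 <= s <= t -> - (e / 2) <= heat T4 c s.
  move=> /pos[s0 st0]; have h0 := wc s s0 st0; rewrite T4E.
  have h1 : 0 <= k * s^-1 * (gauss 1 ((c + t1 - c) / s) - gauss 1 ((c - 2 * t1 - c) / s)).
    by apply: gwall => //; apply: sqN; lra.
  have h2 : 0 <= k * s^-1 * (gauss 1 ((d - t1 - c) / s) - gauss 1 ((d + 2 * t1 - c) / s)).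
    by apply: gwall => //; apply: sq; lra.
  lra.
have W2 s : t1 <= s <= t -> - (e / 2) <= heat T4 d s.
  move=> /pos[s0 st0]; have h0 := wd s s0 st0; rewrite T4E.
  have h1 : 0 <= k * s^-1 * (gauss 1 ((c + t1 - d) / s) - gauss 1 ((c - 2 * t1 - d) / s)).
    by apply: gwall => //; apply: sqN'; lra.
  have h2 : 0 <= k * s^-1 * (gauss 1 ((d - t1 - d) / s) - gauss 1 ((d + 2 * t1 - d) / s)).
    apply: gwall => //; rewrite -(mulrNN (d - t1 - d)); apply: sq; lra.
  lra.
have tn0 : t1 != 0 by rewrite gt_eqF.
(* With z = (y - c) / t1 the pair at c becomes gauss 1 (z - 1) - gauss 1 (z + 2), at least
   [gauss_gap] times gauss 1 z. The weight D = A / [gauss_gap] thus cancels the singular term at c;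
   likewise at d. *)
have W3 y : c <= y <= d -> - (e / 2) <= heat T4 y t1.
  move=> ycd; have := Ht2 y t1 ycd t10 t12; rewrite T4E.
  have /andP[cy yd] := ycd.
  rewrite /k.
  have -> : (c + t1 - y) / t1 = - ((y - c) / t1 - 1) by field.
  have -> : (c - 2 * t1 - y) / t1 = - ((y - c) / t1 + 2) by field.
  have -> : (d - t1 - y) / t1 = (d - y) / t1 - 1 by field.
  have -> : (d + 2 * t1 - y) / t1 = (d - y) / t1 + 2 by field.
  have -> : (y - d) / t1 = - ((d - y) / t1) by field.
  rewrite !gauss1N.
  have z1 : 0 <= (y - c) / t1 by rewrite divr_ge0 ?subr_ge0// ltW.
  have z2 : 0 <= (d - y) / t1 by rewrite divr_ge0 ?subr_ge0// ltW.
  have Dt : 0 <= D * t1^-1 by rewrite mulr_ge0// invr_ge0 ltW.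
  have g1 := ler_wpM2l Dt (gauss_gap_le z1); have g2 := ler_wpM2l Dt (gauss_gap_le z2).
  have DAt u : D * t1^-1 * (gauss_gap * u) = A * (t1^-1 * u) by rewrite -DA; ring.
  rewrite DAt in g1; rewrite DAt in g2; lra.
have tt : t1 <= t <= t by rewrite lexx ltW.
move=> /(_ W1 W2 W3 x t xcd tt); rewrite T4E.
have k1 : 0 <= k * t^-1 by rewrite mulr_ge0// invr_ge0 ltW.
have gb u v : `|u - v| = 3 * t1 -> k * t^-1 * (gauss 1 (u / t) - gauss 1 (v / t)) <= e / 4.
  move=> uv; apply: (@le_trans _ _ (k * t^-1 * (L * (3 * t1 / t)))).
    apply: ler_wpM2l => //; apply: le_trans (ler_norm _) _.
    by apply: le_trans (lip _ _) _; rewrite -mulrBl normrM uv normfV (gtr0_norm t0').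
  have -> : k * t^-1 * (L * (3 * t1 / t)) = 3 * L * k * t1 / (t * t) by field; rewrite gt_eqF.
  rewrite ler_pdivrMr ?mulr_gt0//.
  have : 3 * L * k * t1 <= 3 * L * (D + 1) * t1.
    by rewrite ler_wpM2r ?(ltW t10)// ler_wpM2l ?mulr_ge0 ?(ltW L0)// lerDl.
  lra.
have := gb (c + t1 - x) (c - 2 * t1 - x).
have := gb (d - t1 - x) (d + 2 * t1 - x).
have -> : c + t1 - x - (c - 2 * t1 - x) = 3 * t1 by ring.
have -> : d - t1 - x - (d + 2 * t1 - x) = - (3 * t1) by ring.
rewrite normrN ger0_norm ?mulr_ge0 ?(ltW t10)// => /(_ erefl) h1 /(_ erefl) h2.
lra.
Qed.

Theorem heat_gap T (W : Defs.distribution R) c0 c d d0 N t0 : cfun T -> c0 < c -> c < d -> d < d0 -> 0 <= N ->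
  (forall f, smooth f -> supp_in c0 d0 f -> T f = - W (derive1 f)) ->
  (forall B, smooth B -> (forall x, 0 <= B x) -> supp_in c0 d0 B ->
     `|W B| <= N * integral_cc c0 d0 B) ->
  (forall B a b, c < a -> b < d -> smooth B -> (forall x, 0 <= B x) -> supp_in a b B -> 0 <= T B) ->
  (forall t, 0 < t -> t < t0 -> 0 <= heat T c t) ->
  (forall t, 0 < t -> t < t0 -> 0 <= heat T d t) ->
  forall x t, c <= x <= d -> 0 < t -> t < t0 -> 0 <= heat T x t.
Proof.
move=> cT c0c cd dd0 N0 TW bW pT wc wd.
apply: (@heat_barrier T c d (2 * N * gauss_mass R)) => //.
  by rewrite !mulr_ge0// ltW// gauss_mass_gt0.
by move=> e e0; exact: (heat_gap_bottom cT c0c cd dd0 N0 TW bW pT).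
Qed.

End HeatBarrier.

(** * Positivity off a countable set *)

Section Positivity.
Variable R : realType.
Implicit Types (f g F B psi phi : R -> R) (x y z s t l r a b c d h e : R)
  (T S : (R -> R) -> R) (w W : Defs.distribution R).
Notation mu := (@lebesgue_measure R).

Lemma cfun_integral a b : a <= b -> cfun (integral_cc a b).
Proof.
move=> ab; split=> [c f g sf sg|].
  have cf := smooth_continuous sf; have cg := smooth_continuous sg.
  have ccf := smooth_continuous (@smoothZ R c f sf).
  by rewrite (integral_ccD a b ccf cg) (integral_ccZ a b c cf).
exists (b - a + 1), (`|a| + `|b| + 1), 0%N; split; [lra|by rewrite ltr_wpDl// addr_ge0|].
move=> f M sf HM.
have H x : a <= x <= b -> `|f x| <= M.
  move=> /andP[ax xb]; apply: (HM 0%N) => //.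
  have := lexx `|a|; rewrite {1}ler_norml => /andP[a1 a2].
  have := lexx `|b|; rewrite {1}ler_norml => /andP[b1 b2].
  have := normr_ge0 a; have := normr_ge0 b => *; apply/andP; split; lra.
have M0 : 0 <= M by apply: le_trans (normr_ge0 _) (H a _); rewrite lexx.
apply: le_trans (integral_cc_bound ab (smooth_continuous sf) H) _.
by rewrite mulrC ler_wpM2r//; lra.
Qed.

Lemma cfun_comb T S (k : R) : cfun T -> cfun S -> cfun (fun f => T f + k * S f).
Proof.
move=> cT cS; split=> [c f g sf sg|]; first by rewrite (cfun_lin cT)// (cfun_lin cS)//; ring.
have [_ [C [r [n [C0 r0 HC]]]]] := cT; have [_ [C' [r' [n' [C0' r0' HC']]]]] := cS.
exists (C + `|k| * C'), (r + r'), (maxn n n'); split.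
- by rewrite ltr_pwDl// mulr_ge0// ltW.
- exact: addr_gt0.
move=> f M sf HM.
rewrite (le_trans (ler_normD _ _))// mulrDl lerD//.
  by apply: HC => // j jn x xr; apply: HM; [rewrite leq_max jn|lra].
rewrite normrM -mulrA ler_wpM2l//.
by apply: HC' => // j jn x xr; apply: HM; [rewrite leq_max jn orbT|lra].
Qed.

Lemma integral_cc_supp a b a' b' f : a' <= a -> a <= b -> b <= b' -> supp_in a b f ->
  integral_cc a' b' f = integral_cc a b f.
Proof.
move=> aa ab bb su; rewrite -(Rintegral_supp ab su) (Rintegral_supp (a := a') (b := b'))//.
  exact: le_trans (le_trans aa ab) bb.
exact: supp_inW su.
Qed.

Lemma integral_bump a b z t : 0 < t -> a <= z - t -> z + t <= b ->
  integral_cc a b (fun y => (@stepD R) ((y - z) / t)) = t.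
Proof.
move=> t0 az zb; have tn0 : t != 0 by rewrite gt_eqF.
have ab : a <= b by lra.
have cs : continuous (fun y => (@stepD R) ((y - z) / t)).
  exact/smooth_continuous/smooth_affine_comp/smooth_stepD.
have D y : is_derive y 1 (fun y => t * step ((y - z) / t)) (stepD ((y - z) / t)).
  have H := is_derive_affine tn0 (smooth_is_derive ((y - z) / t) (@smooth_step R)).
  by apply: is_derive_eq (is_deriveZ_fun t H) _; rewrite mulrA mulfV// mul1r.
rewrite (integral_cc_derive cs ab D) step1 ?step0 ?mulr1 ?mulr0 ?subr0//.
  by rewrite ler_pdivrMr//; lra.
by rewrite ler_pdivlMr//; lra.
Qed.

(** N times the integral, plus or minus W, is nonnegative on all small bumps; [mollifier_cfun_ge0]
    carries this over to every nonnegative B. *)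
Lemma primitive_mass_bound W c d N tau : c <= d -> 0 < tau ->
  (forall t z, 0 < t -> t < tau -> c <= z <= d -> `|dilate W z t (@stepD R)| <= N) ->
  forall B, smooth B -> (forall x, 0 <= B x) -> supp_in c d B -> `|W B| <= N * integral_cc c d B.
Proof.
move=> cd tau0 HW B sB B0 su.
pose chi := plateau (c - 2) (d + 2) (1 : R).
have chi1 x : c - 1 <= x <= d + 1 -> chi x = 1 by move=> H; apply: plateau1 => //; lra.
have tchi : test_function chi by exact: test_plateau.
have t1 : 0 < Num.min tau 1 by rewrite lt_min tau0 ltr01.
have key (k : R) : `|k| = 1 -> 0 <= N * integral_cc c d B + k * W B.
  move=> k1.
  pose T f := N * integral_cc (c - 1) (d + 1) f + k * W (fun x => chi x * f x).
  have cT : cfun T.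
    have cI : cfun (integral_cc (c - 1) (d + 1) : (R -> R) -> R) by apply: cfun_integral; lra.
    have c0 : cfun (fun _ : R -> R => 0 : R).
      split=> [a f g _ _|]; first by rewrite mulr0 addr0.
      exists 1, 1, 0%N; split => // f M sf HM; rewrite normr0 mul1r.
      by apply: le_trans (normr_ge0 _) (HM 0%N _ 0 _) => //; rewrite lerN10 ler01.
    have := cfun_comb k (cfun_comb N c0 cI) (cfun_localize W tchi).
    by congr cfun; apply/funext => f; rewrite /T add0r.
  have := @mollifier_cfun_ge0 R T (@step R) c d (Num.min tau 1) B cT (@mollifier_step R) t1.
  rewrite /T => H; have : forall t z, 0 < t -> t < Num.min tau 1 -> c <= z <= d ->
     0 <= N * integral_cc (c - 1) (d + 1) (fun y => derive1 (@step R) ((y - z) / t)) +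
          k * W (fun y => chi y * derive1 (@step R) ((y - z) / t)).
    move=> t z t0; rewrite lt_min => /andP[tt tt1] /andP[cz zd].
    rewrite integral_bump//; [|lra|lra].
    have -> : (fun y => chi y * derive1 (@step R) ((y - z) / t)) = affine_pull z t (@stepD R).
      apply/funext => y; rewrite /affine_pull -[derive1 _]/(@stepD R).
      have [yI|yI] := boolP (c - 1 <= y <= d + 1); first by rewrite chi1// mul1r.
      rewrite stepD_supp ?mulr0// ltr_pdivrMr// ltr_pdivlMr//.
      by move: yI; rewrite negb_and -!ltNge => /orP[]yI; apply/orP; [left|right]; lra.
    have := HW t z t0 tt; rewrite cz zd => /(_ isT).
    rewrite /dilate normrM (ger0_norm (x := t^-1)) ?invr_ge0 ?(ltW t0)// ler_pdivrMl//.
    set X := W _ => HX.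
    have : `|k * X| <= t * N by rewrite normrM k1 mul1r.
    by rewrite ler_norml => /andP[h _]; lra.
  move=> /H /(_ sB B0 su).
  rewrite (integral_cc_supp _ cd _ su); [|lra|lra].
  congr (_ <= _ + _ * W _); apply/funext => x.
  have [xI|xI] := boolP (c - 1 <= x <= d + 1); first by rewrite chi1// mul1r.
  rewrite su ?mulr0//.
  by move: xI; rewrite negb_and -!ltNge => /orP[]xI; apply/orP; [left|right]; lra.
have h1 := key 1 (normr1 _); have h2 := key (-1) (normrN1 _).
by rewrite ler_norml; apply/andP; split; lra.
Qed.

(** Together with [closed_first] it finds the ends of the gap of a closed set around a point z. *)
Lemma closed_last C c z : closed C -> C c -> c <= z ->
  exists y, [/\ C y, c <= y <= z & forall x, y < x -> x <= z -> ~ C x].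
Proof.
move=> cC Cc cz; pose A := [set x | C x /\ c <= x <= z].
have A0 : A !=set0 by exists c; split; rewrite ?lexx.
have Ab : has_ubound A by exists z => x [_ /andP[]].
have AC : closed A.
  have -> : A = C `&` `[c, z]%classic by apply/seteqP; split => x /=; rewrite in_itv.
  by apply: closedI => //; exact: itv_closed.
have [Cs sI] : A (sup A) by apply: AC; apply: closure_sup.
exists (sup A); split => // x sx xz Cx.
have : x <= sup A.
  apply: ub_le_sup => //; split => //.
  have /andP[cs _] := sI; rewrite xz andbT; exact: ltW (le_lt_trans cs sx).
by rewrite leNgt sx.
Qed.

Lemma closed_first C d z : closed C -> C d -> z <= d ->
  exists y, [/\ C y, z <= y <= d & forall x, x < y -> z <= x -> ~ C x].
Proof.
move=> cC Cd zd.
have cC' : closed [set x | C (- x)].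
  apply: (@closed_comp _ _ (fun x => - x) C) => // x _; exact: oppr_continuous.
have [|//|y [Cy /andP[y1 y2] H]] := @closed_last _ (- d) (- z) cC'.
- by rewrite /= opprK.
- by rewrite lerN2.
exists (- y); split => //; first by apply/andP; split; lra.
by move=> x xy zx; have := H (- x); rewrite /= opprK; apply; lra.
Qed.

Lemma closed_all_ge0 (I : Type) (D : set I) (F : I -> R -> R) : (forall i, D i -> continuous (F i)) ->
  closed [set x | forall i, D i -> 0 <= F i x].
Proof.
move=> cF; have -> : [set x | forall i, D i -> 0 <= F i x] = \bigcap_(i in D) [set x | 0 <= F i x].
  by apply/seteqP; split => x /=.
apply: closed_bigI => i Di.
apply: (@closed_comp _ _ (F i) [set y | 0 <= y]) => [x _|]; [exact: cF|exact: closed_ge].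
Qed.

(** A translate of the bump by |s| <= 2 lives in [-3, 3] with the same derivative bounds, so the
    order that is uniform in t serves all s. The range 2 lets [dilate_bump_bound] reach every point
    within 2t of the bad set. *)
Lemma point_value_translates W x l : point_value W x l ->
  exists b, forall s t, `|s| <= 2 -> 0 < t <= 1 -> `|dilate W (x + s * t) t (@stepD R)| <= b.
Proof.
move=> pv; have [C [m [C0 HC]]] := point_value_order pv (ltr0Sn R 2).
have [_ bb] := @bsmooth_stepD R.
have [||M M0 HM] := @unif_nat R (fun j (M : R) => forall x, `|derive1n j (@stepD R) x| <= M) m.
- by move=> j A A1 AB H y; exact: le_trans (H y) AB.
- by move=> j; exact: bb.
exists (C * M) => s t s2 t01; have /andP[t0 _] := t01; have tn0 : t != 0 by rewrite gt_eqF.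
have -> : dilate W (x + s * t) t (@stepD R) = dilate W x t (fun z => stepD ((z - s) / 1)).
  rewrite /dilate /affine_pull; congr (_ * W _); apply/funext => y; congr stepD.
  by field.
apply: HC; first exact: t01.
- by apply: smooth_affine_comp; [rewrite oner_eq0|exact: smooth_stepD].
- move=> z H; rewrite stepD_supp// divr1; move: s2; rewrite ler_norml => /andP[s1 s2].
  by case/orP: H => H; apply/orP; [left|right]; lra.
- move=> j jm z; rewrite (derive1n_affine s j (oner_neq0 R) (@smooth_stepD R)).
  by rewrite invr1 expr1n mul1r; exact: HM.
Qed.

Lemma nonneg_on_sub w p q p' q' : p <= p' -> q' <= q -> nonneg_on w p q -> nonneg_on w p' q'.
Proof.
move=> pp qq H f sf f0 [a [b [pa bq su]]]; apply: H => //; exists a, b; split => //.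
  exact: le_lt_trans pa.
exact: lt_le_trans qq.
Qed.

End Positivity.

(** * The perfect set of bad points and the category argument *)

Section PositivityOffCountable.
Variable R : realType.
Implicit Types (f g F B psi phi : R -> R) (x y z s t l r a b c d h e : R) (w W : Defs.distribution R).

Section perfect.
Variables (w W : Defs.distribution R).
Hypothesis (wW : is_derivative w W) (lW : lojasiewicz_distribution W).

Let O := \bigcup_(lr in [set lr : R * R | nonneg_on w lr.1 lr.2]) `]lr.1, lr.2[%classic.

(** The closed set of bad points; by gluing, w is nonnegative on each interval that avoids it. *)
Definition singular_set := ~` O.

Let O_P x : O x <-> exists l r, l < x < r /\ nonneg_on w l r.
Proof.
split=> [[[l r] /= H]|[l [r [lxr H]]]]; first by rewrite in_itv => lxr; exists l, r.
by exists (l, r) => //=; rewrite in_itv.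
Qed.

Lemma singular_setP x : singular_set x <-> ~ exists l r, l < x < r /\ nonneg_on w l r.
Proof. by split=> H K; apply: H; apply/O_P. Qed.

Lemma closed_singular_set : closed singular_set.
Proof. by apply: open_closedC; apply: bigcup_open => i _; exact: interval_open. Qed.

Lemma nonneg_on_regular l r : (forall x, l < x < r -> ~ singular_set x) -> nonneg_on w l r.
Proof.
move=> H; apply: nonneg_on_glue => x lxr.
have [l' [r' [/andP[lx xr] nn]]] : exists l r, l < x < r /\ nonneg_on w l r.
  by apply: contrapT => K; apply: (H x lxr); apply/singular_setP.
exists (Num.min (x - l') (r' - x) / 2); first by rewrite divr_gt0// lt_min !subr_gt0 lx.
have h1 : Num.min (x - l') (r' - x) <= x - l' by rewrite ge_min lexx.
have h2 : Num.min (x - l') (r' - x) <= r' - x by rewrite ge_min lexx orbT.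
move=> f sf f0 su; apply: nn => //; do 2 eexists; split; last exact: su; lra.
Qed.

(** At an isolated point w would be nonnegative on both sides, and the point value of W makes such a
    point removable. *)
Lemma singular_not_isolated l r x : singular_set x -> l < x < r ->
  exists2 y, singular_set y & l < y < r /\ y != x.
Proof.
move=> Sx lxr; apply: contrapT => H.
have K y : l < y < r -> y != x -> ~ singular_set y by move=> h1 h2 Sy; apply: H; exists y.
have /andP[lx xr] := lxr.
have [e pv] := lW x.
have n1 : nonneg_on w l x.
  by apply: nonneg_on_regular => y /andP[ly yx]; apply: K; rewrite ?lt_eqF// ly (lt_trans yx).
have n2 : nonneg_on w x r.
  by apply: nonneg_on_regular => y /andP[xy yr]; apply: K; rewrite ?gt_eqF// yr (lt_trans lx).
move/singular_setP: Sx; apply; exists l, r; split => //.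
exact: (nonneg_on_removable wW pv n1 n2).
Qed.

Definition meets l r := exists2 x, singular_set x & l < x < r.

Lemma meets_split l r : meets l r -> exists m, meets l m /\ meets m r.
Proof.
move=> [x Sx lxr]; have [y Sy [/andP[ly yr] yx]] := singular_not_isolated Sx lxr.
have /andP[lx xr] := lxr; exists ((x + y) / 2); have [xy|xy|xy] := ltgtP x y.
- by split; [exists x => //|exists y => //]; apply/andP; split; lra.
- by split; [exists y => //|exists x => //]; apply/andP; split; lra.
- by rewrite xy eqxx in yx.
Qed.

Lemma meets_five l r : meets l r -> exists c0 c1 x1 d1 d0,
  [/\ singular_set c0, singular_set c1, singular_set x1, singular_set d1 & singular_set d0] /\
  [/\ l < c0, c0 < c1, c1 < x1 & [/\ x1 < d1, d1 < d0 & d0 < r]].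
Proof.
move=> /meets_split[m [/meets_split[m1 [[c0 S0 /andP[a1 a2]] [c1 S1 /andP[a3 a4]]]]]].
move=> /meets_split[m2 [[x1 Sx /andP[a5 a6]] /meets_split[m3 [[d1 Sd /andP[a7 a8]] [d0 Sd0 /andP[a9 a10]]]]]].
exists c0, c1, x1, d1, d0; split; split => //; try split => //; lra.
Qed.

(* Near the singular set the bump averages of W are bounded by hypothesis; in a
   gap they are monotone and compared with the averages at its ends. *)
Lemma dilate_bump_bound c d N tau : singular_set c -> singular_set d ->
  (forall x s t, singular_set x -> c <= x <= d -> `|s| <= 2 -> 0 < t -> t < tau ->
     `|dilate W (x + s * t) t (@stepD R)| <= N) ->
  forall t z, 0 < t -> t < tau -> c <= z <= d -> `|dilate W z t (@stepD R)| <= N.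
Proof.
move=> Sc Sd HN t z t0 tt /andP[cz zd]; have tn0 : t != 0 by rewrite gt_eqF.
have [[x Sx /andP[xcd xz]]|far] := pselect (exists2 x, singular_set x & (c <= x <= d) && (`|z - x| <= 2 * t)).
  have -> : z = x + (z - x) / t * t by rewrite divfK// addrC subrK.
  by apply: HN => //; rewrite normrM normfV (gtr0_norm t0) ler_pdivrMr.
have far' x : singular_set x -> c <= x <= d -> 2 * t < `|z - x|.
  by move=> Sx xcd; rewrite ltNge; apply/negP => H; apply: far; exists x => //; rewrite xcd.
have [a [Sa /andP[ca az] Ha]] := closed_last closed_singular_set Sc cz.
have [b [Sb /andP[zb bd] Hb]] := closed_first closed_singular_set Sd zd.
have a2 : a + 2 * t < z.
  by have := far' a Sa; rewrite ca (le_trans az zd) => /(_ isT); rewrite ger0_norm ?subr_ge0//; lra.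
have b2 : z < b - 2 * t.
  by have := far' b Sb; rewrite bd (le_trans cz zb) => /(_ isT); rewrite ler0_norm ?subr_le0//; lra.
have nn : nonneg_on w a b.
  apply: nonneg_on_regular => x /andP[ax xb]; have [xz|xz] := leP x z; first exact: Ha.
  by apply: Hb => //; exact: ltW.
have n2 : `|2 : R| <= 2 by rewrite ger0_norm.
have nN2 : `|- 2 : R| <= 2 by rewrite normrN.
have acd : c <= a <= d by rewrite ca (le_trans az).
have bcd : c <= b <= d by rewrite bd (le_trans cz).
have := HN a 2 t Sa acd n2 t0 tt; have := HN b (-2) t Sb bcd nN2 t0 tt.
have := @dilate_bump_le R w W a b (a + 2 * t) z t t wW nn t0 t0.
have := @dilate_bump_le R w W a b z (b + -2 * t) t t wW nn t0 t0.
set X := dilate W (b + -2 * t) _ _; set Y := dilate W z _ _; set Z := dilate W (a + 2 * t) _ _; clearbody X Y Z.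
move=> h1 h2; rewrite !ler_norml => /andP[_ X2] /andP[Z1 _].
have YX : Y <= X by apply: h1; [lra|lra|right; split => //; lra].
have ZY : Z <= Y by apply: h2; [lra|lra|right; split => //; lra].
by apply/andP; split; lra.
Qed.

Variables (chi : R -> R) (p q : R) (E : set R).
Hypotheses (tchi : test_function chi) (chi1 : forall x, p < x < q -> chi x = 1)
  (cE : countable E).

Let T f := w (fun x => chi x * f x).

Let cT : cfun T. Proof. exact: cfun_localize. Qed.

Let T_loc f a b : p < a -> b < q -> supp_in a b f -> T f = w f.
Proof.
move=> pa bq su; congr (w _); apply/funext => x.
have [xI|xI] := boolP (a <= x <= b).
  by have /andP[ax xb] := xI; rewrite chi1 ?mul1r// (lt_le_trans pa)//= (le_lt_trans xb).
by rewrite su ?mulr0//; move: xI; rewrite negb_and -!ltNge.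
Qed.

Lemma heat_ge0_nonneg c d tau : p < c -> d < q -> 0 < tau ->
  (forall x t, c <= x <= d -> 0 < t -> t < tau -> 0 <= heat T x t) -> nonneg_on w c d.
Proof.
move=> pc dq tau0 H f sf f0 [a [b [ca bd su]]].
have su' : supp_in c d f by apply: supp_inW su; exact: ltW.
rewrite -(T_loc pc dq su').
apply: (mollifier_cfun_ge0 cT (@mollifier_gaussCDF R) tau0 _ sf f0 su') => t z t0 tt zI.
rewrite derive1_gaussCDF -(pmulr_rge0 _ (x := t^-1)) ?invr_gt0//.
exact: H.
Qed.

Hypothesis (heat_pos : forall x, p < x < q -> ~ E x ->
  exists2 t0, 0 < t0 & forall t, 0 < t -> t < t0 -> 0 <= heat T x t).

Theorem nonneg_on_countable : nonneg_on w p q.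
Proof.
apply: contrapT => notnn.
have [x0 Sx0 x0I] : meets p q.
  apply: contrapT => H; apply: notnn; apply: nonneg_on_regular => x xpq Sx.
  by apply: H; exists x.
have pq : p < q by have /andP[? ?] := x0I; lra.
have /countable_injP[idx Hidx] := cE.
(* Wide enough for translates by at most 2 of bumps of width at most 1 near ]p, q[. Written through
   T2, the averages of W are continuous in their centre. *)
pose chi2 := plateau (p - 4) (q + 4) (1 : R).
have tchi2 : test_function chi2 by exact: test_plateau.
have cT2 := cfun_localize W tchi2.
pose T2 f := W (fun x => chi2 x * f x).
have T2E z t : p - 2 <= z <= q + 2 -> 0 < t -> t <= 1 ->
    t^-1 * T2 (fun y => (@stepD R) ((y - z) / t)) = dilate W z t (@stepD R).
  move=> /andP[z1 z2] t0 t1; congr (_ * W _); apply/funext => y.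
  have [yI|yI] := boolP (p - 3 <= y <= q + 3); first by rewrite /chi2 plateau1 ?mul1r//; lra.
  rewrite /affine_pull stepD_supp ?mulr0// ltr_pdivrMr// ltr_pdivlMr//.
  by move: yI; rewrite negb_and -!ltNge => /orP[]yI; apply/orP; [left|right]; lra.
pose tau (k : nat) : R := k.+1%:R^-1.
have tau0 k : 0 < tau k by rewrite invr_gt0 ltr0n.
have tau1 k : tau k <= 1 by rewrite invf_le1 ?ltr0n// ler1n.
(* G1 and G2 are closed as intersections of inequalities between continuous functions of x; G3 k
   holds at most one point, the exceptional point of index k. *)
pose G1 k := [set x | forall t, 0 < t /\ t < tau k -> 0 <= heat T x t].
pose G2 k := [set x | forall i : R * R, `|i.1| <= 2 /\ 0 < i.2 /\ i.2 < tau k ->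
   0 <= k%:R - `|i.2^-1 * T2 (fun y => (@stepD R) ((y - (x + i.1 * i.2)) / i.2))|].
pose G3 k := [set x | E x /\ idx x = k].
pose G k := (G1 k `&` G2 k) `|` G3 k.
have cG k : closed (G k).
  apply: closedU; first apply: closedI.
  - apply: closed_all_ge0 => t [t0 _] x.
    apply: cvgM; first exact: cvg_cst.
    by apply: cfun_translation_continuous; [exact: cT|exact: bsmooth_gauss|rewrite gt_eqF].
  - apply: closed_all_ge0 => -[s t] [_ [/= t0 _]] x.
    apply: cvgB; first exact: cvg_cst.
    apply: cvg_norm; apply: cvgM; first exact: cvg_cst.
    have c1 : continuous (fun z => T2 (fun y => (@stepD R) ((y - z) / t))).
      by apply: cfun_translation_continuous; [exact: cT2|exact: bsmooth_stepD|rewrite gt_eqF].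
    apply: (continuous_comp (f := fun x => x + s * t) (g := fun z => T2 (fun y => (@stepD R) ((y - z) / t)))).
      by apply: cvgD; [exact: cvg_id|exact: cvg_cst].
    exact: c1.
  - have [[e [Ee ie]]|no] := pselect (exists e, E e /\ idx e = k).
      have -> : G3 k = [set e].
        apply/seteqP; split => y /=; last by move=> ->.
        by move=> [Ey iy]; apply: Hidx; rewrite ?inE// iy.
      exact: closed_eq.
    have -> : G3 k = set0 by apply/seteqP; split => y //= Hy; apply: no; exists y.
    exact: closed0.
have covG x : singular_set x -> p < x < q -> exists k, G k x.
  move=> Sx xI; have [Ex|nEx] := pselect (E x); first by exists (idx x); right.
  have [t0 t00 Ht0] := heat_pos xI nEx; have [l pv] := lW x.
  have [b Hb] := point_value_translates pv.
  exists (Num.truncn (Num.max (b + 1) t0^-1)).+1; set k := (_.+1); left.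
  have : Num.max (b + 1) t0^-1 < k%:R by exact: truncnS_gt.
  rewrite gt_max => /andP[bk tk].
  have tkt : tau k < t0.
    rewrite -(invrK t0) ltf_pV2 ?posrE ?invr_gt0 ?ltr0n//.
    by apply: lt_trans tk _; rewrite ltr_nat.
  have /andP[px xq] := xI.
  split; first by move=> t [t1 t2]; apply: Ht0 => //; exact: lt_trans tkt.
  move=> [s t] /= [s2 [t1 t2]]; have t1' : t <= 1 by exact: le_trans (ltW t2) (tau1 k).
  have st : `|s * t| <= 2.
    by rewrite normrM (gtr0_norm t1) -[leRHS]mulr1 ler_pM// ltW.
  rewrite T2E//.
    rewrite subr_ge0; apply: (@le_trans _ _ b); last lra.
    by apply: Hb => //; rewrite t1.
  by move: st; rewrite ler_norml => /andP[s1 s2']; apply/andP; split; lra.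
have [|k [l [r [pl rq [x Sx xI] HG]]]] := @baire_portion R singular_set G p q closed_singular_set cG _ covG.
  by exists x0.
(* If the exceptional point of index k lies in the portion, one passes to a side of it that still
   meets the bad set, which has no isolated points. *)
have [l' [r' [ll rr [x' Sx' xI'] HG']]] : exists l' r', [/\ l <= l', r' <= r, meets l' r' &
    forall x, singular_set x -> l' < x < r' -> G1 k x /\ G2 k x].
  have [[e [Ee ie] eI]|no] := pselect (exists2 e, E e /\ idx e = k & l < e < r).
    have sub y : singular_set y -> l < y < r -> y != e -> G1 k y /\ G2 k y.
      move=> Sy yI ye; have [//|[Ey iy]] := HG y Sy yI.
      by move: ye; rewrite (Hidx y e) ?eqxx// ?inE// iy.
    have /andP[le er] := eI.
    have [y Sy [yI ye]] : exists2 y, singular_set y & l < y < r /\ y != e.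
      have [xe|xe] := eqVneq x e; last by exists x.
      by rewrite -xe; exact: singular_not_isolated.
    have /andP[ly yr] := yI; have [yle|ely|H] := ltgtP y e; last by rewrite H eqxx in ye.
      exists l, e; split => //; first exact: ltW.
        by exists y => //; rewrite ly.
      by move=> z Sz /andP[lz ze]; apply: sub; rewrite ?lt_eqF// lz (lt_trans ze).
    exists e, r; split => //; first exact: ltW.
      by exists y => //; rewrite yr ely.
    by move=> z Sz /andP[ez zr]; apply: sub; rewrite ?gt_eqF// zr (lt_trans le).
  exists l, r; split => //; first by exists x.
  move=> y Sy yI; have [//|[Ey iy]] := HG y Sy yI.
  by exfalso; apply: no; exists y.
have [c0 [c1 [x1 [d1 [d0 [[S0 S1 Sx1 Sd1 Sd0] [lc0 c01 c1x [xd1 d10 d0r]]]]]]]] := meets_five (ex_intro2 _ _ x' Sx' xI').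
have inP y : c0 <= y <= d0 -> singular_set y -> G1 k y /\ G2 k y.
  by move=> /andP[y1 y2] Sy; apply: HG' => //; apply/andP; split; lra.
have N0 : 0 <= k%:R :> R by [].
have bound t z : 0 < t -> t < tau k -> c0 <= z <= d0 -> `|dilate W z t (@stepD R)| <= k%:R.
  move=> t0 tt zI; apply: (dilate_bump_bound S0 Sd0 _ t0 tt zI) => y s u Sy yI s2 u0 uk.
  have [_ /(_ (s, u))] := inP y yI Sy; rewrite /= subr_ge0 => H.
  have u1 : u <= 1 by exact: le_trans (ltW uk) (tau1 k).
  have su : `|s * u| <= 2.
    by rewrite normrM (gtr0_norm u0) -[leRHS]mulr1 ler_pM// ltW.
  rewrite -T2E//; first exact: H.
  by move: su; rewrite ler_norml => /andP[h1 h2]; move: yI => /andP[y1 y2]; apply/andP; split; lra.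
have c0d0 : c0 <= d0 by lra.
have mass := primitive_mass_bound c0d0 (tau0 k) bound.
have TW f : smooth f -> supp_in c0 d0 f -> T f = - W (derive1 f).
  move=> sf su; rewrite (@T_loc f c0 d0) //; [|lra|lra].
  by rewrite wW//; exact: supp_in_test su.
have wall y : singular_set y -> c0 <= y <= d0 -> forall t, 0 < t -> t < tau k -> 0 <= heat T y t.
  by move=> Sy yI t t0 tt; have [H _] := inP y yI Sy; exact: H.
(* Bad points are covered by [wall]. Any other y lies in a gap whose two ends are bad points inside
   the window, and [heat_gap] applies to it. *)
have hpos y t : c1 <= y <= d1 -> 0 < t -> t < tau k -> 0 <= heat T y t.
  move=> /andP[c1y yd1] t0 tt.
  have [c [Sc /andP[c1c cy] Hc]] := closed_last closed_singular_set S1 c1y.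
  have [d [Sd /andP[yd dd1] Hd]] := closed_first closed_singular_set Sd1 yd1.
  have cI : c0 <= c <= d0 by apply/andP; split; lra.
  have dI : c0 <= d <= d0 by apply/andP; split; lra.
  have [ec|cy'] := eqVneq c y; first by rewrite -ec; exact: wall.
  have [ed|dy'] := eqVneq d y; first by rewrite -ed; exact: wall.
  have cy2 : c < y by rewrite lt_neqAle cy'.
  have yd2 : y < d by rewrite lt_neqAle eq_sym dy'.
  have nn : nonneg_on w c d.
    apply: nonneg_on_regular => u /andP[cu ud]; have [uy|uy] := leP u y; first exact: Hc.
    by apply: Hd => //; exact: ltW.
  have c0c : c0 < c by lra. have cd : c < d by lra. have dd0 : d < d0 by lra.
  apply: (heat_gap cT c0c cd dd0 N0 TW mass _ (wall c Sc cI) (wall d Sd dI)) => //; last by rewrite cy yd.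
  move=> B a b ca bd sB B0 su; rewrite (@T_loc B a b)//; [|lra|lra].
  by apply: nn => //; exists a, b.
have nn1 : nonneg_on w c1 d1 by apply: (heat_ge0_nonneg _ _ (tau0 k) hpos); lra.
by move/singular_setP: Sx1; apply; exists c1, d1; rewrite c1x xd1.
Qed.

End perfect.
End PositivityOffCountable.

(** * Null sets *)

Section NullSets.
Variable R : realType.
Implicit Types (x y z s t l r a b c d h e : R) (O Z : set R).
Notation mu := (@lebesgue_measure R).

Lemma null_set_open Z e : mu.-negligible Z -> 0 < e ->
  exists O, [/\ open O, Z `<=` O & (mu O <= e%:E)%E].
Proof.
move=> [A [mA A0 ZA]] e0.
have Afin : (mu A < +oo)%E by rewrite A0 ltry.
have [U [oU AU HU]] := lebesgue_regularity_outer mA Afin e0.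
have mU : measurable U by exact: measurable_realfun.open_measurable.
exists U; split => //; first exact: subset_trans AU.
have -> : mu U = (mu (U `\` A) + mu A)%E.
  by rewrite (measureDI mu mU mA) setIidr.
by rewrite A0 adde0 ltW.
Qed.

Section cumulative.
Variables (O : set R) (e : R).
Hypotheses (oO : open O) (muO : (mu O <= e%:E)%E).

(** Its slope is 1 inside O and at most 1 anywhere, so a sum of such functions is steep where many
    of the open sets overlap. *)
Definition cumulative x : R := fine (mu (O `&` `]-oo, x]%classic)).

Let mO : measurable O. Proof. exact: measurable_realfun.open_measurable. Qed.

Let finO A : measurable A -> mu (O `&` A) \is a fin_num.
Proof.
move=> mA; rewrite ge0_fin_numE//; apply: le_lt_trans (ltry e).
by apply: le_trans muO; apply: le_measure; rewrite ?inE//; exact: measurableI.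
Qed.

Lemma cumulative_bound x : 0 <= cumulative x <= e.
Proof.
apply/andP; split; first exact: fine_ge0.
rewrite -lee_fin fineK ?finO//; apply: le_trans muO.
by apply: le_measure; rewrite ?inE//; exact: measurableI.
Qed.

Lemma cumulativeB x y : x <= y ->
  cumulative y - cumulative x = fine (mu (O `&` `]x, y]%classic)).
Proof.
move=> xy; have E : O `&` `]-oo, y]%classic = (O `&` `]-oo, x]%classic) `|` (O `&` `]x, y]%classic).
  apply/seteqP; split => z /=; rewrite !in_itv/=.
    by move=> [Oz zy]; have [zx|zx] := leP z x; [left|right].
  by move=> [[Oz zx]|[Oz /andP[_ zy]]]; split => //; exact: le_trans xy.
rewrite /cumulative E measureU; first last.
- apply/seteqP; split => z //=; rewrite !in_itv/= => -[[_ zx] [_ /andP[xz _]]].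
  by move: xz; rewrite ltNge zx.
- exact: measurableI.
- exact: measurableI.
by rewrite fineD ?finO// addrC addKr.
Qed.

Lemma cumulative_incr x y : x <= y -> 0 <= cumulative y - cumulative x <= y - x.
Proof.
move=> xy; rewrite cumulativeB//; apply/andP; split; first exact: fine_ge0.
have -> : y - x = fine (mu `]x, y]%classic).
  rewrite lebesgue_measure_itv/= lte_fin; case: ltP => // yx.
  by have -> : x = y by [apply/eqP; rewrite eq_le xy yx]; rewrite subrr.
apply: fine_le; [exact: finO| |].
  by rewrite lebesgue_measure_itv/=; case: ifP.
by apply: le_measure; rewrite ?inE//; exact: measurableI.
Qed.

Lemma cumulative_full x y : x <= y -> (forall z, x <= z <= y -> O z) -> cumulative y - cumulative x = y - x.
Proof.
move=> xy H; rewrite cumulativeB//.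
have -> : O `&` `]x, y]%classic = `]x, y]%classic.
  apply/seteqP; split => z /=; rewrite in_itv/=; first by case.
  by move=> /andP[xz zy]; split; [apply: H; rewrite zy (ltW xz)|rewrite xz].
rewrite lebesgue_measure_itv/= lte_fin; case: ltP => // yx.
by have -> : x = y by [apply/eqP; rewrite eq_le xy yx]; rewrite subrr.
Qed.

End cumulative.

Lemma continuous_of_modulus (g : R -> R) :
  (forall x e, 0 < e -> exists2 d, 0 < d & forall y, `|y - x| < d -> `|g y - g x| <= e) -> continuous g.
Proof.
move=> H x; apply/cvgrPdist_le => e e0; have [d d0 Hd] := H x e e0.
apply/nbhs_ballP; exists d => //= y; rewrite /ball/= distrC => /Hd.
by rewrite distrC.
Qed.

(* h is the sum of the functions x |-> mu(O_n `&` ]-oo, x]) for open sets O_n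
   that contain Z and have summable measures. *)
Lemma null_set_function Z e : mu.-negligible Z -> 0 < e -> exists h : R -> R,
  [/\ continuous h, (forall x y, x <= y -> h x <= h y), (forall x, `|h x| <= e) &
   forall x N, Z x -> exists2 d, 0 < d & forall y z, x - d <= y -> y <= z -> z <= x + d ->
     N * (z - y) <= h z - h y].
Proof.
move=> nZ e0; pose e' := e / 2; have e'0 : 0 < e' by rewrite divr_gt0.
have q0 k : 0 < 3^-1 ^+ k :> R by rewrite exprn_gt0// invr_gt0.
have /choice[ O HO] : forall n, exists O, [/\ open O, Z `<=` O & (mu O <= (e' * 3^-1 ^+ n)%:E)%E].
  by move=> n; apply: null_set_open => //; rewrite mulr_gt0.
have oO n : open (O n) by have [] := HO n.
have muO n : (mu (O n) <= (e' * 3^-1 ^+ n)%:E)%E by have [] := HO n.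
pose S k x := \sum_(n < k) cumulative (O n) x.
have SS k x : S k.+1 x = S k x + cumulative (O k) x by rewrite /S big_ord_recr.
have /choice[h Hh] : forall x, exists l, forall k, `|l - S k x| <= 2 * e' * 3^-1 ^+ k.
  move=> x; apply: geometric_limit => k; rewrite SS addrAC subrr add0r.
  by have /andP[c0 c1] := cumulative_bound (oO k) (muO k) x; rewrite ger0_norm.
have Sincr k x y : x <= y -> 0 <= S k y - S k x.
  move=> xy; elim: k => [|k IH]; first by rewrite /S !big_ord0 subrr.
  rewrite !SS; have /andP[c0 _] := cumulative_incr (oO k) (muO k) xy; lra.
have Slip k x y : x <= y -> S k y - S k x <= k%:R * (y - x).
  move=> xy; elim: k => [|k IH]; first by rewrite /S !big_ord0 subrr mul0r.
  rewrite !SS -natr1; have /andP[_ c0] := cumulative_incr (oO k) (muO k) xy; lra.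
have Smono k j x y : x <= y -> S k y - S k x <= S (k + j)%N y - S (k + j)%N x.
  move=> xy; elim: j => [|j IH]; first by rewrite addn0.
  rewrite addnS !SS; have /andP[c0 _] := cumulative_incr (oO (k + j)%N) (muO (k + j)%N) xy; lra.
have two k x y : `|(h y - h x) - (S k y - S k x)| <= 2 * e * 3^-1 ^+ k.
  have h1 := Hh x k; have h2 := Hh y k.
  have -> : h y - h x - (S k y - S k x) = (h y - S k y) - (h x - S k x) by ring.
  rewrite (le_trans (ler_normB _ _))// (le_trans (lerD h2 h1))// /e'.
  by rewrite le_eqVlt; apply/orP; left; apply/eqP; field.
have hS k x y : x <= y -> S k y - S k x <= h y - h x.
  move=> xy; apply: (@geometric_le _ _ _ (2 * e)) => j.
  have := two (k + j)%N x y; rewrite ler_norml => /andP[h1 _].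
  have := Smono k j x y xy => h2.
  have : 2 * e * 3^-1 ^+ (k + j) <= 2 * e * 3^-1 ^+ j.
    by apply: ler_wpM2l; [lra|rewrite exprD ler_piMl ?(ltW (q0 j))// exprn_ile1// invf_le1// ler1n].
  lra.
have hmono x y : x <= y -> h x <= h y.
  by move=> xy; have := hS 0%N x y xy; rewrite /S !big_ord0 subrr subr_ge0.
exists h; split => //.
- apply: continuous_of_modulus => x d d0.
  have [k Hk] : exists k, 2 * e * 3^-1 ^+ k <= d / 2.
    apply: contrapT => H; have : d / 2 <= 0.
      apply: (@geometric_le _ _ _ (2 * e)) => k; rewrite add0r leNgt; apply/negP => K.
      by apply: H; exists k; exact: ltW.
    lra.
  have k1 : 0 < k.+1%:R :> R by rewrite ltr0n.
  exists (d / 2 / k.+1%:R); first by rewrite !divr_gt0.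
  have main y z : y <= z -> z - y < d / 2 / k.+1%:R -> h z - h y <= d.
    move=> yz; rewrite ltr_pdivlMr// => H.
    have := two k y z; rewrite ler_norml => /andP[_ h1]; have h2 := Slip k y z yz.
    have : k%:R * (z - y) <= k.+1%:R * (z - y) by rewrite ler_wpM2r ?subr_ge0// ler_nat.
    lra.
  move=> y; rewrite ltr_norml => /andP[y1 y2].
  have [xy|yx] := leP x y.
    by rewrite ger0_norm ?subr_ge0 ?hmono//; exact: main.
  rewrite ler0_norm ?subr_le0 ?(hmono _ _ (ltW yx))// opprB.
  by apply: main; [exact: ltW|rewrite -opprB ltrNl].
- move=> x; have := Hh x 0%N; rewrite /S big_ord0 subr0 expr0 mulr1 /e' mulrC divfK//.
(* An interval around x lies in the first k >= N open sets; each of them contributes slope 1 there,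
   and the later ones only add to it. *)
- move=> x N Zx; pose k := (Num.truncn N).+1.
  have Nk : N <= k%:R by apply: ltW; exact: truncnS_gt.
  have oI : open (\bigcap_(n in `I_k) O n).
    elim: k {Nk} => [|k IH]; first by rewrite II0 bigcap_set0; exact: openT.
    by rewrite IIS bigcap_setU bigcap_set1; exact: openI.
  have Ix : (\bigcap_(n in `I_k) O n) x by move=> n _; have [_ ZO _] := HO n; exact: ZO.
  have [d d0 Hd] := open_ball_sub oI Ix.
  exists d => // y z xy yz zx; apply: le_trans (hS k y z yz).
  have : forall j, (j <= k)%N -> S j z - S j y = j%:R * (z - y).
    elim=> [|j IH] jk; first by rewrite /S !big_ord0 subrr mul0r.
    have cf : cumulative (O j) z - cumulative (O j) y = z - y.
      apply: (cumulative_full (oO j) (muO j)) => // u /andP[yu uz].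
      by apply: (Hd u _ j) => //; apply/andP; split; lra.
    rewrite !SS opprD addrACA IH ?(ltnW jk)// cf -natr1; ring.
  move=> /(_ k (leqnn k)) ->.
  by rewrite ler_wpM2r// subr_ge0.
Qed.

End NullSets.

(** * Derivatives, combinations and regular distributions *)

Section Constructions.
Variable R : realType.
Implicit Types (f g phi psi : R -> R) (x y z s t l r a b c d e : R) (u v w W V : Defs.distribution R).
Notation mu := (@lebesgue_measure R).

Lemma derive1n_le_Cm_norm n j f x : test_function f -> (j <= n)%N ->
  `|derive1n j f x| <= Cm_norm n f.
Proof.
move=> tf jn; have sf := test_smooth tf; have [r r0 su] := test_supp_in tf.
have [_ bf] := bsmooth_supp sf su.
have ub i : `|derive1n i f x| <= sup (range (fun x => `|derive1n i f x|)).
  have [M HM] := bf i; apply: ub_le_sup; last by exists x.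
  by exists M => _ [y _ <-]; exact: HM.
have j1 : (j < n.+1)%N by [].
rewrite /Cm_norm (bigD1 (Ordinal j1))//=; apply: ler_wpDr; last exact: ub.
by apply: sumr_ge0 => i _; exact: le_trans (normr_ge0 _) (ub i).
Qed.

(** Linearity and continuity are asked on symmetric intervals only, with plain derivative bounds;
    the passage to arbitrary compact sets and to [Cm_norm] is made once here. *)
Lemma distribution_of (L : (R -> R) -> R) :
  (forall (k : R) f g r, 0 < r -> smooth f -> smooth g -> supp_in (- r) r f -> supp_in (- r) r g ->
     L (fun x => k * f x + g x) = k * L f + L g) ->
  (forall r, 0 < r -> exists (C : R) (n : nat), 0 <= C /\ forall f M, smooth f -> supp_in (- r) r f ->
     (forall j, (j <= n)%N -> forall x, `|derive1n j f x| <= M) -> `|L f| <= C * M) ->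
  exists w, forall f, w f = L f.
Proof.
move=> lin bnd.
have lin' (c : R) phi psi : test_function phi -> test_function psi ->
    L (fun x => c * phi x + psi x) = c * L phi + L psi.
  move=> tf tg; have [r r0 su] := test_supp_in tf; have [r' r0' su'] := test_supp_in tg.
  apply: (lin _ _ _ (Num.max r r')).
  - by rewrite lt_max r0.
  - exact: test_smooth tf.
  - exact: test_smooth tg.
  - by apply: supp_inW su; rewrite ?lerN2 le_max lexx.
  - by apply: supp_inW su'; rewrite ?lerN2 le_max lexx orbT.
have bnd' (K : set R) : compact K -> exists (C : R) (n : nat), forall phi,
    test_function phi -> fun_support phi `<=` K -> `|L phi| <= C * Cm_norm n phi.
  move=> cK; have [M [_ HM]] := compact_bounded cK.
  pose r := Num.max (M + 1) 1.
  have r0 : 0 < r by rewrite lt_max ltr01 orbT.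
  have Mr : M + 1 <= r by rewrite le_max lexx.
  have [C [n [C0 HC]]] := bnd r r0; exists C, n => phi tphi su.
  apply: HC; first exact: test_smooth.
  - move=> x xr; apply: fun_support_eq0 => /su Kx.
    have M1 : M < M + 1 by rewrite ltrDl.
    have := HM (M + 1) M1 x Kx; rewrite /= => /le_trans/(_ Mr); rewrite ler_norml => /andP[h1 h2].
    by move: xr; rewrite ltNge h1/= ltNge h2.
  - by move=> j jn x; exact: derive1n_le_Cm_norm.
by exists (Distribution lin' bnd').
Qed.

Lemma dderiv_exists W : exists w, forall f, w f = - W (derive1 f).
Proof.
apply: distribution_of => [k f g r r0 sf sg uf ug|r r0].
  rewrite (_ : derive1 _ = fun x => k * derive1 f x + derive1 g x).
    have sf' := smooth_derive1 sf; have sg' := smooth_derive1 sg.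
    rewrite (distributionZD (a := - r) (b := r) W k sf' sg' (supp_in_derive1 uf) (supp_in_derive1 ug)).
    by rewrite opprD mulrN.
  apply/funext => x; apply: is_derive_derive1; apply: is_deriveD_fun.
    by apply: is_deriveZ_fun; exact: smooth_is_derive.
  exact: smooth_is_derive.
have rr : - r <= r by lra.
have [C [n [C0 HC]]] := distribution_order W rr.
exists C, n.+1; split; first exact: ltW.
move=> f M sf su HM; rewrite normrN; apply: HC; [exact: smooth_derive1|exact: supp_in_derive1|].
by move=> j jn x _; rewrite -derive1Sn; exact: HM.
Qed.

Lemma dcomb_exists v w (k : R) : exists u, forall f, u f = v f + k * w f.
Proof.
apply: distribution_of => [c f g r r0 sf sg uf ug|r r0].
  rewrite (distributionZD v c sf sg uf ug) (distributionZD w c sf sg uf ug); ring.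
have rr : - r <= r by lra.
have [C [n [C0 HC]]] := distribution_order v rr.
have [C' [n' [C0' HC']]] := distribution_order w rr.
exists (C + `|k| * C'), (maxn n n'); split; first by rewrite addr_ge0 ?mulr_ge0// ltW.
move=> f M sf su HM; rewrite (le_trans (ler_normD _ _))// mulrDl lerD//.
  by apply: HC => // j jn x _; apply: HM; rewrite leq_max jn.
rewrite normrM -mulrA ler_wpM2l//.
by apply: HC' => // j jn x _; apply: HM; rewrite leq_max jn orbT.
Qed.

Let contM f g : continuous f -> continuous g -> continuous (fun x => f x * g x).
Proof. by move=> cf cg x; apply: cvgM; [exact: cf|exact: cg]. Qed.

Lemma supp_inMr a b f g : supp_in a b g -> supp_in a b (fun x => f x * g x).
Proof. by move=> su x /su ->; rewrite mulr0. Qed.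

Lemma regular_exists (h : R -> R) : continuous h ->
  exists w, forall f, w f = \int[mu]_x (h x * f x).
Proof.
move=> ch; apply: distribution_of => [c f g r r0 sf sg uf ug|r r0].
  have rr : - r <= r by lra.
  have cf := smooth_continuous sf; have cg := smooth_continuous sg.
  have su : supp_in (- r) r (fun x => c * f x + g x).
    by move=> x xr; rewrite uf// ug// mulr0 addr0.
  rewrite !(Rintegral_supp (a := - r) (b := r))//; try exact: supp_inMr.
  rewrite (@integral_cc_eq _ _ _ _ (fun x => c * (h x * f x) + h x * g x)); last by move=> x _; ring.
  rewrite integral_ccD; [|by apply: contM; [exact: cst_continuous|exact: contM]|exact: contM].
  by rewrite integral_ccZ//; exact: contM.
have rr : - r <= r by lra.
have [M M0 HM] := continuous_bounded (- r) r ch.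
exists (M * (r - - r)), 0%N; split; first by rewrite mulr_ge0 ?(ltW M0)//; lra.
move=> f B sf su HB; rewrite (Rintegral_supp rr (supp_inMr h su)) mulrAC.
apply: integral_cc_bound => //; first by apply: contM => //; exact: smooth_continuous.
by move=> x xr; rewrite normrM ler_pM// ?HM// (HB 0%N).
Qed.

Lemma integral_pull phi x t a b : smooth phi -> t != 0 -> a <= b ->
  integral_cc a b (fun y => phi ((y - x) / t)) = t * (primitive phi ((b - x) / t) - primitive phi ((a - x) / t)).
Proof.
move=> sp t0 ab.
have D y : is_derive y 1 (fun y => t * primitive phi ((y - x) / t)) (phi ((y - x) / t)).
  have Dp : is_derive ((y - x) / t) 1 (primitive phi) (phi ((y - x) / t)).
    apply: (@is_derive_primitive R phi (derive1 phi)); first exact/smooth_continuous/smooth_derive1.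
    by move=> z; exact: smooth_is_derive.
  by apply: is_derive_eq (is_deriveZ_fun t (is_derive_affine t0 Dp)) _; rewrite mulrA mulfV// mul1r.
rewrite (integral_cc_derive _ ab D) ?mulrBr//.
by apply: smooth_continuous; exact: smooth_affine_comp.
Qed.

Let N1_neq0 : - 1 != 0 :> R. Proof. by rewrite oppr_eq0 oner_eq0. Qed.

Lemma smooth_flip phi : smooth phi -> smooth (fun z => phi (- z)).
Proof.
move=> sp; have := @smooth_affine_comp R phi 0 (-1) N1_neq0 sp.
by under eq_fun do rewrite subr0 invrN1 mulrN1.
Qed.

Lemma supp_in_flip r phi : supp_in (- r) r phi -> supp_in (- r) r (fun z => phi (- z)).
Proof. by move=> su x xr; apply: su; rewrite ltrN2 ltrNr orbC. Qed.

Lemma integral_flip phi : test_function phi -> \int[mu]_x phi (- x) = \int[mu]_x phi x.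
Proof.
move=> tp; have sp := test_smooth tp; have [r r0 su] := test_supp_in tp.
have rr : - r <= r by lra.
rewrite (Rintegral_supp rr su) (Rintegral_supp rr (supp_in_flip su)).
have := @integral_pull phi 0 (-1) (- r) r sp N1_neq0 rr.
under [in X in X -> _]eq_fun do rewrite subr0 invrN1 mulrN1.
move=> ->; rewrite !subr0 invrN1 !mulrN1 opprK mulN1r opprB.
by rewrite primitiveB//; exact: smooth_continuous.
Qed.

(** A scale t < 0 is the scale - t with the reflected test function, whose integral is the same. *)
Lemma point_value_right W x l :
  (forall phi, test_function phi -> forall e, 0 < e -> exists2 d, 0 < d & forall t, 0 < t -> t < d ->
     `|dilate W x t phi - l * \int[mu]_y phi y| <= e) -> point_value W x l.
Proof.
move=> H phi tp; apply/cvgrPdist_le => e e0.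
have tp' : test_function (fun z => phi (- z)).
  have [r r0 su] := test_supp_in tp.
  by apply: (@supp_in_test R (- r) r); [exact/smooth_flip/test_smooth|exact: supp_in_flip].
have [d d0 Hd] := H phi tp e e0; have [d' d'0 Hd'] := H _ tp' e e0.
rewrite near_withinE; apply/nbhs_ballP; exists (Num.min d d'); first by rewrite /= lt_min d0.
move=> t; rewrite /ball/= sub0r normrN lt_min => /andP[td td'] t0.
rewrite distrC; have [tp0|tn|t00] := ltgtP 0 t.
- by move: td; rewrite gtr0_norm// => td; exact: Hd.
- move: td'; rewrite ltr0_norm// => td'.
  have t'0 : 0 < - t by rewrite oppr_gt0.
  have := Hd' (- t) t'0 td'; rewrite integral_flip// /dilate.
  by rewrite (_ : affine_pull x (- t) _ = affine_pull x t phi)//; apply/funext => y;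
    rewrite /affine_pull invrN mulrN opprK.
- by rewrite -t00 eqxx in t0.
Qed.

Lemma point_value_comb W V w x a b (k : R) : point_value W x a -> point_value V x b ->
  (forall f, w f = W f + k * V f) -> point_value w x (a + k * b).
Proof.
move=> pW pV wE phi tp; rewrite mulrDl -mulrA.
have -> : (fun t => `|t|^-1 * w (affine_pull x t phi)) = fun t =>
    `|t|^-1 * W (affine_pull x t phi) + k * (`|t|^-1 * V (affine_pull x t phi)).
  by apply/funext => t; rewrite wE; ring.
apply: cvgD; first exact: pW.
by apply: cvgM; [exact: cvg_cst|exact: pV].
Qed.

Lemma point_value_regular (h : R -> R) W x : continuous h ->
  (forall f, W f = \int[mu]_x (h x * f x)) -> point_value W x (h x).
Proof.
move=> ch WE; apply: point_value_right => phi tp e e0.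
have sp := test_smooth tp; have [r r0 su] := test_supp_in tp.
have rr : - r <= r by lra.
have cp := smooth_continuous sp.
have [M M0 HM] := continuous_bounded (- r) r cp.
pose e' := e / (M * (2 * r)); have e'0 : 0 < e' by rewrite divr_gt0// !mulr_gt0.
have := ch x => /cvgrPdist_le/(_ e' e'0)/nbhs_ballP[d /= d0 Hd].
exists (d / (2 * r)); first by rewrite divr_gt0// mulr_gt0.
move=> t t0; rewrite ltr_pdivlMr ?mulr_gt0// => td.
have tr0 : 0 < t * r by rewrite mulr_gt0.
have tn0 : t != 0 by rewrite gt_eqF.
have ab : x - t * r <= x + t * r by lra.
have sup : supp_in (x - t * r) (x + t * r) (affine_pull x t phi) by exact: supp_in_affine_pull.
have spull : smooth (affine_pull x t phi) by exact: smooth_affine_pull.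
have cpull := smooth_continuous spull.
have Iphi : integral_cc (x - t * r) (x + t * r) (affine_pull x t phi) = t * \int[mu]_y phi y.
  rewrite (Rintegral_supp rr su) /affine_pull (integral_pull x sp tn0 ab) -primitiveB//.
  by congr (_ * (primitive _ _ - primitive _ _)); field.
have chx : continuous (fun y => h y - h x).
  by move=> y; apply: cvgB; [exact: ch|exact: cvg_cst].
have -> : dilate W x t phi - h x * \int[mu]_y phi y =
   t^-1 * integral_cc (x - t * r) (x + t * r) (fun y => (h y - h x) * affine_pull x t phi y).
  rewrite /dilate WE (Rintegral_supp ab (supp_inMr h sup)).
  rewrite (@integral_cc_eq _ _ _ (fun y => (h y - h x) * affine_pull x t phi y)
    (fun y => h y * affine_pull x t phi y - h x * affine_pull x t phi y)); last by move=> y _; ring.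
  rewrite integral_ccB; [|exact: contM|by apply: contM => //; exact: cst_continuous].
  rewrite integral_ccZ// Iphi mulrBr; congr (_ - _).
  by rewrite mulrCA mulKf.
rewrite normrM (ger0_norm (x := t^-1)) ?invr_ge0 ?(ltW t0)// ler_pdivrMl//.
have -> : t * e = e' * M * (x + t * r - (x - t * r)).
  by rewrite /e'; field; rewrite !gt_eqF.
apply: integral_cc_bound => //; first exact: contM.
move=> y /andP[y1 y2]; rewrite normrM ler_pM//.
  by rewrite distrC; apply: Hd; rewrite /ball/= ltr_norml; apply/andP; split; lra.
apply: HM; rewrite ler_pdivlMr// ler_pdivrMr//; apply/andP; split; lra.
Qed.

(** By [mollifier_cfun_ge0] it suffices to test Gaussians k centred at some z, and there (h y - h z)
    k' y <= 0 for all y between A and B. Gaussians do not vanish at A and B, so T includes the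
    boundary terms; they are 0 for f. *)
Lemma stieltjes_ge0 (h : R -> R) (A B c d : R) f : continuous h ->
  (forall x y, A <= x -> x <= y -> y <= B -> h x <= h y) -> A < c -> c <= d -> d < B ->
  smooth f -> (forall x, 0 <= f x) -> supp_in c d f -> integral_cc A B (fun x => h x * derive1 f x) <= 0.
Proof.
move=> ch hmono Ac cd dB sf f0 su.
have AB : A <= B by lra.
pose T0 (f : R -> R) := integral_cc A B (fun x => h x * derive1 f x).
pose T f := (0 + -1 * T0 f) + h B * f B + - h A * f A.
have cT0 : cfun T0.
  split=> [k g g' sg sg'|].
    have dE : derive1 (fun x => k * g x + g' x) = fun x => k * derive1 g x + derive1 g' x.
      apply/funext => x; apply: is_derive_derive1; apply: is_deriveD_fun.
        by apply: is_deriveZ_fun; exact: smooth_is_derive.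
      exact: smooth_is_derive.
    have c1 := smooth_continuous (smooth_derive1 sg); have c2 := smooth_continuous (smooth_derive1 sg').
    rewrite /T0 dE (@integral_cc_eq _ _ _ _ (fun x => k * (h x * derive1 g x) + h x * derive1 g' x)); last by move=> x _; ring.
    rewrite integral_ccD; [|by apply: contM; [exact: cst_continuous|exact: contM]|exact: contM].
    by rewrite integral_ccZ//; exact: contM.
  have [M M0 HM] := continuous_bounded A B ch.
  exists (M * (B - A) + 1), (`|A| + `|B| + 1), 1%N; split.
  - by rewrite ltr_wpDl// mulr_ge0 ?(ltW M0)//; lra.
  - by rewrite ltr_wpDl// addr_ge0.
  move=> g N sg HN.
  have H x : A <= x <= B -> `|derive1 g x| <= N.
    move=> /andP[ax xb]; apply: (HN 1%N) => //.
    have := lexx `|A|; rewrite {1}ler_norml => /andP[a1 a2].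
    have := lexx `|B|; rewrite {1}ler_norml => /andP[b1 b2].
    have := normr_ge0 A; have := normr_ge0 B => *; apply/andP; split; lra.
  have N0 : 0 <= N by apply: le_trans (normr_ge0 _) (H A _); rewrite lexx.
  apply: (@le_trans _ _ (M * N * (B - A))).
    apply: integral_cc_bound => //; first by apply: contM => //; exact/smooth_continuous/smooth_derive1.
    by move=> x xI; rewrite normrM ler_pM// ?HM// H.
  by rewrite mulrAC ler_wpM2r// lerDl.
have c0 : cfun (fun _ : R -> R => 0 : R).
  split=> [k g g' _ _|]; first by rewrite mulr0 addr0.
  exists 1, 1, 0%N; split => // g M sg HM; rewrite normr0 mul1r.
  by apply: le_trans (normr_ge0 _) (HM 0%N _ 0 _) => //; rewrite lerN10 ler01.
have cT : cfun T by do 2 apply: cfun_eval; exact: cfun_comb.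
have : 0 <= T f.
  apply: (mollifier_cfun_ge0 cT (@mollifier_gaussCDF R) ltr01 _ sf f0 su) => t z t0 _ /andP[cz zd].
  have tn0 : t != 0 by rewrite gt_eqF.
  rewrite derive1_gaussCDF; pose k y := gauss 1 ((y - z) / t).
  have sk : smooth k by exact: smooth_gauss_pull.
  have ck' := smooth_continuous (smooth_derive1 sk).
  have k0 y : 0 <= k y by apply: ltW; exact: gauss1_gt0.
  have Ik : integral_cc A B (derive1 k) = k B - k A.
    exact: (integral_cc_derive ck' AB (fun y => smooth_is_derive y sk)).
  have chz : continuous (fun y => h y - h z).
    by move=> y; apply: cvgB; [exact: ch|exact: cvg_cst].
  have I0 : integral_cc A B (fun y => (h y - h z) * derive1 k y) <= 0.
    rewrite -oppr_ge0 -mulN1r -integral_ccZ; last exact: contM.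
    apply: integral_cc_ge0 => [|y /andP[Ay yB]].
      by apply: contM; [exact: cst_continuous|exact: contM].
    rewrite mulN1r -mulNr derive1_gauss_pull// (mulrA (- (h y - h z))); apply: mulr_ge0; last exact: k0.
    have ti : 0 <= t^-1 by rewrite invr_ge0 ltW.
    have [yz|yz] := leP y z.
      have hh : h y <= h z by apply: hmono => //; lra.
      by apply: mulr_ge0; [lra|do 2 (apply: mulr_ge0 => //); lra].
    have hh : h z <= h y by apply: hmono => //; lra.
    rewrite -mulrNN opprK; apply: mulr_ge0; first lra.
    by rewrite -!mulrN; do 2 (apply: mulr_ge0 => //); lra.
  have I1 : T0 k = integral_cc A B (fun y => (h y - h z) * derive1 k y) + h z * (k B - k A).
    rewrite -Ik -integral_ccZ// -integral_ccD; [|exact: contM|by apply: contM => //; exact: cst_continuous].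
    by apply: integral_cc_eq => y _; ring.
  rewrite -/k -[T k]/((0 + -1 * T0 k) + h B * k B + - h A * k A) I1.
  have hB : 0 <= (h B - h z) * k B by apply: mulr_ge0 => //; rewrite subr_ge0; apply: hmono => //; lra.
  have hA : 0 <= (h z - h A) * k A by apply: mulr_ge0 => //; rewrite subr_ge0; apply: hmono => //; lra.
  lra.
rewrite /T /T0 !su ?dB ?Ac ?orbT//; lra.
Qed.

End Constructions.

(** * Perturbation on a null set *)

Section PositivityOffNull.
Variable R : realType.
Implicit Types (f g phi psi : R -> R) (x y z s t l r a b c d e : R) (u v w W V : Defs.distribution R).
Notation mu := (@lebesgue_measure R).

Let contM f g : continuous f -> continuous g -> continuous (fun x => f x * g x).
Proof. by move=> cf cg x; apply: cvgM; [exact: cf|exact: cg]. Qed.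

(** Near x the measure dh dominates N dx, and over [x - t, x + t], of length 2t, the kernel is at
    least gauss 1 1. The plateau [be] restricts to the region of the slope bound; what it discards
    is nonnegative as h is increasing. *)
Lemma heat_growth (h chi : R -> R) (sd : Defs.distribution R) x d N :
  continuous h -> (forall y z, y <= z -> h y <= h z) ->
  (forall f, sd f = - \int[mu]_y (h y * derive1 f y)) ->
  test_function chi -> (forall y, 0 <= chi y) -> 0 < d ->
  (forall y, x - d <= y <= x + d -> chi y = 1) -> 0 <= N ->
  (forall y z, x - d <= y -> y <= z -> z <= x + d -> N * (z - y) <= h z - h y) ->
  forall t, 0 < t -> t <= d / 4 ->
    2 * N * gauss 1 1 <= t^-1 * sd (fun y => chi y * gauss 1 ((y - x) / t)).
Proof.
move=> ch hm sE tchi chi0 d0 chi1 N0 HN t t0 td; have tn0 : t != 0 by rewrite gt_eqF.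
pose g y := gauss 1 ((y - x) / t).
have sg : smooth g by exact: smooth_gauss_pull.
have g0 y : 0 <= g y by apply: ltW; exact: gauss1_gt0.
have d4 : 0 < d / 4 by rewrite divr_gt0.
pose be := plateau (x - d / 2) (x + d / 2) (d / 4).
have [sbe be01] : smooth01 be by exact: smooth01_plateau.
have ube : supp_in (x - 3 * (d / 4)) (x + 3 * (d / 4)) be.
  by apply: supp_inW; [| |exact: plateau_supp]; lra.
have be1 y : x - d / 4 <= y <= x + d / 4 -> be y = 1.
  by move=> /andP[y1 y2]; apply: plateau1 => //; apply/andP; split; lra.
have schi := test_smooth tchi; have [r r0 uchi] := test_supp_in tchi.
have be_chi y : be y <= chi y.
  have [yI|yI] := boolP (x - d <= y <= x + d); first by rewrite chi1//; have /andP[] := be01 y.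
  rewrite ube ?chi0//; move: yI; rewrite negb_and -!ltNge => /orP[]yI; apply/orP; [left|right]; lra.
have sbg : smooth (fun y => be y * g y) by exact: (@smoothM R be g sbe sg).
have scg : smooth (fun y => chi y * g y) by exact: (@smoothM R chi g schi sg).
have ubg : supp_in (x - 3 * (d / 4)) (x + 3 * (d / 4)) (fun y => be y * g y).
  by move=> y /ube ->; rewrite mul0r.
have sd_ge0 f r' : smooth f -> (forall y, 0 <= f y) -> 0 < r' -> supp_in (- r') r' f -> 0 <= sd f.
  move=> sf f0 r'0 uf; rewrite sE oppr_ge0.
  have rr : - (r' + 1) <= r' + 1 by lra.
  rewrite (Rintegral_supp rr); last first.
    apply: supp_inMr; apply: supp_in_derive1; apply: supp_inW uf; lra.
  by apply: (@stieltjes_ge0 R h _ _ (- r') r') => //; [move=> *; exact: hm|lra|lra|lra].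
pose r' := r + (`|x| + d).
have xr : - `|x| <= x <= `|x| by rewrite -ler_norml.
have /andP[xr1 xr2] := xr.
have r'0 : 0 < r' by rewrite /r'; have := normr_ge0 x; lra.
have step1 : sd (fun y => be y * g y) <= sd (fun y => chi y * g y).
  have ucg' : supp_in (- r') r' (fun y => chi y * g y).
    have H : supp_in (- r') r' chi by apply: supp_inW uchi; rewrite /r'; have := normr_ge0 x; lra.
    by move=> y /H ->; rewrite mul0r.
  have ubg' : supp_in (- r') r' (fun y => be y * g y).
    by apply: supp_inW ubg; rewrite /r'; lra.
  rewrite -subr_ge0 -(distributionB sd scg sbg ucg' ubg').
  apply: (sd_ge0 _ r' (smoothB scg sbg) _ r'0).
  - by move=> y; rewrite -mulrBl mulr_ge0// subr_ge0.
  - by move=> y H; rewrite ucg'// ubg'// subrr.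
rewrite -/g; apply: le_trans (ler_wpM2l _ step1); last by rewrite invr_ge0 ltW.
rewrite -(ler_pM2l t0) mulrA mulfV// mul1r.
have AB : x - d <= x + d by lra.
have cbg' := smooth_continuous (smooth_derive1 sbg).
have cid : continuous (fun y : R => N * y).
  by move=> y; apply: cvgM; [exact: cvg_cst|exact: cvg_id].
have := @stieltjes_ge0 R (fun y => h y - N * y) (x - d) (x + d) (x - 3 * (d / 4)) (x + 3 * (d / 4)) (fun y => be y * g y).
have chN : continuous (fun y => h y - N * y).
  by move=> y; apply: cvgB; [exact: ch|exact: cid].
move=> /(_ chN) H.
have {H} : integral_cc (x - d) (x + d) (fun y => (h y - N * y) * derive1 (fun y => be y * g y) y) <= 0.
  apply: H => //; [|lra|lra|lra|by move=> y; rewrite mulr_ge0//; have /andP[] := be01 y].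
  by move=> y z y1 yz z1; have := HN y z y1 yz z1; lra.
rewrite (@integral_cc_eq _ _ _ _ (fun y => h y * derive1 (fun y => be y * g y) y - N * (y * derive1 (fun y => be y * g y) y))); last first.
  by move=> y _; ring.
have cy : continuous (fun y => y * derive1 (fun y => be y * g y) y).
  by apply: contM => // y; exact: cvg_id.
rewrite integral_ccB; [|exact: contM|by apply: contM => //; exact: cst_continuous].
rewrite integral_ccZ//.
rewrite (integral_cc_parts AB (df := fun=> 1) _ cbg' (fun y => is_derive_id y 1) (fun y => smooth_is_derive y sbg)); last first.
  exact: cst_continuous.
have -> : be (x + d) * g (x + d) = 0 by rewrite ube ?mul0r//; apply/orP; right; lra.
have -> : be (x - d) * g (x - d) = 0 by rewrite ube ?mul0r//; apply/orP; left; lra.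
have -> : integral_cc (x - d) (x + d) (fun y => 1 * (be y * g y)) = integral_cc (x - d) (x + d) (fun y => be y * g y).
  by apply: integral_cc_eq => y _; rewrite mul1r.
rewrite !mulr0 subrr sub0r mulrN opprK => H.
rewrite sE (Rintegral_supp AB); last first.
  by apply: supp_inMr; apply: supp_in_derive1; apply: supp_inW ubg; lra.
have lower : t * (2 * gauss 1 1) <= integral_cc (x - d) (x + d) (fun y => be y * g y).
  have cbg := smooth_continuous sbg.
  rewrite (integral_cc_split (b := x - t) cbg); [|lra|lra].
  rewrite (integral_cc_split (a := x - t) (b := x + t) cbg); [|lra|lra].
  have h1 : 0 <= integral_cc (x - d) (x - t) (fun y => be y * g y).
    by apply: integral_cc_ge0 => // y _; rewrite mulr_ge0//; have /andP[] := be01 y.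
  have h2 : 0 <= integral_cc (x + t) (x + d) (fun y => be y * g y).
    by apply: integral_cc_ge0 => // y _; rewrite mulr_ge0//; have /andP[] := be01 y.
  have h3 : t * (2 * gauss 1 1) <= integral_cc (x - t) (x + t) (fun y => be y * g y).
    have -> : t * (2 * gauss 1 1) = integral_cc (x - t) (x + t) (fun=> gauss 1 1).
      by rewrite integral_cc_cst; [ring|lra].
    apply: integral_cc_le => //; first exact: cst_continuous.
    move=> y /andP[y1 y2]; rewrite be1; last by apply/andP; split; lra.
    rewrite mul1r; apply: gauss1_le; rewrite mulf_div ler_pdivrMr ?mulr_gt0// !mul1r.
    have : 0 <= (t - (y - x)) * (t + (y - x)) by rewrite mulr_ge0//; lra.
    by have -> : (t - (y - x)) * (t + (y - x)) = t * t - (y - x) * (y - x) by [ring]; rewrite subr_ge0.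
  lra.
have := ler_wpM2l N0 lower; lra.
Qed.

(** W is perturbed by H = h + e x. Off Z the averages are nonnegative only in the limit, and the
    slope e makes up for it; on Z the infinite slope of h outweighs the finite lower bound. Since H
    is O(e) on [a, b], e can then tend to 0. *)
Theorem nonneg_on_null w W chi p q (E Z : set R) : is_derivative w W -> lojasiewicz_distribution W ->
  test_function chi -> (forall x, 0 <= chi x) -> (forall x, p < x < q -> chi x = 1) ->
  countable E -> mu.-negligible Z ->
  (forall x, p < x < q -> ~ E x -> exists M, exists2 t0, 0 < t0 &
     forall t, 0 < t -> t < t0 -> - M <= heat (fun f => w (fun x => chi x * f x)) x t) ->
  (forall x, p < x < q -> ~ E x -> ~ Z x -> forall e, 0 < e -> exists2 t0, 0 < t0 &
     forall t, 0 < t -> t < t0 -> - e <= heat (fun f => w (fun x => chi x * f x)) x t) ->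
  nonneg_on w p q.
Proof.
move=> wW lW tchi chi0 chi1 cE nZ HE HZ psi spsi psi0 [a [b [pa bq su]]].
have [ab|ba] := leP a b; last first.
  rewrite distribution0//= => x; apply: su.
  by have [xa|ax] := ltP x a => //; rewrite (lt_le_trans ba)// orbT.
have [B B0 HB] := continuous_bounded a b (smooth_continuous (smooth_derive1 spsi)).
(* As |H| <= e (1 + |a| + |b|) on [a, b], e K bounds the pairing of H with psi'. *)
pose K := (1 + (`|a| + `|b|)) * B * (b - a).
have K0 : 0 <= K.
  by rewrite /K; apply: mulr_ge0; [apply: mulr_ge0; [have := normr_ge0 a; have := normr_ge0 b; lra|exact: ltW]|lra].
have g1 : 0 < gauss (1 : {poly R}) 1 by exact: gauss1_gt0.
apply/ler_addgt0Pr => e' e'0; pose e := e' / (K + 1).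
have e0 : 0 < e by rewrite divr_gt0//; lra.
have [h [ch hm hb hN]] := null_set_function nZ e0.
pose H x := h x + e * x.
have cH : continuous H.
  by move=> x; apply: cvgD; [exact: ch|apply: cvgM; [exact: cvg_cst|exact: cvg_id]].
have Hm y z : y <= z -> H y <= H z by move=> yz; rewrite lerD ?hm// ler_wpM2l// ltW.
have [G GE] := regular_exists cH; have [s sG] := dderiv_exists G.
have sE f : s f = - \int[mu]_y (H y * derive1 f y) by rewrite sG GE.
have [W1 W1E] := dcomb_exists W G 1; have [w1 w1E] := dcomb_exists w s 1.
have dw1 : is_derivative w1 W1.
  by move=> phi tphi; rewrite w1E W1E wW// sG; ring.
have lW1 : lojasiewicz_distribution W1.
  move=> x; have [l pv] := lW x; exists (l + 1 * H x).
  exact: (point_value_comb pv (point_value_regular cH GE) W1E).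
have heat1 x t : heat (fun f => w1 (fun x => chi x * f x)) x t =
    heat (fun f => w (fun x => chi x * f x)) x t + t^-1 * s (fun y => chi y * gauss 1 ((y - x) / t)).
  by rewrite /heat w1E; ring.
have pos x : p < x < q -> ~ E x -> exists2 t0, 0 < t0 & forall t, 0 < t -> t < t0 ->
    0 <= heat (fun f => w1 (fun x => chi x * f x)) x t.
  move=> /andP[px xq] nEx; have xI : p < x < q by rewrite px.
  pose d := Num.min (x - p) (q - x) / 2.
  have d0 : 0 < d by rewrite divr_gt0// lt_min !subr_gt0 px.
  have dp : d < x - p by rewrite /d ltr_pdivrMr//; have : Num.min (x - p) (q - x) <= x - p by [rewrite ge_min lexx]; lra.
  have dq : d < q - x by rewrite /d ltr_pdivrMr//; have : Num.min (x - p) (q - x) <= q - x by [rewrite ge_min lexx orbT]; lra.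
  clearbody d.
  have chid d' y : d' <= d -> x - d' <= y <= x + d' -> chi y = 1.
    by move=> dd /andP[y1 y2]; apply: chi1; apply/andP; split; lra.
  have [Zx|nZx] := pselect (Z x).
    have [M [t0 t00 Ht]] := HE x xI nEx.
    pose N := `|M| / (2 * gauss 1 1).
    have N0 : 0 <= N by rewrite divr_ge0// mulr_ge0// ltW.
    have [d1 d10 Hd1] := hN x N Zx.
    pose d2 := Num.min d d1; have d20 : 0 < d2 by rewrite lt_min d0.
    have d2d : d2 <= d by rewrite ge_min lexx.
    have d2d1 : d2 <= d1 by rewrite ge_min lexx orbT.
    exists (Num.min t0 (d2 / 4)); first by rewrite lt_min t00 divr_gt0.
    move=> t tp; rewrite lt_min => /andP[tt td]; rewrite heat1.
    have := @heat_growth H chi s x d2 N cH Hm sE tchi chi0 d20 (fun y => chid d2 y d2d) N0 _ t tp (ltW td).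
    have -> : 2 * N * gauss 1 1 = `|M| by rewrite /N; field; rewrite gt_eqF.
    have := Ht t tp tt; have := ler_norm M => h1 h2 h3.
    suff : `|M| <= t^-1 * s (fun y => chi y * gauss 1 ((y - x) / t)) by lra.
    apply: h3 => y z y1 yz z1; have := Hd1 y z; rewrite /H => h4.
    have {}h4 : N * (z - y) <= h z - h y by apply: h4; lra.
    have : 0 <= e * (z - y) by rewrite mulr_ge0 ?(ltW e0)// subr_ge0.
    lra.
  have e2 : 0 < 2 * e * gauss (1 : {poly R}) 1 by apply: mulr_gt0 => //; exact: mulr_gt0.
  have [t0 t00 Ht] := HZ x xI nEx nZx _ e2.
  exists (Num.min t0 (d / 4)); first by rewrite lt_min t00 divr_gt0.
  move=> t tp; rewrite lt_min => /andP[tt td]; rewrite heat1.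
  have := @heat_growth H chi s x d e cH Hm sE tchi chi0 d0 (fun y => chid d y (lexx d)) (ltW e0) _ t tp (ltW td).
  have := Ht t tp tt => h2 h3.
  suff : 2 * e * gauss 1 1 <= t^-1 * s (fun y => chi y * gauss 1 ((y - x) / t)) by lra.
  by apply: h3 => y z y1 yz z1; rewrite /H; have := hm y z yz; lra.
have := nonneg_on_countable dw1 lW1 tchi chi1 cE pos spsi psi0.
have ex : exists a b, [/\ p < a, b < q & supp_in a b psi] by exists a, b.
move=> /(_ ex); rewrite w1E mul1r sE (Rintegral_supp ab); last first.
  by apply: supp_inMr; exact: supp_in_derive1.
have cI : continuous (fun x => H x * derive1 psi x).
  by apply: contM => //; exact/smooth_continuous/smooth_derive1.
have : `|integral_cc a b (fun x => H x * derive1 psi x)| <= (e * (1 + (`|a| + `|b|))) * B * (b - a).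
  apply: integral_cc_bound => // x xI; rewrite normrM ler_pM// ?HB//.
  rewrite (le_trans (ler_normD _ _))// mulrDr mulr1 lerD//.
  rewrite normrM (gtr0_norm e0) ler_wpM2l ?(ltW e0)//.
  have := lexx `|a|; rewrite {1}ler_norml => /andP[a1 a2].
  have := lexx `|b|; rewrite {1}ler_norml => /andP[b1 b2].
  have /andP[x1 x2] := xI.
  rewrite ler_norml; have := normr_ge0 a; have := normr_ge0 b => *; apply/andP; split; lra.
have -> : e * (1 + (`|a| + `|b|)) * B * (b - a) = e * K by rewrite /K; ring.
have eK : e * K <= e'.
  by rewrite /e mulrAC ler_pdivrMr; [rewrite ler_wpM2l ?(ltW e'0)//; lra|lra].
rewrite ler_norml => /andP[h1 h2]; lra.
Qed.

End PositivityOffNull.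

(** * Comparison of major and minor pairs *)

Section MonotoneValues.
Variable R : realType.
Implicit Types (f g phi psi : R -> R) (x y z s t l r a b c d e : R) (u v w W V : Defs.distribution R).
Notation mu := (@lebesgue_measure R).

Lemma bump_translate_lim W x l s : point_value W x l ->
  forall e, 0 < e -> exists2 d, 0 < d & forall t, 0 < t -> t < d ->
    `|dilate W (x + s * t) t (@stepD R) - l| <= e.
Proof.
move=> pv e e0; pose phi := fun z => (@stepD R) ((z - s) / 1).
have sphi : smooth phi by apply: smooth_affine_comp; [exact: oner_neq0|exact: smooth_stepD].
have su : supp_in (s - 1) (s + 1) phi.
  move=> z H; rewrite /phi divr1 stepD_supp//.
  by case/orP: H => H; apply/orP; [left|right]; lra.
have tphi : test_function phi by exact: supp_in_test su.
have [d d0 Hd] := point_value_lim pv tphi e0.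
exists d => // t t0 td; have := Hd t t0 td; have tn0 : t != 0 by rewrite gt_eqF.
have ss : s - 1 <= s + 1 by lra.
have I1 : integral_cc (s - 1) (s + 1) phi = 1.
  by apply: (@integral_bump R (s - 1) (s + 1) s 1); rewrite ?ltr01.
rewrite (Rintegral_supp ss su) I1 mulr1 /dilate.
have -> : affine_pull x t phi = affine_pull (x + s * t) t (@stepD R).
  apply/funext => y; rewrite /affine_pull /phi; congr stepD.
  by field.
by [].
Qed.

(** Bumps of width t centred at p + 2t and q - 2t stay inside the interval, and 7t <= q - p keeps
    them apart. Off-centre averages have the same limits, by [bump_translate_lim]. *)
Lemma mono_value w W p q a b : is_derivative w W -> p < q -> nonneg_on w p q ->
  point_value W p a -> point_value W q b -> a <= b.
Proof.
move=> wW pq nn pa qb; apply/ler_addgt0Pr => e e0; have e2 : 0 < e / 2 by rewrite divr_gt0.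
have [d d0 Hd] := bump_translate_lim 2 pa e2; have [d' d'0 Hd'] := bump_translate_lim (-2) qb e2.
pose t := Num.min (Num.min d d') (q - p) / 7.
have m0 : 0 < Num.min (Num.min d d') (q - p) by rewrite !lt_min d0 d'0 subr_gt0.
have t0 : 0 < t by rewrite divr_gt0.
have tm : 7 * t = Num.min (Num.min d d') (q - p) by rewrite /t; field.
have td : t < d.
  have : Num.min (Num.min d d') (q - p) <= d by rewrite !ge_min lexx.
  lra.
have td' : t < d'.
  have : Num.min (Num.min d d') (q - p) <= d' by rewrite !ge_min lexx orbT.
  lra.
have tq : 7 * t <= q - p by rewrite tm ge_min lexx orbT.
clearbody t.
have : dilate W (p + 2 * t) t (@stepD R) <= dilate W (q + -2 * t) t (@stepD R).
  by clear Hd Hd'; apply: (dilate_bump_le wW nn t0 t0); [lra|lra|left; lra].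
have := Hd t t0 td; have := Hd' t t0 td'; clear Hd Hd'.
move: (dilate W (p + 2 * t) _ _) (dilate W (q + -2 * t) _ _) => X Y.
rewrite !ler_norml => /andP[h1 h2] /andP[h3 h4] h5; lra.
Qed.

(** A bump of width s < t at y, with |y - x| < t, lies between the bumps of width t at x - 3t and x
    + 3t. The outer averages are close to g x, and the inner one tends to g y as s tends to 0. *)
Lemma mono_value_continuous w W g : is_derivative w W -> (forall x, point_value W x (g x)) ->
  (forall p q, nonneg_on w p q) -> continuous g.
Proof.
move=> wW pv nn; apply: continuous_of_modulus => x e e0.
have e2 : 0 < e / 2 by rewrite divr_gt0.
have [d d0 Hd] := bump_translate_lim 3 (pv x) e2; have [d' d'0 Hd'] := bump_translate_lim (-3) (pv x) e2.
pose t := Num.min d d' / 2.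
have m0 : 0 < Num.min d d' by rewrite lt_min d0.
have t0 : 0 < t by rewrite divr_gt0.
have td : t < d by apply: (@lt_le_trans _ _ (Num.min d d')); [rewrite /t; lra|rewrite ge_min lexx].
have td' : t < d' by apply: (@lt_le_trans _ _ (Num.min d d')); [rewrite /t; lra|rewrite ge_min lexx orbT].
clearbody t; exists t => // y; rewrite ltr_norml => /andP[y1 y2].
have [d2 d20 Hd2] := bump_translate_lim 0 (pv y) e2.
pose s := Num.min d2 t / 2.
have m2 : 0 < Num.min d2 t by rewrite lt_min d20.
have s0 : 0 < s by rewrite divr_gt0.
have sd2 : s < d2 by apply: (@lt_le_trans _ _ (Num.min d2 t)); [rewrite /s; lra|rewrite ge_min lexx].
have st : s < t by apply: (@lt_le_trans _ _ (Num.min d2 t)); [rewrite /s; lra|rewrite ge_min lexx orbT].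
clearbody s.
have le1 : dilate W y s (@stepD R) <= dilate W (x + 3 * t) t (@stepD R).
  by apply: (@dilate_bump_le _ _ _ (x - 9 * t) (x + 9 * t) _ _ _ _ wW (nn _ _) s0 t0); [lra|lra|left; lra].
have le2 : dilate W (x + -3 * t) t (@stepD R) <= dilate W y s (@stepD R).
  clear le1.
  by apply: (@dilate_bump_le _ _ _ (x - 9 * t) (x + 9 * t) _ _ _ _ wW (nn _ _) t0 s0); [lra|lra|left; lra].
have h1 := Hd t t0 td; have h2 := Hd' t t0 td'.
have h3 := Hd2 s s0 sd2; rewrite mul0r addr0 in h3.
clear Hd Hd' Hd2; move: le1 le2 h1 h2 h3; move: (dilate W y _ _) (dilate W (x + 3 * t) _ _) (dilate W (x + -3 * t) _ _) => X Y Z.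
move=> le1 le2; rewrite !ler_norml => /andP[a1 a2] /andP[a3 a4] /andP[a5 a6].
apply/andP; split; lra.
Qed.

End MonotoneValues.

(** * Lower and upper values along the Gaussian *)

Section Comparison.
Variable R : realType.
Implicit Types (g phi psi : R -> R) (x y z s t l r a b c d e : R) (u v w U V W : Defs.distribution R)
  (f : R -> \bar R).
Notation mu := (@lebesgue_measure R).

Lemma limf_einf_gt (F : R -> R) (r : R) :
  (r%:E < limf_einf (fun t => (F t)%:E) (0 : R)^'+)%E ->
  exists2 d, 0 < d & forall t, 0 < t -> t < d -> r <= F t.
Proof.
rewrite limf_einfE => /ereal_sup_gt[_ [A A0 <-]] rA.
have : \forall t \near (0 : R)^'+, A t by [].
rewrite near_withinE => /nbhs_ballP[d /= d0 Hd]; exists d => // t t0 td.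
have At : A t by apply: Hd => //; rewrite /ball/= sub0r normrN gtr0_norm.
rewrite -lee_fin; apply: le_trans (ltW rA) _.
by apply: ereal_inf_lbound; exists t.
Qed.

Lemma le_limf_einf (F : R -> R) (r d : R) : 0 < d -> (forall t, 0 < t -> t < d -> r <= F t) ->
  (r%:E <= limf_einf (fun t => (F t)%:E) (0 : R)^'+)%E.
Proof.
move=> d0 H; rewrite limf_einfE.
apply: (@le_trans _ _ (ereal_inf ((fun t => (F t)%:E) @` [set t | 0 < t < d]))).
  by apply: le_ereal_inf_tmp => _ [t /andP[t0 td] <-]; rewrite lee_fin H.
apply: ereal_sup_ubound; exists [set t | 0 < t < d] => //.
rewrite /at_right; apply/nbhs_ballP; exists d => //= t; rewrite /ball/= sub0r normrN => td t0.
by rewrite t0 -(gtr0_norm t0).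
Qed.

Lemma limf_esup_lt (F : R -> R) (r : R) :
  (limf_esup (fun t => (F t)%:E) (0 : R)^'+ < r%:E)%E ->
  exists2 d, 0 < d & forall t, 0 < t -> t < d -> F t <= r.
Proof.
rewrite limf_esupE => /ereal_inf_lt[_ [A A0 <-]] rA.
have : \forall t \near (0 : R)^'+, A t by [].
rewrite near_withinE => /nbhs_ballP[d /= d0 Hd]; exists d => // t t0 td.
have At : A t by apply: Hd => //; rewrite /ball/= sub0r normrN gtr0_norm.
rewrite -lee_fin; apply: le_trans _ (ltW rA).
by apply: ereal_sup_ubound; exists t.
Qed.

(** Normalised so as to belong to T1; [heat] uses the bare kernel, which explains the factors
    [normal_peak 1] in the comparison. *)
Definition gaussian x : R := normal_peak 1 * gauss 1 x.

Lemma normal_peak1_gt0 : 0 < normal_peak (1 : R).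
Proof. by apply: normal_peak_gt0; rewrite oner_eq0. Qed.

Lemma smooth_gaussian : smooth gaussian.
Proof. by apply: smoothZ; exact: smooth_gauss. Qed.

Lemma T1_gaussian : T1 gaussian.
Proof.
have p0 := normal_peak1_gt0.
split; first split.
- exact: smooth_gaussian.
- by move=> x; apply: mulr_ge0; apply: ltW => //; exact: gauss1_gt0.
- rewrite -[RHS](integral_normal_pdf (0 : R) 1); apply: eq_integral => x _.
  rewrite normal_pdfE ?oner_eq0// /gaussian gauss1E; congr (_ * expR _)%:E.
  by rewrite subr0 expr1n expr2; field.
- exists (-2); split; first by rewrite ltrN2 ltr1n.
  move=> m; have [B B0 HB] := gauss_decay (iter m (@dgauss R) 1) (2 + m).
  exists (normal_peak 1 * B), 1; split => // x x1.
  have x0 : 0 < `|x| by exact: lt_le_trans x1.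
  rewrite /gaussian (derive1nZ _ m (@smooth_gauss R 1)) derive1n_gaussE normrM (gtr0_norm p0) -mulrA.
  rewrite ler_wpM2l ?(ltW p0)//.
  rewrite -opprD -natrD powRN powR_mulrn// ler_pdivlMr ?exprn_gt0// mulrC.
  exact: HB.
- move=> x /=; rewrite /gaussian.
  rewrite (@is_derive_derive1 _ _ _ _ (is_deriveZ_fun (normal_peak 1) (is_derive_gauss 1 x))).
  rewrite /gauss derivC sub0r mulr1 hornerN hornerX.
  set E := expR _; have E0 : 0 <= E by exact: expR_ge0.
  have -> : x * (normal_peak 1 * (- x * E)) = - (x ^+ 2 * (normal_peak 1 * E)) by ring.
  by rewrite oppr_le0 mulr_ge0 ?sqr_ge0// mulr_ge0// ltW.
Qed.

Lemma T0_gaussian : T0 gaussian. Proof. by have [] := T1_gaussian. Qed.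

Lemma countableU (A B : set R) : countable A -> countable B -> countable (A `|` B).
Proof. by move=> cA cB; rewrite -bigcup2E; apply: bigcup_countable => // -[|[|i]] _ /=. Qed.

Lemma cutoff_exists a b : a <= b -> exists chi : R -> R, exists O : set R,
  [/\ test_function chi, (forall x, 0 <= chi x), open O, `[a, b]%classic `<=` O & forall x, O x -> chi x = 1].
Proof.
move=> ab; exists (plateau (a - 2) (b + 2) (1 : R)), `]a - 1, b + 1[%classic; split.
- exact: test_plateau.
- by move=> x; have [_ /(_ x)/andP[]] := @smooth01_plateau R (a - 2) (b + 2) 1 ltr01.
- exact: interval_open.
- by move=> x /=; rewrite !in_itv/= => /andP[ax xb]; apply/andP; split; lra.
- by move=> x /=; rewrite in_itv/= => /andP[ax xb]; apply: plateau1 => //; apply/andP; split; lra.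
Qed.

Lemma E'W a b a' b' w : a' <= a -> b <= b' -> E' a b w -> E' a' b' w.
Proof.
move=> aa bb H x /H /=; rewrite !in_itv/= => /andP[ax xb].
by rewrite (le_trans aa ax) (le_trans xb bb).
Qed.

(** Off the countable sets the lower value of u is above -oo and the upper value of v below +oo, so
    the averages of u - v are bounded below; off the null sets f x separates the two values. The two
    intervals differ so that any major pair on [a, c] can meet a minor pair on [a, b]. *)
Theorem major_minor_nonneg a b c f u U v V w : a <= c -> c <= b ->
  major_pair a c f u U -> minor_pair a b f v V -> (forall g, w g = u g + -1 * v g) ->
  nonneg_on w a c.
Proof.
move=> ac cb [uE lU uU _ [E1 [Z1 [cE1 nZ1 HZ1 HE1]]]] [vE lV vV _ [E2 [Z2 [cE2 nZ2 HZ2 HE2]]]] wE.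
have ab : a <= b by exact: le_trans cb.
have [W WE] := dcomb_exists U V (-1).
have wW : is_derivative w W by move=> phi tphi; rewrite wE WE uU// vV//; ring.
have lW : lojasiewicz_distribution W.
  move=> x; have [l pl] := lU x; have [l' pl'] := lV x; exists (l + -1 * l').
  exact: point_value_comb pl pl' WE.
have [chi [ O [tchi chi0 oO abO chi1]]] := cutoff_exists ab.
have chiac x : a < x < c -> chi x = 1.
  by move=> /andP[ax xc]; apply: chi1; apply: abO; rewrite /= in_itv/= (ltW ax) (le_trans (ltW xc)).
have p0 := normal_peak1_gt0.
pose tu x t : R := `|t|^-1 * smooth_pairing u (affine_pull x t gaussian).
pose tv x t : R := `|t|^-1 * smooth_pairing v (affine_pull x t gaussian).
have heatE x t : 0 < t ->
    normal_peak 1 * heat (fun g => w (fun x => chi x * g x)) x t = tu x t - tv x t.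
  move=> t0; have tn0 : t != 0 by rewrite gt_eqF.
  have sp : smooth (affine_pull x t gaussian) by apply: smooth_affine_pull => //; exact: smooth_gaussian.
  have sg : smooth (fun y => gauss 1 ((y - x) / t)) by exact: smooth_gauss_pull.
  have pair w' : w' (fun y => chi y * affine_pull x t gaussian y) =
      normal_peak 1 * w' (fun y => chi y * gauss 1 ((y - x) / t)).
    have cT := cfun_localize w' tchi; rewrite -(cfunZ cT _ sg).
    by congr (w' _); apply/funext => y.
  rewrite /tu /tv (gtr0_norm t0).
  have acO : `[a, c]%classic `<=` O.
    by apply: subset_trans abO => y /=; rewrite !in_itv/= => /andP[-> yc]; rewrite (le_trans yc).
  rewrite (smooth_pairingE uE tchi oO acO chi1 sp) (smooth_pairingE vE tchi oO abO chi1 sp).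
  by rewrite !pair /heat wE; ring.
have lower x r : (r%:E < lower_value u gaussian x)%E ->
    exists2 d, 0 < d & forall t, 0 < t -> t < d -> r <= tu x t.
  exact: limf_einf_gt.
have upper x r : (upper_value v gaussian x < r%:E)%E ->
    exists2 d, 0 < d & forall t, 0 < t -> t < d -> tv x t <= r.
  exact: limf_esup_lt.
have key x r1 r2 : (r1%:E < lower_value u gaussian x)%E -> (upper_value v gaussian x < r2%:E)%E ->
    exists2 t0, 0 < t0 & forall t, 0 < t -> t < t0 ->
      - ((r2 - r1) / normal_peak 1) <= heat (fun g => w (fun x => chi x * g x)) x t.
  move=> /lower[d d0 Hd] /upper[d' d'0 Hd']; exists (Num.min d d'); first by rewrite lt_min d0.
  move=> t t0; rewrite lt_min => /andP[td td'].
  rewrite -(ler_pM2l p0) heatE// mulrN mulrC divfK ?gt_eqF//.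
  by have := Hd t t0 td; have := Hd' t t0 td'; move: (tu x t) (tv x t) => X Y h1 h2; lra.
have fin_lt (A : \bar R) : (-oo < A)%E -> exists r : R, (r%:E < A)%E.
  case: A => [r _||//]; first by exists (r - 1); rewrite lte_fin ltrBlDr ltrDl.
  by exists 0; rewrite ltry.
have fin_gt (A : \bar R) : (A < +oo)%E -> exists r : R, (A < r%:E)%E.
  case: A => [r _|//|]; first by exists (r + 1); rewrite lte_fin ltrDl.
  by exists 0; rewrite ltNyr.
have mem x : a < x < c -> `[a, c]%classic x /\ `[a, b]%classic x.
  by move=> /andP[ax xc]; rewrite /= !in_itv/= !(ltW ax) !(ltW xc) (le_trans (ltW xc)).
have lowE x : a < x < c -> ~ (E1 `|` E2) x -> (-oo < lower_value u gaussian x)%E.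
  by move=> /mem[m1 _] nE; apply: HE1 (T1_gaussian); split => // Ex; apply: nE; left.
have upE x : a < x < c -> ~ (E1 `|` E2) x -> (upper_value v gaussian x < +oo)%E.
  by move=> /mem[_ m2] nE; apply: HE2 (T1_gaussian); split => // Ex; apply: nE; right.
apply: (nonneg_on_null wW lW tchi chi0 chiac (countableU cE1 cE2) (negligibleU nZ1 nZ2)).
  move=> x xI nE; have [r1 h1] := fin_lt _ (lowE x xI nE); have [r2 h2] := fin_gt _ (upE x xI nE).
  by exists ((r2 - r1) / normal_peak 1); exact: key h1 h2.
move=> x xI nE nZ e e0; have [m1 m2] := mem x xI.
have fl : (f x <= lower_value u gaussian x)%E.
  by apply: HZ1 (T0_gaussian); split => // Zx; apply: nZ; left.
have uf : (upper_value v gaussian x <= f x)%E.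
  by apply: HZ2 (T0_gaussian); split => // Zx; apply: nZ; right.
have lo := lowE x xI nE; have up := upE x xI nE.
(* For finite f x both values are compared with it. If f x is +oo, so is the lower value of u, and
   r1 = r2 may be any real above the upper value of v; dually for -oo. *)
have [r1 [r2 [h1 h2 h12]]] : exists r1 r2 : R, [/\ (r1%:E < lower_value u gaussian x)%E,
    (upper_value v gaussian x < r2%:E)%E & r2 - r1 <= e * normal_peak 1].
  have ep : 0 < e * normal_peak 1 by rewrite mulr_gt0.
  move: fl uf; case: (f x) => [r||] fl uf.
  - exists (r - e * normal_peak 1 / 2), (r + e * normal_peak 1 / 2); split.
    + by apply: lt_le_trans fl; rewrite lte_fin; lra.
    + by apply: le_lt_trans uf _; rewrite lte_fin; lra.
    + lra.
  - have [r2 h2] := fin_gt _ up; exists r2, r2; split => //; last by rewrite subrr ltW.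
    by apply: lt_le_trans fl; rewrite ltry.
  - have [r1 h1] := fin_lt _ lo; exists r1, r1; split => //; last by rewrite subrr ltW.
    by apply: le_lt_trans uf _; rewrite ltNyr.
have [t0 t00 Ht] := key x r1 r2 h1 h2; exists t0 => // t tp tt.
apply: le_trans _ (Ht t tp tt); rewrite lerN2 ler_pdivrMr//.
Qed.

End Comparison.

(** * Truncation *)

Section Truncation.
Variable R : realType.
Implicit Types (g phi psi : R -> R) (x y z s t l r a b c d e : R) (u v w U V W : Defs.distribution R).
Notation mu := (@lebesgue_measure R).

(** The descent takes place in [-3, -1], strictly left of 0. So [fall c s] annihilates functions
    that vanish up to c, and for small s leaves unchanged those that vanish from some c - d on. *)
Definition falling z : R := 1 - ramp (-2) 1 z.

Lemma smooth_falling : smooth falling.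
Proof. exact: (@smoothB R (fun=> 1) (ramp (-2) 1) (@smooth_cst R 1) (@smooth_ramp R (-2) 1 ltr01)). Qed.

Lemma falling1 z : z <= -3 -> falling z = 1.
Proof. by move=> H; rewrite /falling ramp0 ?subr0//; lra. Qed.

Lemma falling0 z : -1 <= z -> falling z = 0.
Proof. by move=> H; rewrite /falling ramp1 ?subrr//; lra. Qed.

Lemma falling_bounded : bsmooth falling.
Proof.
split; first exact: smooth_falling.
have s' := smooth_derive1 smooth_falling.
have su : supp_in (-3) (-1) (derive1 falling).
  move=> z H; rewrite (_ : derive1 falling z = - derive1 (ramp (-2) 1) z).
    rewrite (ramp_derive_supp (m := -2) (ltr01 : (0 : R) < 1)) ?oppr0//.
    by case/orP: H => H; apply/orP; [left|right]; lra.
  apply: is_derive_derive1; rewrite -sub0r; apply: is_deriveB_fun.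
  exact/smooth_is_derive/smooth_ramp.
have [_ b'] := bsmooth_supp s' su.
case=> [|j].
  exists 1 => z /=; rewrite /falling; have /andP[h1 h2] := ramp01 (-2) 1 z.
  by rewrite ger0_norm; lra.
by have [M HM] := b' j; exists M => z; rewrite derive1Sn.
Qed.

Definition fall c s y : R := falling ((y - c) / s).

Lemma smooth_fall c s : s != 0 -> smooth (fall c s).
Proof. by move=> s0; apply: smooth_affine_comp => //; exact: smooth_falling. Qed.

Lemma fall1 c s y : 0 < s -> y <= c - 3 * s -> fall c s y = 1.
Proof. by move=> s0 H; apply: falling1; rewrite ler_pdivrMr//; lra. Qed.

Lemma fall0 c s y : 0 < s -> c - s <= y -> fall c s y = 0.
Proof. by move=> s0 H; apply: falling0; rewrite ler_pdivlMr//; lra. Qed.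

Lemma supp_in_mull a b g psi : supp_in a b psi -> supp_in a b (fun y => psi y * g y).
Proof. by move=> su y /su ->; rewrite mul0r. Qed.

Lemma test_mul psi g : test_function psi -> smooth g -> test_function (fun y => psi y * g y).
Proof.
move=> tp sg; have [r r0 su] := test_supp_in tp.
apply: (@supp_in_test R (- r) r); last exact: supp_in_mull.
exact: (@smoothM R psi g (test_smooth tp) sg).
Qed.

Section truncate.
Variables (W : Defs.distribution R) (c : R).
Hypothesis pv : point_value W c 0.

Let blowup psi s := fun z => psi (c + s * z).

(** Seen at scale s, the difference of the cut-offs is a function on [-3, 3] with bounds independent
    of s, times the blow-up of psi. The order at c that is uniform in the scale bounds its dilation,
    and undoing the factor s^-1 gives O(s). *)
Lemma fall_step : exists C m, 0 < C /\ forall psi (s s' M : R), test_function psi -> 0 < s' -> s' <= s ->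
  s <= 3 * s' -> s <= 1 ->
  (forall j, (j <= m)%N -> forall z, -3 <= z <= 3 -> `|derive1n j (blowup psi s) z| <= M) ->
  `|W (fun y => psi y * fall c s' y) - W (fun y => psi y * fall c s y)| <= C * M * s.
Proof.
have [C [m [C0 HC]]] := point_value_order pv (ltr0Sn R 2).
have [_ bf] := falling_bounded.
have [||B B0 HB] := @unif_nat R (fun j (B : R) => forall z, `|derive1n j falling z| <= B) m.
- by move=> j A A1 AB H y; exact: le_trans (H y) AB.
- by move=> j; exact: bf.
pose D := 3 ^+ m * B + B; have D0 : 0 < D by rewrite addr_gt0// mulr_gt0// exprn_gt0.
exists (C * (2 ^+ m * D)), m; split; first by rewrite !mulr_gt0// exprn_gt0.
move=> psi s s' M tpsi s'0 ss s3 s1 HM.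
have s0 : 0 < s by exact: lt_le_trans ss. have sn0 : s != 0 by rewrite gt_eqF.
have sn0' : s' != 0 by rewrite gt_eqF.
have spsi := test_smooth tpsi; have [r r0 su] := test_supp_in tpsi.
have [sb _] := derive1n_blowup c s 0 spsi.
pose F z := falling ((z - 0) / (s' / s)) - falling z.
have la0 : s' / s != 0 by rewrite mulf_neq0// invr_neq0.
have sF1 : smooth (fun z => falling ((z - 0) / (s' / s))) by exact: (@smooth_affine_comp R falling 0 (s' / s) la0 smooth_falling).
have sF : smooth F by exact: (@smoothB R _ falling sF1 smooth_falling).
have suF : supp_in (-3) 3 F.
  move=> z H; rewrite /F subr0 invf_div; have l1 : 1 <= s / s' by rewrite ler_pdivlMr// mul1r.
  case/orP: H => H.
    have h : z * (s / s') <= -3.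
      have : z * (s / s') <= z * 1 by rewrite ler_wnM2l//; lra.
      lra.
    by rewrite !falling1 ?subrr//; lra.
  have h : 0 <= z * (s / s') by rewrite mulr_ge0//; lra.
  by rewrite !falling0 ?subrr//; lra.
have M0 : 0 <= M by apply: le_trans (normr_ge0 _) (HM 0%N isT 0 _); apply/andP; split; lra.
have HF j : (j <= m)%N -> forall z, `|derive1n j F z| <= D.
  move=> jm z; rewrite (derive1nB j sF1 smooth_falling) (le_trans (ler_normB _ _))//.
  apply: lerD; last exact: HB.
  rewrite (derive1n_affine 0 j la0 smooth_falling) normrM ler_pM ?HB//.
  rewrite invf_div normrX ger0_norm ?divr_ge0 ?(ltW s0) ?(ltW s'0)//.
  apply: (@le_trans _ _ (3 ^+ j)); last by rewrite ler_weXn2l// ler1n.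
  by rewrite lerXn2r ?nnegrE ?divr_ge0 ?(ltW s0) ?(ltW s'0)// ler_pdivrMr.
pose G z := blowup psi s z * F z.
have sG : smooth G by exact: (@smoothM R _ F sb sF).
have suG : supp_in (-3) 3 G by move=> z /suF H; rewrite /G H mulr0.
have HG j : (j <= m)%N -> forall z, `|derive1n j G z| <= 2 ^+ m * (M * D).
  move=> jm z; have [zI|zI] := boolP (-3 <= z <= 3).
    apply: (@le_trans _ _ (2 ^+ j * (M * D))).
      apply: (leibniz_bound sb sF) => i ij; first by apply: HM zI; exact: leq_trans ij jm.
      by apply: HF; exact: leq_trans ij jm.
    by apply: ler_wpM2r; [rewrite mulr_ge0// ltW|rewrite ler_weXn2l// ler1n].
  rewrite (derive1n_supp j suG) ?normr0; last by move: zI; rewrite negb_and -!ltNge.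
  by apply: mulr_ge0; rewrite ?exprn_ge0// mulr_ge0// ltW.
have s01 : 0 < s <= 1 by rewrite s0.
have := HC G (2 ^+ m * (M * D)) s s01 sG suG HG.
have -> : dilate W c s G = s^-1 * (W (fun y => psi y * fall c s' y) - W (fun y => psi y * fall c s y)).
  have s1' : smooth (fun y => psi y * fall c s' y) by exact: (@smoothM R psi (fall c s') spsi (@smooth_fall c s' sn0')).
  have s2' : smooth (fun y => psi y * fall c s y) by exact: (@smoothM R psi (fall c s) spsi (@smooth_fall c s sn0)).
  rewrite -(distributionB W s1' s2' (supp_in_mull _ su) (supp_in_mull _ su)).
  congr (_ * W _); apply/funext => y; rewrite /affine_pull /G /F /blowup /fall mulrBr subr0.
  have -> : c + s * ((y - c) / s) = y by field.
  by have -> : (y - c) / s / (s' / s) = (y - c) / s' by [field; rewrite sn0'].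
rewrite normrM (ger0_norm (x := s^-1)) ?invr_ge0 ?(ltW s0)// ler_pdivrMl// => H.
by apply: le_trans H _; rewrite le_eqVlt; apply/orP; left; apply/eqP; ring.
Qed.

Let p3 k : 0 < 3^-1 ^+ k :> R. Proof. by rewrite exprn_gt0// invr_gt0. Qed.

Let p31 k : 3^-1 ^+ k <= 1 :> R.
Proof. by rewrite exprn_ile1// ?invr_ge0// invf_le1// ler1n. Qed.

Lemma blowup_bound psi s M m : smooth psi -> 0 <= s <= 1 ->
  (forall j, (j <= m)%N -> forall x, `|derive1n j psi x| <= M) ->
  forall j, (j <= m)%N -> forall z, -3 <= z <= 3 -> `|derive1n j (blowup psi s) z| <= M.
Proof.
move=> sp /andP[s0 s1] HM j jm z _; have [_ E] := derive1n_blowup c s j sp.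
rewrite /blowup E normrM normrX (ger0_norm s0).
apply: (@le_trans _ _ (1 * `|derive1n j psi (c + s * z)|)); last by rewrite mul1r; exact: HM.
by rewrite ler_wpM2r// exprn_ile1.
Qed.

Lemma pow3_between s : 0 < s -> s <= 1 -> exists k, 3^-1 ^+ k <= s /\ s <= 3 * 3^-1 ^+ k.
Proof.
move=> s0 s1.
have ex : exists k, (3^-1 ^+ k <= s).
  apply: contrapT => H; have : s <= 0.
    apply: (@geometric_le _ _ _ 1) => k; rewrite add0r mul1r leNgt; apply/negP => K.
    by apply: H; exists k; exact: ltW.
  lra.
case: (ex_minnP ex) => -[|k] Hk mk.
  by exists 0%N; split => //; rewrite expr0; lra.
exists k.+1; split => //; rewrite leNgt; apply/negP => K.
have : (k.+1 <= k)%N.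
  apply: mk; apply: ltW; apply: le_lt_trans K.
  by rewrite exprS mulrA mulfV ?mul1r// pnatr_eq0.
by rewrite ltnn.
Qed.

(** The rate is part of the notion, so that uniqueness and linearity reduce to [geometric_le]. *)
Definition fall_limit psi (L : R) := exists A, forall k, `|L - W (fun y => psi y * fall c (3^-1 ^+ k) y)| <= A * 3^-1 ^+ k.

Lemma fall_limit_unique psi L L' : fall_limit psi L -> fall_limit psi L' -> L = L'.
Proof.
move=> [A HA] [A' HA']; apply/eqP; rewrite eq_le; apply/andP; split;
  apply: (@geometric_le _ _ _ (A + A')) => k; have := HA k; have := HA' k;
  rewrite !ler_norml mulrDl => /andP[h1 h2] /andP[h3 h4]; lra.
Qed.

(** Along s = 3^-k the increments are geometric by [fall_step]. The last clause is uniform in psi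
    and bounds the blow-ups only at scales up to si: it is meant for rescaled test functions of
    width t, with si = t, and yields the point value of the truncation at c. *)
Lemma truncation_exists : exists (Wt : Defs.distribution R) (K : R) (m : nat), 0 < K /\
  (forall psi, test_function psi -> fall_limit psi (Wt psi)) /\
  (forall psi si M s, test_function psi -> si <= 1 ->
    (forall s, 0 < s -> s <= si -> forall j, (j <= m)%N -> forall z, -3 <= z <= 3 -> `|derive1n j (blowup psi s) z| <= M) ->
    0 < s -> s <= si -> `|Wt psi - W (fun y => psi y * fall c s y)| <= K * M * s).
Proof.
have [C [m [C0 HC]]] := fall_step.
have cauchy psi si M k : test_function psi -> si <= 1 -> 3^-1 ^+ k <= si ->
    (forall s, 0 < s -> s <= si -> forall j, (j <= m)%N -> forall z, -3 <= z <= 3 -> `|derive1n j (blowup psi s) z| <= M) ->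
    exists l, forall i, `|l - W (fun y => psi y * fall c (3^-1 ^+ (i + k)) y)| <= 2 * (C * M * 3^-1 ^+ k) * 3^-1 ^+ i.
  move=> tpsi si1 ksi HM.
  apply: (@geometric_limit R (fun i => W (fun y => psi y * fall c (3^-1 ^+ (i + k)) y))) => i.
  have E : C * M * 3^-1 ^+ k * 3^-1 ^+ i = C * M * 3^-1 ^+ (i + k) by rewrite exprD; ring.
  have ik : 3^-1 ^+ (i + k) <= si.
    by apply: le_trans ksi; rewrite exprD ler_piMl// ltW.
  rewrite E; apply: HC => //; first by rewrite addSn exprS ler_piMl ?(ltW (p3 _))// invf_le1// ler1n.
    by rewrite addSn exprS mulrA mulfV ?mul1r// pnatr_eq0.
  by apply: HM.
have bound psi : test_function psi -> exists M, forall s, 0 < s -> s <= 1 -> forall j, (j <= m)%N ->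
    forall z, -3 <= z <= 3 -> `|derive1n j (blowup psi s) z| <= M.
  move=> tpsi; have spsi := test_smooth tpsi; have [r r0 su] := test_supp_in tpsi.
  have [_ bp] := bsmooth_supp spsi su.
  have [||M M0 HM] := @unif_nat R (fun j (B : R) => forall z, `|derive1n j psi z| <= B) m.
  - by move=> j A A1 AB H y; exact: le_trans (H y) AB.
  - by move=> j; exact: bp.
  by exists M => s s0 s1; apply: blowup_bound => //; rewrite (ltW s0).
have lim_ex psi : exists L, test_function psi -> fall_limit psi L.
  have [tpsi|] := pselect (test_function psi); last by exists 0.
  have [M HM] := bound psi tpsi.
  have [L HL] := cauchy psi 1 M 0%N tpsi (lexx 1) (p31 0) HM.
  exists L => _; exists (2 * (C * M)) => k; have := HL k.
  by rewrite addn0 expr0 mulr1.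
have [L HL] := choice lim_ex.
have close psi si M s : test_function psi -> si <= 1 ->
    (forall s, 0 < s -> s <= si -> forall j, (j <= m)%N -> forall z, -3 <= z <= 3 -> `|derive1n j (blowup psi s) z| <= M) ->
    0 < s -> s <= si -> `|L psi - W (fun y => psi y * fall c s y)| <= 3 * C * M * s.
  move=> tpsi si1 HM s0 ssi.
  have [k [k1 k2]] := pow3_between s0 (le_trans ssi si1).
  have ksi : 3^-1 ^+ k <= si by exact: le_trans ssi.
  have M0 : 0 <= M.
    by apply: le_trans (normr_ge0 _) (HM s s0 ssi 0%N isT 0 _); apply/andP; split; lra.
  have [l Hl] := cauchy psi si M k tpsi si1 ksi HM.
  (* l is the limit of the sequence shifted by k; the finitely many indices below k are absorbed by
     constants with a factor 3^k. *)
  have lL : l = L psi.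
    apply: (@fall_limit_unique psi); last exact: HL.
    have [A HA] := HL psi tpsi.
    exists (A + 2 * (C * M * 3^-1 ^+ k) * (3 ^+ k) + `|l - L psi| * 3 ^+ k) => i.
    have [ki|ik] := leqP k i.
      have := Hl (i - k)%N; rewrite subnK// => /le_trans; apply.
      have -> : 3^-1 ^+ (i - k) = 3^-1 ^+ i * 3 ^+ k :> R.
        rewrite -{2}(subnK ki) exprD -mulrA -exprMn mulVf ?expr1n ?mulr1// pnatr_eq0.
      have A0 : 0 <= A.
        by have := le_trans (normr_ge0 _) (HA 0%N); rewrite expr0 mulr1.
      rewrite mulrDl mulrDl.
      have h1 : 0 <= A * 3^-1 ^+ i by rewrite mulr_ge0// ltW.
      have h2 : 0 <= `|l - L psi| * 3 ^+ k * 3^-1 ^+ i by rewrite !mulr_ge0 ?exprn_ge0// ltW.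
      lra.
    have -> : l - W (fun y => psi y * fall c (3^-1 ^+ i) y) = (l - L psi) + (L psi - W (fun y => psi y * fall c (3^-1 ^+ i) y)) by ring.
    rewrite (le_trans (ler_normD _ _))//.
    have h1 := HA i.
    have h2 : `|l - L psi| <= `|l - L psi| * 3 ^+ k * 3^-1 ^+ i.
      rewrite -mulrA ler_peMr// -(subnK (ltnW ik)) exprD -mulrA -exprMn mulfV ?expr1n ?mulr1 ?pnatr_eq0//.
      by rewrite exprn_ege1// ler1n.
    have h3 : 0 <= 2 * (C * M * 3^-1 ^+ k) * 3 ^+ k * 3^-1 ^+ i.
      by rewrite !mulr_ge0 ?exprn_ge0 ?(ltW C0) ?(ltW (p3 _)).
    rewrite !mulrDl; lra.
  have h1 : `|L psi - W (fun y => psi y * fall c (3^-1 ^+ k) y)| <= 2 * (C * M * 3^-1 ^+ k).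
    by have := Hl 0%N; rewrite add0n expr0 mulr1 lL.
  have h2 : `|W (fun y => psi y * fall c (3^-1 ^+ k) y) - W (fun y => psi y * fall c s y)| <= C * M * s.
    by apply: HC => //; [exact: le_trans si1|exact: HM].
  have h3 : C * M * 3^-1 ^+ k <= C * M * s by apply: ler_wpM2l => //; rewrite mulr_ge0// ltW.
  have -> : L psi - W (fun y => psi y * fall c s y) = (L psi - W (fun y => psi y * fall c (3^-1 ^+ k) y)) +
     (W (fun y => psi y * fall c (3^-1 ^+ k) y) - W (fun y => psi y * fall c s y)) by ring.
  by rewrite (le_trans (ler_normD _ _))// (le_trans (lerD h1 h2))//; lra.
have [Wt WtE] : exists w, forall f, w f = L f.
  apply: distribution_of => [k f g r r0 sf sg uf ug|r r0].
    have tf := supp_in_test sf uf; have tg := supp_in_test sg ug.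
    have th : test_function (fun x => k * f x + g x).
      apply: (@supp_in_test R (- r) r); first exact: (@smoothD R (fun x => k * f x) g (@smoothZ R k f sf) sg).
      by move=> x xr; rewrite uf// ug// mulr0 addr0.
    apply: (@fall_limit_unique (fun x => k * f x + g x)); first exact: HL.
    have [A HA] := HL f tf; have [A' HA'] := HL g tg.
    exists (`|k| * A + A') => i.
    have sn0 : 3^-1 ^+ i != 0 :> R by rewrite gt_eqF.
    have sfa := @smooth_fall c _ sn0.
    have s1 : smooth (fun y => f y * fall c (3^-1 ^+ i) y) by exact: (@smoothM R f (fall c _) sf sfa).
    have s2 : smooth (fun y => g y * fall c (3^-1 ^+ i) y) by exact: (@smoothM R g (fall c _) sg sfa).
    have -> : (fun y => (k * f y + g y) * fall c (3^-1 ^+ i) y) =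
       (fun y => k * (f y * fall c (3^-1 ^+ i) y) + g y * fall c (3^-1 ^+ i) y).
      by apply/funext => y; ring.
    rewrite (distributionZD W k s1 s2 (supp_in_mull _ uf) (supp_in_mull _ ug)).
    have -> (X Y : R) : k * L f + L g - (k * X + Y) = k * (L f - X) + (L g - Y) by ring.
    rewrite (le_trans (ler_normD _ _))// mulrDl lerD// normrM -mulrA ler_wpM2l//; exact: HA.
  have rr : - r <= r by lra.
  have [C' [n [C'0 HC']]] := distribution_order W rr.
  have [_ bf] := falling_bounded.
  have [||B B0 HB] := @unif_nat R (fun j (B : R) => forall z, `|derive1n j falling z| <= B) n.
  - by move=> j A A1 AB H y; exact: le_trans (H y) AB.
  - by move=> j; exact: bf.
  exists (3 * C + C' * (2 ^+ n * B)), (maxn m n); split.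
    by rewrite addr_ge0 ?mulr_ge0 ?exprn_ge0// ltW.
  move=> f M sf su HM; have tf := supp_in_test sf su.
  have sfa := @smooth_fall c 1 (oner_neq0 R).
  have s1 : smooth (fun y => f y * fall c 1 y) by exact: (@smoothM R f (fall c _) sf sfa).
  have h1 : `|L f - W (fun y => f y * fall c 1 y)| <= 3 * C * M * 1.
    apply: (close f 1 M 1) => // s s0 s1'; apply: blowup_bound => //; first by rewrite (ltW s0).
    by move=> j jm; apply: HM; rewrite leq_max jm.
  have M0 : 0 <= M by exact: le_trans (normr_ge0 _) (HM 0%N isT 0).
  have h2 : `|W (fun y => f y * fall c 1 y)| <= C' * (2 ^+ n * (M * B)).
    apply: HC' => //; first exact: supp_in_mull.
    move=> j jn x _; apply: (@le_trans _ _ (2 ^+ j * (M * B))).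
      apply: leibniz_bound => // i ij.
        by apply: HM; rewrite leq_max (leq_trans ij jn) orbT.
      rewrite (derive1n_affine c i (oner_neq0 R) smooth_falling) invr1 expr1n mul1r.
      by apply: HB; exact: leq_trans ij jn.
    by apply: ler_wpM2r; [rewrite mulr_ge0// ltW|rewrite ler_weXn2l// ler1n].
  have -> : L f = (L f - W (fun y => f y * fall c 1 y)) + W (fun y => f y * fall c 1 y) by ring.
  by rewrite (le_trans (ler_normD _ _))// (le_trans (lerD h1 h2))//; lra.
exists Wt, (3 * C), m; split; first by rewrite mulr_gt0.
split=> [psi tpsi|psi si M s tpsi si1 HM s0 ssi]; rewrite WtE; first exact: HL.
exact: (@close psi si M s).
Qed.

End truncate.
End Truncation.

(** * Locality of lower values, and truncation of major pairs *)

Section Locality.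
Variable R : realType.
Implicit Types (g phi psi : R -> R) (x y z s t l r a b c d e h : R) (u v w U V W : Defs.distribution R)
  (f : R -> \bar R).
Notation mu := (@lebesgue_measure R).

Lemma powR_decay_small (p e : R) : p < 0 -> 0 < e -> exists2 Z, 0 < Z & forall z, Z <= z -> z `^ p <= e.
Proof.
move=> p0 e0; exists (e `^ p^-1); first exact: powR_gt0.
move=> z Zz; have Z0 : 0 < e `^ p^-1 by exact: powR_gt0.
have z0 : 0 < z by exact: lt_le_trans Zz.
have -> : e = (e `^ p^-1) `^ p by rewrite -powRrM mulVf ?lt_eqF// powRr1// ltW.
have np : 0 <= - p by lra.
rewrite -[p]opprK !(powRN _ (- p)) lef_pV2 ?posrE ?powR_gt0// opprK.
by apply: (ge0_ler_powR np); rewrite // nnegrE ltW.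
Qed.

(** With z = |x| / t one has t^-1 <= z / h, so the quantity is at most a constant times z^(j+1)
    z^(alpha - j) = z^(1 + alpha), and alpha < -1. *)
Lemma T0_tail phi h : T0 phi -> 0 < h -> forall (j : nat) k, 0 < k ->
  exists2 t1, 0 < t1 & forall t x, 0 < t -> t < t1 -> h <= `|x| ->
    t^-1 ^+ j.+1 * `|derive1n j phi (x / t)| <= k.
Proof.
move=> [sphi _ _ [al [al1 H]]] h0 j k k0; have [C [M [M0 HC]]] := H j.
have hj : 0 < h ^- j.+1 by rewrite invr_gt0 exprn_gt0.
have C0 : 0 < `|C| + 1 by have := normr_ge0 C; lra.
have k'0 : 0 < k / ((`|C| + 1) * h ^- j.+1) by rewrite divr_gt0// mulr_gt0.
have al0 : 1 + al < 0 by lra.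
have [Z Z0 HZ] := powR_decay_small al0 k'0.
pose m := Num.max M Z; have m0 : 0 < m by rewrite lt_max M0.
exists (h / m); first exact: divr_gt0.
move=> t x t0; rewrite ltr_pdivlMr// => tm hx.
have z0 : 0 < `|x| / t by rewrite divr_gt0// (lt_le_trans h0).
have mz : m <= `|x| / t by rewrite ler_pdivlMr// mulrC (le_trans (ltW tm)).
have Mz : M <= `|x / t| by rewrite normrM normfV (gtr0_norm t0) (le_trans _ mz)// le_max lexx.
have Zz : Z <= `|x| / t by rewrite (le_trans _ mz)// le_max lexx orbT.
have := HC _ Mz; rewrite normrM normfV (gtr0_norm t0); set z := `|x| / t => Hphi.
have tz : t^-1 <= z / h by rewrite ler_pdivlMr// mulrC /z ler_wpM2r// invr_ge0 ltW.
have ti : 0 <= t^-1 by rewrite invr_ge0 ltW.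
apply: (@le_trans _ _ ((z / h) ^+ j.+1 * ((`|C| + 1) * z `^ (al - j%:R)))).
  apply: ler_pM => //; first exact: exprn_ge0.
    by rewrite lerXn2r// nnegrE divr_ge0 ?(ltW z0) ?(ltW h0).
  apply: le_trans Hphi _; rewrite ler_wpM2r ?powR_ge0//.
  by have := ler_norm C; lra.
have -> : (z / h) ^+ j.+1 * ((`|C| + 1) * z `^ (al - j%:R)) =
    (`|C| + 1) * h ^- j.+1 * z `^ (1 + al).
  have -> : z `^ (1 + al) = z ^+ j.+1 * z `^ (al - j%:R).
    rewrite -powR_mulrn ?(ltW z0)// -powRD; last by rewrite (gt_eqF z0) implybT.
    by congr (_ `^ _); rewrite -natr1; ring.
  by rewrite exprMn exprVn; ring.
have := HZ z Zz; rewrite ler_pdivlMr ?mulr_gt0// mulrC => /le_trans; apply.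
exact: lexx.
Qed.

Lemma ereal_le_approx (A B : \bar R) :
  (forall r e : R, (r%:E < A)%E -> 0 < e -> ((r - e)%:E <= B)%E) -> (A <= B)%E.
Proof.
case: A => [a| |] H; last exact: leNye.
- case: B H => [b| |] H; rewrite ?leey//.
    rewrite lee_fin; apply/ler_addgt0Pr => e e0.
    have e2 : 0 < e / 2 by rewrite divr_gt0.
    have := H (a - e / 2) (e / 2); rewrite lte_fin lee_fin => K.
    have : a - e / 2 - e / 2 <= b by apply: K => //; lra.
    lra.
  by have := H (a - 1) 1; rewrite lte_fin => /(_ _ ltr01); apply; lra.
- case: B H => [b| |] H //.
    by have := H (b + 2) 1 (ltry _) ltr01; rewrite lee_fin => K; exfalso; lra.
  by have := H 0 1 (ltry _) ltr01.
Qed.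

Lemma limf_einf_close (F G : R -> R) :
  (forall e, 0 < e -> exists2 d, 0 < d & forall t, 0 < t -> t < d -> `|F t - G t| <= e) ->
  (limf_einf (fun t => (F t)%:E) (0 : R)^'+ <= limf_einf (fun t => (G t)%:E) (0 : R)^'+)%E.
Proof.
move=> H; apply: ereal_le_approx => r e /limf_einf_gt[d d0 Hd] e0.
have [d' d'0 Hd'] := H e e0.
apply: (@le_limf_einf _ _ _ (Num.min d d')); first by rewrite lt_min d0.
move=> t t0; rewrite lt_min => /andP[td td'].
by have := Hd t t0 td; have := Hd' t t0 td'; rewrite ler_norml => /andP[h1 h2] h3; lra.
Qed.

(** The difference of u and v ignores functions supported near x, and by [far_pull] the part of the
    kernel away from x vanishes in the limit although phi has no compact support. *)
Lemma lower_value_local a b u v phi x d : a <= b -> E' a b u -> E' a b v -> T0 phi -> 0 < d ->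
  (forall psi, smooth psi -> supp_in (x - d) (x + d) psi -> u psi = v psi) ->
  (lower_value u phi x <= lower_value v phi x)%E.
Proof.
move=> ab uE vE Tphi d0 uv; have [sphi _ _ _] := Tphi.
have [chi [ O [tchi chi0 oO abO chi1]]] := cutoff_exists ab.
have schi := test_smooth tchi.
apply: limf_einf_close => e e0.
pose D g := u (fun y => chi y * g y) + -1 * v (fun y => chi y * g y).
have cD : cfun D by apply: cfun_comb; exact: cfun_localize.
have D0 g : smooth g -> supp_in (x - d) (x + d) g -> D g = 0.
  move=> sg su; rewrite /D (uv _ (@smoothM R chi g schi sg) (supp_inMr chi su)).
  by rewrite mulN1r subrr.
have d4 : 0 < d / 4 by rewrite divr_gt0.
pose be := plateau (x - d / 2) (x + d / 2) (d / 4).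
have [sbe be01] : smooth01 be by exact: smooth01_plateau.
have ube : supp_in (x - d) (x + d) be.
  by apply: supp_inW; [| |exact: plateau_supp]; lra.
have sF : smooth (fun y => 1 - be y) by exact: (@smoothB R (fun=> 1) be (@smooth_cst R 1) sbe).
have F0 y : x - d / 4 < y < x + d / 4 -> 1 - be y = 0.
  by move=> /andP[y1 y2]; rewrite /be plateau1 ?subrr//; apply/andP; split; lra.
have [t1 t10 Ht] := far_pull cD sF sphi (T0_tail Tphi d4) F0 e0.
exists t1 => // t t0 tt; have tn0 : t != 0 by rewrite gt_eqF.
have sp : smooth (affine_pull x t phi) by exact: smooth_affine_pull.
rewrite (smooth_pairingE uE tchi oO abO chi1 sp) (smooth_pairingE vE tchi oO abO chi1 sp).
have xI : x - d / 4 + d / 4 <= x <= x + d / 4 - d / 4 by rewrite subrK addrK lexx.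
have := Ht x t xI t0 tt; rewrite (gtr0_norm t0) -mulrBr.
have -> : u (fun y => chi y * affine_pull x t phi y) - v (fun y => chi y * affine_pull x t phi y) = D (affine_pull x t phi).
  by rewrite /D mulN1r.
have s1 : smooth (fun y => be y * affine_pull x t phi y) by exact: (@smoothM R be _ sbe sp).
have s2 : smooth (fun y => (1 - be y) * affine_pull x t phi y) by exact: (@smoothM R (fun y => 1 - be y) _ sF sp).
have -> : D (affine_pull x t phi) = D (fun y => be y * affine_pull x t phi y) + D (fun y => (1 - be y) * affine_pull x t phi y).
  by rewrite -(cfunD cD s1 s2); congr (D _); apply/funext => y; ring.
by rewrite (D0 _ s1) ?add0r//; exact: supp_in_mull.
Qed.

Lemma point_value_local W V x l d : 0 < d ->
  (forall psi, smooth psi -> supp_in (x - d) (x + d) psi -> W psi = V psi) ->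
  point_value W x l -> point_value V x l.
Proof.
move=> d0 WV pv; apply: point_value_right => phi tphi e e0.
have [r r0 su] := test_supp_in tphi; have sphi := test_smooth tphi.
have [d' d'0 Hd'] := point_value_lim pv tphi e0.
exists (Num.min d' (d / r)); first by rewrite lt_min d'0 divr_gt0.
move=> t t0; rewrite lt_min => /andP[td']; rewrite ltr_pdivlMr// => tr.
have := Hd' t t0 td'; rewrite /dilate WV//.
  by apply: smooth_affine_pull; rewrite ?gt_eqF.
by apply: supp_inW; [| |exact: (@supp_in_affine_pull R x t phi r t0 su)]; lra.
Qed.

Section truncation.
Variables (W : Defs.distribution R) (c : R).
Hypothesis pv : point_value W c 0.

(** The value 0 at c is what prevents a jump: the truncation of a nonzero constant would be a
    Heaviside function, without a value at c. *)
Lemma truncation : exists Wt : Defs.distribution R,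
  [/\ (forall psi d, 0 < d -> test_function psi -> (forall y, c - d <= y -> psi y = 0) -> Wt psi = W psi),
      (forall psi, test_function psi -> (forall y, y <= c -> psi y = 0) -> Wt psi = 0) &
      point_value Wt c 0].
Proof.
have [Wt [K [m [K0 [Hlim Hclose]]]]] := truncation_exists pv.
have p3 k : 0 < 3^-1 ^+ k :> R by rewrite exprn_gt0// invr_gt0.
have lim_const psi L : test_function psi -> (exists k0, forall k, (k0 <= k)%N ->
    W (fun y => psi y * fall c (3^-1 ^+ k) y) = L) -> Wt psi = L.
  move=> tpsi [k0 Hk]; apply: (@fall_limit_unique _ W c psi); first exact: Hlim.
  pose B := \sum_(k < k0) `|L - W (fun y => psi y * fall c (3^-1 ^+ k) y)|.
  exists (B * 3 ^+ k0) => k; have [kk|kk] := leqP k0 k.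
    rewrite Hk// subrr normr0 !mulr_ge0 ?exprn_ge0 ?(ltW (p3 _))//.
    by apply: sumr_ge0.
  have h1 : `|L - W (fun y => psi y * fall c (3^-1 ^+ k) y)| <= B.
    rewrite /B (bigD1 (Ordinal kk))//= lerDl; exact: sumr_ge0.
  apply: le_trans h1 _; rewrite -mulrA ler_peMr//; first exact: sumr_ge0.
  rewrite -(subnK (ltnW kk)) exprD -mulrA -exprMn mulfV ?expr1n ?mulr1 ?pnatr_eq0//.
  by rewrite exprn_ege1// ler1n.
exists Wt; split.
- move=> psi d d0 tpsi psi0; apply: lim_const => //.
  have [k0 Hk0] : exists k0, 3 * 3^-1 ^+ k0 <= d.
    apply: contrapT => H; have : d <= 0.
      apply: (@geometric_le _ _ _ 3) => k; rewrite add0r leNgt; apply/negP => Hk.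
      by apply: H; exists k; exact: ltW.
    lra.
  exists k0 => k kk; congr (W _); apply/funext => y.
  have kd : 3 * 3^-1 ^+ k <= d.
    apply: le_trans Hk0; rewrite ler_wpM2l//.
    by rewrite ler_wiXn2l// ?invr_ge0// invf_le1// ler1n.
  have [yc|yc] := leP (c - d) y; first by rewrite psi0// mul0r.
  by rewrite fall1 ?mulr1//; lra.
- move=> psi tpsi psi0; apply: lim_const => //; exists 0%N => k _.
  apply: distribution0 => y; have [yc|yc] := leP y c; first by rewrite psi0// mul0r.
  by rewrite fall0 ?mulr0//; have := p3 k; lra.
- apply: point_value_right => phi tphi e e0; rewrite mul0r.
  have sphi := test_smooth tphi; have [r r0 su] := test_supp_in tphi.
  have [_ bp] := bsmooth_supp sphi su.
  have [||M M0 HM] := @unif_nat R (fun j (B : R) => forall z, `|derive1n j phi z| <= B) m.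
  + by move=> j A A1 AB H y; exact: le_trans (H y) AB.
  + by move=> j; exact: bp.
  (* The cut-off scale t eta is a fixed fraction of t. The truncation error K M t eta is at most e /
     2 after division by t, while phi' = phi * fall 0 eta does not depend on t, so the value 0 of W
     at c takes care of it. *)
  pose eta := Num.min 1 (e / 2 / (K * M)).
  have KM : 0 < K * M by rewrite mulr_gt0.
  have eta0 : 0 < eta by rewrite lt_min ltr01 !divr_gt0.
  have eta1 : eta <= 1 by rewrite ge_min lexx.
  have etaK : K * M * eta <= e / 2.
    by rewrite mulrC -ler_pdivlMr// ge_min lexx orbT.
  clearbody eta; have etan0 : eta != 0 by rewrite gt_eqF.
  pose phi' z := phi z * fall 0 eta z.
  have tphi' : test_function phi'.
    by apply: test_mul => //; exact: (@smooth_fall R 0 eta etan0).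
  have e2 : 0 < e / 2 by rewrite divr_gt0.
  have [d d0 Hd] := point_value_lim pv tphi' e2.
  exists (Num.min d 1); first by rewrite lt_min d0 ltr01.
  move=> t t0; rewrite lt_min => /andP[td t1]; have tn0 : t != 0 by rewrite gt_eqF.
  have tpull : test_function (affine_pull c t phi) by exact: test_affine_pull sphi su.
  have te0 : 0 < t * eta by rewrite mulr_gt0.
  have tet : t * eta <= t by rewrite ler_piMr// ltW.
  have H : forall s, 0 < s -> s <= t -> forall j, (j <= m)%N -> forall z, -3 <= z <= 3 ->
      `|derive1n j (fun z => affine_pull c t phi (c + s * z)) z| <= M.
    move=> s s0 st j jm z _.
    have -> : (fun z => affine_pull c t phi (c + s * z)) = (fun z => phi ((z - 0) / (t / s))).
      apply/funext => y; rewrite /affine_pull; congr phi; field.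
      by rewrite tn0 gt_eqF.
    have ts0 : t / s != 0 by rewrite mulf_neq0// invr_neq0// gt_eqF.
    rewrite (derive1n_affine 0 j ts0 sphi) normrM -[leRHS]mul1r; apply: ler_pM => //; last exact: HM.
    rewrite normrX invf_div ger0_norm ?divr_ge0 ?(ltW s0) ?(ltW t0)//.
    by rewrite exprn_ile1 ?divr_ge0 ?(ltW s0) ?(ltW t0)// ler_pdivrMr// mul1r.
  have := Hclose _ t M (t * eta) tpull (ltW t1) H te0 tet.
  have := Hd t t0 td; rewrite mul0r !subr0 /dilate.
  have -> : affine_pull c t phi' = (fun y => affine_pull c t phi y * fall c (t * eta) y).
    apply/funext => y; rewrite /affine_pull /phi' /fall; congr (_ * falling _); field.
    by rewrite tn0 etan0.
  have ti : 0 < t^-1 by rewrite invr_gt0.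
  rewrite !normrM (gtr0_norm ti) !ler_pdivrMl//.
  move: (W _) (Wt _) => X Y h1 h2.
  have h3 : K * M * (t * eta) <= t * (e / 2).
    have -> : K * M * (t * eta) = t * (K * M * eta) by ring.
    by rewrite ler_wpM2l// ltW.
  have -> : Y = X + (Y - X) by ring.
  by rewrite (le_trans (ler_normD _ _))//; lra.
Qed.

End truncation.

(** U is lowered by l, truncated at c and raised again: it is unchanged left of c, equals l to the
    right, and keeps its value at c. The point c joins both exceptional sets, so lower values are
    transported only to x < c, where u' and u agree locally. *)
Theorem truncate_major a b c f u U l : a < c -> c <= b -> major_pair a b f u U -> point_value U c l ->
  exists u' U', major_pair a c f u' U' /\ point_value U' c l.
Proof.
move=> ac cb [uE lU uU Ua [E [Z [cE nZ HZ HE]]]] pc.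
have ab : a <= b by apply: le_trans cb; exact: ltW.
have c1 : continuous (fun _ : R => 1 : R) by exact: cst_continuous.
have [one oneE] := regular_exists c1.
have pone x : point_value one x 1 by exact: (point_value_regular c1 oneE).
have [U0 U0E] := dcomb_exists U one (- l).
have pU0 : point_value U0 c 0.
  by have := point_value_comb pc (pone c) U0E; rewrite mulr1 subrr.
have [Wt [Wl Wr Wc]] := truncation pU0.
have [U' U'E] := dcomb_exists Wt one l.
have [u' u'E] := dderiv_exists U'.
have U'c : point_value U' c l.
  by have := point_value_comb Wc (pone c) U'E; rewrite mulr1 add0r.
have left_eq psi d : 0 < d -> test_function psi -> (forall y, c - d <= y -> psi y = 0) -> U' psi = U psi.
  by move=> d0 tpsi H; rewrite U'E (Wl psi d)// U0E; ring.
have left_loc x psi : x < c -> smooth psi -> supp_in (x - (c - x) / 2) (x + (c - x) / 2) psi -> U' psi = U psi.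
  move=> xc sp su; apply: (left_eq psi ((c - x) / 3)); first by rewrite divr_gt0// subr_gt0.
    exact: supp_in_test su.
  by move=> y H; apply: su; apply/orP; right; lra.
have dpos x : x < c -> 0 < (c - x) / 2 by move=> xc; rewrite divr_gt0// subr_gt0.
have u'_left x psi : x < c -> smooth psi -> supp_in (x - (c - x) / 2) (x + (c - x) / 2) psi -> u' psi = u psi.
  move=> xc sp su; rewrite u'E (left_loc x)//; [|exact: smooth_derive1|exact: supp_in_derive1].
  by rewrite uU//; exact: supp_in_test su.
have lU' : lojasiewicz_distribution U'.
  move=> x; have [xc|cx|->] := ltgtP x c; last by exists l.
    have [l' pl'] := lU x; exists l'.
    by apply: (@point_value_local U U' x l' ((c - x) / 2) (dpos x xc) _ pl') => psi sp su; rewrite (left_loc x).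
  (* V is the constant distribution l, written as 1 + (l - 1) 1. *)
  have [V VE] := dcomb_exists one one (l - 1).
  exists (1 + (l - 1) * 1).
  have d0 : 0 < (x - c) / 2 by rewrite divr_gt0// subr_gt0.
  apply: (@point_value_local V U' x _ ((x - c) / 2) d0 _ (point_value_comb (pone x) (pone x) VE)).
  move=> psi sp su; rewrite U'E Wr ?VE; first by ring.
    exact: supp_in_test su.
  by move=> y yc; apply: su; apply/orP; left; lra.
have u'E' : E' a c u'.
  move=> x; apply: contraPP => xac.
  have [xa|ax] := ltP x a.
    pose m := (x + a) / 2; suff vanish : vanishes_on u' `]-oo, m[%classic.
      move=> H; apply: H; exists `]-oo, m[%classic; first by split => //; exact: interval_open.
      by rewrite /= in_itv/= /m; lra.
    move=> phi tphi su; have [r r0 ur] := test_supp_in tphi.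
    have um : supp_in (- r) m phi.
      move=> y /orP[H|H]; first by rewrite ur// H.
      by apply: fun_support_eq0 => /su; rewrite /= in_itv/= => H'; move: (lt_trans H H'); rewrite ltxx.
    have sphi := test_smooth tphi.
    rewrite u'E (left_eq _ ((c - a) / 2)).
    - rewrite -uU//; apply: (E'_vanish uE sphi um); apply/orP; left; rewrite /m; lra.
    - by rewrite divr_gt0// subr_gt0.
    - by apply: (@supp_in_test R (- r) m); [exact: smooth_derive1|exact: supp_in_derive1].
    - by move=> y H; apply: (supp_in_derive1 um); apply/orP; right; rewrite /m; lra.
  have cx : c < x by rewrite ltNge; apply/negP => xc; apply: xac; rewrite /= in_itv/= ax.
  pose m := (x + c) / 2; suff vanish : vanishes_on u' `]m, +oo[%classic.
    move=> H; apply: H; exists `]m, +oo[%classic; first by split => //; exact: interval_open.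
    by rewrite /= in_itv/= /m; lra.
  move=> phi tphi su; have [r r0 ur] := test_supp_in tphi.
  have um : supp_in m r phi.
    move=> y /orP[H|H]; last by rewrite ur// H orbT.
    apply: fun_support_eq0 => /su; rewrite /= in_itv/= andbT => H'; move: (lt_trans H H').
    by rewrite ltxx.
  have sphi := test_smooth tphi.
  rewrite u'E U'E Wr.
  - have rr : - r <= r by lra.
    rewrite oneE (_ : (fun y => 1 * derive1 phi y) = derive1 phi); last by apply/funext => y; rewrite mul1r.
    by rewrite (integral_derive_supp rr sphi ur) mulr0 addr0 oppr0.
  - by apply: (@supp_in_test R m r); [exact: smooth_derive1|exact: supp_in_derive1].
  - by move=> y H; apply: (supp_in_derive1 um); apply/orP; left; rewrite /m; lra.
exists u', U'; split => //; split => //.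
  by apply: (@point_value_local U U' a 0 ((c - a) / 2) (dpos a ac) _ Ua) => psi sp su; rewrite (left_loc a).
exists (E `|` [set c]), (Z `|` [set c]); split.
- by apply: countableU => //; exact: countable1.
- apply: negligibleU => //; exists [set c]; split => //; exact: lebesgue_measure_set1.
- move=> x phi [xac nZx] Tphi; have [ax xc] : a <= x /\ x < c.
    move: xac; rewrite /= in_itv/= => /andP[ax xc]; split => //; rewrite lt_neqAle xc andbT.
    by apply/eqP => xE; apply: nZx; right.
  apply: le_trans (HZ x phi _ Tphi) _.
    split; last by move=> Zx; apply: nZx; left.
    by rewrite /= in_itv/= ax (le_trans (ltW xc)).
  apply: (lower_value_local ab uE (E'W (lexx a) cb u'E') Tphi (dpos x xc)) => psi sp su.
  by rewrite (u'_left x).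
- move=> x phi [xac nEx] Tphi; have [ax xc] : a <= x /\ x < c.
    move: xac; rewrite /= in_itv/= => /andP[ax xc]; split => //; rewrite lt_neqAle xc andbT.
    by apply/eqP => xE; apply: nEx; right.
  apply: (@lt_le_trans _ _ (lower_value u phi x)).
    apply: HE => //; split; last by move=> Ex; apply: nEx; left.
    by rewrite /= in_itv/= ax (le_trans (ltW xc)).
  apply: (lower_value_local ab uE (E'W (lexx a) cb u'E') (proj1 Tphi) (dpos x xc)) => psi sp su.
  by rewrite (u'_left x).
Qed.

End Locality.

(** * The indefinite integral *)

Section Assembly.
Variable R : realType.
Implicit Types (g phi psi : R -> R) (x y z s t l r a b c d e h : R) (u v w U V W : Defs.distribution R)
  (f : R -> \bar R).
Notation mu := (@lebesgue_measure R).

Lemma point_value_unique W x l l' : point_value W x l -> point_value W x l' -> l = l'.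
Proof.
move=> pl pl'; suff le m m' : point_value W x m -> point_value W x m' -> m <= m'.
  by apply/eqP; rewrite eq_le !le.
move=> pm pm'; apply/ler_addgt0Pr => e e0; have e2 : 0 < e / 2 by rewrite divr_gt0.
have [d d0 Hd] := bump_translate_lim 0 pm e2; have [d' d'0 Hd'] := bump_translate_lim 0 pm' e2.
pose t := Num.min d d' / 2.
have m0 : 0 < Num.min d d' by rewrite lt_min d0.
have t0 : 0 < t by rewrite divr_gt0.
have td : t < d by apply: (@lt_le_trans _ _ (Num.min d d')); [rewrite /t; lra|rewrite ge_min lexx].
have td' : t < d' by apply: (@lt_le_trans _ _ (Num.min d d')); [rewrite /t; lra|rewrite ge_min lexx orbT].
have := Hd t t0 td; have := Hd' t t0 td'; clear Hd Hd'; move: (dilate _ _ _ _) => X.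
by rewrite !ler_norml => /andP[h1 h2] /andP[h3 h4]; lra.
Qed.

(** Monotonicity of the values is applied to u and to u - 2 u = - u. *)
Lemma const_value u U p q l l' : is_derivative u U -> p < q ->
  (forall g c d, p < c -> d < q -> smooth g -> supp_in c d g -> u g = 0) ->
  point_value U p l -> point_value U q l' -> l = l'.
Proof.
move=> uU pq u0 pp pq'; apply/eqP; rewrite eq_le; apply/andP; split.
  apply: (mono_value uU pq _ pp pq') => g sg g0 [c [d [pc dq su]]].
  by rewrite (u0 g c d).
have [V VE] := dcomb_exists U U (-2); have [v vE] := dcomb_exists u u (-2).
have vV : is_derivative v V by move=> phi tphi; rewrite vE VE !uU//; ring.
have := mono_value vV pq _ (point_value_comb pp pp VE) (point_value_comb pq' pq' VE).
have nn : nonneg_on v p q.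
  by move=> g sg g0 [c [d [pc dq su]]]; rewrite vE (u0 g c d)// mulr0 addr0.
by move=> /(_ nn); lra.
Qed.

Lemma value_outside a b u U X : a < b -> E' a b u -> is_derivative u U ->
  (forall x, point_value U x (X x)) ->
  (forall x, x <= a -> X x = X a) /\ (forall x, b <= x -> X x = X b).
Proof.
move=> ab uE uU pX; split=> x; rewrite le_eqVlt => /orP[/eqP->//|xa].
  apply: (const_value uU xa _ (pX x) (pX a)) => g c d _ da sg su.
  by apply: (E'_vanish uE sg su); rewrite da.
apply/esym; apply: (const_value uU xa _ (pX b) (pX x)) => g c d bc _ sg su.
by apply: (E'_vanish uE sg su); rewrite bc orbT.
Qed.

(** Outside [a, b] the difference u - v vanishes, and the ends a and b are removable since the
    primitives have values there. *)
Lemma major_minor_nonneg_all a b f u U v V w p q : a < b -> major_pair a b f u U -> minor_pair a b f v V ->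
  (forall g, w g = u g + -1 * v g) -> nonneg_on w p q.
Proof.
move=> ab Ma mi wE.
have nn := major_minor_nonneg (ltW ab) (lexx b) Ma mi wE.
have [uE lU uU _ _] := Ma; have [vE lV vV _ _] := mi.
have [W WE] := dcomb_exists U V (-1).
have wW : is_derivative w W by move=> phi tphi; rewrite wE WE uU// vV//; ring.
have [la pa] := lU a; have [la' pa'] := lV a; have [lb pb] := lU b; have [lb' pb'] := lV b.
pose p' := Num.min p (a - 1); pose q' := Num.max q (b + 1).
have zero g c d : smooth g -> supp_in c d g -> (d < a) || (b < c) -> w g = 0.
  by move=> sg su H; rewrite wE (E'_vanish uE sg su H) (E'_vanish vE sg su H) mulr0 addr0.
have nl : nonneg_on w p' a.
  by move=> g sg g0 [c [d [_ da su]]]; rewrite (zero g c d)// da.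
have nr : nonneg_on w b q'.
  by move=> g sg g0 [c [d [bc _ su]]]; rewrite (zero g c d)// bc orbT.
have n1 := nonneg_on_removable wW (point_value_comb pa pa' WE) nl nn.
have n2 := nonneg_on_removable wW (point_value_comb pb pb' WE) n1 nr.
apply: nonneg_on_sub n2; first by rewrite ge_min lexx.
by rewrite le_max lexx.
Qed.

Section indefinite.
Variables (a b : R) (f : R -> \bar R).
Hypothesis ab : a < b.

Definition major_value X := exists u U, major_pair a b f u U /\ forall x, point_value U x (X x).

Definition minor_value Y := exists v V, minor_pair a b f v V /\ forall x, point_value V x (Y x).

Lemma major_value_exists u U l : major_pair a b f u U -> point_value U b l ->
  exists2 X, major_value X & X b = l.
Proof.
move=> Ma pb; have [_ lU _ _ _] := Ma; have [X HX] := choice lU.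
by exists X; [exists u, U|exact: point_value_unique (HX b) pb].
Qed.

Lemma minor_value_exists v V l : minor_pair a b f v V -> point_value V b l ->
  exists2 Y, minor_value Y & Y b = l.
Proof.
move=> Ma pb; have [_ lV _ _ _] := Ma; have [Y HY] := choice lV.
by exists Y; [exists v, V|exact: point_value_unique (HY b) pb].
Qed.

Lemma value_gap X Y : major_value X -> minor_value Y ->
  (forall x y, x <= y -> X x - Y x <= X y - Y y) /\ continuous (fun x => X x - Y x).
Proof.
move=> [u [U [Ma pX]]] [v [V [Mi pY]]].
have [_ _ uU _ _] := Ma; have [_ _ vV _ _] := Mi.
have [W WE] := dcomb_exists U V (-1); have [w wE] := dcomb_exists u v (-1).
have wW : is_derivative w W by move=> phi tphi; rewrite wE WE uU// vV//; ring.
have nn p q : nonneg_on w p q by exact: (major_minor_nonneg_all ab Ma Mi wE).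
have pv x : point_value W x (X x - Y x).
  by have := point_value_comb (pX x) (pY x) WE; rewrite mulN1r.
split; last exact: (mono_value_continuous wW pv nn).
move=> x y; rewrite le_eqVlt => /orP[/eqP ->//|xy].
exact: (mono_value wW xy (nn x y) (pv x) (pv y)).
Qed.

Lemma major_value_outside X : major_value X ->
  (forall x, x <= a -> X x = 0) /\ (forall x, b <= x -> X x = X b).
Proof.
move=> [u [U [[uE _ uU Ua _] pX]]]; have [h1 h2] := value_outside ab uE uU pX.
by split=> // x /h1 ->; exact: point_value_unique (pX a) Ua.
Qed.

Lemma minor_value_outside Y : minor_value Y ->
  (forall x, x <= a -> Y x = 0) /\ (forall x, b <= x -> Y x = Y b).
Proof.
move=> [u [U [[uE _ uU Ua _] pX]]]; have [h1 h2] := value_outside ab uE uU pX.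
by split=> // x /h1 ->; exact: point_value_unique (pX a) Ua.
Qed.

(** One bound comes from truncating the given major pair at c; the other compares each major pair on
    [a, c] with the minor pair on [a, b], both primitives being 0 at a. *)
Lemma upper_between X Y c : major_value X -> minor_value Y -> a < c -> c <= b ->
  ((Y c)%:E <= upper_dist_integral a c f)%E /\ (upper_dist_integral a c f <= (X c)%:E)%E.
Proof.
move=> [u [U [Ma pX]]] [v [V [Mi pY]]] ac cb; split; last first.
  apply: ereal_inf_lbound; exists (X c) => //.
  exact: (truncate_major ac cb Ma (pX c)).
apply: le_ereal_inf_tmp => _ [l [u' [U' [Ma' pl]]] <-]; rewrite lee_fin.
have [_ _ uU U'a _] := Ma'; have [_ _ vV Va _] := Mi.
have [W WE] := dcomb_exists U' V (-1); have [w wE] := dcomb_exists u' v (-1).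
have wW : is_derivative w W by move=> phi tphi; rewrite wE WE uU// vV//; ring.
have nn := major_minor_nonneg (ltW ac) cb Ma' Mi wE.
have := mono_value wW ac nn (point_value_comb U'a Va WE) (point_value_comb pl (pY c) WE).
lra.
Qed.

(** The real bounds show that the upper integral over [a, c] is finite, so [fine] does not alter
    it. *)
Lemma indefinite_between X Y x : major_value X -> minor_value Y ->
  Y x <= indefinite_dist_integral a b f x <= X x.
Proof.
move=> MX MY; have [X0 Xb] := major_value_outside MX; have [Y0 Yb] := minor_value_outside MY.
have fin c : a < c -> c <= b -> Y c <= dist_integral a c f <= X c.
  move=> ac cb; have [] := upper_between MX MY ac cb; rewrite /dist_integral.
  by case: (upper_dist_integral a c f) => [r|//|//]; rewrite !lee_fin => -> ->.
rewrite /indefinite_dist_integral; case: ifPn => [xa|]; first by rewrite X0// Y0// lexx.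
rewrite -ltNge => ax; case: ifPn => [xb|]; first exact: fin.
by rewrite -ltNge => bx; rewrite Xb ?(ltW bx)// Yb ?(ltW bx)//; exact: fin.
Qed.

Lemma small_gap e : dist_integrable a b f -> 0 < e ->
  exists X Y, [/\ major_value X, minor_value Y & X b - Y b <= e].
Proof.
move=> [[u [U Ma]] [v [V Mi]] lu] e0.
have [_ lU _ _ _] := Ma; have [_ lV _ _ _] := Mi.
have [l pl] := lU b; have [l' pl'] := lV b.
have [X MX _] := major_value_exists Ma pl; have [Y MY _] := minor_value_exists Mi pl'.
have [low up] := upper_between MX MY ab (lexx b).
have [I IE] : exists I : R, upper_dist_integral a b f = I%:E.
  by move: low up; case: (upper_dist_integral a b f) => [r|//|//] _ _; exists r.
have e2 : 0 < e / 2 by rewrite divr_gt0.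
have : (upper_dist_integral a b f < (I + e / 2)%:E)%E by rewrite IE lte_fin ltrDl.
move=> /ereal_inf_lt[_ [x1 [u1 [U1 [M1 p1]]] <-]]; rewrite lte_fin => h1.
have : ((I - e / 2)%:E < lower_dist_integral a b f)%E by rewrite lu IE lte_fin gtrBl.
move=> /ereal_sup_gt[_ [x2 [u2 [U2 [M2 p2]]] <-]]; rewrite lte_fin => h2.
have [X1 MX1 X1b] := major_value_exists M1 p1; have [Y2 MY2 Y2b] := minor_value_exists M2 p2.
by exists X1, Y2; split => //; rewrite X1b Y2b; lra.
Qed.

(** For a close pair X', Y' the difference F - X' is at most e / 4 everywhere, as X' - Y' is
    increasing and constant beyond b. In F - X = (F - X') + (X' - Y') - (X - Y') the last two terms
    are continuous, so four errors e / 4 suffice. *)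
Lemma indefinite_gap_continuous X : dist_integrable a b f -> major_value X ->
  continuous (fun x => indefinite_dist_integral a b f x - X x).
Proof.
move=> int MX; apply: continuous_of_modulus => x e e0.
have e4 : 0 < e / 4 by rewrite divr_gt0.
have [X' [Y' [MX' MY' gap]]] := small_gap int e4.
have [_ c1] := value_gap MX' MY'; have [_ c2] := value_gap MX MY'.
have [mono _] := value_gap MX' MY'.
have [_ X'b] := major_value_outside MX'; have [_ Y'b] := minor_value_outside MY'.
have close y : `|indefinite_dist_integral a b f y - X' y| <= e / 4.
  have /andP[h1 h2] := indefinite_between y MX' MY'.
  have h3 : X' y - Y' y <= e / 4.
    have ym : y <= Num.max y b by rewrite le_max lexx.
    have bm : b <= Num.max y b by rewrite le_max lexx orbT.
    by have := mono y _ ym; rewrite (X'b _ bm) (Y'b _ bm) => /le_trans; apply.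
  by rewrite ler_norml; apply/andP; split; lra.
have := c1 x => /cvgrPdist_le/(_ _ e4)/nbhs_ballP[d /= d0 Hd].
have := c2 x => /cvgrPdist_le/(_ _ e4)/nbhs_ballP[d' /= d'0 Hd'].
exists (Num.min d d'); first by rewrite lt_min d0.
move=> y; rewrite lt_min => /andP[yd yd'].
have := Hd y; rewrite /ball/= distrC => /(_ yd); have := Hd' y; rewrite /ball/= distrC => /(_ yd').
have := close x; have := close y.
move: (indefinite_dist_integral a b f x) (indefinite_dist_integral a b f y) => Fx Fy.
by rewrite !ler_norml => /andP[h1 h2] /andP[h3 h4] /andP[h5 h6] /andP[h7 h8]; apply/andP; split; lra.
Qed.

End indefinite.
End Assembly.

Theorem theorem5p2 (R : realType) (a b : R) (f : R -> \bar R)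
    (hab : a < b) (hf : dist_integrable a b f) :
  lojasiewicz_function (indefinite_dist_integral a b f).
Proof.
have [X [Y [MX MY _]]] := small_gap hab hf ltr01.
have cF := indefinite_gap_continuous hab hf MX.
have [u [U [_ pX]]] := MX; have [V VE] := regular_exists cF.
have [G GE] := dcomb_exists U V 1; exists G.
have pG x : point_value G x (indefinite_dist_integral a b f x).
  have := point_value_comb (pX x) (point_value_regular cF VE) GE.
  by rewrite mul1r addrC subrK.
by split=> [x|//]; exists (indefinite_dist_integral a b f x).
Qed.
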